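(* Let $\Omega\subset\mathbb{R}^n$ be a strictly convex connected domain containing the origin, and let $(\Omega,F)$ be a projectively flat Finsler manifold with flag curvature $\mathbf K=1$. Then the following hold: (i) $(\Omega,F)$ is neither forward complete nor backward complete; (ii) the diameter of $(\Omega,F)$ is at most $\pi$, and equals $\pi$ when $\Omega=\mathbb{R}^n$; (iii) provided that $\Omega=\mathbb{R}^n$ and $(\mathfrak p^{-1})^*F$ can be extended to a Finsler metric on $\overline{\mathbb{S}^n_+}$, there exists a complete locally projectively flat Finsler metric $\mathscr F$ on $\mathbb{S}^n$ such that: - the flag curvature of $(\mathbb{S}^n,\mathscr F)$ remains $1$, the diameter is $\pi$ and $\mathscr F|_{\mathbb{S}^n_+}=(\mathfrak p^{-1})^*F$; - every geodesic of length $2\pi$ in $(\mathbb{S}^n,\mathscr F)$ is a great circle.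
   Context: Throughout $n\ge 2$; subscripts $x^i,y^i$ denote partial derivatives in the canonical coordinates of the tangent bundle and repeated indices are summed. A Minkowski norm on a vector space $V$ is a function $\psi\ge0$, vanishing only at $0$, with $\psi(\alpha y)=\alpha\psi(y)$ for $\alpha>0$, smooth on $V\setminus\{0\}$, with $([\psi^2]_{y^iy^j}(y))$ positive definite for $y\neq0$. A Finsler metric on a manifold $M$ is a function $F$ on $TM$, smooth on $TM\setminus\{0\}$, with $F(x,\cdot)$ a Minkowski norm on $T_xM$ for each $x$. Lengths are $L_F(c)=\int F(c,c')dt$, $d_F(x_1,x_2)$ is the infimum of lengths of piecewise smooth curves from $x_1$ to $x_2$, and the diameter is $\sup_{x_1,x_2}d_F(x_1,x_2)$. Geodesics are the constant-speed curves satisfying $\ddot\gamma^i+2G^i(\gamma,\dot\gamma)=0$, $G^i=\frac14 g^{ij}\{[F^2]_{x^ky^j}y^k-[F^2]_{x^j}\}$, with $(g^{ij})$ the inverse of $g_{ij}=\frac12[F^2]_{y^iy^j}$. $(M,F)$ is forward (resp. backward) complete if every geodesic can be extended to parameter $+\infty$ (resp. $-\infty$), and complete if both hold. A Finsler metric on an open subset of $\mathbb{R}^n$ is projectively flat if the images of all geodesics are straight lines; equivalently $G^i=Py^i$ with $P=\frac{y^kF_{x^k}}{2F}$. A Finsler metric on a manifold is locally projectively flat if around each point there are local coordinates in which it is projectively flat. The flag curvature $\mathbf K$ is the Finsler generalization of sectional curvature; for projectively flat $F$, $\mathbf K=\frac{P^2-y^iP_{x^i}}{F^2}$. $\mathbb{S}^n\subset\mathbb{R}^{n+1}$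 is the unit sphere, $\mathbb{S}^n_+=\{w\in\mathbb{S}^n:w^{n+1}>0\}$ the open upper hemisphere, $\overline{\mathbb{S}^n_+}$ its closure, and $\mathfrak p:\mathbb{R}^n\to\mathbb{S}^n_+$ is the diffeomorphism $\mathfrak p(x)=\left(\frac{x}{\sqrt{1+|x|^2}},\frac1{\sqrt{1+|x|^2}}\right)$. $(\mathfrak p^{-1})^*F$ denotes the metric on $\mathbb{S}^n_+$ pulled back from $F$ by $\mathfrak p^{-1}$. *)

(* Defs.v *)
From HB Require Import structures.
From mathcomp Require Import all_boot all_order all_algebra.
From mathcomp Require Import all_classical all_reals all_analysis.

Set Implicit Arguments.
Unset Strict Implicit.
Unset Printing Implicit Defensive.

Import Order.TTheory GRing.Theory Num.Theory.
Import numFieldNormedType.Exports.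

Local Open Scope classical_set_scope.
Local Open Scope ring_scope.

(* A function on (a subset of) a tangent bundle is a curried function
   F : V -> V -> R, F x y being its value at the tangent vector y based at x.
   Only the values at points x of the manifold and at vectors y tangent there
   are meaningful; no definition below looks at the other ones. *)

Section Smoothness.
Context {R : realType}.

(* Class C^k on an open set, through iterated directional derivatives; in
   finite dimension (the only use below) this is the usual notion. *)
Fixpoint class_C (V W : normedModType R) (k : nat) (U : set V) (f : V -> W)
    : Prop :=
  (forall x, U x -> {for x, continuous f}) /\
  (if k is k'.+1 then
     forall v : V, (forall x, U x -> derivable f x v) /\
                   class_C k' U (fun x => 'D_v f x)
   else True).

(* Smoothness on an arbitrary subset A: locally, f coincides on A with a
   smooth function defined on an open set. For open A this is smoothness in
   the usual sense; for a manifold with boundary it is smoothness up to the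
   boundary, and for a closed interval smoothness up to the end points. *)
Definition smooth_on (V W : normedModType R) (A : set V) (f : V -> W) : Prop :=
  forall x, A x -> exists (U : set V) (g : V -> W),
    [/\ open U, U x, (forall k, class_C k U g) &
        forall z, A z -> U z -> g z = f z].

End Smoothness.

Section Euclidean.
Context {R : realType}.

(* The library norm `|x| on 'rV[R]_n is the sup norm, hence this one. *)
Definition edot n (u v : 'rV[R]_n) : R := \sum_i u 0 i * v 0 i.

Definition strictly_convex n (Omega : set 'rV[R]_n) : Prop :=
  forall x y, closure Omega x -> closure Omega y -> x != y ->
  forall t : R, 0 < t -> t < 1 -> Omega° (t *: x + (1 - t) *: y).

End Euclidean.

Section Curves.
Context {R : realType} {V : normedModType R}.
Implicit Types (F : V -> V -> R) (M : set V) (c : R -> V).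

Definition curve_length F c (a b : R) : \bar R :=
  (\int[lebesgue_measure]_(t in `[a, b]) (F (c t) (derive1 c t))%:E)%E.

(* a < s_1 < ... < s_k = b, and c is smooth on each closed piece *)
Definition piecewise_smooth (a b : R) c : Prop :=
  exists s : seq R,
    [/\ path <%R a s, last a s = b &
        forall i, (i < size s)%N ->
          smooth_on `[nth a (a :: s) i, nth a (a :: s) i.+1] c].

Definition finsler_dist F M (x1 x2 : V) : \bar R :=
  ereal_inf [set L | exists (a b : R) (c : R -> V),
    a < b /\ piecewise_smooth a b c /\
    (forall t, a <= t <= b -> M (c t)) /\
    c a = x1 /\ c b = x2 /\ L = curve_length F c a b].

Definition diameter F M : \bar R :=
  ereal_sup [set d | exists x1 x2, [/\ M x1, M x2 & d = finsler_dist F M x1 x2]].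

(* Here geod lo hi c means that c is a geodesic on the open interval ]lo, hi[,
   whose end points may be infinite. *)
Implicit Type geod : \bar R -> \bar R -> (R -> V) -> Prop.

Definition forward_complete geod : Prop :=
  forall (lo hi : \bar R) c, (lo < hi)%E -> geod lo hi c ->
  exists c', geod lo +oo%E c' /\
    forall t : R, (lo < t%:E)%E -> (t%:E < hi)%E -> c' t = c t.

Definition backward_complete geod : Prop :=
  forall (lo hi : \bar R) c, (lo < hi)%E -> geod lo hi c ->
  exists c', geod -oo%E hi c' /\
    forall t : R, (lo < t%:E)%E -> (t%:E < hi)%E -> c' t = c t.

End Curves.

Section FinslerRn.
Context {R : realType} {n : nat}.
Notation V := 'rV[R]_n.
Implicit Types (F f : V -> V -> R) (x y u v : V).

(* Partial derivatives in the canonical coordinates (x^i, y^i) of TR^n. *)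
Definition pdx f (i : 'I_n) : V -> V -> R :=
  fun x y => 'D_(delta_mx 0 i) (fun z => f z y) x.
Definition pdy f (i : 'I_n) : V -> V -> R :=
  fun x y => 'D_(delta_mx 0 i) (f x) y.

Definition sqF F : V -> V -> R := fun x y => F x y ^+ 2.

(* g_ij = 1/2 [F^2]_{y^i y^j} *)
Definition fund_tensor F x y : 'M[R]_n :=
  \matrix_(i, j) (2^-1 * pdy (pdy (sqF F) i) j x y).

Definition minkowski_norm (psi : V -> R) : Prop :=
  [/\ (forall y, 0 <= psi y),
      (forall y, psi y = 0 <-> y = 0),
      (forall (a : R) y, 0 < a -> psi (a *: y) = a * psi y),
      smooth_on [set y | y != 0] psi &
      forall y u, y != 0 -> u != 0 ->
        0 < \sum_i \sum_j
              'D_(delta_mx 0 j) ('D_(delta_mx 0 i) (fun z => psi z ^+ 2)) y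
              * u 0 i * u 0 j].

(* D need not be open: a domain with boundary is allowed. *)
Definition finsler (D : set V) F : Prop :=
  (forall x, D x -> minkowski_norm (F x)) /\
  smooth_on [set p : V * V | D p.1 /\ p.2 != 0] (fun p => F p.1 p.2).

Definition spray F (i : 'I_n) x y : R :=
  4^-1 * \sum_j invmx (fund_tensor F x y) i j *
    ((\sum_k pdy (pdx (sqF F) k) j x y * y 0 k) - pdx (sqF F) j x y).

Definition geodesic_eq_at F (c : R -> V) (t : R) : Prop :=
  [/\ (\forall s \near t, derivable c s 1),
      derivable (derive1 c) t 1 &
      forall i, derive1 (derive1 c) t 0 i + 2 * spray F i (c t) (derive1 c t) = 0].

(* Positivity of the speed excludes constant curves, at which the spray is not
   defined. *)
Definition geodesic (Omega : set V) F (lo hi : \bar R) (c : R -> V) : Prop :=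
  (forall t : R, (lo < t%:E)%E -> (t%:E < hi)%E ->
     Omega (c t) /\ geodesic_eq_at F c t) /\
  exists2 k : R, 0 < k &
    forall t : R, (lo < t%:E)%E -> (t%:E < hi)%E -> F (c t) (derive1 c t) = k.

Definition projectively_flat (Omega : set V) F : Prop :=
  forall (lo hi : \bar R) (c : R -> V), (lo < hi)%E ->
  geodesic Omega F lo hi c ->
  exists p v : V, v != 0 /\
    forall t : R, (lo < t%:E)%E -> (t%:E < hi)%E -> exists s : R, c t = p + s *: v.

(* Riemann curvature R^i_k of the spray:
     2 [G^i]_{x^k} - y^j [G^i]_{x^j y^k} + 2 G^j [G^i]_{y^j y^k}
       - [G^i]_{y^j} [G^j]_{y^k}. *)
Definition riemann_curv F x y : 'M[R]_n :=
  \matrix_(i, k)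
    (2 * pdx (spray F i) k x y
     - (\sum_j y 0 j * pdy (pdx (spray F i) j) k x y)
     + 2 * (\sum_j spray F j x y * pdy (pdy (spray F i) j) k x y)
     - \sum_j pdy (spray F i) j x y * pdy (spray F j) k x y).

Definition fund_form F x y u v : R := (u *m fund_tensor F x y *m v^T) 0 0.

(* Curvature of the flag spanned by u with flagpole y. *)
Definition flag_curvature F x y u : R :=
  fund_form F x y (u *m (riemann_curv F x y)^T) u /
  (fund_form F x y y y * fund_form F x y u u - fund_form F x y y u ^+ 2).

Definition const_flag_curvature (Omega : set V) F (kappa : R) : Prop :=
  forall x y u, Omega x -> y != 0 -> (forall a : R, u <> a *: y) ->
    flag_curvature F x y u = kappa.

End FinslerRn.

(* The metric induced by G through phi. *)
Definition pullback {R : realType} {V W : normedModType R}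
    (phi : V -> W) (G : W -> W -> R) : V -> V -> R :=
  fun x y => G (phi x) ('D_y phi x).

Section Sphere.
Context {R : realType} {n : nat}.
Notation V := 'rV[R]_n.
Notation E := 'rV[R]_(n + 1).
Implicit Types (A : 'M[R]_(n + 1)) (F : E -> E -> R).

Definition sphere : set E := [set w | edot w w = 1].

Definition tangent (w v : E) : Prop := edot w v = 0.

Definition last_coord (w : E) : R := w 0 (rshift n ord0).

Definition hemisphere : set E := [set w | sphere w /\ 0 < last_coord w].

(* The map p : R^n -> S^n_+ and its inverse. *)
Definition gnomonic (x : V) : E :=
  (Num.sqrt (1 + edot x x))^-1 *: row_mx x 1%:M.
Definition gnomonic_inv (w : E) : V := (last_coord w)^-1 *: lsubmx w.

(* The smooth structure of S^n is given by the atlas of all rotated copies of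
   p: for A orthogonal, chart_param A is a parametrization of the open
   hemisphere chart_dom A, with inverse chart_coord A. *)
Definition orthogonal_mx A : Prop := A *m A^T = 1%:M.
Definition chart_param A (x : V) : E := gnomonic x *m A.
Definition chart_coord A (w : E) : V := gnomonic_inv (w *m A^T).
Definition chart_dom A : set E := [set w | hemisphere (w *m A^T)].

(* Finsler metric on a domain D of S^n, possibly with boundary, such as the
   closed hemisphere. *)
Definition sphere_finsler (D : set E) F : Prop :=
  forall A, orthogonal_mx A ->
    finsler (chart_param A @^-1` D) (pullback (chart_param A) F).

Definition sphere_geodesic F (lo hi : \bar R) (c : R -> E) : Prop :=
  (forall t : R, (lo < t%:E)%E -> (t%:E < hi)%E ->
     [/\ sphere (c t), derivable c t 1 &
         forall A, orthogonal_mx A -> chart_dom A (c t) ->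
           geodesic_eq_at (pullback (chart_param A) F) (chart_coord A \o c) t]) /\
  exists2 k : R, 0 < k &
    forall t : R, (lo < t%:E)%E -> (t%:E < hi)%E -> F (c t) (derive1 c t) = k.

Definition sphere_const_flag_curvature F (kappa : R) : Prop :=
  forall A, orthogonal_mx A ->
    const_flag_curvature setT (pullback (chart_param A) F) kappa.

(* An arbitrary local parametrization of S^n; being an injective immersion
   between manifolds of the same dimension, it is a diffeomorphism onto an
   open subset of S^n. *)
Definition local_coordinates (U : set V) (phi : V -> E) : Prop :=
  [/\ open U, smooth_on U phi, phi @` U `<=` sphere,
      (forall x y, U x -> U y -> phi x = phi y -> x = y) &
      forall x y, U x -> 'D_y phi x = 0 -> y = 0].

Definition sphere_locally_projectively_flat F : Prop :=
  forall w, sphere w -> exists (U : set V) (phi : V -> E),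
    [/\ local_coordinates U phi, (phi @` U) w &
        projectively_flat U (pullback phi F)].

Definition great_circle (C : set E) : Prop :=
  exists P : 'M[R]_(2, n + 1),
    row_free P /\ C = [set w | sphere w /\ (w <= P)%MS].

End Sphere.

(* Main.v *)
Require Import Defs.

From HB Require Import structures.
From mathcomp Require Import all_boot all_order all_algebra.
From mathcomp Require Import all_classical all_reals all_analysis.
From mathcomp Require Import measurable_realfun ring lra.

Set Implicit Arguments.
Unset Strict Implicit.
Unset Printing Implicit Defensive.

Import Order.TTheory GRing.Theory Num.Theory.
Import numFieldNormedType.Exports.

Local Open Scope classical_set_scope.
Local Open Scope ring_scope.

(* Write P = y^k F_{x^k} / (2 F). For a projectively flat metric of flag curvature 1, Hamel's equations
   and the curvature equation say that P + i F solves the complex Burgers equation. Hence the angle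
   atan (P / F) decreases at unit rate along unit speed geodesics, which therefore last less than pi.
   More generally, x |-> - atan ((P - b) / F), evaluated at the vector e - b x, has differential
   F_y, which is at most F by the fundamental inequality, and it calibrates the lines through the
   point [e : b] of projective space; this gives both bounds on the diameter.

   On the sphere the metric of the hemisphere is doubled by the antipodal map. Along a line, F and P
   are determined by their values at a single point, so that near a vector transverse to the equator
   both halves of the metric are given by one smooth formula in terms of values away from the
   equator. Transverse vectors are dense, hence all derivatives of the two halves match along the
   equator. The Burgers equation persists by continuity, geodesics are the radial projections of
   cos (k t) f + sin (k t) g, and the calibration of the lines through a point e is invariant under
   changes of chart, which shows that e and - e are at distance pi. *)

(** * Smooth functions *)

(** With [Psi = P + i F], the restriction of [Psi] to a line directed by y satisfies
    [Psi' = Psi ^ 2], since [Psi_y] contracted with y is [Psi] by homogeneity. Hence [1 / Psi + t]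
    is constant: this is the source of the formula that transports F and P along a line. A
    fractional linear change of coordinates pulls F back and adds a real term to P, because the
    second derivative of such a map is a combination of its first derivatives; so the equation makes
    sense on the sphere, whose central charts differ by such changes. The obstacle in the last part
    is that the extended metric is smooth only up to the equator: each half has derivatives of all
    orders there, but nothing in the hypotheses compares those of one half with those of the other.
    Vectors tangent to the equator escape the transport formula, as their lines stay in it, and this
    forces a passage to the limit. For the lower bound on the diameter of the sphere, the
    calibration breaks down at e and - e, where only its limits are available; they are found from
    the fact that F and P are of the order of the length of the vector. *)

Section ClassC.
Context {R : realType}.
Implicit Types V W : normedModType R.

Lemma class_C_cont V W k (U : set V) (f : V -> W) x :
  class_C k U f -> U x -> {for x, continuous f}.
Proof. by case: k => [|k] [h _] /h. Qed.

Lemma class_C_derivable V W k (U : set V) (f : V -> W) x v :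
  class_C k.+1 U f -> U x -> derivable f x v.
Proof. by case=> _ /(_ v)[+ _] => /[apply]. Qed.

Lemma class_CD V W k (U : set V) (f : V -> W) v :
  class_C k.+1 U f -> class_C k U (fun x => 'D_v f x).
Proof. by case=> _ /(_ v)[]. Qed.

Lemma class_CW V W k (U : set V) (f : V -> W) :
  class_C k.+1 U f -> class_C k U f.
Proof.
elim: k f => [|k IH] f [fc fd]; first by split.
by split=> // v; have [? ?] := fd v; split=> //; exact: IH.
Qed.

Lemma class_C_sub V W k (U U' : set V) (f : V -> W) :
  U' `<=` U -> class_C k U f -> class_C k U' f.
Proof.
move=> sU; elim: k f => [|k IH] f [fc fd]; split=> //; first by move=> x /sU/fc.
  by move=> x /sU/fc.
by move=> v; have [fv ?] := fd v; split; [move=> x /sU/fv | exact: IH].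
Qed.

Lemma near_eq_cont V W (f g : V -> W) x :
  (\near x, f x = g x) -> {for x, continuous f} -> {for x, continuous g}.
Proof.
move=> fg fx; have E : f x = g x by exact: nbhs_singleton fg.
move: fx; rewrite /prop_for /continuous_at -E => fx.
by apply: cvg_trans fx; apply: near_eq_cvg.
Qed.

Lemma open_near_eq V W (U : set V) (f g : V -> W) x : open U -> U x ->
  (forall z, U z -> f z = g z) -> \near x, f x = g x.
Proof.
move=> Uo Ux fg; near=> z; apply: fg; near: z; exact: open_nbhs_nbhs.
Unshelve. all: by end_near. Qed.

Lemma class_C_eq V W k (U : set V) (f g : V -> W) : open U ->
  (forall x, U x -> f x = g x) -> class_C k U f -> class_C k U g.
Proof.
move=> Uo; elim: k f g => [|k IH] f g fg [fc fd]; split=> //.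
- by move=> x Ux; apply: near_eq_cont (fc _ Ux); exact: open_near_eq fg.
- by move=> x Ux; apply: near_eq_cont (fc _ Ux); exact: open_near_eq fg.
move=> v; have [fv Df] := fd v; split.
  by move=> x Ux; apply: near_eq_derivable (fv _ Ux); exact: open_near_eq fg.
apply: IH Df => x Ux; apply: near_eq_derive; exact: open_near_eq fg.
Qed.

Lemma class_C_local V W k (O : set V) (f : V -> W) :
  (forall x, O x -> exists U : set V, [/\ open U, U x & class_C k U f]) ->
  class_C k O f.
Proof.
elim: k f => [|k IH] f h; split=> //.
- by move=> x /h[U [_ Ux fU]]; exact: class_C_cont fU Ux.
- by move=> x /h[U [_ Ux fU]]; exact: class_C_cont fU Ux.
move=> v; split; first by move=> x /h[U [_ Ux fU]]; exact: class_C_derivable fU Ux.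
apply: IH => x /h[U [Uo Ux fU]]; exists U; split=> //; exact: class_CD.
Qed.

Lemma smooth_on_open V W (O : set V) (f : V -> W) k :
  open O -> smooth_on O f -> class_C k O f.
Proof.
move=> Oo sf; apply: class_C_local => x Ox.
have [U [g [Uo Ux gC gf]]] := sf _ Ox.
exists (U `&` O); split=> //; first exact: openI.
apply: (@class_C_eq _ _ _ _ g); first exact: openI.
  by move=> z [Uz Oz]; exact: gf.
by apply: class_C_sub (gC k) => z [].
Qed.

Lemma class_C_cst V W k (U : set V) (a : W) : class_C k U (fun=> a).
Proof.
elim: k a => [|k IH] a; split=> //; try by move=> x _; exact: cvg_cst.
move=> v; split; first by move=> x _; exact: derivable_cst.
suff -> : (fun x => 'D_v (fun=> a : W) x) = fun=> 0 by exact: IH.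
by apply/funext => x; exact: derive_cst.
Qed.

(** The difference quotient of an affine map is constant, equal to its linear part [f']; the
    derivative does not depend on the base point and falls under [class_C_cst]. *)
Lemma class_C_aff V W k (U : set V) (f : V -> W) (f' : V -> W) :
  continuous f -> (forall x v h, f (h *: v + x) = h *: f' v + f x) ->
  class_C k U f.
Proof.
move=> fc fa; have D x v : is_derive x v f (f' v).
  have E : \forall h \near 0^', h^-1 *: (f (h *: v + x) - f x) = f' v.
    near=> h; rewrite fa addrK scalerA mulVf ?scale1r//.
    by near: h; exact: nbhs_dnbhs_neq.
  by split; [exact: is_cvg_near_cst E | exact: lim_near_cst E].
case: k => [|k]; split=> //; try by move=> x _; exact: fc.
move=> v; split; first by move=> x _; exact: ex_derive.
suff -> : (fun x => 'D_v f x) = fun=> f' v by exact: class_C_cst.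
by apply/funext => x; have := D x v => ?; exact: derive_val.
Unshelve. all: by end_near. Qed.

(** Along [v] the composite has derivative ['D_(g' v) f \o g], again a directional derivative of [f]
    composed with the same [g], and this closes the induction on [k]. It serves for the shear
    [(x, y) |-> (x + y, y)] of the gluing argument. *)
Lemma class_C_comp_aff V1 V W k (U : set V) (f : V -> W) (g g' : V1 -> V) :
  continuous g -> (forall x v h, g (h *: v + x) = h *: g' v + g x) -> open U ->
  class_C k U f -> class_C k (g @^-1` U) (f \o g).
Proof.
move=> gc ga Uo.
have Oo : open (g @^-1` U) by apply: open_comp => // x _; exact: gc.
elim: k f => [|k IH] f fC.
  split=> // x Ux; apply: continuous_comp; [exact: gc | exact: class_C_cont fC Ux].
have D x v : U (g x) -> is_derive x v (f \o g) ('D_(g' v) f (g x)).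
  move=> Ux; have := class_C_derivable (v := g' v) fC Ux.
  have E : (fun h : R => h^-1 *: ((f \o g) (h *: v + x) - (f \o g) x)) =
      (fun h => h^-1 *: (f (h *: g' v + g x) - f (g x))).
    by apply/funext => h /=; rewrite ga.
  by move=> df; split; rewrite ?/derivable ?/derive E.
split; first by move=> x Ux; apply: continuous_comp; [exact: gc | exact: class_C_cont fC Ux].
move=> v; split; first by move=> x Ux; have [] := D x v Ux.
apply: class_C_eq (IH _ (class_CD (g' v) fC)) => // x Ux /=.
by have := D x v Ux => ?; rewrite derive_val.
Qed.

Lemma class_CDd V W k (U : set V) (f g : V -> W) : open U ->
  class_C k U f -> class_C k U g -> class_C k U (fun x => f x + g x).
Proof.
move=> Uo; elim: k f g => [|k IH] f g fC gC; split=> //.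
- by move=> x Ux; apply: continuousD; [exact: class_C_cont fC Ux | exact: class_C_cont gC Ux].
- by move=> x Ux; apply: continuousD; [exact: class_C_cont fC Ux | exact: class_C_cont gC Ux].
move=> v; split.
  by move=> x Ux; apply: derivableD; [exact: class_C_derivable fC Ux | exact: class_C_derivable gC Ux].
apply: class_C_eq (IH _ _ (class_CD v fC) (class_CD v gC)) => // x Ux.
by rewrite [RHS]deriveD //; [exact: class_C_derivable fC Ux | exact: class_C_derivable gC Ux].
Qed.

Lemma class_C_mul V k (U : set V) (f g : V -> R) : open U ->
  class_C k U f -> class_C k U g -> class_C k U (fun x => f x * g x).
Proof.
move=> Uo; elim: k f g => [|k IH] f g fC gC; split=> //.
- by move=> x Ux; apply: continuousM; [exact: class_C_cont fC Ux | exact: class_C_cont gC Ux].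
- by move=> x Ux; apply: continuousM; [exact: class_C_cont fC Ux | exact: class_C_cont gC Ux].
move=> v; split.
  by move=> x Ux; apply: derivableM; [exact: class_C_derivable fC Ux | exact: class_C_derivable gC Ux].
have C : class_C k U (fun x => f x * 'D_v g x + g x * 'D_v f x).
  by apply: class_CDd => //; apply: IH; [exact: class_CW|exact: class_CD|exact: class_CW|exact: class_CD].
apply: class_C_eq C => // x Ux.
by rewrite [RHS]deriveM //; [exact: class_C_derivable fC Ux | exact: class_C_derivable gC Ux].
Qed.

Lemma class_C_opp V k (U : set V) (f : V -> R) : open U ->
  class_C k U f -> class_C k U (fun x => - f x).
Proof.
move=> Uo fC; apply: (@class_C_eq _ _ _ _ (fun x => -1 * f x)) => //.
  by move=> x _; rewrite mulN1r.
by apply: class_C_mul => //; exact: class_C_cst.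
Qed.

Lemma class_CB V k (U : set V) (f g : V -> R) : open U ->
  class_C k U f -> class_C k U g -> class_C k U (fun x => f x - g x).
Proof. by move=> Uo fC gC; apply: class_CDd => //; exact: class_C_opp. Qed.

Lemma class_C_sum V k (U : set V) (I : Type) (r : seq I) (P : pred I)
  (f : I -> V -> R) : open U ->
  (forall i, class_C k U (f i)) -> class_C k U (fun x => \sum_(i <- r | P i) f i x).
Proof.
move=> Uo fC; elim: r => [|i r IH].
  by apply: class_C_eq (class_C_cst _ _ (0 : R)) => // x _; rewrite big_nil.
have C : class_C k U (fun x => (if P i then f i x else 0) + \sum_(j <- r | P j) f j x).
  by apply: class_CDd => //; case: (P i) => //; exact: class_C_cst.
by apply: class_C_eq C => // x _; rewrite big_cons; case: (P i); rewrite ?add0r.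
Qed.

Lemma class_C_prod V k (U : set V) (I : Type) (r : seq I) (P : pred I)
  (f : I -> V -> R) : open U ->
  (forall i, class_C k U (f i)) -> class_C k U (fun x => \prod_(i <- r | P i) f i x).
Proof.
move=> Uo fC; elim: r => [|i r IH].
  by apply: class_C_eq (class_C_cst _ _ (1 : R)) => // x _; rewrite big_nil.
have C : class_C k U (fun x => (if P i then f i x else 1) * \prod_(j <- r | P j) f j x).
  by apply: class_C_mul => //; case: (P i) => //; exact: class_C_cst.
by apply: class_C_eq C => // x _; rewrite big_cons; case: (P i); rewrite ?mul1r.
Qed.

(** The derivative involves the inverse one order lower, so the induction hypothesis covers it;
    [class_C_sqrt] follows the same scheme. *)
Lemma class_C_inv V k (U : set V) (f : V -> R) : open U ->
  (forall x, U x -> f x != 0) ->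
  class_C k U f -> class_C k U (fun x => (f x)^-1).
Proof.
move=> Uo f0; elim: k f f0 => [|k IH] f f0 fC; split=> //.
- by move=> x Ux; apply: continuousV; [exact: f0 | exact: class_C_cont fC Ux].
- by move=> x Ux; apply: continuousV; [exact: f0 | exact: class_C_cont fC Ux].
move=> v; split.
  by move=> x Ux; apply: derivableV; [exact: f0 | exact: class_C_derivable fC Ux].
have C : class_C k U (fun x => - (((f x)^-1 * (f x)^-1) * 'D_v f x)).
  apply: class_C_opp => //; apply: class_C_mul => //; last exact: class_CD.
  by apply: class_C_mul => //; apply: IH => //; exact: class_CW.
apply: class_C_eq C => // x Ux.
rewrite [RHS]deriveV ?f0 //; last exact: class_C_derivable fC Ux.
by rewrite /GRing.scale /= expr2 invfM mulNr.
Qed.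

Lemma is_derive_line V W (f : V -> W) x v (t : R) :
  derivable f (t *: v + x) v ->
  is_derive t (1:R) (fun s : R => f (s *: v + x)) ('D_v f (t *: v + x)).
Proof.
have E : (fun h : R => h^-1 *: (f ((h *: (1:R) + t) *: v + x) - f (t *: v + x))) =
      (fun h => h^-1 *: (f (h *: v + (t *: v + x)) - f (t *: v + x))).
  by apply/funext => h /=; rewrite [h%:A]mulr1 scalerDl addrA.
by move=> df; split; rewrite ?/derivable ?/derive E.
Qed.

Lemma is_derive_aff V (u x : V) (t : R) :
  is_derive t (1:R) (fun s : R => s *: u + x) u.
Proof.
have := @is_derive_line _ _ (@id V) x u t (@derivable_id _ _ _ _).
by rewrite derive_id.
Qed.

(** Converse of [is_derive_line] at parameter 0. Directional derivatives are computed throughout as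
    derivatives of functions of one real variable, where product, quotient and chain rules are at
    hand. *)
Lemma is_derive_line0 V W (f : V -> W) x v l :
  is_derive (0:R) (1:R) (fun s : R => f (s *: v + x)) l -> is_derive x v f l.
Proof.
have E : (fun h : R => h^-1 *: (f ((h *: (1:R) + 0) *: v + x) - f (0 *: v + x))) =
      (fun h => h^-1 *: (f (h *: v + x) - f x)).
  by apply/funext => h /=; rewrite [h%:A]mulr1 addr0 scale0r add0r.
by case; rewrite ?/derivable ?/derive E => d <-.
Qed.

Lemma is_derive_scale V (f : V -> R) x v (c : R) : derivable f x v ->
  is_derive x (c *: v) f (c * 'D_v f x).
Proof.
move=> df; apply: is_derive_line0.
have -> : (fun s : R => f (s *: (c *: v) + x)) = (fun s => f (s *: v + x)) \o (fun s => c * s).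
  by apply/funext => s /=; rewrite scalerA mulrC.
have d1 : is_derive (c * 0 : R) (1:R) (fun s : R => f (s *: v + x)) ('D_v f x).
  by have := @is_derive_line _ _ f x v (c * 0); rewrite mulr0 scale0r add0r; apply.
have d2 : is_derive (0:R) (1:R) (fun s : R => c * s) c.
  by apply: is_derive_eq; rewrite /GRing.scale /= !mulr1.
by rewrite mulrC; exact: is_derive1_comp.
Qed.

Lemma class_C_sqrt V k (U : set V) (f : V -> R) : open U ->
  (forall x, U x -> 0 < f x) ->
  class_C k U f -> class_C k U (fun x => Num.sqrt (f x)).
Proof.
move=> Uo f0; elim: k f f0 => [|k IH] f f0 fC; split=> //.
- by move=> x Ux; apply: continuous_comp; [exact: class_C_cont fC Ux|exact: sqrt_continuous].
- by move=> x Ux; apply: continuous_comp; [exact: class_C_cont fC Ux|exact: sqrt_continuous].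
move=> v.
have D x : U x -> is_derive x v (fun x => Num.sqrt (f x))
    ((2 * Num.sqrt (f x))^-1 * 'D_v f x).
  move=> Ux; apply: is_derive_line0.
  have -> : (fun s : R => Num.sqrt (f (s *: v + x))) = Num.sqrt \o (fun s => f (s *: v + x)) by [].
  have := @is_derive_line _ _ f x v 0; rewrite scale0r add0r => /(_ (class_C_derivable (v := v) fC Ux)) d.
  apply: is_derive1_comp; rewrite scale0r add0r; exact: is_derive1_sqrt (f0 _ Ux).
split; first by move=> x Ux; have [] := D x Ux.
have C : class_C k U (fun x => (2 * Num.sqrt (f x))^-1 * 'D_v f x).
  apply: class_C_mul => //; last exact: class_CD.
  apply: class_C_inv => //.
    by move=> x Ux; rewrite mulf_neq0 ?pnatr_eq0// gt_eqF// sqrtr_gt0 f0.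
  by apply: class_C_mul => //; [exact: class_C_cst | apply: IH => //; exact: class_CW].
by apply: class_C_eq C => // x Ux; have := D x Ux => ?; rewrite derive_val.
Qed.

End ClassC.

(** * From continuous partial derivatives to differentiability *)

Section Differentiability.
Context {R : realType}.

Lemma differentiable_intro (V W : normedModType R) (f : V -> W) (L : V -> W) x :
  linear L -> continuous L ->
  (forall e : R, 0 < e -> \forall h \near (0 : V), `|f (h + x) - f x - L h| <= e * `|h|) ->
  differentiable f x.
Proof.
move=> Llin Lc H.
pose lM := GRing.isLinear.Build _ _ _ _ _ Llin.
pose Ll : {linear V -> W} := HB.pack L lM.
have E : f \o shift x = cst (f x) + Ll +o_ (0 : V) id.
  apply: eqaddoE; apply/eqaddoP => e e0; near=> h.
  have -> : (f \o shift x - (cst (f x) + Ll)) h = f (h + x) - f x - L h.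
    by rewrite /= opprD addrA.
  near: h; exact: H.
have D := diff_unique (df := Ll) Lc E.
apply/diff_locallyP; rewrite D; split; first exact: Lc.
exact: E.
Unshelve. all: by end_near. Qed.

Lemma mvt_dir (V : normedModType R) (f : V -> R) x v (c : R) :
  (forall t : R, 0 <= t <= 1 -> derivable f (t *: (c *: v) + x) v) ->
  exists2 t : R, 0 <= t <= 1 &
    f (c *: v + x) - f x = c * 'D_v f (t *: (c *: v) + x).
Proof.
move=> df.
have D (t : R) : 0 <= t <= 1 -> is_derive t (1:R) (fun s : R => f (s *: (c *: v) + x))
    (c * 'D_v f (t *: (c *: v) + x)).
  move=> t01; have H := is_derive_scale c (df t t01).
  have := @is_derive_line _ _ _ f x (c *: v) t.
  by rewrite (derive_val (is_derive := H)); apply; have [] := H.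
have [| |t t01 E] := @MVT_segment R (fun s : R => f (s *: (c *: v) + x))
    (fun t => c * 'D_v f (t *: (c *: v) + x)) 0 1 ler01.
- by move=> t /[!in_itv]/= /andP[t0 t1]; apply: D; rewrite !ltW.
- apply: derivable_within_continuous => t; rewrite in_itv/= => t01.
  by have [] := D t t01.
exists t; first by move: t01; rewrite in_itv.
by move: E; rewrite scale1r scale0r add0r subr0 mulr1.
Qed.

(** The displacement is made one vector [e j] at a time, with the mean value theorem on each step;
    the increment differs from [c j * 'D_(e j) f x] by at most [eps * |c j|]. The bound [d] on the
    total length keeps every intermediate point where the derivatives are within [eps] of those at
    x. *)
Lemma telescope_bound (V : normedModType R) (J : Type) (e : J -> V) (f : V -> R)
    (U : set V) x (d eps : R) :
  (forall z, `|z - x| <= d -> U z) ->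
  (forall z j, U z -> derivable f z (e j)) ->
  (forall z j, `|z - x| <= d -> `|'D_(e j) f z - 'D_(e j) f x| <= eps) ->
  forall (r : seq J) (c : J -> R) y,
  `|y - x| + \sum_(j <- r) `|c j *: e j| <= d ->
  `|f (y + \sum_(j <- r) c j *: e j) - f y - \sum_(j <- r) c j * 'D_(e j) f x|
    <= eps * \sum_(j <- r) `|c j|.
Proof.
move=> dU df De; elim=> [|j r IH] c y.
  by rewrite !big_nil !addr0 subrr subr0 normr0 mulr0.
rewrite !big_cons => yd.
have yd' t : 0 <= t <= 1 -> `|t *: (c j *: e j) + y - x| <= d.
  move=> /andP[t0 t1]; apply: le_trans yd; rewrite -addrA.
  apply: le_trans (ler_normD _ _) _.
  rewrite [leLHS]addrC lerD2l normrZ (ger0_norm t0).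
  apply: (@le_trans _ _ `|c j *: e j|); first by rewrite ler_piMl.
  by rewrite lerDl sumr_ge0.
have [|t t01 Et] := @mvt_dir _ f y (e j) (c j).
  by move=> t /yd' /dU ?; exact: df.
have /IH : `|(c j *: e j + y) - x| + \sum_(j <- r) `|c j *: e j| <= d.
  apply: le_trans yd; rewrite addrA lerD2r -addrA addrC.
  exact: ler_normD.
move=> {}IH.
rewrite mulrDr.
have -> : f (y + (c j *: e j + \sum_(j0 <- r) c j0 *: e j0)) - f y -
   (c j * 'D_(e j) f x + \sum_(j0 <- r) c j0 * 'D_(e j0) f x) =
   c j * ('D_(e j) f (t *: (c j *: e j) + y) - 'D_(e j) f x) +
   (f (c j *: e j + y + \sum_(j0 <- r) c j0 *: e j0) - f (c j *: e j + y) -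
     \sum_(j0 <- r) c j0 * 'D_(e j0) f x).
  by rewrite mulrBr -Et addrCA addrA; ring.
apply: le_trans (ler_normD _ _) _; apply: lerD => //.
by rewrite normrM mulrC ler_wpM2r // De // yd'.
Qed.

(** The basis [e] and its coordinate forms [phi] are parameters so that the result applies to
    [V * V], whose basis is indexed by ['I_n + 'I_n]. *)
Lemma differentiable_C1 (V : normedModType R) (J : finType) (e : J -> V)
    (phi : J -> V -> R) (U : set V) (f : V -> R) x :
  (forall j (a : R) u v, phi j (a *: u + v) = a * phi j u + phi j v) ->
  (forall j v, `|phi j v| <= `|v|) ->
  (forall v, v = \sum_j phi j v *: e j) ->
  open U -> U x -> class_C 1 U f ->
  differentiable f x.
Proof.
move=> plin pb pe Uo Ux fC.
pose L v := \sum_j phi j v * 'D_(e j) f x.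
have Llin : linear (L : V -> R).
  move=> a u v; rewrite /L /GRing.scale /= mulr_sumr -big_split /=.
  by apply: eq_bigr => j _; rewrite plin mulrDl mulrA.
pose lM := GRing.isLinear.Build _ _ _ _ _ Llin.
pose Ll : {linear V -> R} := HB.pack L lM.
have Lc : continuous L.
  apply: (@bounded_linear_continuous _ _ _ Ll).
  apply/linear_boundedP; exists (\sum_j `|'D_(e j) f x|); split; first exact: num_real.
  move=> K HK v; rewrite /= /L.
  apply: le_trans (ler_norm_sum _ _ _) _.
  apply: (@le_trans _ _ (\sum_j `|'D_(e j) f x| * `|v|)).
    by apply: ler_sum => j _; rewrite normrM mulrC ler_wpM2l.
  by rewrite -mulr_suml ler_wpM2r // ltW.
apply: (@differentiable_intro _ _ _ L) => // eps eps0.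
(* [S] exceeds the number of coordinates by one, so that the errors [e' * |h|], one per coordinate,
   add up to at most [eps * |h|]; the extra 1 keeps it positive when [J] is empty. *)
pose S := 1 + \sum_(j : J) (1 : R).
have S0 : 0 < S by rewrite ltr_pwDl // sumr_ge0.
pose e' := eps / S.
have e'0 : 0 < e' by rewrite divr_gt0.
have [d d0 Hd] : exists2 d : R, 0 < d & forall z, `|z - x| <= d ->
    U z /\ forall j, `|'D_(e j) f z - 'D_(e j) f x| <= e'.
  have : \forall z \near x, U z /\ forall j, `|'D_(e j) f z - 'D_(e j) f x| <= e'.
    near=> z; split; first by near: z; exact: open_nbhs_nbhs.
    near: z; apply: filter_forall => j.
    have := class_C_cont (class_CD (e j) fC) Ux.
    move=> /cvgrPdist_le /(_ _ e'0).
    by apply: filterS => z; rewrite distrC.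
  move=> /nbhs_ballP [d /= d0 Hd]; exists (d / 2); first by rewrite divr_gt0.
  move=> z zd; apply: Hd; rewrite -ball_normE /= distrC (le_lt_trans zd) //.
  by rewrite ltr_pdivrMr // ltr_pMr // ltr1n.
pose M := 1 + \sum_(j : J) `|e j|.
have M0 : 0 < M by rewrite ltr_pwDl // sumr_ge0.
near=> h.
have hd : `|h| * M <= d.
  rewrite -ler_pdivlMr //; near: h.
  by apply: nbhs0_le; rewrite divr_gt0.
have := @telescope_bound _ J e f U x d e' (fun z zd => (Hd z zd).1)
  (fun z j Uz => class_C_derivable fC Uz) (fun z j zd => (Hd z zd).2 j)
  (index_enum J) (phi ^~ h) x.
rewrite subrr normr0 add0r -pe => T.
rewrite (addrC h x); apply: le_trans (T _) _.
  apply: le_trans hd; rewrite /M mulrDr mulr1 mulr_sumr.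
  apply: (@le_trans _ _ (\sum_j `|h| * `|e j|)).
    by apply: ler_sum => j _; rewrite normrZ ler_wpM2r.
  by rewrite lerDr.
rewrite /e' -mulrA ler_wpM2l ?(ltW eps0)// ler_pdivrMl //.
apply: (@le_trans _ _ (\sum_(j : J) `|h|)); first by apply: ler_sum => j _; exact: pb.
rewrite /S mulrDl mul1r mulr_suml.
under [X in _ <= _ + X]eq_bigr do rewrite mul1r.
by rewrite lerDr.
Unshelve. all: by end_near. Qed.

Lemma coord_le_norm m n (M : 'M[R]_(m, n)) i j : `|M i j| <= `|M|.
Proof.
rewrite [leRHS]/Num.Def.normr/= mx_normrE.
exact: (le_trans _ (le_bigmax _ (fun ij : 'I_m * 'I_n => `|M ij.1 ij.2|) (i, j))).
Qed.

End Differentiability.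

(** * Calculus on the tangent bundle without its zero section *)

Section TangentFunctions.
Context {R : realType} {n : nat}.
Notation V := 'rV[R]_n.
Implicit Types (f g : V -> V -> R) (x y u v : V) (D : set V).

(** Derivatives along arbitrary vectors: [pdx] and [pdy] are the cases of the basis vectors, and
    identities between one-forms can be written without indices. *)
Definition dx f u : V -> V -> R := fun x y => 'D_u (fun z => f z y) x.
Definition dy f u : V -> V -> R := fun x y => 'D_u (f x) y.
Definition slit D : set (V * V) := [set p | D p.1 /\ p.2 != 0].
Definition smoothF D f := forall k, class_C k (slit D) (fun p => f p.1 p.2).

Lemma open_slit D : open D -> open (slit D).
Proof.
move=> Do; rewrite (_ : slit D = fst @^-1` D `&` snd @^-1` [set y | y != 0]) //.
apply: openI; first by apply: open_comp => // p _; exact: cvg_fst.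
apply: open_comp; first by move=> p _; exact: cvg_snd.
have -> : [set y : V | y != 0] = ~` [set 0] by apply/seteqP; split => y /= /eqP.
by apply: closed_openC; apply: accessible_closed_set1; apply: hausdorff_accessible; exact: norm_hausdorff.
Qed.

Lemma derive_dx f u x y : 'D_(u, 0) (fun p : V * V => f p.1 p.2) (x, y) = dx f u x y.
Proof.
rewrite /dx /derive; set d := (fun _ : R => _); set d' := (fun _ : R => _).
suff -> : d = d' by []; apply/funext => h; rewrite /d /d' /=.
by rewrite scaler0 add0r.
Qed.

Lemma derive_dy f u x y : 'D_(0, u) (fun p : V * V => f p.1 p.2) (x, y) = dy f u x y.
Proof.
rewrite /dy /derive; set d := (fun _ : R => _); set d' := (fun _ : R => _).
suff -> : d = d' by []; apply/funext => h; rewrite /d /d' /=.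
by rewrite scaler0 add0r.
Qed.

Section Smooth.
Variables (D : set V) (Dopen : open D).

Let Oo := open_slit Dopen.

Lemma smoothF_dx f u : smoothF D f -> smoothF D (dx f u).
Proof.
move=> fC k; apply: class_C_eq (class_CD ((u, 0) : V * V) (fC k.+1)) => //.
by move=> [x y] _; exact: derive_dx.
Qed.

Lemma smoothF_dy f u : smoothF D f -> smoothF D (dy f u).
Proof.
move=> fC k; apply: class_C_eq (class_CD ((0, u) : V * V) (fC k.+1)) => //.
by move=> [x y] _; exact: derive_dy.
Qed.

Lemma smoothF_differentiable f x y : smoothF D f -> D x -> y != 0 ->
  differentiable (fun p : V * V => f p.1 p.2) (x, y).
Proof.
move=> fC Dx y0.
pose e (j : 'I_n + 'I_n) : V * V := match j with inl i => (delta_mx 0 i, 0) | inr i => (0, delta_mx 0 i) end.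
pose phi (j : 'I_n + 'I_n) (p : V * V) : R := match j with inl i => p.1 0 i | inr i => p.2 0 i end.
apply: (@differentiable_C1 _ _ _ e phi (slit D)) => //.
- by case=> i a u v; rewrite /= !mxE.
- case=> i v /=; rewrite prod_normE; apply: le_trans (coord_le_norm _ _ _) _.
    by rewrite le_max lexx.
  by rewrite le_max lexx orbT.
- move=> [u v]; rewrite big_sumType /=.
  have -> : \sum_i u 0 i *: ((delta_mx 0 i, 0) : V * V) = (\sum_i u 0 i *: delta_mx 0 i, 0).
    apply: (big_rec2 (fun (p : V * V) q => p = (q, 0))) => // i q p _ ->.
    by congr pair; rewrite /= ?scaler0 ?addr0.
  have -> : \sum_i v 0 i *: ((0, delta_mx 0 i) : V * V) = (0, \sum_i v 0 i *: delta_mx 0 i).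
    apply: (big_rec2 (fun (p : V * V) q => p = (0, q))) => // i q p _ ->.
    by congr pair; rewrite /= ?scaler0 ?addr0.
  by rewrite -!row_sum_delta; congr pair; rewrite ?addr0 ?add0r.
Qed.

Lemma diffF f x y u v : smoothF D f -> D x -> y != 0 ->
  'd (fun p : V * V => f p.1 p.2) (x, y) (u, v) = dx f u x y + dy f v x y.
Proof.
move=> fC Dx y0; have df := smoothF_differentiable fC Dx y0.
rewrite -derive_dx -derive_dy !deriveE // -linearD; congr ('d _ _ _).
by congr pair; rewrite ?addr0 ?add0r.
Qed.

(** Base point and vector move together, so this rests on differentiability of the function on
    [V * V]. Derivatives along geodesics and lines, and those of the calibrations, come from
    here. *)
Lemma is_derive_chain f (c1 c2 : R -> V) (t : R) u v : smoothF D f ->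
  D (c1 t) -> c2 t != 0 -> is_derive t (1:R) c1 u -> is_derive t (1:R) c2 v ->
  is_derive t (1:R) (fun s => f (c1 s) (c2 s)) (dx f u (c1 t) (c2 t) + dy f v (c1 t) (c2 t)).
Proof.
move=> fC Dx y0 d1 d2.
have df := smoothF_differentiable fC Dx y0.
have e1 : differentiable c1 t by apply/derivable1_diffP; case: d1.
have e2 : differentiable c2 t by apply/derivable1_diffP; case: d2.
have dp := differentiable_pair e1 e2.
have dcomp : differentiable ((fun p : V * V => f p.1 p.2) \o (fun s => (c1 s, c2 s))) t.
  exact: differentiable_comp.
split; first by apply/derivable1_diffP; exact: dcomp.
have Ec : 'd ((fun p : V * V => f p.1 p.2) \o (fun s => (c1 s, c2 s))) t 1 =
    'd (fun p : V * V => f p.1 p.2) (c1 t, c2 t) ('d (fun s => (c1 s, c2 s)) t 1).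
  by rewrite (diff_comp dp df).
have Ep : 'd (fun s => (c1 s, c2 s)) t 1 = ('d c1 t 1, 'd c2 t 1).
  by rewrite (diff_pair e1 e2).
have Eu : 'd c1 t 1 = u by case: d1 => _ <-; apply/esym; exact: deriveE.
have Ev : 'd c2 t 1 = v by case: d2 => _ <-; apply/esym; exact: deriveE.
apply: etrans (deriveE _ dcomp) _.
have Ep' := etrans Ep (f_equal2 pair Eu Ev).
clear Ep Eu Ev.
apply: etrans Ec _.
have Ed := diffF u v fC Dx y0.
apply: etrans _ Ed.
apply: (f_equal ('d (fun p : V * V => f p.1 p.2) (c1 t, c2 t))).
exact Ep'.
Qed.

Lemma dxD f a u v x y : smoothF D f -> D x -> y != 0 ->
  dx f (a *: u + v) x y = a * dx f u x y + dx f v x y.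
Proof.
move=> fC Dx y0; have df := smoothF_differentiable fC Dx y0.
have -> : dx f (a *: u + v) x y = 'd (fun p : V * V => f p.1 p.2) (x, y) (a *: (u, 0) + (v, 0)).
  rewrite -derive_dx deriveE //; congr ('d _ _ _).
  by congr pair; rewrite /= ?scaler0 ?addr0.
by rewrite linearP /= !diffF // /dy !derive0 !addr0.
Qed.

Lemma dyD f a u v x y : smoothF D f -> D x -> y != 0 ->
  dy f (a *: u + v) x y = a * dy f u x y + dy f v x y.
Proof.
move=> fC Dx y0; have df := smoothF_differentiable fC Dx y0.
have -> : dy f (a *: u + v) x y = 'd (fun p : V * V => f p.1 p.2) (x, y) (a *: (0, u) + (0, v)).
  rewrite -derive_dy deriveE //; congr ('d _ _ _).
  by congr pair; rewrite /= ?scaler0 ?addr0.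
by rewrite linearP /= !diffF // /dx !derive0 !add0r.
Qed.

End Smooth.
End TangentFunctions.

Section TangentCalculus.
Context {R : realType} {n : nat}.
Notation V := 'rV[R]_n.
Implicit Types (f g : V -> V -> R) (x y u v : V).
Variables (D : set V) (Dopen : open D).

Lemma is_derive_dy f x y u : smoothF D f -> D x -> y != 0 ->
  is_derive y u (f x) (dy f u x y).
Proof.
move=> fC Dx y0; apply: is_derive_line0.
have c : is_derive (0:R) (1:R) (fun s : R => s *: u + y) (u : V) by exact: is_derive_aff.
have := @is_derive_chain _ _ D Dopen f (fun=> x) (fun s : R => s *: u + y) 0 0 u fC Dx.
rewrite /= scale0r add0r => /(_ y0 _ c) H.
by move: H; rewrite /dx derive0 add0r.
Qed.

Lemma is_derive_dx f x y u : smoothF D f -> D x -> y != 0 ->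
  is_derive x u (fun z => f z y) (dx f u x y).
Proof.
move=> fC Dx y0; apply: is_derive_line0.
have c : is_derive (0:R) (1:R) (fun s : R => s *: u + x) (u : V) by exact: is_derive_aff.
have := @is_derive_chain _ _ D Dopen f (fun s : R => s *: u + x) (fun=> y) 0 u 0 fC.
rewrite /= scale0r add0r => /(_ Dx y0 c) H.
by move: H; rewrite /dy derive0 addr0 => /(_ (is_derive_cst _ _ _)).
Qed.

Lemma dy_eq f g x y u : D x -> y != 0 ->
  (forall x y, D x -> y != 0 -> f x y = g x y) -> dy f u x y = dy g u x y.
Proof.
move=> Dx y0 fg; apply: near_eq_derive.
have Oy : open [set y : V | y != 0].
  have -> : [set y : V | y != 0] = ~` [set 0] by apply/seteqP; split => z /= /eqP.
  by apply: closed_openC; apply: accessible_closed_set1; apply: hausdorff_accessible; exact: norm_hausdorff.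
by apply: (open_near_eq Oy y0) => z z0; exact: fg.
Qed.

Lemma dx_eq f g x y u : D x -> y != 0 ->
  (forall x y, D x -> y != 0 -> f x y = g x y) -> dx f u x y = dx g u x y.
Proof.
move=> Dx y0 fg; apply: near_eq_derive.
by apply: (open_near_eq Dopen Dx) => z Dz; exact: fg.
Qed.

Lemma dyM f g x y u : smoothF D f -> smoothF D g -> D x -> y != 0 ->
  dy (fun x y => f x y * g x y) u x y = f x y * dy g u x y + dy f u x y * g x y.
Proof.
move=> fC gC Dx y0; have df := is_derive_dy u fC Dx y0.
have dg := is_derive_dy u gC Dx y0.
have [_ E] := is_deriveM df dg.
rewrite [dy f u x y * _]mulrC; exact: E.
Qed.

Lemma dxM f g x y u : smoothF D f -> smoothF D g -> D x -> y != 0 ->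
  dx (fun x y => f x y * g x y) u x y = f x y * dx g u x y + dx f u x y * g x y.
Proof.
move=> fC gC Dx y0; have df := is_derive_dx u fC Dx y0.
have dg := is_derive_dx u gC Dx y0.
have [_ E] := is_deriveM df dg.
rewrite [dx f u x y * _]mulrC; exact: E.
Qed.

Lemma dyDf f g x y u : smoothF D f -> smoothF D g -> D x -> y != 0 ->
  dy (fun x y => f x y + g x y) u x y = dy f u x y + dy g u x y.
Proof.
move=> fC gC Dx y0; have df := is_derive_dy u fC Dx y0.
by have dg := is_derive_dy u gC Dx y0; have [_] := is_deriveD df dg.
Qed.

Lemma smoothF_eq f g : (forall x y, D x -> y != 0 -> f x y = g x y) ->
  smoothF D f -> smoothF D g.
Proof.
move=> fg fC k; apply: class_C_eq (fC k); first exact: open_slit.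
by move=> [x y] [/= Dx y0]; exact: fg.
Qed.

Lemma smoothF_cst (c : R) : smoothF D (fun _ _ => c).
Proof. by move=> k; exact: class_C_cst. Qed.

Lemma smoothFM f g : smoothF D f -> smoothF D g -> smoothF D (fun x y => f x y * g x y).
Proof. by move=> fC gC k; apply: (class_C_mul (open_slit Dopen)); [exact: fC|exact: gC]. Qed.

Lemma smoothFD f g : smoothF D f -> smoothF D g -> smoothF D (fun x y => f x y + g x y).
Proof. by move=> fC gC k; apply: (class_CDd (open_slit Dopen)); [exact: fC|exact: gC]. Qed.

Lemma smoothFB f g : smoothF D f -> smoothF D g -> smoothF D (fun x y => f x y - g x y).
Proof. by move=> fC gC k; apply: (class_CB (open_slit Dopen)); [exact: fC|exact: gC]. Qed.

Lemma smoothFV f : (forall x y, D x -> y != 0 -> f x y != 0) ->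
  smoothF D f -> smoothF D (fun x y => (f x y)^-1).
Proof.
move=> f0 fC k; apply: (class_C_inv (open_slit Dopen)); last exact: fC.
by move=> [x y] [/= Dx y0]; exact: f0.
Qed.

Lemma smoothF_sum (I : Type) (r : seq I) (P : pred I) (f : I -> V -> V -> R) :
  (forall i, smoothF D (f i)) -> smoothF D (fun x y => \sum_(i <- r | P i) f i x y).
Proof.
move=> fC k.
by apply: (class_C_sum _ _ (open_slit Dopen) (f := fun i p => f i p.1 p.2)) => i; exact: fC.
Qed.

Lemma smoothF_prod (I : Type) (r : seq I) (P : pred I) (f : I -> V -> V -> R) :
  (forall i, smoothF D (f i)) -> smoothF D (fun x y => \prod_(i <- r | P i) f i x y).
Proof.
move=> fC k.
by apply: (class_C_prod _ _ (open_slit Dopen) (f := fun i p => f i p.1 p.2)) => i; exact: fC.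
Qed.

Lemma smoothF_coord (i : 'I_n) : smoothF D (fun _ y => y 0 i).
Proof.
move=> k; apply: (@class_C_aff _ _ _ _ _ _ (fun p : V * V => p.2 0 i)).
  move=> p; apply: (@continuous_comp _ _ _ (snd : V * V -> V) (fun z : V => z 0 i)).
    exact: cvg_snd.
  exact: coord_continuous.
by move=> x v h; rewrite /= !mxE.
Qed.

Lemma dy0 f x y : dy f 0 x y = 0. Proof. exact: derive0. Qed.
Lemma dx0 f x y : dx f 0 x y = 0. Proof. exact: derive0. Qed.

Lemma dyZ f a u x y : smoothF D f -> D x -> y != 0 -> dy f (a *: u) x y = a * dy f u x y.
Proof. by move=> fC Dx y0; rewrite -[a *: u]addr0 (dyD Dopen) // dy0 addr0. Qed.

Lemma dxZ f a u x y : smoothF D f -> D x -> y != 0 -> dx f (a *: u) x y = a * dx f u x y.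
Proof. by move=> fC Dx y0; rewrite -[a *: u]addr0 (dxD Dopen) // dx0 addr0. Qed.

Lemma dy_sum f u x y : smoothF D f -> D x -> y != 0 ->
  dy f u x y = \sum_i u 0 i * pdy f i x y.
Proof.
move=> fC Dx y0; rewrite {1}(row_sum_delta u).
apply: (big_rec2 (fun v r => dy f v x y = r)); first exact: dy0.
by move=> i r v _ <-; rewrite (dyD Dopen).
Qed.

Lemma dx_sum f u x y : smoothF D f -> D x -> y != 0 ->
  dx f u x y = \sum_i u 0 i * pdx f i x y.
Proof.
move=> fC Dx y0; rewrite {1}(row_sum_delta u).
apply: (big_rec2 (fun v r => dx f v x y = r)); first exact: dx0.
by move=> i r v _ <-; rewrite (dxD Dopen).
Qed.

Lemma dy_sumf (I : Type) (r : seq I) (f : I -> V -> V -> R) u x y :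
  (forall i, smoothF D (f i)) -> D x -> y != 0 ->
  dy (fun x y => \sum_(i <- r) f i x y) u x y = \sum_(i <- r) dy (f i) u x y.
Proof.
move=> fC Dx y0; elim: r => [|i r IH].
  rewrite big_nil (@dy_eq _ (fun _ _ => 0)) //; first exact: derive_cst.
  by move=> *; rewrite big_nil.
rewrite big_cons -IH -dyDf //; last exact: smoothF_sum.
by apply: dy_eq => // *; rewrite big_cons.
Qed.

Lemma dy_cst (c : R) u x y : dy (fun _ _ => c) u x y = 0.
Proof. exact: derive_cst. Qed.

Lemma dy_coord (i : 'I_n) u x y : D x -> y != 0 -> dy (fun _ y => y 0 i) u x y = u 0 i.
Proof.
move=> Dx y0; rewrite dy_sum //; last exact: smoothF_coord.
have E j : pdy (fun _ y => y 0 i) j x y = (j == i)%:R.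
  have D1 : is_derive (0:R) (1:R) (fun s : R => (s *: delta_mx 0 j + y) 0 i : R) (j == i)%:R.
    have -> : (fun s : R => (s *: delta_mx 0 j + y) 0 i : R) = (fun s => s * (j == i)%:R + y 0 i).
      by apply/funext => s; rewrite !mxE eqxx /= eq_sym.
    by apply: is_derive_eq; rewrite /GRing.scale /= mulr0 add0r mulr1 addr0.
  have D2 : is_derive y (delta_mx 0 j) (fun y : V => y 0 i : R) (j == i)%:R.
    exact: (@is_derive_line0 _ _ _ (fun y : V => y 0 i : R)).
  by rewrite /pdy (derive_val (is_derive := D2)).
rewrite (bigD1 i) //= E eqxx mulr1 big1 ?addr0 // => j ji.
by rewrite E (negbTE ji) mulr0.
Qed.

(** The first sum appears because the coefficients [y 0 i] are differentiated too. Applied to Euler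
    relations, the identity yields their differentiated forms. *)
Lemma dy_contr (f : 'I_n -> V -> V -> R) u x y : (forall i, smoothF D (f i)) ->
  D x -> y != 0 -> dy (fun x y => \sum_i y 0 i * f i x y) u x y =
  \sum_i u 0 i * f i x y + \sum_i y 0 i * dy (f i) u x y.
Proof.
move=> fC Dx y0; rewrite dy_sumf //; last by move=> i; apply: smoothFM => //; exact: smoothF_coord.
rewrite -big_split /=; apply: eq_bigr => i _.
by rewrite dyM // ?dy_coord // 1?addrC //; exact: smoothF_coord.
Qed.

(** Positive factors only, since the metrics need not be reversible. *)
Definition homog d f := forall x y (a : R), D x -> y != 0 -> 0 < a ->
  f x (a *: y) = a ^+ d * f x y.

(** Derivative at [s = 0] of [f x ((s + 1) *: y) = (s + 1) ^+ d * f x y], valid for [- 1 < s]. *)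
Lemma euler d f x y : homog d f -> smoothF D f -> D x -> y != 0 ->
  dy f y x y = d%:R * f x y.
Proof.
move=> hf fC Dx y0; have [df _] := is_derive_dy y fC Dx y0.
have := @is_derive_line _ _ _ (f x) y y 0; rewrite scale0r add0r => /(_ df) H.
have E : \forall s \near (0:R), f x (s *: y + y) = (s + 1) ^+ d * f x y.
  have : \forall s \near (0:R), - 1 < s.
    by apply: (open_nbhs_nbhs (conj _ _)); [exact: open_gt | rewrite /= ltrN10].
  apply: filterS => s s1; rewrite -[X in _ + X]scale1r -scalerDl hf //.
  by rewrite -(ltrD2r (-1)) sub0r addrK.
have H2 := near_eq_is_derive E H.
have D2 : is_derive (0:R) (1:R) (fun s : R => (s + 1) ^+ d * f x y) (d%:R * f x y).
  have D3 : is_derive (0:R) (1:R) (fun s : R => s + 1) 1 by apply: is_derive_eq; rewrite addr0.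
  have D4 := is_deriveX d D3.
  have D5 : is_derive (0:R) (1:R) (fun s : R => (s + 1) ^+ d) (d%:R : R).
    by move: D4; rewrite exprfctE add0r expr1n mulr1 [_%:A]mulr1.
  have D6 := is_deriveM D5 (is_derive_cst (f x y) (0:R) (1:R)).
  apply: (@is_derive_eq _ _ _ _ _ _ _ _ D6).
  by rewrite scaler0 add0r; exact: mulrC.
by rewrite -[LHS](derive_val (is_derive := H2)) (derive_val (is_derive := D2)).
Qed.

Lemma homog_dx d f u : smoothF D f -> homog d f -> homog d (dx f u).
Proof.
move=> fC hf x y a Dx y0 a0; rewrite /dx.
have [df _] := is_derive_dx u fC Dx y0.
rewrite (@near_eq_derive _ _ _ _ (fun z => a ^+ d * f z y)).
  have -> : (fun z => a ^+ d * f z y) = a ^+ d *: (fun z => f z y) by [].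
  by rewrite deriveZ.
by apply: (open_near_eq Dopen Dx) => z Dz; rewrite hf.
Qed.

(** Pulling the factor [a] out of [s *: u + a *: y] turns the direction [u] into [a^-1 *: u], which
    costs one degree. *)
Lemma homog_dy d f u : smoothF D f -> homog d.+1 f -> homog d (dy f u).
Proof.
move=> fC hf x y a Dx y0 a0; have ay0 : a *: y != 0 by rewrite scaler_eq0 gt_eqF.
have au0 : a != 0 by rewrite gt_eqF.
have c : is_derive (0:R) (1:R) (fun s : R => s *: (a^-1 *: u) + y) (a^-1 *: u : V) by exact: is_derive_aff.
have := @is_derive_chain _ _ D Dopen f (fun=> x) (fun s : R => s *: (a^-1 *: u) + y) 0 0 (a^-1 *: u) fC Dx.
rewrite /= scale0r add0r dx0 add0r => /(_ y0 (is_derive_cst _ _ _) c) H.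
have [df _] := is_derive_dy u fC Dx ay0.
have := @is_derive_line _ _ _ (f x) (a *: y) u 0; rewrite scale0r add0r => /(_ df) H1.
have E : \forall s \near (0:R), f x (s *: u + a *: y) = a ^+ d.+1 * f x (s *: (a^-1 *: u) + y).
  have Oy : open [set y : V | y != 0].
    have -> : [set y : V | y != 0] = ~` [set 0] by apply/seteqP; split => z /= /eqP.
    by apply: closed_openC; apply: accessible_closed_set1; apply: hausdorff_accessible; exact: norm_hausdorff.
  have cc : {for 0, continuous (fun s : R => s *: (a^-1 *: u) + y)}.
    by apply: differentiable_continuous; apply/derivable1_diffP; case: c.
  have : \forall s \near (0:R), s *: (a^-1 *: u) + y != 0.
    have : nbhs (0 *: (a^-1 *: u) + y) [set y : V | y != 0].
      by apply: open_nbhs_nbhs; split => //=; rewrite scale0r add0r.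
    by move/cc.
  apply: filterS => s s0; rewrite -hf //; congr (f x _).
  by rewrite scalerDr !scalerA mulrAC mulfV // mul1r.
have H2 := near_eq_is_derive E H1.
have H3 : is_derive (0:R) (1:R) (fun s : R => a ^+ d.+1 * f x (s *: (a^-1 *: u) + y))
   (a ^+ d.+1 * dy f (a^-1 *: u) x y).
  exact: (@is_deriveZ _ _ _ (fun s : R => f x (s *: (a^-1 *: u) + y)) (a ^+ d.+1)).
rewrite -[LHS](derive_val (is_derive := H2)) (derive_val (is_derive := H3)).
by rewrite dyZ // exprSr -mulrA mulVKf.
Qed.

End TangentCalculus.

(** * Spray and curvature of straight metrics *)

Section FinslerAlgebra.
Context {R : realType} {n : nat}.
Notation V := 'rV[R]_n.
Implicit Types (x y u v w : V).
Variables (D : set V) (Dopen : open D) (F : V -> V -> R) (HF : finsler D F).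

Lemma finsler_smooth : smoothF D F.
Proof.
move=> k; case: HF => _ sF; apply: smooth_on_open; first exact: open_slit.
exact: sF.
Qed.

Let FC := finsler_smooth.

Lemma finsler_pos x y : D x -> y != 0 -> 0 < F x y.
Proof.
move=> Dx y0; case: HF => /(_ _ Dx)[h1 h2 _ _ _] _.
by rewrite lt_neqAle h1 andbT eq_sym; apply: contra y0 => /eqP/h2 ->.
Qed.

Lemma finsler_homog : homog D 1 F.
Proof. by move=> x y a Dx y0 a0; case: HF => /(_ _ Dx)[_ _ h _ _] _; rewrite h. Qed.

Lemma homog_sqF : homog D 2 (sqF F).
Proof.
move=> x y a Dx y0 a0; rewrite /sqF finsler_homog //.
by rewrite expr1 exprMn.
Qed.

Lemma sqF_smooth : smoothF D (sqF F).
Proof. by apply: (smoothF_eq Dopen) (smoothFM Dopen FC FC) => x y _ _; rewrite /sqF expr2. Qed.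

Let QC := sqF_smooth.

Lemma dy_sqF u x y : D x -> y != 0 -> dy (sqF F) u x y = 2 * F x y * dy F u x y.
Proof.
move=> Dx y0; rewrite (@dy_eq _ _ D _ (fun x y => F x y * F x y)) //.
by rewrite (dyM Dopen) //; ring.
Qed.

Lemma dx_sqF u x y : D x -> y != 0 -> dx (sqF F) u x y = 2 * F x y * dx F u x y.
Proof.
move=> Dx y0; rewrite (@dx_eq _ _ D Dopen _ (fun x y => F x y * F x y)) //.
by rewrite (dxM Dopen) //; ring.
Qed.

(** The fundamental tensor as a bilinear form, kept free of matrices. *)
Definition gform u w x y := 2^-1 * dy (dy (sqF F) u) w x y.

Lemma gformE u w x y : D x -> y != 0 ->
  gform u w x y = \sum_i \sum_j u 0 i * fund_tensor F x y i j * w 0 j.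
Proof.
move=> Dx y0; rewrite /gform.
have E : dy (dy (sqF F) u) w x y = \sum_i u 0 i * dy (pdy (sqF F) i) w x y.
  rewrite (@dy_eq _ _ D _ (fun x y => \sum_i u 0 i * pdy (sqF F) i x y)) //; last first.
    by move=> *; rewrite (dy_sum Dopen).
  have iC i : smoothF D (pdy (sqF F) i) by exact: smoothF_dy.
  rewrite (dy_sumf Dopen) //; last by move=> i; apply: smoothFM => //; exact: smoothF_cst.
  apply: eq_bigr => i _; rewrite (dyM Dopen) ?dy_cst ?mul0r ?addr0 //; exact: smoothF_cst.
rewrite E mulr_sumr; apply: eq_bigr => i _.
rewrite (dy_sum Dopen) //; last exact: smoothF_dy.
rewrite !mulr_sumr; apply: eq_bigr => j _; rewrite mxE; ring.
Qed.

Lemma fund_formE u w x y : D x -> y != 0 -> fund_form F x y u w = gform u w x y.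
Proof.
move=> Dx y0; rewrite gformE // /fund_form mxE exchange_big /=.
by apply: eq_bigr => j _; rewrite !mxE mulr_suml.
Qed.

Lemma gform_gt0 u x y : D x -> y != 0 -> u != 0 -> 0 < gform u u x y.
Proof.
move=> Dx y0 u0; case: (HF) => /(_ _ Dx)[_ _ _ _ /(_ y u y0 u0) h] _.
rewrite gformE //; suff -> : \sum_i \sum_j u 0 i * fund_tensor F x y i j * u 0 j =
   2^-1 * \sum_i \sum_j 'D_(delta_mx 0 j) ('D_(delta_mx 0 i) (fun z => F x z ^+ 2)) y
              * u 0 i * u 0 j by rewrite mulr_gt0 // invr_gt0.
rewrite mulr_sumr; apply: eq_bigr => i _; rewrite mulr_sumr; apply: eq_bigr => j _.
by rewrite mxE /pdy /sqF; ring.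
Qed.

Lemma gformDl a u v w x y : D x -> y != 0 ->
  gform (a *: u + v) w x y = a * gform u w x y + gform v w x y.
Proof.
move=> Dx y0; rewrite !gformE // mulr_sumr -big_split; apply: eq_bigr => i _ /=.
rewrite mulr_sumr -big_split; apply: eq_bigr => j _ /=; rewrite !mxE; ring.
Qed.

Lemma gformDr a u v w x y : D x -> y != 0 ->
  gform w (a *: u + v) x y = a * gform w u x y + gform w v x y.
Proof.
move=> Dx y0; rewrite !gformE // mulr_sumr -big_split; apply: eq_bigr => i _ /=.
rewrite mulr_sumr -big_split; apply: eq_bigr => j _ /=; rewrite !mxE; ring.
Qed.

Lemma gform_addl u v w x y : D x -> y != 0 ->
  gform (u + v) w x y = gform u w x y + gform v w x y.
Proof.
move=> Dx y0; rewrite !gformE // -big_split; apply: eq_bigr => i _ /=.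
rewrite -big_split; apply: eq_bigr => j _ /=; rewrite !mxE; ring.
Qed.

Lemma gform_addr u v w x y : D x -> y != 0 ->
  gform w (u + v) x y = gform w u x y + gform w v x y.
Proof.
move=> Dx y0; rewrite !gformE // -big_split; apply: eq_bigr => i _ /=.
rewrite -big_split; apply: eq_bigr => j _ /=; rewrite !mxE; ring.
Qed.

Lemma gform_r u x y : D x -> y != 0 -> gform u y x y = F x y * dy F u x y.
Proof.
move=> Dx y0; rewrite /gform (@euler _ _ D Dopen 1) //.
- by rewrite dy_sqF //; field.
- by apply: (homog_dy Dopen _ QC); exact: homog_sqF.
- exact: smoothF_dy.
Qed.

(** In [gform_r] the vector y is the outer direction and Euler's relation applies to the first
    derivative. Here it is the inner one, frozen while differentiating, so the relation [y^i
    [F^2]_{y^i} = 2 F^2] is differentiated instead. *)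
Lemma gform_l u x y : D x -> y != 0 -> gform y u x y = F x y * dy F u x y.
Proof.
move=> Dx y0; have iC i : smoothF D (pdy (sqF F) i) by exact: smoothF_dy.
have E : dy (dy (sqF F) y) u x y = \sum_i y 0 i * dy (pdy (sqF F) i) u x y.
  rewrite (@dy_eq _ _ D _ (fun x z => \sum_i y 0 i * pdy (sqF F) i x z)) //; last first.
    by move=> *; rewrite (dy_sum Dopen).
  rewrite (dy_sumf Dopen) //; last by move=> i; apply: smoothFM => //; exact: smoothF_cst.
  apply: eq_bigr => i _; rewrite (dyM Dopen) ?dy_cst ?mul0r ?addr0 //; exact: smoothF_cst.
have := dy_contr Dopen u iC Dx y0.
rewrite -(dy_sum Dopen) // -E.
rewrite (@dy_eq _ _ D _ (fun x y => 2 * sqF F x y)) //; last first.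
  move=> x' y' Dx' y0'; rewrite -(dy_sum Dopen) // (@euler _ _ D Dopen 2) //.
  exact: homog_sqF.
rewrite (dyM Dopen) ?dy_cst //; last exact: smoothF_cst.
rewrite dy_sqF // => e; rewrite /gform; lra.
Qed.

Lemma smoothF_dxc f : smoothF D f -> smoothF D (fun x y => dx f y x y).
Proof.
move=> fC; apply: (@smoothF_eq _ _ D Dopen (fun x y => \sum_i y 0 i * pdx f i x y)).
  by move=> x y Dx y0; rewrite (dx_sum Dopen).
apply: (smoothF_sum Dopen) => i; apply: (smoothFM Dopen); first exact: smoothF_coord.
exact: smoothF_dx.
Qed.

Lemma homog_dxc d f : smoothF D f -> homog D d f -> homog D d.+1 (fun x y => dx f y x y).
Proof.
move=> fC hf x y a Dx y0 a0.
have ay0 : a *: y != 0 by rewrite scaler_eq0 gt_eqF.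
by rewrite (dxZ Dopen) // (homog_dx Dopen _ fC hf) // exprS mulrA.
Qed.

Lemma dy_dxc f u x y : smoothF D f -> D x -> y != 0 ->
  dy (fun x y => dx f y x y) u x y = dx f u x y + \sum_j y 0 j * dy (pdx f j) u x y.
Proof.
move=> fC Dx y0; have iC i : smoothF D (pdx f i) by exact: smoothF_dx.
rewrite (@dy_eq _ _ D _ (fun x y => \sum_i y 0 i * pdx f i x y)) //.
  by rewrite (dy_contr Dopen) // -(dx_sum Dopen).
by move=> *; rewrite (dx_sum Dopen).
Qed.

Definition sprayv x y : V := \row_i spray F i x y.

Lemma fund_tensor_unit x y : D x -> y != 0 -> fund_tensor F x y \in unitmx.
Proof.
move=> Dx y0; rewrite -row_free_unit -kermx_eq0; apply/negP => /negP /rowV0Pn[u uk u0].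
have /sub_kermxP um := uk.
have := gform_gt0 Dx y0 u0.
by rewrite -fund_formE // /fund_form um mul0mx mxE ltxx.
Qed.

(** Contraction with the fundamental tensor removes its inverse from the definition of the spray.
    Differentiating [[F^2]_{x^k} y^k] in y also hits [y^k], which produces one more x-derivative;
    hence the factor 2 in the last term. *)
Lemma spray_char u x y : D x -> y != 0 ->
  4 * gform u (sprayv x y) x y =
  dy (fun x y => dx (sqF F) y x y) u x y - 2 * dx (sqF F) u x y.
Proof.
move=> Dx y0; set T : 'cV[R]_n := \col_j ((\sum_k pdy (pdx (sqF F) k) j x y * y 0 k) - pdx (sqF F) j x y).
have Es : (sprayv x y)^T = 4^-1 *: (invmx (fund_tensor F x y) *m T).
  by apply/colP => i; rewrite !mxE; congr (_ * _); apply: eq_bigr => j _; rewrite mxE.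
rewrite -fund_formE // /fund_form Es -scalemxAr mulmxA -(mulmxA u) mulmxV ?fund_tensor_unit //.
rewrite mulmx1 mxE mulVKf ?pnatr_eq0 // mxE.
have EL : \sum_j u 0 j * T j 0 =
    \sum_j u 0 j * (\sum_k y 0 k * pdy (pdx (sqF F) k) j x y) - dx (sqF F) u x y.
  rewrite (dx_sum Dopen _ QC) // -sumrB; apply: eq_bigr => j _; rewrite mxE mulrBr; congr (_ * _ - _).
  by apply: eq_bigr => k _; rewrite mulrC.
have E1 : \sum_j y 0 j * dy (pdx (sqF F) j) u x y =
    \sum_j u 0 j * (\sum_k y 0 k * pdy (pdx (sqF F) k) j x y).
  transitivity (\sum_j \sum_k y 0 j * (u 0 k * pdy (pdx (sqF F) j) k x y)).
    apply: eq_bigr => j _; rewrite (dy_sum Dopen) ?mulr_sumr //.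
    exact: smoothF_dx.
  rewrite exchange_big /=; apply: eq_bigr => k _; rewrite mulr_sumr; apply: eq_bigr => j _.
  by rewrite mulrCA.
have lin (L X S1 S2 W : R) : L = S2 - X -> W = X + S1 -> S1 = S2 -> L = W - 2 * X.
  by move=> -> -> ->; ring.
exact: (lin _ _ _ _ _ EL (dy_dxc u QC Dx y0) E1).
Qed.

(** The difference [d] of two candidates satisfies [gform d d = 0], which positive definiteness
    excludes unless [d = 0]. *)
Lemma spray_unique w x y : D x -> y != 0 ->
  (forall u, 4 * gform u w x y =
    dy (fun x y => dx (sqF F) y x y) u x y - 2 * dx (sqF F) u x y) ->
  sprayv x y = w.
Proof.
move=> Dx y0 H; apply/eqP; rewrite -subr_eq0; apply/negPn/negP.
have [d Ed] : exists d : V, d = sprayv x y - w by eexists.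
rewrite -Ed => d0; have d1 := gform_gt0 Dx y0 d0.
have E := spray_char d Dx y0; rewrite -H in E.
have E2 := gformDr (-1) w (sprayv x y) d Dx y0.
have E3 : -1 *: w + sprayv x y = d by rewrite Ed addrC scaleN1r.
rewrite E3 in E2.
have E4 : gform d (sprayv x y) x y = gform d w x y by apply: (mulfI _ E); rewrite pnatr_eq0.
by move: d1; rewrite E2 E4 mulN1r addNr ltxx.
Qed.

(** This is [spray_char] in the direction y, where [[F^2]_{x^k} y^k] has degree 3. It expresses that
    F is constant along the solutions of the geodesic equation. *)
Lemma spray_energy x y : D x -> y != 0 ->
  dx (sqF F) y x y - 2 * dy (sqF F) (sprayv x y) x y = 0.
Proof.
move=> Dx y0; have := spray_char y Dx y0.
rewrite gform_l // dy_sqF // (@euler _ _ D Dopen 3) //.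
- move=> E; lra.
- by apply: homog_dxc => //; exact: homog_sqF.
- exact: smoothF_dxc.
Qed.

Definition pfac x y := dx F y x y / (2 * F x y).

Lemma pfac_smooth : smoothF D pfac.
Proof.
apply: (smoothFM Dopen); first exact: smoothF_dxc.
apply: (smoothFV Dopen); last by apply: (smoothFM Dopen) => //; exact: smoothF_cst.
by move=> x y Dx y0; rewrite mulf_neq0 // ?pnatr_eq0 // gt_eqF // finsler_pos.
Qed.

Lemma pfac_homog : homog D 1 pfac.
Proof.
move=> x y a Dx y0 a0; rewrite /pfac (homog_dxc FC finsler_homog) // finsler_homog //.
have F0 := finsler_pos Dx y0.
by field; rewrite !gt_eqF.
Qed.

Lemma dxF_pfac x y : D x -> y != 0 -> dx F y x y = 2 * pfac x y * F x y.
Proof. by move=> Dx y0; rewrite /pfac; field; rewrite gt_eqF // finsler_pos. Qed.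

(** For a spray proportional to y the energy identity reads [4 P F^2 = 4 l F^2]. *)
Lemma spray_parallel_pfac (l : R) x y : D x -> y != 0 ->
  sprayv x y = l *: y -> l = pfac x y.
Proof.
move=> Dx y0 E; have := spray_energy Dx y0.
rewrite E (dyZ Dopen) // (@euler _ _ D Dopen 2) //; last exact: homog_sqF.
rewrite dx_sqF // dxF_pfac // /sqF => e.
have F0 := finsler_pos Dx y0.
have : 4 * F x y ^+ 2 * (pfac x y - l) = 0 by lra.
move/eqP; rewrite mulf_eq0 mulf_eq0 pnatr_eq0 /= sqrf_eq0 gt_eqF //=.
by rewrite subr_eq0 => /eqP.
Qed.

Definition straight_spray := forall x y, D x -> y != 0 -> sprayv x y = pfac x y *: y.

(* The complex Burgers equation [Psi_x = Psi Psi_y] for [Psi = P + i F]. *)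
Definition burgers := forall u x y, D x -> y != 0 ->
  dx F u x y = pfac x y * dy F u x y + F x y * dy pfac u x y /\
  dx pfac u x y = pfac x y * dy pfac u x y - F x y * dy F u x y.

Let PC := pfac_smooth.

Lemma dy_dxc_sqF u x y : D x -> y != 0 ->
  dy (fun x y => dx (sqF F) y x y) u x y =
  4 * dy pfac u x y * F x y ^+ 2 + 8 * pfac x y * F x y * dy F u x y.
Proof.
move=> Dx y0.
rewrite (@dy_eq _ _ D _ (fun x y => 4 * (pfac x y * sqF F x y))) //.
  rewrite (dyM Dopen) ?dy_cst //; [|exact: smoothF_cst|exact: (smoothFM Dopen)].
  rewrite (dyM Dopen) // dy_sqF // /sqF; ring.
by move=> x' y' Dx' y0'; rewrite dx_sqF // dxF_pfac // /sqF; ring.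
Qed.

(** Hamel's equation: it is [spray_char] for the spray [P y], whose contraction is [P F F_y] by
    Euler's relation, divided by [4 F]. *)
Lemma straight_hamel u x y : straight_spray -> D x -> y != 0 ->
  dx F u x y = pfac x y * dy F u x y + F x y * dy pfac u x y.
Proof.
move=> S Dx y0; have := spray_char u Dx y0.
rewrite S // dy_dxc_sqF // dx_sqF //.
have -> : gform u (pfac x y *: y) x y = pfac x y * (F x y * dy F u x y).
  rewrite -[_ *: y]addr0 gformDr // gform_r //.
  by rewrite [gform u 0 x y]/gform /dy derive0 mulr0 addr0.
have F0 := finsler_pos Dx y0.
move=> e; apply: (@mulfI _ (4 * F x y)); first by rewrite mulf_neq0 ?pnatr_eq0 // gt_eqF.
lra.
Qed.

Lemma hamel_straight :
  (forall u x y, D x -> y != 0 ->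
     dx F u x y = pfac x y * dy F u x y + F x y * dy pfac u x y) ->
  straight_spray.
Proof.
move=> B x y Dx y0; apply: spray_unique => // u.
rewrite dy_dxc_sqF // dx_sqF // B //.
have -> : gform u (pfac x y *: y) x y = pfac x y * (F x y * dy F u x y).
  rewrite -[_ *: y]addr0 gformDr // gform_r //.
  by rewrite [gform u 0 x y]/gform /dy derive0 mulr0 addr0.
ring.
Qed.

End FinslerAlgebra.

Section Curvature.
Context {R : realType} {n : nat}.
Notation V := 'rV[R]_n.
Implicit Types (x y u v w : V).
Variables (D : set V) (Dopen : open D) (F : V -> V -> R) (HF : finsler D F).

Let FC := finsler_smooth Dopen HF.
Let P := pfac F.
Let PC := pfac_smooth Dopen HF.
Let AP : V -> V -> R := fun x y => dx P y x y.

(* For [G^i = P y^i] the curvature is [R^i_k = (P^2 - P_{x^j} y^j) delta^i_k + tau_k y^i], where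
   [tau] is the following covector. *)
Definition curv_trace u x y :=
  3 * dx P u x y - dy AP u x y - P x y * dy P u x y.

Lemma sum_delta (a : 'I_n -> R) i : \sum_j a j * (j == i)%:R = a i.
Proof.
rewrite (bigD1 i) //= eqxx mulr1 big1 ?addr0 // => j ji.
by rewrite (negbTE ji) mulr0.
Qed.

Hypothesis S : straight_spray D F.

Let sprayE i x y : D x -> y != 0 -> spray F i x y = P x y * y 0 i.
Proof. by move=> Dx y0; have /rowP/(_ i) := S Dx y0; rewrite !mxE. Qed.

Let coordC (i : 'I_n) := @smoothF_coord R n D i.

Let pdP (i : 'I_n) : smoothF D (pdy P i). Proof. exact: smoothF_dy. Qed.
Let pdxP (i : 'I_n) : smoothF D (pdx P i). Proof. exact: smoothF_dx. Qed.

Let dy_coordE (i k : 'I_n) x y : D x -> y != 0 ->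
  dy (fun _ y => y 0 i) (delta_mx 0 k) x y = (k == i)%:R :> R.
Proof.
by move=> Dx y0; rewrite (dy_coord Dopen) // mxE eqxx /= eq_sym.
Qed.

Let pdx_spray i k x y : D x -> y != 0 -> pdx (spray F i) k x y = y 0 i * pdx P k x y.
Proof.
move=> Dx y0; rewrite [LHS](@dx_eq _ _ D Dopen _ (fun x y => y 0 i * P x y)) //.
  rewrite (dxM Dopen) //.
  have -> : dx (fun=> (fun y0 : V => y0 0 i)) (delta_mx 0 k) x y = 0 by exact: derive_cst.
  by rewrite mul0r addr0.
by move=> *; rewrite sprayE // mulrC.
Qed.

Let pdy_spray i k x y : D x -> y != 0 ->
  pdy (spray F i) k x y = y 0 i * pdy P k x y + (k == i)%:R * P x y.
Proof.
move=> Dx y0; rewrite [LHS](@dy_eq _ _ D _ (fun x y => y 0 i * P x y)) //.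
  by rewrite (dyM Dopen) // dy_coordE.
by move=> *; rewrite sprayE // mulrC.
Qed.

Let pdy_pdx_spray i j k x y : D x -> y != 0 ->
  pdy (pdx (spray F i) j) k x y = y 0 i * pdy (pdx P j) k x y + (k == i)%:R * pdx P j x y.
Proof.
move=> Dx y0; rewrite [LHS](@dy_eq _ _ D _ (fun x y => y 0 i * pdx P j x y)) //.
  by rewrite (dyM Dopen) // dy_coordE.
by move=> *; rewrite pdx_spray.
Qed.

Let pdy_pdy_spray i j k x y : D x -> y != 0 ->
  pdy (pdy (spray F i) j) k x y =
  y 0 i * pdy (pdy P j) k x y + (k == i)%:R * pdy P j x y + (j == i)%:R * pdy P k x y.
Proof.
move=> Dx y0.
rewrite [LHS](@dy_eq _ _ D _ (fun x y => y 0 i * pdy P j x y + (j == i)%:R * P x y)) //.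
  have C1 : smoothF D (fun _ _ : V => (j == i)%:R : R) by exact: smoothF_cst.
  have CA : smoothF D (fun x y => y 0 i * pdy P j x y) by exact: (smoothFM Dopen (coordC i) (pdP j)).
  have CB : smoothF D (fun x y => (j == i)%:R * P x y) by exact: (smoothFM Dopen C1 PC).
  rewrite (dyDf Dopen _ CA CB) // (dyM Dopen _ (coordC i) (pdP j)) // (dyM Dopen _ C1 PC) //.
  by rewrite dy_cst mul0r addr0 dy_coordE.
by move=> *; rewrite pdy_spray.
Qed.

Let euler_P x y : D x -> y != 0 -> \sum_j y 0 j * pdy P j x y = P x y.
Proof.
move=> Dx y0; rewrite -(dy_sum Dopen) // (@euler _ _ D Dopen 1) ?mul1r //.
exact: pfac_homog.
Qed.

Let euler_P2 k x y : D x -> y != 0 -> \sum_j y 0 j * pdy (pdy P j) k x y = 0.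
Proof.
move=> Dx y0; have := dy_contr Dopen (delta_mx 0 k) pdP Dx y0.
rewrite -(dy_sum Dopen) // (@dy_eq _ _ D _ P) // => e.
apply: (@addrI _ (dy P (delta_mx 0 k) x y)); rewrite addr0; exact/esym.
Qed.

(** Every derivative of [P y^i] is a multiple of [y^i] plus Kronecker terms. The contractions with y
    are evaluated by Euler's relations for P, of degree 1, and for its first y-derivatives, of
    degree 0; the coefficient of [y^i] is collected in [curv_trace]. *)
Lemma riemann_straight i k x y : D x -> y != 0 ->
  riemann_curv F x y i k = (k == i)%:R * (P x y ^+ 2 - AP x y) +
    y 0 i * curv_trace (delta_mx 0 k) x y.
Proof.
move=> Dx y0; rewrite mxE pdx_spray //.
have EA : dy AP (delta_mx 0 k) x y = pdx P k x y + \sum_j y 0 j * pdy (pdx P j) k x y.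
  exact: (dy_dxc Dopen _ PC Dx y0).
have E1 : \sum_j y 0 j * pdy (pdx (spray F i) j) k x y =
    y 0 i * (\sum_j y 0 j * pdy (pdx P j) k x y) + (k == i)%:R * AP x y.
  rewrite /AP (dx_sum Dopen) // !mulr_sumr -big_split /=; apply: eq_bigr => j _.
  rewrite pdy_pdx_spray //; ring.
have E2 : \sum_j spray F j x y * pdy (pdy (spray F i) j) k x y =
    P x y * (y 0 i * (\sum_j y 0 j * pdy (pdy P j) k x y) +
      (k == i)%:R * (\sum_j y 0 j * pdy P j x y) + (\sum_j (y 0 j * pdy P k x y) * (j == i)%:R)).
  rewrite !mulr_sumr -!big_split /= mulr_sumr; apply: eq_bigr => j _.
  rewrite sprayE // pdy_pdy_spray //; ring.
have E3 : \sum_j pdy (spray F i) j x y * pdy (spray F j) k x y =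
    y 0 i * pdy P k x y * (\sum_j y 0 j * pdy P j x y) +
    y 0 i * P x y * (\sum_j pdy P j x y * (j == k)%:R) +
    P x y * pdy P k x y * (\sum_j y 0 j * (j == i)%:R) +
    P x y ^+ 2 * (\sum_j (k == j)%:R * (j == i)%:R).
  rewrite !mulr_sumr -!big_split /=; apply: eq_bigr => j _.
  rewrite !pdy_spray // (eq_sym k j); ring.
have E2' : \sum_j spray F j x y * pdy (pdy (spray F i) j) k x y =
    P x y * (y 0 i * 0 + (k == i)%:R * P x y + y 0 i * pdy P k x y).
  apply: etrans E2 _; congr (_ * (_ * _ + _ * _ + _)).
  - exact: euler_P2.
  - exact: euler_P.
  - exact: (sum_delta (fun j => y 0 j * pdy P k x y) i).
have E3' : \sum_j pdy (spray F i) j x y * pdy (spray F j) k x y =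
    y 0 i * pdy P k x y * P x y + y 0 i * P x y * pdy P k x y +
    P x y * pdy P k x y * y 0 i + P x y ^+ 2 * (k == i)%:R.
  apply: etrans E3 _; congr (_ * _ + _ * _ + _ * _ + _ * _).
  - exact: euler_P.
  - exact: (sum_delta (fun j => pdy P j x y) k).
  - exact: (sum_delta (fun j => y 0 j) i).
  - exact: (sum_delta (fun j => (k == j)%:R) i).
transitivity (2 * (y 0 i * pdx P k x y) -
   (y 0 i * (\sum_j y 0 j * pdy (pdx P j) k x y) + (k == i)%:R * AP x y) +
   2 * (P x y * (y 0 i * 0 + (k == i)%:R * P x y + y 0 i * pdy P k x y)) -
   (y 0 i * pdy P k x y * P x y + y 0 i * P x y * pdy P k x y +
    P x y * pdy P k x y * y 0 i + P x y ^+ 2 * (k == i)%:R)).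
  by congr (_ - _ + 2 * _ - _).
transitivity ((k == i)%:R * (P x y ^+ 2 - AP x y) + y 0 i *
   (3 * pdx P k x y - (pdx P k x y + \sum_j y 0 j * pdy (pdx P j) k x y) - P x y * pdy P k x y)); last first.
  by congr (_ + _ * (_ - _ - _)); apply/esym.
move: (AP x y) (pdx P k x y) (pdy P k x y) (P x y) (\sum_j y 0 j * pdy (pdx P j) k x y) => *; ring.
Qed.

Lemma curv_traceD a u v x y : D x -> y != 0 ->
  curv_trace (a *: u + v) x y = a * curv_trace u x y + curv_trace v x y.
Proof.
move=> Dx y0; have AC : smoothF D AP by exact: smoothF_dxc.
rewrite /curv_trace (dxD Dopen a u v PC Dx y0) (dyD Dopen a u v AC Dx y0).
rewrite (dyD Dopen a u v PC Dx y0).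
move: (dx P u x y) (dx P v x y) (dy P u x y) (dy P v x y) (dy AP u x y) (dy AP v x y) (P x y) => *; ring.
Qed.

Lemma curv_trace0 x y : curv_trace 0 x y = 0.
Proof. by rewrite /curv_trace dx0 !dy0 !mulr0 !subr0. Qed.

Lemma curv_trace_sum u x y : D x -> y != 0 ->
  curv_trace u x y = \sum_k u 0 k * curv_trace (delta_mx 0 k) x y.
Proof.
move=> Dx y0; rewrite {1}(row_sum_delta u).
apply: (big_rec2 (fun v r => curv_trace v x y = r)); first exact: curv_trace0.
by move=> i r v _ <-; rewrite curv_traceD.
Qed.

Lemma flag_straight x y u : D x -> y != 0 ->
  flag_curvature F x y u =
  ((P x y ^+ 2 - AP x y) * gform F u u x y + curv_trace u x y * (F x y * dy F u x y)) /
  (F x y ^+ 2 * gform F u u x y - (F x y * dy F u x y) ^+ 2).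
Proof.
move=> Dx y0; rewrite /flag_curvature.
have E : u *m (riemann_curv F x y)^T = (P x y ^+ 2 - AP x y) *: u + curv_trace u x y *: y.
  apply/rowP => i; rewrite !mxE curv_trace_sum // mulr_suml.
  rewrite -[u 0 i](sum_delta (u 0)) mulr_sumr -big_split /=; apply: eq_bigr => k _.
  rewrite [_^T _ _]mxE riemann_straight //; ring.
rewrite E !(fund_formE Dopen HF) // (gformDl Dopen HF) //.
rewrite -[curv_trace u x y *: y]addr0 (gformDl Dopen HF) // !(gform_l Dopen HF) //.
rewrite [gform F 0 u x y]/gform.
have -> : dy (dy (sqF F) 0) u x y = 0.
  rewrite (@dy_eq _ _ D _ (fun _ _ => 0)) ?dy_cst // => *; exact: dy0.
rewrite (@euler _ _ D Dopen 1) //; last exact: finsler_homog.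
by rewrite mulr0 addr0 mul1r expr2.
Qed.

Lemma AP_euler x y : D x -> y != 0 -> dy AP y x y = 2 * AP x y.
Proof.
move=> Dx y0; rewrite (@euler _ _ D Dopen 2) //.
  by apply: (homog_dxc Dopen) => //; exact: pfac_homog.
exact: smoothF_dxc.
Qed.

Lemma curv_trace_flagpole x y : D x -> y != 0 -> curv_trace y x y = AP x y - P x y ^+ 2.
Proof.
move=> Dx y0; rewrite /curv_trace AP_euler // (@euler _ _ D Dopen 1) //; last exact: pfac_homog.
by rewrite -/(AP x y); ring.
Qed.

(** For a flag vector in the kernel of [F_y] the term in [curv_trace] disappears from
    [flag_straight], and curvature 1 gives [P^2 - P_x y = F^2]; dimension at least 2 makes that
    kernel nonzero. Testing [y + w] with [w] in the kernel then brings [curv_trace w] back with the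
    factor [F^2], so it vanishes. With the value at y, linearity determines the one-form. *)
Lemma flag_const_trace : (2 <= n)%N -> const_flag_curvature D F 1 ->
  forall x y, D x -> y != 0 -> AP x y = P x y ^+ 2 - F x y ^+ 2 /\
    forall u, curv_trace u x y = - (F x y * dy F u x y).
Proof.
move=> n2 K x y Dx y0; have F0 := finsler_pos HF Dx y0.
have FE : dy F y x y = F x y.
  by rewrite (@euler _ _ D Dopen 1) ?mul1r //; exact: finsler_homog.
have [v vy] : exists v : V, forall a : R, v <> a *: y.
  have [i yi] : exists i, y 0 i != 0.
    by have /rV0Pn := y0.
  have [j ji] : exists j : 'I_n, j != i.
    case: (eqVneq i (Ordinal (ltnW n2))) => [->|]; last by exists (Ordinal (ltnW n2)); rewrite eq_sym.
    by exists (Ordinal n2).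
  exists (delta_mx 0 j) => a /rowP e; have := e i; have := e j.
  rewrite !mxE !eqxx /= eq_sym (negbTE ji) /= => e1 /esym/eqP.
  rewrite mulf_eq0 (negbTE yi) orbF => /eqP a0.
  by move: e1; rewrite a0 mul0r => /eqP; rewrite oner_eq0.
have Pr u : dy F (- (dy F u x y / F x y) *: y + u) x y = 0.
  by rewrite (dyD Dopen) // FE; field; rewrite gt_eqF.
have XiE : P x y ^+ 2 - AP x y = F x y ^+ 2.
  set w := - (dy F v x y / F x y) *: y + v.
  have w0 : w != 0.
    apply/eqP => e; apply: (vy (dy F v x y / F x y)).
    by apply/eqP; rewrite -subr_eq0 addrC -scaleNr; apply/eqP.
  have wy a : w <> a *: y.
    move=> e; apply: (vy (a + dy F v x y / F x y)); rewrite scalerDl -e /w.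
    by rewrite addrAC scaleNr addNr add0r.
  have := K x y w Dx y0 wy; rewrite flag_straight // Pr !mulr0 addr0 expr0n /= subr0.
  have g0 := gform_gt0 Dopen HF Dx y0 w0.
  move=> e; have : (P x y ^+ 2 - AP x y) / F x y ^+ 2 = 1.
    by rewrite -e; field; rewrite !gt_eqF.
  by move/divr1_eq.
split; first by lra.
have Tw w : w != 0 -> dy F w x y = 0 -> curv_trace w x y = 0.
  move=> w0 dw.
  have uy a : y + w <> a *: y.
    move=> e; have : dy F ((1 - a) *: y + w) x y = 0.
      by rewrite scalerBl scale1r addrAC e subrr dy0.
    rewrite (dyD Dopen) // FE dw addr0 => /eqP; rewrite mulf_eq0 (gt_eqF F0) orbF subr_eq0 => /eqP a1.
    by move: e => /eqP; rewrite -a1 scale1r -subr_eq0 addrAC subrr add0r (negbTE w0).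
  have := K x y (y + w) Dx y0 uy.
  have e1 : dy F (y + w) x y = F x y by rewrite -[y in y + w]scale1r (dyD Dopen) // FE dw; ring.
  have e2 : curv_trace (y + w) x y = curv_trace w x y - F x y ^+ 2.
    by rewrite -[y in y + w]scale1r curv_traceD // curv_trace_flagpole //; lra.
  have e3 : gform F (y + w) (y + w) x y = F x y ^+ 2 + gform F w w x y.
    have a1 := gform_addl Dopen HF y w (y + w) Dx y0.
    have a2 := gform_addr Dopen HF y w y Dx y0.
    have a3 := gform_addr Dopen HF y w w Dx y0.
    have b1 := gform_l Dopen HF y Dx y0; have b2 := gform_l Dopen HF w Dx y0.
    have b3 := gform_r Dopen HF w Dx y0; rewrite FE in b1; rewrite dw mulr0 in b2 b3.
    apply: etrans a1 _; apply: etrans (f_equal2 +%R a2 a3) _.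
    apply: etrans (f_equal2 +%R (f_equal2 +%R b1 b2) (f_equal2 +%R b3 erefl)) _.
    by move: (gform F w w x y) => g; rewrite addr0 add0r expr2.
  have g0 := gform_gt0 Dopen HF Dx y0 w0.
  rewrite flag_straight // e1 e2 e3 XiE => e.
  have : (F x y ^+ 2 * gform F w w x y + curv_trace w x y * F x y ^+ 2) / (F x y ^+ 2 * gform F w w x y) = 1.
    by rewrite -[RHS]e; congr (_ / _); ring.
  move/divr1_eq => e4; apply: (@mulIf _ (F x y ^+ 2)); first by rewrite sqrf_eq0 gt_eqF.
  by rewrite mul0r; apply: etrans (canRL (addKr _) e4) _; exact: addNr.
move=> u; set w := - (dy F u x y / F x y) *: y + u.
have -> : curv_trace u x y = curv_trace w x y - F x y * dy F u x y.
  by rewrite /w curv_traceD // curv_trace_flagpole // -[AP x y - _]opprB XiE; field; rewrite gt_eqF.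
case: (eqVneq w 0) => [->|w0]; first by rewrite curv_trace0 sub0r.
by rewrite Tw ?sub0r //; exact: Pr.
Qed.

(** The first half is Hamel's equation. For the second, inserting the y-derivative of
    [P_x y = P^2 - F^2] into [curv_trace] leaves three times the wanted equation. *)
Lemma straight_burgers : (2 <= n)%N -> const_flag_curvature D F 1 -> burgers D F.
Proof.
move=> n2 K u x y Dx y0; split; first exact: (straight_hamel Dopen HF).
have [_ /(_ u)] := flag_const_trace n2 K Dx y0.
have : dy AP u x y = 2 * P x y * dy P u x y - 2 * F x y * dy F u x y.
  rewrite (@dy_eq _ _ D _ (fun x y => P x y * P x y - F x y * F x y)) //; last first.
    by move=> x' y' Dx' y0'; have [-> _] := flag_const_trace n2 K Dx' y0'; rewrite !expr2.
  have C2 : smoothF D (fun x y => -1 * (F x y * F x y)).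
    apply: (smoothFM Dopen); [exact: smoothF_cst | exact: (smoothFM Dopen)].
  rewrite (@dy_eq _ _ D _ (fun x y => P x y * P x y + -1 * (F x y * F x y))) //; last first.
    by move=> *; rewrite mulN1r.
  rewrite (dyDf Dopen) //; last exact: (smoothFM Dopen).
  rewrite (dyM Dopen _ PC PC) // (dyM Dopen _ (smoothF_cst _ _) (smoothFM Dopen FC FC)) // dy_cst.
  rewrite (dyM Dopen _ FC FC) //.
  rewrite -/P; move: (dy P u x y) (dy F u x y) (P x y) (F x y) => *; ring.
rewrite /curv_trace => -> e.
rewrite -/P; move: e.
move: (dx P u x y) (dy P u x y) (dy F u x y) (P x y) (F x y) => *; lra.
Qed.

End Curvature.

Section CurvatureConverse.
Context {R : realType} {n : nat}.
Notation V := 'rV[R]_n.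
Implicit Types (x y u v w : V).
Variables (D : set V) (Dopen : open D) (F : V -> V -> R) (HF : finsler D F).
Hypothesis B : burgers D F.

Let FC := finsler_smooth Dopen HF.
Let PC := pfac_smooth Dopen HF.

Lemma burgers_straight : straight_spray D F.
Proof. by apply: (hamel_straight Dopen HF) => u x y Dx y0; have [] := B u Dx y0. Qed.

Lemma burgers_dxP x y : D x -> y != 0 ->
  dx (pfac F) y x y = pfac F x y ^+ 2 - F x y ^+ 2.
Proof.
move=> Dx y0; have [_ ->] := B y Dx y0.
rewrite !(@euler _ _ D Dopen 1) //; [|exact: finsler_homog|exact: pfac_homog].
by rewrite !mul1r !expr2.
Qed.

(** Converse of [straight_burgers], through which the doubled metric gets its curvature: it is the
    equation, involving only first derivatives of F and P, that is carried across charts and across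
    the equator. *)
Lemma burgers_curvature : const_flag_curvature D F 1.
Proof.
move=> x y u Dx y0 uy; rewrite (flag_straight Dopen HF burgers_straight) //.
have F0 := finsler_pos HF Dx y0.
have FE : dy F y x y = F x y.
  by rewrite (@euler _ _ D Dopen 1) ?mul1r //; exact: finsler_homog.
set P := pfac F.
have EA : dy (fun x y => dx P y x y) u x y = 2 * P x y * dy P u x y - 2 * F x y * dy F u x y.
  have C2 : smoothF D (fun x y => -1 * (F x y * F x y)).
    apply: (smoothFM Dopen); [exact: smoothF_cst | exact: (smoothFM Dopen)].
  rewrite (@dy_eq _ _ D _ (fun x y => P x y * P x y + -1 * (F x y * F x y))) //; last first.
    by move=> x' y' Dx' y0'; rewrite burgers_dxP // mulN1r !expr2.
  rewrite (dyDf Dopen) //; last exact: (smoothFM Dopen).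
  rewrite (dyM Dopen _ PC PC) // (dyM Dopen _ (smoothF_cst _ _) (smoothFM Dopen FC FC)) // dy_cst.
  rewrite (dyM Dopen) // -/P; ring.
have [_ E2] := B u Dx y0.
have -> : curv_trace F u x y = - (F x y * dy F u x y).
  by rewrite /curv_trace EA E2 -/P; ring.
rewrite burgers_dxP // -/P.
(* The denominator of the flag curvature is [F^2 g(w, w)] for this component of [u] in the kernel of
   [F_y], hence positive. *)
pose w := - (dy F u x y / F x y) *: y + u.
have w0 : w != 0.
  apply/eqP => e; apply: (uy (dy F u x y / F x y)).
  by apply/eqP; rewrite -subr_eq0 addrC -scaleNr; apply/eqP.
have := gform_gt0 Dopen HF Dx y0 w0.
rewrite /w (gformDl Dopen HF) // !(gformDr Dopen HF) // !(gform_l Dopen HF) // (gform_r Dopen HF) // FE => g0.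
have -> : (P x y ^+ 2 - (P x y ^+ 2 - F x y ^+ 2)) * gform F u u x y +
  - (F x y * dy F u x y) * (F x y * dy F u x y) =
  F x y ^+ 2 * gform F u u x y - (F x y * dy F u x y) ^+ 2 by ring.
rewrite divff // gt_eqF //.
have : 0 < F x y ^+ 2 * (gform F u u x y - dy F u x y ^+ 2).
  rewrite pmulr_rgt0 ?exprn_gt0 //; move: g0; congr (_ < _); field; exact: lt0r_neq0.
by congr (_ < _); ring.
Qed.

End CurvatureConverse.

(** * Existence of geodesics *)

Section VectorCurves.
Context {R : realType}.

Lemma norm_le_coord m n (M : 'M[R]_(m, n)) C :
  0 <= C -> (forall i j, `|M i j| <= C) -> `|M| <= C.
Proof.
by move=> C0 h; rewrite [leLHS]/Num.Def.normr/= mx_normrE (bigmax_le _ C0).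
Qed.

Lemma is_derive_coordP n (c : R -> 'rV[R]_n) t (u : 'rV[R]_n) :
  is_derive t (1:R) c u <-> forall i, is_derive t (1:R) (fun s => c s 0 i) (u 0 i).
Proof.
split.
  move=> [dc E] i; have /derivable_mxP/(_ 0 i) dci := dc.
  by split=> //; move: E; rewrite derive_mx // => <-; rewrite mxE.
move=> h; have dc : derivable c t 1.
  apply/derivable_mxP => i j; rewrite ord1; by case: (h j).
split=> //; rewrite derive_mx //; apply/rowP => j; rewrite mxE.
by case: (h j).
Qed.

Lemma is_derive_continuous (V : normedModType R) (c : R -> V) t u :
  is_derive t (1:R) c u -> {for t, continuous c}.
Proof. by case=> dc _; apply: differentiable_continuous; apply/derivable1_diffP. Qed.

Lemma is_derive_within (f f' : R -> R) (a b : R) :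
  (forall t, a <= t <= b -> is_derive t (1:R) f (f' t)) -> {within `[a, b], continuous f}.
Proof.
move=> h; apply: derivable_within_continuous => t; rewrite in_itv /= => /h; by case.
Qed.

Lemma mean_value_le (f f' : R -> R) (a b C : R) : a <= b ->
  (forall t, a <= t <= b -> is_derive t (1:R) f (f' t)) ->
  (forall t, a <= t <= b -> `|f' t| <= C) ->
  `|f b - f a| <= C * (b - a).
Proof.
move=> ab df bf.
have HD t : t \in `]a, b[ -> is_derive t (1:R) f (f' t).
  by rewrite in_itv /= => /andP[h1 h2]; apply: df; rewrite !ltW.
have [t tab ->] := @MVT_segment R f f' a b ab HD (is_derive_within df).
rewrite normrM [X in _ * X]ger0_norm ?subr_ge0 // ler_wpM2r ?subr_ge0 //.
by apply: bf; move: tab; rewrite in_itv.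
Qed.

Lemma derive0_cst (f : R -> R) (lo hi : \bar R) :
  (forall t : R, (lo < t%:E)%E -> (t%:E < hi)%E -> is_derive t (1:R) f 0) ->
  forall s t : R, (lo < s%:E)%E -> (s%:E < hi)%E -> (lo < t%:E)%E -> (t%:E < hi)%E ->
  f s = f t.
Proof.
move=> df s t; wlog st : s t / s <= t.
  by move=> H s1 s2 t1 t2; case: (leP s t) => [|/ltW] h; [exact: H | apply/esym; exact: H].
move=> s1 s2 t1 t2.
have D r : s <= r <= t -> is_derive r (1:R) f 0.
  by move=> /andP[r1 r2]; apply: df; [apply: lt_le_trans s1 _|apply: le_lt_trans t2]; rewrite lee_fin.
have := @mean_value_le f (fun=> 0) s t 0 st D.
rewrite normr0 mul0r => /(_ (fun _ _ => lexx _)).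
by rewrite normr_le0 subr_eq0 => /eqP.
Qed.

Lemma primitive (f : R -> R) (a : R) : continuous f ->
  exists G : R -> R, G 0 = 0 /\ forall t, a < t -> is_derive t (1:R) G (f t).
Proof.
move=> fc; pose G x := (\int[lebesgue_measure]_(t in [set` `[a, x]]) (f t))%R.
exists (fun t => G t - G 0); split; first by rewrite subrr.
move=> t at'; have [] := @continuous_FTC1_closed R f a t (t + 1) _ _ at' (fc t).
- by rewrite ltrDl.
- apply: continuous_compact_integrable; first exact: segment_compact.
  exact: continuous_subspaceT.
move=> dG EG.
have D1 : is_derive t (1:R) G (f t).
  by apply: DeriveDef; [exact: dG | rewrite -derive1E; exact: EG].
have D2 := is_deriveB D1 (is_derive_cst (G 0) t (1:R)).
by rewrite subr0 in D2; exact: D2.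
Qed.

Lemma primitive_vec n (f : R -> 'rV[R]_n) (a : R) : continuous f ->
  exists G : R -> 'rV[R]_n, G 0 = 0 /\ forall t, a < t -> is_derive t (1:R) G (f t).
Proof.
move=> fc; have /choice[G HG] : forall i : 'I_n, exists G : R -> R,
    G 0 = 0 /\ forall t, a < t -> is_derive t (1:R) G (f t 0 i).
  move=> i; apply: primitive => t.
  apply: (@continuous_comp _ _ _ f (fun z : 'rV[R]_n => z 0 i)); first exact: fc.
  exact: coord_continuous.
exists (fun t => \row_i G i t); split.
  by apply/rowP => i; rewrite !mxE; case: (HG i).
move=> t at'; apply/is_derive_coordP => i.
have -> : (fun s => (\row_i0 G i0 s) 0 i) = G i by apply/funext => s; rewrite mxE.
by case: (HG i) => _; apply.
Qed.

(** Truncation to [[- d, d]], 1-Lipschitz. It extends local data everywhere: the time in the Picard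
    iteration, the state in [geodesic_ex], the integrand in [continuous_integral_ge]. *)
Definition clamp (d t : R) := Order.max (- d) (Order.min t d).

Lemma clamp_itv d t : 0 <= d -> - d <= clamp d t <= d.
Proof.
move=> d0; rewrite /clamp le_max lexx /= ge_max ge_min lexx orbT andbT.
by rewrite lerNl (le_trans _ d0) // oppr_le0.
Qed.

Lemma clamp_id d t : `|t| <= d -> clamp d t = t.
Proof.
by rewrite ler_norml => /andP[t1 t2]; rewrite /clamp min_l // max_r.
Qed.

Lemma max_lip (a b c : R) : `|Order.max a b - Order.max a c| <= `|b - c|.
Proof.
wlog bc : b c / b <= c.
  move=> H; case: (leP b c) => [/H //|/ltW/H].
  by rewrite distrC (distrC c b).
rewrite distrC (distrC b c) (ger0_norm (_ : 0 <= c - b)) ?subr_ge0 //.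
rewrite ler_norml; case: (leP a b) => ?; case: (leP a c) => ?; apply/andP; split; lra.
Qed.

Lemma clamp_lip d s t : `|clamp d s - clamp d t| <= `|s - t|.
Proof.
apply: le_trans (max_lip _ _ _) _.
rewrite -[Order.min s d]opprK -[Order.min t d]opprK !oppr_min.
rewrite ![Order.max (- _) (- d)]maxC -opprD normrN; apply: le_trans (max_lip _ _ _) _.
by rewrite -opprD normrN.
Qed.

Lemma clamp_continuous d : continuous (clamp d).
Proof.
move=> t; apply/cvgrPdist_le => e e0; near=> s.
by apply: le_trans (clamp_lip _ _ _) _; near: s; apply: cvgr_dist_le.
Unshelve. all: by end_near. Qed.

End VectorCurves.

(** * Picard iteration for a globally Lipschitz field *)

Section Picard.
Context {R : realType} {m : nat}.
Notation W := 'rV[R]_m.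
Variables (X : W -> W) (L : R) (L0 : 0 < L).
Hypothesis XL : forall a b, `|X a - X b| <= L * `|a - b|.
Variable w0 : W.

Let d := (2 * L)^-1.
Let d0 : 0 < d. Proof. by rewrite invr_gt0 mulr_gt0. Qed.

Let Xc : continuous X.
Proof.
move=> a; apply/(@cvgrPdist_le _ _ _ (nbhs a) (nbhs_filter a)) => e e0.
apply/nbhs_ballP; exists (L^-1 * e); first by rewrite /= mulr_gt0 // invr_gt0.
move=> b; rewrite -ball_normE /= => ab.
by apply: le_trans (XL _ _) _; rewrite -ler_pdivlMl // ltW.
Qed.

(** The relation [v t = w0 + \int_0^t X (u s) ds], with time frozen outside [[- d, d]] so that the
    curves live on the whole line and can be compared uniformly. The primitive must be
    differentiable a little beyond the left end, hence [- d - 1]. As [d = 1 / (2 L)], a step halves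
    distances. *)
Definition picard_step (u v : R -> W) := exists G : R -> W,
  [/\ G 0 = 0, forall t, - d - 1 < t -> is_derive t (1:R) G (X (u t)) &
      forall t, v t = w0 + G (clamp d t)].

Lemma picard_step_ex u : continuous u -> exists v, continuous v /\ picard_step u v.
Proof.
move=> uc; have [|G [G0 GD]] := @primitive_vec R m (fun t => X (u t)) (- d - 1).
  by move=> t; apply: continuous_comp; [exact: uc | exact: Xc].
exists (fun t => w0 + G (clamp d t)); split; last by exists G.
move=> t; apply: continuousD; first exact: cvg_cst.
apply: continuous_comp; first exact: clamp_continuous.
apply: (is_derive_continuous (GD _ _)).
have /andP[h _] := clamp_itv t (ltW d0); lra.
Qed.

Lemma picard_lip C (u v u' v' : R -> W) : 0 <= C ->
  (forall t, `|u t - v t| <= C) -> picard_step u u' -> picard_step v v' ->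
  forall t, `|u' t - v' t| <= C / 2.
Proof.
move=> C0 uv [G [G0 GD Gu]] [H [H0 HD Hv]] t; rewrite Gu Hv opprD addrACA subrr add0r.
apply: norm_le_coord; first by rewrite divr_ge0.
move=> i j; rewrite ord1 !mxE.
have D s : - d - 1 < s -> is_derive s (1:R) (fun s => G s 0 j - H s 0 j) (X (u s) 0 j - X (v s) 0 j).
  move=> hs; apply: is_deriveB.
    by have /is_derive_coordP/(_ j) := GD s hs.
  by have /is_derive_coordP/(_ j) := HD s hs.
have bd s : `|X (u s) 0 j - X (v s) 0 j| <= L * C.
  have -> : X (u s) 0 j - X (v s) 0 j = (X (u s) - X (v s)) 0 j by rewrite !mxE.
  apply: le_trans (coord_le_norm _ _ _) _; apply: le_trans (XL _ _) _.
  by rewrite ler_pM2l.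
have /andP[h1 h2] := clamp_itv t (ltW d0).
have E : L * C * d = C / 2 by rewrite /d; field; rewrite gt_eqF.
have e0 : G 0 0 j - H 0 0 j = 0 by rewrite G0 H0 subrr.
case: (leP 0 (clamp d t)) => ct.
  have Dp s : 0 <= s <= clamp d t -> is_derive s (1:R) (fun s => G s 0 j - H s 0 j) (X (u s) 0 j - X (v s) 0 j).
    by move=> /andP[hs _]; apply: D; apply: lt_le_trans hs; rewrite ltrBlDr add0r (lt_trans _ ltr01) // oppr_lt0.
  have := @mean_value_le _ _ _ 0 (clamp d t) (L * C) ct Dp (fun s _ => bd s).
  rewrite e0 !subr0 => T; apply: le_trans T _.
  by rewrite -E ler_wpM2l // mulr_ge0 // ltW.
have Dp s : clamp d t <= s <= 0 -> is_derive s (1:R) (fun s => G s 0 j - H s 0 j) (X (u s) 0 j - X (v s) 0 j).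
  by move=> /andP[hs _]; apply: D; apply: lt_le_trans (le_trans h1 hs); rewrite ltrBlDr ltrDl.
have := @mean_value_le _ _ _ (clamp d t) 0 (L * C) (ltW ct) Dp (fun s _ => bd s).
rewrite e0 !sub0r normrN => T; apply: le_trans T _.
by rewrite -E ler_wpM2l ?mulr_ge0 ?(ltW L0) // lerNl.
Qed.

Let Cfun := {u : R -> W | continuous u}.
Let step (u : Cfun) : Cfun :=
  let: exist v h := cid (picard_step_ex (svalP u)) in exist _ v h.1.
Let stepP (u : Cfun) : picard_step (sval u) (sval (step u)).
Proof. by rewrite /step; case: cid => v []. Qed.

Let cst0 : continuous ((fun=> w0) : R -> W).
Proof. by move=> t; exact: cvg_cst. Qed.
Let it k : Cfun := iter k step (exist _ (fun=> w0) cst0).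
Let u_ k := sval (it k).

Let M0 : exists2 M, 0 <= M & forall t, `|u_ 1 t - u_ 0 t| <= M.
Proof.
have [G [G0 GD Gu]] := stepP (it 0).
exists (`|X w0| * d); first by rewrite mulr_ge0 // ltW.
move=> t; rewrite [u_ 1 t]Gu [u_ 0 t]/= addrAC subrr add0r.
apply: norm_le_coord; first by rewrite mulr_ge0 // ltW.
move=> i j; rewrite ord1.
have D s : - d - 1 < s -> is_derive s (1:R) (fun s => G s 0 j) (X w0 0 j).
  by move=> hs; have /is_derive_coordP/(_ j) := GD s hs.
have /andP[h1 h2] := clamp_itv t (ltW d0).
have e0 : G 0 0 j = 0 by rewrite G0 mxE.
case: (leP 0 (clamp d t)) => ct.
  have Dp s : 0 <= s <= clamp d t -> is_derive s (1:R) (fun s => G s 0 j) (X w0 0 j).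
    by move=> /andP[hs _]; apply: D; apply: lt_le_trans hs; rewrite ltrBlDr add0r (lt_trans _ ltr01) // oppr_lt0.
  have := @mean_value_le _ _ _ 0 (clamp d t) `|X w0| ct Dp (fun s _ => coord_le_norm _ _ _).
  rewrite e0 !subr0 => T; apply: le_trans T _.
  by rewrite ler_wpM2l.
have Dp s : clamp d t <= s <= 0 -> is_derive s (1:R) (fun s => G s 0 j) (X w0 0 j).
  by move=> /andP[hs _]; apply: D; apply: lt_le_trans (le_trans h1 hs); rewrite ltrBlDr ltrDl.
have := @mean_value_le _ _ _ (clamp d t) 0 `|X w0| (ltW ct) Dp (fun s _ => coord_le_norm _ _ _).
rewrite e0 !sub0r normrN => T; apply: le_trans T _.
by rewrite ler_wpM2l // lerNl.
Qed.

Let diff_bound M : 0 <= M -> (forall t, `|u_ 1 t - u_ 0 t| <= M) ->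
  forall k t, `|u_ k.+1 t - u_ k t| <= M / 2 ^+ k.
Proof.
move=> M0' hM; elim=> [|k IH] t; first by rewrite expr0 divr1.
have := @picard_lip (M / 2 ^+ k) _ _ _ _ (divr_ge0 M0' (exprn_ge0 _ _)) IH (stepP (it k.+1)) (stepP (it k)) t.
by rewrite -mulrA -invfM -exprSr; apply; rewrite ler0n.
Qed.

Let cauchy_bound M : 0 <= M -> (forall t, `|u_ 1 t - u_ 0 t| <= M) ->
  forall k j t, `|u_ (k + j)%N t - u_ k t| <= 2 * M / 2 ^+ k.
Proof.
move=> M0' hM k j t.
(* The partial geometric sum is kept exactly, so that the induction on [j] closes. *)
suff : `|u_ (k + j)%N t - u_ k t| <= 2 * M / 2 ^+ k * (1 - (2 ^+ j)^-1).
  move=> h; apply: le_trans h _; apply: ler_piMr.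
    by rewrite divr_ge0 ?mulr_ge0 // exprn_ge0.
  by rewrite gerBl invr_ge0 exprn_ge0.
elim: j => [|j IH]; first by rewrite addn0 subrr normr0 expr0 invr1 subrr mulr0.
rewrite addnS.
have -> : u_ (k + j).+1 t - u_ k t = (u_ (k + j).+1 t - u_ (k + j)%N t) + (u_ (k + j)%N t - u_ k t).
  by rewrite addrA subrK.
apply: le_trans (ler_normD _ _) _.
apply: le_trans (lerD (diff_bound M0' hM (k + j) t) IH) _.
rewrite exprD exprSr le_eqVlt; apply/orP; left; apply/eqP.
by field; rewrite !expf_neq0 // pnatr_eq0.
Qed.

Let pow2_cvg (C e : R) : 0 <= C -> 0 < e -> exists k, C / 2 ^+ k <= e.
Proof.
move=> C0 e0.
have : (2^-1 : R) ^+ k @[k --> \oo] --> 0.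
  apply: cvg_expr; rewrite ger0_norm ?invr_ge0 // invf_lt1 ?ltr1n //.
move=> /cvgrPdist_le /(_ (e / (C + 1))).
have C1 : 0 < C + 1 by rewrite ltr_wpDl.
move=> /(_ (divr_gt0 e0 C1)) [N _ /(_ N (leqnn _))] /=.
rewrite sub0r normrN exprVn ger0_norm ?invr_ge0 ?exprn_ge0 // => h; exists N.
apply: (@le_trans _ _ (C * (e / (C + 1)))); first by rewrite ler_wpM2l.
by rewrite mulrCA ler_piMr ?(ltW e0) // ler_pdivrMr // mul1r lerDl.
Qed.

(** The iterates converge uniformly to some [u], continuous for that reason. One further step from
    [u] gives [v], and [u_ k.+1] is close to both, so that [u = v] solves the integral equation. *)
Lemma picard : exists u : R -> W, u 0 = w0 /\
  exists2 e : R, 0 < e & forall t, `|t| < e -> is_derive t (1:R) u (X (u t)).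
Proof.
have [M M0' hM] := M0.
have cb := cauchy_bound M0' hM.
have cv t : cvg ((fun k => u_ k t) @ \oo).
  apply/cauchy_cvgP/cauchy_exP => e e0.
  have [k hk] := @pow2_cvg (2 * M) (e / 2) (mulr_ge0 (ler0n _ _) M0') (divr_gt0 e0 (ltr0n _ 2)).
  exists (u_ k t); exists k => // p /= kp.
  rewrite -ball_normE /= distrC -(subnKC kp).
  by apply: le_lt_trans (cb k (p - k)%N t) _; apply: le_lt_trans hk _; lra.
pose u t := lim ((fun k => u_ k t) @ \oo).
have ub k t : `|u t - u_ k t| <= 2 * M / 2 ^+ k.
  apply/ler_addgt0Pl => e e0; have /cvgrPdist_le/(_ _ e0)[N _ hN] := cv t.
  have -> : u t - u_ k t = (u t - u_ (k + N)%N t) + (u_ (k + N)%N t - u_ k t) by rewrite addrA subrK.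
  apply: le_trans (ler_normD _ _) _; apply: lerD; last exact: cb.
  by apply: hN; rewrite /= leq_addl.
have uc : continuous u.
  move=> t; apply/cvgrPdist_le => e e0.
  have [k hk] := @pow2_cvg (2 * M) (e / 3) (mulr_ge0 (ler0n _ _) M0') (divr_gt0 e0 (ltr0n _ 3)).
  have := svalP (it k) t => /cvgrPdist_le /(_ _ (divr_gt0 e0 (ltr0n _ 3))).
  apply: filterS => s hs.
  have -> : u t - u s = (u t - u_ k t) + (u_ k t - u_ k s) + (u_ k s - u s) by rewrite !addrA !subrK.
  have h1 := ub k t; have h2 := ub k s; rewrite distrC in h2.
  apply: le_trans (ler_normD _ _) _.
  have h3 : `|u t - u_ k t + (u_ k t - u_ k s)| <= e / 3 + e / 3.
    apply: le_trans (ler_normD _ _) _; apply: lerD; last exact: hs.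
    exact: le_trans hk.
  apply: le_trans (lerD h3 (le_trans h2 hk)) _; lra.
have [v [vc vs]] := picard_step_ex uc.
have uv : u = v.
  apply/funext => t; apply/eqP; rewrite -subr_eq0 -normr_le0; apply/ler_addgt0Pl => e e0.
  have [k hk] := @pow2_cvg (2 * M) (e / 2) (mulr_ge0 (ler0n _ _) M0') (divr_gt0 e0 (ltr0n _ 2)).
  have h1 := ub k.+1 t.
  have b0 : 0 <= 2 * M / 2 ^+ k by rewrite divr_ge0 ?mulr_ge0 ?exprn_ge0.
  have h2 := picard_lip b0 (ub k) vs (stepP (it k)) t; rewrite distrC in h2.
  have -> : u t - v t = (u t - u_ k.+1 t) + (u_ k.+1 t - v t) by rewrite addrA subrK.
  apply: le_trans (ler_normD _ _) _; rewrite addr0.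
  apply: le_trans (lerD h1 h2) _.
  have -> : 2 * M / 2 ^+ k.+1 = 2 * M / 2 ^+ k / 2 by rewrite exprSr; field; rewrite expf_neq0 // pnatr_eq0.
  lra.
exists u; case: vs => G [G0 GD Gv]; split.
  by rewrite uv Gv clamp_id ?normr0 ?ltW // G0 addr0.
exists d => // t td.
have Dt : is_derive t (1:R) (fun s => w0 + G s) (X (u t)).
  rewrite -[X (u t)]add0r; apply: is_deriveD; apply: GD.
  by move: td; rewrite ltr_norml => /andP[]; lra.
apply: near_eq_is_derive Dt; near=> s; rewrite uv Gv clamp_id //.
near: s.
have : \forall s \near t, `|s| < d.
  by have /cvgr_lt := @norm_continuous R R^o t; apply.
by apply: filterS => s /ltW.
Unshelve. all: by end_near. Qed.

End Picard.

(** * Smoothness and local Lipschitz bounds of the spray *)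

Section SpraySmooth.
Context {R : realType} {n : nat}.
Notation V := 'rV[R]_n.
Implicit Types (x y u v w : V).
Variables (D : set V) (Dopen : open D).

Lemma smoothF_det m (M : V -> V -> 'M[R]_m) :
  (forall i j, smoothF D (fun x y => M x y i j)) -> smoothF D (fun x y => \det (M x y)).
Proof.
move=> MC; apply: (smoothF_sum Dopen) => s; apply: (smoothFM Dopen).
  exact: smoothF_cst.
apply: (smoothF_prod Dopen) => i; exact: MC.
Qed.

(** By the cofactor formula the entries of the inverse are quotients of polynomials in the entries
    of the matrix. *)
Lemma smoothF_invmx m (M : V -> V -> 'M[R]_m) i j :
  (forall x y, D x -> y != 0 -> M x y \in unitmx) ->
  (forall i j, smoothF D (fun x y => M x y i j)) -> smoothF D (fun x y => invmx (M x y) i j).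
Proof.
move=> Mu MC.
apply: (@smoothF_eq _ _ D Dopen (fun x y => (\det (M x y))^-1 * ((-1) ^+ (j + i) *
    \det (\matrix_(a, b) M x y (lift j a) (lift i b))))).
  move=> x y Dx y0; rewrite /invmx Mu // !mxE; congr (_ * (_ * \det _)).
  by apply/matrixP => a b; rewrite !mxE.
apply: (smoothFM Dopen).
  apply: (smoothFV Dopen); last exact: smoothF_det.
  by move=> x y Dx y0; have := Mu _ _ Dx y0; rewrite unitmxE unitfE.
apply: (smoothFM Dopen); first exact: smoothF_cst.
apply: smoothF_det => a b; apply: (smoothF_eq Dopen) (MC (lift j a) (lift i b)).
by move=> x y _ _; rewrite mxE.
Qed.

Variables (F : V -> V -> R) (HF : finsler D F).

Lemma spray_smooth i : smoothF D (spray F i).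
Proof.
have QC := sqF_smooth Dopen HF.
apply: (smoothFM Dopen); first exact: smoothF_cst.
apply: (smoothF_sum Dopen) => j; apply: (smoothFM Dopen).
  apply: smoothF_invmx; first by move=> x y Dx y0; exact: (fund_tensor_unit Dopen HF).
  move=> a b; apply: (@smoothF_eq _ _ D Dopen (fun x y => 2^-1 * pdy (pdy (sqF F) a) b x y)).
    by move=> *; rewrite mxE.
  apply: (smoothFM Dopen); first exact: smoothF_cst.
  by apply: smoothF_dy => //; exact: smoothF_dy.
apply: (smoothFB Dopen); last exact: smoothF_dx.
apply: (smoothF_sum Dopen) => k; apply: (smoothFM Dopen); last exact: smoothF_coord.
by apply: smoothF_dy => //; exact: smoothF_dx.
Qed.

Lemma smoothF_lip f x y : smoothF D f -> D x -> y != 0 ->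
  exists r L : R, [/\ 0 < r, 0 <= L,
    (forall x' y', `|x' - x| <= r -> `|y' - y| <= r -> D x' /\ y' != 0) &
    forall x1 y1 x2 y2 C, `|x1 - x| <= r -> `|y1 - y| <= r -> `|x2 - x| <= r -> `|y2 - y| <= r ->
      `|x1 - x2| <= C -> `|y1 - y2| <= C -> `|f x1 y1 - f x2 y2| <= L * C].
Proof.
move=> fC Dx y0; have Oo := open_slit Dopen.
pose e (j : 'I_n + 'I_n) : V * V := match j with inl i => (delta_mx 0 i, 0) | inr i => (0, delta_mx 0 i) end.
have fC1 := fC 1%N.
pose f' (p : V * V) := f p.1 p.2; pose p0 : V * V := (x, y).
have Op : slit D p0 by [].
have [d d0 Hd] : exists2 d : R, 0 < d & forall z : V * V, `|z - p0| <= d ->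
    slit D z /\ forall j, `|'D_(e j) f' z - 'D_(e j) f' p0| <= 1.
  have : \forall z \near p0, slit D z /\ forall j, `|'D_(e j) f' z - 'D_(e j) f' p0| <= 1.
    apply: filterI; first exact: open_nbhs_nbhs.
    apply: (@filter_forall _ _ (fun j z => `|'D_(e j) f' z - 'D_(e j) f' p0| <= 1) (nbhs p0)) => j.
    have := class_C_cont (class_CD (e j) fC1) Op.
    move=> /cvgrPdist_le /(_ _ ltr01).
    by apply: filterS => z; rewrite distrC.
  move=> /nbhs_ballP [d /= d0 Hd]; exists (d / 2); first by rewrite divr_gt0.
  move=> z zd; apply: Hd; rewrite -ball_normE /= distrC (le_lt_trans zd) //.
  by rewrite ltr_pdivrMr // ltr_pMr // ltr1n.
pose N := \sum_(j : 'I_n + 'I_n) (1 : R); pose M := \sum_(j : 'I_n + 'I_n) `|e j|.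
pose K := \sum_(j : 'I_n + 'I_n) `|'D_(e j) f' p0|.
have N0 : 0 <= N by exact: sumr_ge0.
have M0 : 0 <= M by exact: sumr_ge0.
have K0 : 0 <= K by exact: sumr_ge0.
(* A path that changes one coordinate at a time between two points of the ball of this radius [r]
   moves each coordinate by at most [2 r], so it stays within [r + 2 r M = d] of the centre, where
   the derivatives are bounded. *)
have r0 : 0 < d / (1 + 2 * M) by rewrite divr_gt0 // ltr_pwDl // mulr_ge0.
have rd : d / (1 + 2 * M) <= d.
  by rewrite ler_pdivrMr ?ltr_pwDl ?mulr_ge0 // ler_peMr ?(ltW d0) // lerDl mulr_ge0.
have nb (a b : V) c : `|a| <= c -> `|b| <= c -> `|(a, b) : V * V| <= c.
  by move=> h1 h2; rewrite prod_normE /= ge_max h1 h2.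
exists (d / (1 + 2 * M)), (N + K); split=> //; first exact: addr_ge0.
  move=> x' y' h1 h2; have /Hd[[]] : `|(x', y') - p0| <= d by apply: nb; exact: le_trans rd.
  by [].
move=> x1 y1 x2 y2 C hx1 hy1 hx2 hy2 hC1 hC2.
have C0 : 0 <= C by exact: le_trans hC1.
pose c (j : 'I_n + 'I_n) : R := match j with inl i => (x1 - x2) 0 i | inr i => (y1 - y2) 0 i end.
have cC j : `|c j| <= C.
  by case: j => i; apply: le_trans (coord_le_norm _ _ _) _.
have cr j : `|c j| <= 2 * (d / (1 + 2 * M)).
  case: j => i; apply: le_trans (coord_le_norm _ _ _) _.
    have -> : x1 - x2 = (x1 - x) - (x2 - x) by rewrite opprB addrA subrK.
    apply: le_trans (ler_normB _ _) _; lra.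
  have -> : y1 - y2 = (y1 - y) - (y2 - y) by rewrite opprB addrA subrK.
  apply: le_trans (ler_normB _ _) _; lra.
have Es : (x1, y1) = (x2, y2) + \sum_j c j *: e j.
  rewrite big_sumType /=.
  have -> : \sum_i (x1 - x2) 0 i *: ((delta_mx 0 i, 0) : V * V) = (\sum_i (x1 - x2) 0 i *: delta_mx 0 i, 0).
    apply: (big_rec2 (fun (p : V * V) q => p = (q, 0))) => // i q p _ ->.
    by congr pair; rewrite /= ?scaler0 ?addr0.
  have -> : \sum_i (y1 - y2) 0 i *: ((0, delta_mx 0 i) : V * V) = (0, \sum_i (y1 - y2) 0 i *: delta_mx 0 i).
    apply: (big_rec2 (fun (p : V * V) q => p = (0, q))) => // i q p _ ->.
    by congr pair; rewrite /= ?scaler0 ?addr0.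
  rewrite -!row_sum_delta; congr pair; rewrite /= ?addr0 ?add0r.
    by rewrite addrC subrK.
  by rewrite addrC subrK.
have := @telescope_bound R (V * V)%type _ e f' (slit D) p0 d 1 (fun z zd => (Hd z zd).1)
  (fun z j Uz => class_C_derivable fC1 Uz) (fun z j zd => (Hd z zd).2 j)
  (index_enum ('I_n + 'I_n)%type) c (x2, y2).
rewrite -Es => T.
have {}T : `|f x1 y1 - f x2 y2 - \sum_j c j * 'D_(e j) f' p0| <= 1 * \sum_j `|c j|.
  apply: T; apply: (@le_trans _ _ (d / (1 + 2 * M) + 2 * (d / (1 + 2 * M)) * M)).
    apply: lerD; first by apply: nb.
    rewrite mulr_sumr; apply: ler_sum => j _; rewrite normrZ ler_wpM2r //.
  rewrite le_eqVlt; apply/orP; left; apply/eqP; field.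
  by rewrite gt_eqF // ltr_pwDl // mulr_ge0.
have -> : f x1 y1 - f x2 y2 = (f x1 y1 - f x2 y2 - \sum_j c j * 'D_(e j) f' p0) + \sum_j c j * 'D_(e j) f' p0.
  by rewrite subrK.
apply: le_trans (ler_normD _ _) _; rewrite mulrDl; apply: lerD.
  apply: le_trans T _; rewrite mul1r /N mulr_suml; apply: ler_sum => j _.
  by rewrite mul1r.
apply: le_trans (ler_norm_sum _ _ _) _; rewrite /K mulr_suml; apply: ler_sum => j _.
by rewrite normrM mulrC ler_wpM2l.
Qed.

End SpraySmooth.

Section GeodesicExistence.
Context {R : realType} {n : nat}.
Notation V := 'rV[R]_n.
Implicit Types (x y u v w : V).

Lemma derive1_val (V' : normedModType R) (c : R -> V') t (u : V') : is_derive t (1:R) c u -> derive1 c t = u.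
Proof. by case=> _; rewrite derive1E. Qed.

Lemma derive1_is_derive (V' : normedModType R) (c : R -> V') t :
  derivable c t 1 -> is_derive t (1:R) c (derive1 c t).
Proof. by move=> dc; apply: DeriveDef => //; rewrite derive1E. Qed.

Lemma near_abs_lt (e t : R) : `|t| < e -> \forall s \near t, `|s| < e.
Proof. by move=> te; have /cvgr_lt := @norm_continuous R R^o t; apply. Qed.

Variables (D : set V) (Dopen : open D) (F : V -> V -> R) (HF : finsler D F).

Lemma sprayv_lip x y : D x -> y != 0 ->
  exists r L : R, [/\ 0 < r, 0 <= L,
    (forall x' y', `|x' - x| <= r -> `|y' - y| <= r -> D x' /\ y' != 0) &
    forall x1 y1 x2 y2 C, `|x1 - x| <= r -> `|y1 - y| <= r -> `|x2 - x| <= r -> `|y2 - y| <= r ->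
      `|x1 - x2| <= C -> `|y1 - y2| <= C -> `|sprayv F x1 y1 - sprayv F x2 y2| <= L * C].
Proof.
move=> Dx y0; have S i := smoothF_lip Dopen (spray_smooth Dopen HF i) Dx y0.
have /choice[r /choice[L H]] := S.
have [r0 [L0 [r00 L00 HD _]]] := smoothF_lip Dopen (finsler_smooth Dopen HF) Dx y0.
(* A positive radius below [r0] and below every [r i]. *)
pose ri := (r0^-1 + \sum_i (r i)^-1)^-1.
have rip i : 0 < r i by case: (H i).
have Lip i : 0 <= L i by case: (H i).
have s0 : 0 <= \sum_i (r i)^-1 by apply: sumr_ge0 => i _; rewrite invr_ge0 ltW.
have ri0 : 0 < ri by rewrite invr_gt0 ltr_pwDl // invr_gt0.
have rile i : ri <= r i.
  rewrite -[r i]invrK lef_pV2 ?posrE ?invr_gt0 ?ltr_pwDl ?invr_gt0 //.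
  rewrite (bigD1 i) //= addrCA lerDl addr_ge0 ?invr_ge0 ?(ltW r00) //.
  by apply: sumr_ge0 => j _; rewrite invr_ge0 ltW.
have rle0 : ri <= r0.
  by rewrite -[r0]invrK lef_pV2 ?posrE ?invr_gt0 ?ltr_pwDl ?invr_gt0 // lerDl.
exists ri, (\sum_i L i); split=> //; first exact: sumr_ge0.
  by move=> x' y' h1 h2; apply: HD; apply: le_trans rle0.
move=> x1 y1 x2 y2 C h1 h2 h3 h4 h5 h6.
have C0 : 0 <= C by exact: le_trans h5.
apply: norm_le_coord; first by rewrite mulr_ge0 // sumr_ge0.
move=> a i; rewrite ord1 !mxE; have [_ _ _ Hi] := H i.
apply: (@le_trans _ _ (L i * C)).
  by apply: Hi => //; apply: le_trans (rile i).
by rewrite ler_wpM2r // (bigD1 i) //= lerDl sumr_ge0.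
Qed.

(** The geodesic equation is a first order system for [row_mx x y]. The truncation [cl] of the state
    to a box around its initial value makes the field globally Lipschitz and is inactive for short
    times. Constancy of the speed is [spray_energy]. *)
Lemma geodesic_ex x y : D x -> y != 0 ->
  exists (e : R) (c : R -> V), [/\ 0 < e, geodesic D F (- e)%:E e%:E c, c 0 = x & derive1 c 0 = y].
Proof.
move=> Dx y0; have [r [L [r0 L0 HD HL]]] := sprayv_lip Dx y0.
pose w0 : 'rV[R]_(n + n) := row_mx x y.
pose cl (w : 'rV[R]_(n + n)) : 'rV[R]_(n + n) := \row_j (w0 0 j + clamp r (w 0 j - w0 0 j)).
have clr (w : 'rV[R]_(n + n)) : `|cl w - w0| <= r.
  apply: norm_le_coord; first exact: ltW.
  by move=> i j; rewrite ord1 !mxE addrAC subrr add0r ler_norml clamp_itv // ltW.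
have clL (a b : 'rV[R]_(n + n)) : `|cl a - cl b| <= `|a - b|.
  apply: norm_le_coord => // i j; rewrite ord1 !mxE opprD addrACA subrr add0r.
  apply: le_trans (clamp_lip _ _ _) _; rewrite opprB addrA subrK.
  by have := coord_le_norm (a - b) 0 j; rewrite !mxE.
have clid (w : 'rV[R]_(n + n)) : `|w - w0| <= r -> cl w = w.
  move=> h; apply/rowP => j; rewrite mxE clamp_id; first by rewrite addrC subrK.
  by apply: le_trans h; have := coord_le_norm (w - w0) 0 j; rewrite !mxE.
have lsubn (w : 'rV[R]_(n + n)) : `|lsubmx w| <= `|w|.
  by apply: norm_le_coord => // i j; rewrite mxE; exact: coord_le_norm.
have rsubn (w : 'rV[R]_(n + n)) : `|rsubmx w| <= `|w|.
  by apply: norm_le_coord => // i j; rewrite mxE; exact: coord_le_norm.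
have cll (w : 'rV[R]_(n + n)) : `|lsubmx (cl w) - x| <= r.
  apply: le_trans (clr w); have -> : lsubmx (cl w) - x = lsubmx (cl w - w0).
    by rewrite linearB /= /w0 row_mxKl.
  exact: lsubn.
have clrr (w : 'rV[R]_(n + n)) : `|rsubmx (cl w) - y| <= r.
  apply: le_trans (clr w); have -> : rsubmx (cl w) - y = rsubmx (cl w - w0).
    by rewrite linearB /= /w0 row_mxKr.
  exact: rsubn.
pose X (w : 'rV[R]_(n + n)) : 'rV[R]_(n + n) :=
  row_mx (rsubmx (cl w)) (- 2 *: sprayv F (lsubmx (cl w)) (rsubmx (cl w))).
(* The Lipschitz constant is 1 for the block [x' = y] and [2 L] for the block [y' = - 2 G]. *)
have K0 : 0 < 1 + 2 * L by rewrite ltr_pwDl // mulr_ge0.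
have XL (a b : 'rV[R]_(n + n)) : `|X a - X b| <= (1 + 2 * L) * `|a - b|.
  apply: norm_le_coord; first by rewrite mulr_ge0 // ltW.
  move=> i j; rewrite ord1 /X opp_row_mx add_row_mx mxE.
  have ab : `|a - b| <= (1 + 2 * L) * `|a - b|.
    by rewrite ler_peMl // lerDl mulr_ge0.
  case: fintype.split => k.
    apply: le_trans (coord_le_norm _ _ _) _; rewrite -linearB /=.
    by apply: le_trans (rsubn _) _; apply: le_trans (clL _ _) _.
  rewrite -scalerBr mxE normrM normrN (ger0_norm (ler0n _ 2)).
  apply: (@le_trans _ _ (2 * (L * `|a - b|))).
    rewrite ler_pM2l ?ltr0n //; apply: le_trans (coord_le_norm _ _ _) _.
    apply: HL => //.
      by rewrite -linearB /=; apply: le_trans (lsubn _) _; exact: clL.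
    by rewrite -linearB /=; apply: le_trans (rsubn _) _; exact: clL.
  by rewrite mulrA ler_wpM2r // lerDr.
have [u [u0 [e e0 De]]] := picard K0 XL w0.
have uc0 : {for 0, continuous u}.
  by apply: (is_derive_continuous (De 0 _)); rewrite normr0.
have [e1 [e10 e1e He1]] : exists e1 : R, [/\ 0 < e1, e1 <= e & forall t, `|t| < e1 -> `|u t - w0| <= r].
  have /cvgrPdist_le/(_ _ r0)/nbhs_ballP[d /= d0 Hd] := uc0.
  exists (Order.min d e); split.
  - by rewrite lt_min d0.
  - by rewrite ge_min lexx orbT.
  move=> t; rewrite lt_min => /andP[td _]; rewrite distrC -u0; apply: Hd.
  by rewrite -ball_normE /= sub0r normrN.
pose c s := lsubmx (u s); pose v s := rsubmx (u s).
have Dv t : `|t| < e1 -> D (c t) /\ v t != 0.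
  move=> /He1 h; have := cll (u t); have := clrr (u t); rewrite !clid // => h1 h2.
  exact: HD.
have Dc t : `|t| < e1 -> is_derive t (1:R) c (v t).
  move=> te; have /is_derive_coordP Du := De t (lt_le_trans te e1e).
  apply/is_derive_coordP => i.
  have -> : (fun s => c s 0 i) = fun s => u s 0 (lshift n i) by apply/funext => s; rewrite /c mxE.
  have -> : v t 0 i = X (u t) 0 (lshift n i) by rewrite /X row_mxEl clid // He1.
  exact: Du.
have Dd t : `|t| < e1 -> is_derive t (1:R) v (- 2 *: sprayv F (c t) (v t)).
  move=> te; have /is_derive_coordP Du := De t (lt_le_trans te e1e).
  apply/is_derive_coordP => i.
  have -> : (fun s => v s 0 i) = fun s => u s 0 (rshift n i) by apply/funext => s; rewrite /v mxE.
  have -> : (- 2 *: sprayv F (c t) (v t)) 0 i = X (u t) 0 (rshift n i).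
    by rewrite /X row_mxEr clid // He1.
  exact: Du.
have E1 t : `|t| < e1 -> derive1 c t = v t by move=> te; exact: derive1_val (Dc t te).
have D2 t : `|t| < e1 -> is_derive t (1:R) (derive1 c) (- 2 *: sprayv F (c t) (v t)).
  move=> te; apply: near_eq_is_derive (Dd t te).
  by have := near_abs_lt te; apply: filterS => s /E1.
have itv t : ((- e1)%:E < t%:E)%E -> (t%:E < e1%:E)%E -> `|t| < e1.
  by rewrite !lte_fin => h1 h2; rewrite ltr_norml h1.
have e1p : `|0 : R| < e1 by rewrite normr0.
exists e1, c; split=> //; last first.
- by rewrite E1 // /v u0 row_mxKr.
- by rewrite /c u0 row_mxKl.
split.
  move=> t t1 t2; have te := itv t t1 t2; split; first by case: (Dv t te).
  split.
  - by have := near_abs_lt te; apply: filterS => s se; case: (Dc s se).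
  - by case: (D2 t te).
  - move=> i; rewrite (derive1_val (D2 t te)) E1 // !mxE; ring.
exists (F (c 0) (derive1 c 0)).
  by rewrite E1 //; have [h1 h2] := Dv 0 e1p; exact: (finsler_pos HF).
move=> t t1 t2; have te := itv t t1 t2.
have Q0 s : ((- e1)%:E < s%:E)%E -> (s%:E < e1%:E)%E -> is_derive s (1:R) (fun s => sqF F (c s) (v s)) 0.
  move=> s1 s2; have se := itv s s1 s2; have [h1 h2] := Dv s se.
  have := is_derive_chain Dopen (sqF_smooth Dopen HF) h1 h2 (Dc s se) (Dd s se).
  rewrite (dyZ Dopen) //; last exact: sqF_smooth.
  by have -> // : dx (sqF F) (v s) (c s) (v s) + - 2 * dy (sqF F) (sprayv F (c s) (v s)) (c s) (v s) = 0;
    rewrite -(spray_energy Dopen HF h1 h2) mulNr.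
have := derive0_cst Q0 (s := t) (t := 0) t1 t2.
rewrite !lte_fin oppr_lt0 e10 => /(_ isT isT).
rewrite /sqF !E1 // => /eqP; rewrite eqrXn2 // => [/eqP //||].
  by have [h1 h2] := Dv t te; exact: ltW (finsler_pos HF h1 h2).
by have [h1 h2] := Dv 0 e1p; exact: ltW (finsler_pos HF h1 h2).
Qed.

(** The geodesic issued from a given vector lies on a line, so its velocity near time 0 is parallel
    to a fixed [v]; differentiating once more, so is its acceleration, and the geodesic equation
    makes the spray a multiple of y. *)
Lemma flat_straight : projectively_flat D F -> straight_spray D F.
Proof.
move=> flat x y Dx y0.
have [e [c [e0 gc c0 c1]]] := geodesic_ex Dx y0.
have ee : ((- e)%:E < e%:E)%E by rewrite lte_fin gtrN.
have [p [v [v0 Hv]]] := flat _ _ _ ee gc.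
have h1 : ((- e)%:E < (0 : R)%:E)%E by rewrite lte_fin oppr_lt0.
have h2 : ((0 : R)%:E < e%:E)%E by rewrite lte_fin.
have [_ [d1 d2 eqn]] := gc.1 0 h1 h2.
have Hp i j : \forall t \near (0:R), v 0 j * (derive1 c t) 0 i = v 0 i * (derive1 c t) 0 j.
  have N : \forall t \near (0:R), `|t| < e by apply: near_abs_lt; rewrite normr0.
  near=> t.
  have dt : derivable c t 1 by near: t.
  have /is_derive_coordP Dt := derive1_is_derive dt.
  have Z : is_derive t (1:R) (fun s => v 0 j * c s 0 i - v 0 i * c s 0 j)
     (v 0 j * (derive1 c t) 0 i - v 0 i * (derive1 c t) 0 j).
    exact: (is_deriveB (is_deriveZ (v 0 j) (Dt i)) (is_deriveZ (v 0 i) (Dt j))).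
  have C : is_derive t (1:R) (fun s => v 0 j * c s 0 i - v 0 i * c s 0 j) 0.
    apply: (@near_eq_is_derive _ _ _ (fun=> v 0 j * p 0 i - v 0 i * p 0 j)).
    have te : `|t| < e by near: t.
    have := near_abs_lt te; apply: filterS => s; rewrite ltr_norml => /andP[s1 s2].
    have [||a ->] := Hv s; rewrite ?lte_fin // !mxE; ring.
  by apply/eqP; rewrite -subr_eq0; apply/eqP; case: Z => _ <-; case: C.
have Hs i j : v 0 j * (derive1 (derive1 c) 0) 0 i = v 0 i * (derive1 (derive1 c) 0) 0 j.
  have /is_derive_coordP Dt := derive1_is_derive d2.
  have Z : is_derive (0:R) (1:R) (fun s => v 0 j * (derive1 c s) 0 i - v 0 i * (derive1 c s) 0 j)
     (v 0 j * (derive1 (derive1 c) 0) 0 i - v 0 i * (derive1 (derive1 c) 0) 0 j).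
    exact: (is_deriveB (is_deriveZ (v 0 j) (Dt i)) (is_deriveZ (v 0 i) (Dt j))).
  have C : is_derive (0:R) (1:R) (fun s => v 0 j * (derive1 c s) 0 i - v 0 i * (derive1 c s) 0 j) 0.
    apply: (@near_eq_is_derive _ _ _ (fun=> 0)).
    by have := Hp i j; apply: filterS => s ->; rewrite subrr.
  by apply/eqP; rewrite -subr_eq0; apply/eqP; case: Z => _ <-; case: C.
have /rV0Pn[k vk] := v0.
have yE : y = (y 0 k / v 0 k) *: v.
  apply/rowP => i; rewrite mxE -c1.
  have := nbhs_singleton (Hp i k) => h; apply: (mulfI vk); rewrite h; field; exact: vk.
have yk : y 0 k / v 0 k != 0.
  by apply/negP => /eqP a0; move/eqP: y0; apply; apply: etrans yE _; rewrite a0 scale0r.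
pose l := - 2^-1 * (derive1 (derive1 c) 0) 0 k / v 0 k / (y 0 k / v 0 k).
have Sl : sprayv F x y = l *: y.
  apply/rowP => i; rewrite !mxE; have := eqn i; rewrite c0 c1 => h.
  have -> : spray F i x y = - 2^-1 * (derive1 (derive1 c) 0) 0 i by lra.
  have -> : (derive1 (derive1 c) 0) 0 i = v 0 i * (derive1 (derive1 c) 0) 0 k / v 0 k.
    by apply: (mulfI vk); rewrite Hs; field.
  rewrite [in y 0 i]yE mxE /l; field.
  by rewrite vk /=; apply: contra yk => /eqP ->; rewrite mul0r.
by rewrite Sl (spray_parallel_pfac Dopen HF Dx y0 Sl).
Unshelve. all: by end_near. Qed.

End GeodesicExistence.

Lemma time_bound_aux (R : realFieldType) (a b k s t p : R) :
  a + k * s = b + k * t -> a < p / 2 -> - (p / 2) < b -> k * (t - s) < p.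
Proof. by move=> e h1 h2; have -> : k * (t - s) = a - b; [rewrite mulrBr|]; lra. Qed.

Section BurgersGeodesics.
Context {R : realType} {n : nat}.
Notation V := 'rV[R]_n.
Implicit Types (x y u v w : V).
Variables (D : set V) (Dopen : open D) (F : V -> V -> R) (HF : finsler D F).
Hypothesis B : burgers D F.

Let FC := finsler_smooth Dopen HF.
Let PC := pfac_smooth Dopen HF.
Let q x y := pfac F x y / F x y.

Lemma slope_smooth : smoothF D q.
Proof.
apply: (smoothFM Dopen) => //; apply: (smoothFV Dopen) => // x y Dx y0.
by rewrite gt_eqF // (finsler_pos HF).
Qed.

Lemma dy_slope u x y : D x -> y != 0 ->
  dy q u x y = (dy (pfac F) u x y * F x y - pfac F x y * dy F u x y) / F x y ^+ 2.
Proof.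
move=> Dx y0; have F0 := finsler_pos HF Dx y0.
have : dy (pfac F) u x y = dy (fun x y => q x y * F x y) u x y.
  by apply: dy_eq Dx y0 _ => // a b Da b0; rewrite /q divfK // gt_eqF // (finsler_pos HF).
rewrite (dyM Dopen _ slope_smooth FC) // => ->.
rewrite [q x y]/q; field; exact: lt0r_neq0.
Qed.

Lemma dx_slope u x y : D x -> y != 0 ->
  dx q u x y = (dx (pfac F) u x y * F x y - pfac F x y * dx F u x y) / F x y ^+ 2.
Proof.
move=> Dx y0; have F0 := finsler_pos HF Dx y0.
have : dx (pfac F) u x y = dx (fun x y => q x y * F x y) u x y.
  by apply: (dx_eq Dopen) Dx y0 _ => // a b Da b0; rewrite /q divfK // gt_eqF // (finsler_pos HF).
rewrite (dxM Dopen _ slope_smooth FC) // => ->.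
rewrite [q x y]/q; field; exact: lt0r_neq0.
Qed.

Lemma geodesic_eq_straight c t : D (c t) -> derive1 c t != 0 -> geodesic_eq_at F c t ->
  is_derive t (1:R) c (derive1 c t) /\
  is_derive t (1:R) (derive1 c) (- (2 * pfac F (c t) (derive1 c t)) *: derive1 c t).
Proof.
move=> Dc c0 [d1 d2 eqn]; split.
  by apply: derive1_is_derive; exact: nbhs_singleton d1.
apply: DeriveDef => //; rewrite -derive1E; apply/rowP => i.
have := eqn i; have /rowP/(_ i) := burgers_straight Dopen HF B Dc c0.
rewrite !mxE => ->; lra.
Qed.

(* The angle with tangent [P / F] decreases at the speed of the geodesic, which bounds the
   life span of geodesics. *)
Lemma slope_geodesic c t : D (c t) -> derive1 c t != 0 -> geodesic_eq_at F c t ->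
  is_derive t (1:R) (fun s => atan (q (c s) (derive1 c s))) (- F (c t) (derive1 c t)).
Proof.
move=> Dc c0 ge; have [D1 D2] := geodesic_eq_straight Dc c0 ge.
set x := c t in Dc D2 *; set y := derive1 c t in c0 D1 D2 *.
have F0 := finsler_pos HF Dc c0.
have := is_derive_chain Dopen slope_smooth Dc c0 D1 D2.
rewrite -/x -/y (dyZ Dopen) //; last exact: slope_smooth.
rewrite dx_slope // dy_slope //.
have [-> ->] := B y Dc c0.
have -> : dy F y x y = F x y by rewrite (@euler _ _ D Dopen 1) ?mul1r //; exact: finsler_homog.
have -> : dy (pfac F) y x y = pfac F x y by rewrite (@euler _ _ D Dopen 1) ?mul1r //; exact: pfac_homog.
move=> Dq; have Da := @is_derive1_comp R atan (fun s => q (c s) (derive1 c s)) t _ _ (is_derive1_atan _) Dq.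
apply: (@is_derive_eq _ _ _ _ _ _ _ _ Da).
rewrite -/x -/y /q; move: (pfac F x y) (F x y) F0 => p f f0.
have h : 0 < f ^+ 2 + p ^+ 2 by rewrite ltr_pwDl ?exprn_gt0 // sqr_ge0.
field; rewrite !gt_eqF //=.
Qed.

(** The sum [atan (P / F) + k t] is constant, while the arctangent stays in an open interval of
    length [pi]; this is also why the bound is strict. *)
Lemma geodesic_time_bound lo hi c (k : R) : 0 < k ->
  (forall t : R, (lo < t%:E)%E -> (t%:E < hi)%E -> D (c t) /\ geodesic_eq_at F c t) ->
  (forall t : R, (lo < t%:E)%E -> (t%:E < hi)%E -> F (c t) (derive1 c t) = k) ->
  forall s t : R, (lo < s%:E)%E -> (t%:E < hi)%E -> s <= t -> k * (t - s) < pi.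
Proof.
move=> k0 g Fk s t s1 t2 st.
have s2 : (s%:E < hi)%E by apply: le_lt_trans t2; rewrite lee_fin.
have t1 : (lo < t%:E)%E by apply: lt_le_trans s1 _; rewrite lee_fin.
have c0 r : (lo < r%:E)%E -> (r%:E < hi)%E -> derive1 c r != 0.
  move=> r1 r2; have := Fk r r1 r2; have [Dr _] := g r r1 r2.
  apply: contra_eq_neq => ->; have [/(_ _ Dr)[_ h _ _ _] _] := HF.
  by rewrite (iffRL (h 0)) // eq_sym gt_eqF.
have Z r : (lo < r%:E)%E -> (r%:E < hi)%E ->
  is_derive r (1:R) (fun r => atan (q (c r) (derive1 c r)) + k * r) 0.
  move=> r1 r2; have [Dr gr] := g r r1 r2; have Ds := slope_geodesic Dr (c0 r r1 r2) gr.
  have Dk : is_derive r (1:R) (fun r : R => k * r) k.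
    by apply: is_derive_eq; rewrite /GRing.scale /= !mulr1.
  have := is_deriveD Ds Dk; rewrite Fk // addNr; exact.
have E := derive0_cst Z s1 s2 t1 t2.
have a1 := atan_ltpi2 (q (c s) (derive1 c s)); have a2 := atan_gtNpi2 (q (c t) (derive1 c t)).
exact: time_bound_aux E a1 a2.
Qed.

End BurgersGeodesics.

(** * Calibrations and incompleteness *)

Section SlopeAlgebra.
Variable R : realFieldType.

(** When the base point moves by [u], the vector [e - b x] moves by [- b u], so that [p] is replaced
    by [p - b] as a coefficient in the Burgers equations. In the derivative of the angle the terms
    in [pu] then cancel. *)
Lemma slope_deriv_alg (p f pu fu b : R) : 0 < f ->
  (1 + ((p - b) / f) ^+ 2)^-1 *
    ((((p - b) * pu - f * fu) * f - (p - b) * ((p - b) * fu + f * pu)) / f ^+ 2) = - fu.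
Proof.
move=> f0; have h : 0 < f ^+ 2 + (p - b) ^+ 2 by rewrite ltr_pwDl ?exprn_gt0 // sqr_ge0.
field; rewrite (gt_eqF f0) /=; apply: lt0r_neq0; move: h; congr (_ < _); ring.
Qed.

Lemma line_den_gt0 (p f s : R) : 0 < f -> 0 < (1 + s * p) ^+ 2 + s ^+ 2 * f ^+ 2.
Proof.
move=> f0; have [->|s0] := eqVneq s 0; first by rewrite mul0r addr0 expr1n expr0n mul0r addr0.
apply: ltr_wpDl; first exact: sqr_ge0.
by apply: mulr_gt0; [rewrite lt0r sqrf_eq0 s0 sqr_ge0 | exact: exprn_gt0].
Qed.

(** This and [line_p_alg] are the numerators of the derivatives in [s] of the imaginary and real
    parts of [Psi / (1 + s Psi)] when [Psi' = Psi ^ 2]; the denominator is [|1 + s Psi| ^ 2]. *)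
Lemma line_f_alg (p f s : R) : 0 < f ->
  (2 * p * f * ((1 + s * p) ^+ 2 + s ^+ 2 * f ^+ 2) -
   f * (2 * (1 + s * p) * (p + s * (p ^+ 2 - f ^+ 2)) + (2 * s * f ^+ 2 + s ^+ 2 * (2 * f * (2 * p * f))))) = 0.
Proof. by move=> f0; ring. Qed.

Lemma line_p_alg (p f s : R) : 0 < f ->
  ((p ^+ 2 - f ^+ 2 + (p ^+ 2 + f ^+ 2 + s * (2 * p * (p ^+ 2 - f ^+ 2) + 2 * f * (2 * p * f)))) *
     ((1 + s * p) ^+ 2 + s ^+ 2 * f ^+ 2) -
   (p + s * (p ^+ 2 + f ^+ 2)) *
     (2 * (1 + s * p) * (p + s * (p ^+ 2 - f ^+ 2)) + (2 * s * f ^+ 2 + s ^+ 2 * (2 * f * (2 * p * f))))) = 0.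
Proof. by move=> f0; ring. Qed.

Lemma fundamental_alg (a b d : R) : 0 < a -> 0 < b ->
  b ^+ 2 + 2 * b * (a^-1 * b * d - b) <= (a^-1 * b * a) ^+ 2 -> d <= a.
Proof.
move=> a0 b0; have -> : a^-1 * b * a = b by rewrite mulrAC mulVf ?gt_eqF // mul1r.
move=> h.
have h2 : b * (a^-1 * b * d - b) <= 0 by lra.
rewrite pmulr_rle0 // subr_le0 mulrAC ger_pMl // in h2.
by rewrite mulrC ler_pdivrMr // mul1r in h2.
Qed.
End SlopeAlgebra.

Section RealDerivatives.
Context {R : realType}.

Lemma is_derive_mulr (f g : R -> R) (t a b : R) :
  is_derive t (1:R) f a -> is_derive t (1:R) g b ->
  is_derive t (1:R) (fun s => f s * g s) (a * g t + f t * b).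
Proof.
move=> df dg; apply: (@is_derive_eq _ _ _ _ _ _ _ _ (is_deriveM df dg)).
by rewrite /GRing.scale /= addrC mulrC.
Qed.

Lemma is_derive_div (f g : R -> R) (t a b : R) : g t != 0 ->
  is_derive t (1:R) f a -> is_derive t (1:R) g b ->
  is_derive t (1:R) (fun s => f s / g s) ((a * g t - f t * b) / g t ^+ 2).
Proof.
move=> g0 df dg.
apply: (@is_derive_eq _ _ _ _ _ _ _ _ (is_derive_mulr df (is_deriveV g0 dg))).
by rewrite /GRing.scale /=; field.
Qed.

Lemma is_derive_atan (f : R -> R) (t a : R) :
  is_derive t (1:R) f a -> is_derive t (1:R) (fun s => atan (f s)) ((1 + f t ^+ 2)^-1 * a).
Proof. by move=> df; exact: (is_derive1_comp (is_derive1_atan (f t)) df). Qed.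

Lemma is_derive_id1 (t : R) : is_derive t (1:R) (fun s : R => s) 1.
Proof. exact: is_derive_id. Qed.

End RealDerivatives.

Section FundamentalInequality.
Context {R : realType} {n : nat}.
Notation V := 'rV[R]_n.
Implicit Types (x y u v w e : V).
Variables (D : set V) (Dopen : open D) (F : V -> V -> R) (HF : finsler D F).

Let FC := finsler_smooth Dopen HF.
Let QC := sqF_smooth Dopen HF.

Lemma finsler0 x : D x -> F x 0 = 0.
Proof. by move=> Dx; have [/(_ _ Dx)[_ h _ _ _] _] := HF; apply/h. Qed.

Lemma finsler_ge0 x y : D x -> 0 <= F x y.
Proof. by move=> Dx; have [/(_ _ Dx)[h _ _ _ _] _] := HF. Qed.

Lemma finslerZ x y (a : R) : D x -> 0 < a -> F x (a *: y) = a * F x y.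
Proof. by move=> Dx a0; have [/(_ _ Dx)[_ _ h _ _] _] := HF; apply: h. Qed.

(** Convexity of [F ^ 2] in y, by two applications of the mean value theorem on the segment from [v]
    to [u]. The segment must avoid 0, where F need not be smooth. *)
Lemma sqF_tangent_le x u v : D x ->
  (forall t : R, 0 <= t <= 1 -> t *: (u - v) + v != 0) ->
  F x v ^+ 2 + 2 * F x v * (dy F u x v - F x v) <= F x u ^+ 2.
Proof.
move=> Dx h.
have v0 : v != 0 by have := h 0; rewrite scale0r add0r lexx ler01; apply.
pose w := u - v.
have D1 (f : V -> V -> R) (t : R) : smoothF D f -> 0 <= t <= 1 ->
    is_derive t (1:R) (fun s => f x (s *: w + v)) (dy f w x (t *: w + v)).
  move=> fC t01; have := is_derive_chain Dopen fC (c1 := fun=> x) (c2 := fun s : R => s *: w + v) (t := t) (u := 0) (v := w) Dx (h t t01) (is_derive_cst _ _ _) (is_derive_aff _ _ _).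
  by rewrite dx0 add0r.
have D2 (t : R) : t \in `]0, 1[%R -> is_derive t (1:R) (fun s => sqF F x (s *: w + v)) (dy (sqF F) w x (t *: w + v)).
  by rewrite in_itv /= => /andP[t0 t1]; apply: D1 => //; rewrite !ltW.
have [c c01 E] := @MVT_segment R _ _ 0 1 ler01 D2 (is_derive_within (fun t => @D1 _ t QC)).
have /andP[c0 c1] : 0 <= c <= 1 by move: c01; rewrite in_itv.
have QyC := smoothF_dy Dopen w QC.
have sub t : 0 <= t <= c -> 0 <= t <= 1 by move=> /andP[-> /le_trans ->].
have D3 (t : R) : t \in `]0, c[%R -> is_derive t (1:R) (fun s => dy (sqF F) w x (s *: w + v)) (dy (dy (sqF F) w) w x (t *: w + v)).
  by rewrite in_itv /= => /andP[t0 t1]; apply: D1 => //; apply: sub; rewrite !ltW.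
have [c' c'01 E'] := @MVT_segment R _ _ 0 c c0 D3 (is_derive_within (fun t h => @D1 _ t QyC (sub t h))).
have /sub c'1 : 0 <= c' <= c by move: c'01; rewrite in_itv.
have pos : 0 <= dy (dy (sqF F) w) w x (c' *: w + v).
  have [w0|w0] := eqVneq w 0; first by rewrite w0 dy0.
  have := gform_gt0 Dopen HF Dx (h c' c'1) w0; rewrite /gform pmulr_rgt0 ?invr_gt0 ?ltr0n //.
  exact: ltW.
have {}E : sqF F x u - sqF F x v = dy (sqF F) w x (c *: w + v).
  by move: E; rewrite scale1r scale0r add0r subr0 mulr1 /w subrK.
have {}E' : dy (sqF F) w x v <= dy (sqF F) w x (c *: w + v).
  rewrite -subr_ge0; have -> : dy (sqF F) w x (c *: w + v) - dy (sqF F) w x v = dy (dy (sqF F) w) w x (c' *: w + v) * c.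
    by move: E'; rewrite scale0r add0r subr0.
  exact: mulr_ge0.
have Ew : dy (sqF F) w x v = 2 * F x v * (dy F u x v - F x v).
  rewrite (dy_sqF Dopen HF) // /w addrC -scaleN1r (dyD Dopen) //.
  rewrite (@euler _ _ D Dopen 1) //; last exact: finsler_homog.
  by rewrite mul1r mulN1r addrC.
by rewrite -Ew -lerBrDl; move: E' ; rewrite -E /sqF.
Qed.

(** If [u] is a nonpositive multiple of [v] the segment between them may meet 0, but then the left
    side is at most 0. Otherwise [sqF_tangent_le] applies to a positive multiple of [u]. *)
Lemma finsler_fundamental x u v : D x -> v != 0 -> dy F u x v <= F x u.
Proof.
move=> Dx v0; have Fv := finsler_pos HF Dx v0.
have Ev : dy F v x v = F x v by rewrite (@euler _ _ D Dopen 1) ?mul1r //; exact: finsler_homog.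
have [[l [l0 ul]]|nu] := pselect (exists l : R, 0 <= l /\ u = - l *: v).
  rewrite {1}ul (dyZ Dopen) // Ev; apply: le_trans (finsler_ge0 _ Dx).
  by rewrite mulNr oppr_le0 mulr_ge0 // ltW.
have u0 : u != 0.
  by apply/eqP => u0; apply: nu; exists 0; rewrite lexx oppr0 scale0r.
have Fu := finsler_pos HF Dx u0.
(* With this factor [F x (a *: u) = F x v], and the tangent inequality for [F ^ 2] reduces to one
   for F. *)
pose a := (F x u)^-1 * F x v.
have a0 : 0 < a by rewrite mulr_gt0 ?invr_gt0.
have := @sqF_tangent_le x (a *: u) v Dx.
rewrite (dyZ Dopen) // finslerZ // => H; apply: (fundamental_alg Fu Fv); apply: H.
move=> t /andP[t0 t1]; apply/eqP => e; apply: nu.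
have [t00|t00] := eqVneq t 0.
  by move: e v0; rewrite t00 scale0r add0r => ->; rewrite eqxx.
exists ((1 - t) / (t * a)); split; first by rewrite divr_ge0 ?subr_ge0 // mulr_ge0 // ltW.
have ta : t * a != 0 by rewrite mulf_neq0 // gt_eqF.
apply: (scalerI ta); rewrite scalerA mulrN [t * a * _]mulrC divfK // scaleNr.
move: e; rewrite scalerBr scalerA => /eqP; rewrite -addrA addr_eq0 => /eqP ->.
by rewrite scalerBl scale1r addrC.
Qed.

(** Compactness of the unit sphere makes local bounds uniform in the direction, and homogeneity
    extends them to all nonzero vectors. This controls F and P near the zero section, out of reach
    of their smoothness. *)
Lemma homog_bound f x : smoothF D f -> homog D 1 f -> D x ->
  exists2 M : R, 0 < M & \forall x' \near x, forall y, y != 0 -> `|f x' y| <= M * `|y|.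
Proof.
move=> fC hf Dx; pose S := [set y : V | `|y| = 1].
have Sc : compact S.
  apply: bounded_closed_compact.
    by exists 1; split; [exact: num_real | move=> M M1 y /= ->; exact: ltW].
  have -> : S = (@Num.norm _ V) @^-1` [set 1] by [].
  apply: (@closed_comp _ _ (@Num.norm _ V)); first by move=> y _; exact: norm_continuous.
  by apply: accessible_closed_set1; apply: hausdorff_accessible; exact: norm_hausdorff.
have /compact_near_coveringP/(_ (V * R)%type (filter_prod (nbhs x) (pinfty_nbhs R))
   (fun i y => `|f i.1 y| <= i.2) _) H := Sc.
have [|[A B] [/= Ax BM] AB] := H.
  move=> y Sy; have y0 : y != 0 by rewrite -normr_gt0 Sy ltr01.
  have fc := class_C_cont (fC 0%N) (conj Dx y0 : slit D (x, y)).
  have /cvgrPdist_le/(_ _ ltr01) := fc; rewrite /= => -[[A B] [/= Ax By] AB].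
  exists (B, [set i | A i.1 /\ `|f x y| + 1 <= i.2]).
    split=> //=; exists (A, [set M | `|f x y| + 1 <= M]) => //.
    by split=> //=; apply: nbhs_pinfty_ge; exact: num_real.
  move=> [y' [x' M]] [/= By' [Ax' hM]]; apply: le_trans hM.
  have := AB (x', y') (conj Ax' By'); rewrite /= => h.
  rewrite -[f x' y'](subrK (f x y)) addrC; apply: le_trans (ler_normD _ _) _.
  by rewrite lerD2l distrC.
have [M [M0 BMM]] : exists M : R, 0 < M /\ B M.
  move: BM => [M0 [_ hM]]; exists (1 + `|M0|); split; first by rewrite ltr_pwDl.
  by apply: hM; apply: le_lt_trans (ler_norm _) _; rewrite ltrDr.
exists M => //; near=> x' => y y0.
have Ax' : A x' by near: x'.
have Dx' : D x' by near: x'; exact: open_nbhs_nbhs.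
have yn : 0 < `|y| by rewrite normr_gt0.
have := AB (x', M) (conj Ax' BMM) (`|y|^-1 *: y); rewrite /= => h.
have Sy : S (`|y|^-1 *: y) by rewrite /S /= normrZ normfV normr_id mulVf // gt_eqF.
have := h Sy; rewrite hf ?invr_gt0 // expr1 normrM normfV normr_id.
by rewrite ler_pdivrMl // mulrC.
Unshelve. all: by end_near. Qed.

(** A curve may have zero velocity, so continuity is wanted at zero vectors as well; there
    [homog_bound] takes the place of smoothness. *)
Lemma finsler_continuous (c1 c2 : R -> V) t : D (c1 t) ->
  {for t, continuous c1} -> {for t, continuous c2} ->
  {for t, continuous (fun s => F (c1 s) (c2 s))}.
Proof.
move=> Dt h1 h2; have [c20|c20] := eqVneq (c2 t) 0; last first.
  have fc := class_C_cont (FC 0%N) (conj Dt c20 : slit D (c1 t, c2 t)).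
  apply: (@continuous_comp _ _ _ (fun s => (c1 s, c2 s)) (fun p : V * V => F p.1 p.2)) => //.
  exact: (cvg_pair h1 h2).
have [M M0 HM] := homog_bound FC (finsler_homog HF) Dt.
apply/cvgrPdist_le => e e0; rewrite c20 finsler0 //.
have e1 : 0 < e / M by rewrite divr_gt0.
have /cvgrPdist_le/(_ _ e1) N2 := h2.
have N1 := h1 _ HM.
near=> s; rewrite sub0r normrN.
have [->|s0] := eqVneq (c2 s) 0.
  rewrite finsler0 ?normr0 ?(ltW e0) //; near: s.
  by apply: h1; apply: open_nbhs_nbhs; split.
have h : forall y, y != 0 -> `|F (c1 s) y| <= M * `|y| by near: s; exact: N1.
apply: le_trans (h _ s0) _; rewrite -ler_pdivlMl // mulrC.
have : `|c2 t - c2 s| <= e / M by near: s; exact: N2.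
by rewrite c20 sub0r normrN.
Unshelve. all: by end_near. Qed.

End FundamentalInequality.

Section BurgersCalibration.
Context {R : realType} {n : nat}.
Notation V := 'rV[R]_n.
Implicit Types (x y u v w e : V).
Variables (D : set V) (Dopen : open D) (F : V -> V -> R) (HF : finsler D F).
Hypothesis B : burgers D F.

Let FC := finsler_smooth Dopen HF.
Let PC := pfac_smooth Dopen HF.

(* [pi / 2] minus this function is the length of the ray that reaches [x] along the line
   through [x] directed by [e - b x]. *)
Definition calib e (b : R) x := atan ((pfac F x (e - b *: x) - b) / F x (e - b *: x)).

Lemma is_derive_calib e b (c : R -> V) t u : D (c t) -> e - b *: c t != 0 ->
  is_derive t (1:R) c u ->
  is_derive t (1:R) (fun s => calib e b (c s)) (- dy F u (c t) (e - b *: c t)).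
Proof.
move=> Dt y0 dc; set x := c t; set y := e - b *: x.
have F0 : 0 < F x y by exact: (finsler_pos HF).
have dc2 : is_derive t (1:R) (fun s => e - b *: c s) (- b *: u).
  have H := is_deriveB (is_derive_cst e t (1:R)) (is_deriveZ b dc).
  by apply: (@is_derive_eq _ _ _ _ _ _ _ _ H); rewrite sub0r scaleNr.
have dF := is_derive_chain Dopen FC Dt y0 dc dc2.
have dP := is_derive_chain Dopen PC Dt y0 dc dc2.
have dPb := is_deriveB dP (is_derive_cst b t (1:R)).
have Fn0 : F (c t) (e - b *: c t) != 0 by rewrite gt_eqF.
have := is_derive_atan (is_derive_div Fn0 dPb dF).
have [E1 E2] := B u Dt y0.
move=> H; apply: (@is_derive_eq _ _ _ _ _ _ _ _ H).
rewrite subr0 !(dyZ Dopen) // E1 E2 -/x -/y.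
rewrite -[RHS](slope_deriv_alg (pfac F x y) (dy (pfac F) u x y) (dy F u x y) b F0).
congr (_ * (_ / _)); rewrite -/x -/y.
rewrite !fctE -/x -/y.
move: (pfac F x y) (F x y) (dy (pfac F) u x y) (dy F u x y) => *; ring.
Qed.

Lemma line_geodesic_length x v (t : R) : D (t *: v + x) -> v != 0 ->
  is_derive t (1:R) (fun s => - calib v 0 (s *: v + x)) (F (t *: v + x) v).
Proof.
move=> Dt v0.
have E y : v - 0 *: y = v by rewrite scale0r subr0.
have := @is_derive_calib v 0 (fun s => s *: v + x) t v Dt.
rewrite E => /(_ v0 (is_derive_aff _ _ _)) H; have := is_deriveN H.
by rewrite opprK (@euler _ _ D Dopen 1) ?mul1r //; exact: finsler_homog.
Qed.

End BurgersCalibration.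

Section LineFormula.
Context {R : realType} {n : nat}.
Notation V := 'rV[R]_n.
Implicit Types (x y : V).
Variables (F : V -> V -> R) (HF : finsler setT F) (B : burgers setT F).

Let Topen : open [set: V] := openT.
Let FC := finsler_smooth Topen HF.
Let PC := pfac_smooth Topen HF.

(** The right sides are the two parts of [Psi / (1 + s Psi)], with [Psi] taken at the point of
    parameter [s]. As [Psi' = Psi ^ 2] along the line they do not depend on [s], and at [s = 0] they
    are the left sides. *)
Lemma line_formula x y (s : R) : y != 0 ->
  let p := pfac F (s *: y + x) y in let f := F (s *: y + x) y in
  F x y = f / ((1 + s * p) ^+ 2 + s ^+ 2 * f ^+ 2) /\
  pfac F x y = (p + s * (p ^+ 2 + f ^+ 2)) / ((1 + s * p) ^+ 2 + s ^+ 2 * f ^+ 2).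
Proof.
move=> y0 /=.
pose f t := F (t *: y + x) y; pose p t := pfac F (t *: y + x) y.
have f0 t : 0 < f t by exact: (finsler_pos HF).
have dfp (g : V -> V -> R) t : smoothF setT g -> is_derive t (1:R) (fun t => g (t *: y + x) y) (dx g y (t *: y + x) y).
  move=> gC; have := is_derive_chain Topen gC (c1 := fun t : R => t *: y + x) (c2 := fun=> y) (t := t) (u := y) (v := 0) I y0 (is_derive_aff _ _ _) (is_derive_cst _ _ _).
  by rewrite dy0 addr0.
have df t : is_derive t (1:R) f (2 * p t * f t).
  by have := dfp F t FC; rewrite (dxF_pfac HF).
have dp t : is_derive t (1:R) p (p t ^+ 2 - f t ^+ 2).
  by have := dfp (pfac F) t PC; rewrite (burgers_dxP Topen HF B).
have dX (g : R -> R) (g' t : R) : is_derive t (1:R) g g' -> is_derive t (1:R) (fun s => g s ^+ 2) (2 * g t * g').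
  move=> dg; apply: (@is_derive_eq _ _ _ _ _ _ _ _ (is_derive_mulr dg dg)); ring.
pose N t := (1 + t * p t) ^+ 2 + t ^+ 2 * f t ^+ 2.
have N0 t : N t != 0 by rewrite gt_eqF // line_den_gt0.
have dN t : is_derive t (1:R) N (2 * (1 + t * p t) * (p t + t * (p t ^+ 2 - f t ^+ 2)) +
   (2 * t * f t ^+ 2 + t ^+ 2 * (2 * f t * (2 * p t * f t)))).
  have h1 := is_deriveD (is_derive_cst (1:R) t (1:R)) (is_derive_mulr (is_derive_id1 t) (dp t)).
  have h2 := is_derive_mulr (dX _ _ _ (is_derive_id1 t)) (dX _ _ _ (df t)).
  apply: (@is_derive_eq _ _ _ _ _ _ _ _ (is_deriveD (dX _ _ _ h1) h2)).
  by rewrite !fctE; ring.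
have lo (t : R) : (-oo < t%:E)%E := ltNyr t.
have hi (t : R) : (t%:E < +oo)%E := ltry t.
split.
  have Z t : is_derive t (1:R) (fun t => f t / N t) 0.
    apply: (@is_derive_eq _ _ _ _ _ _ _ _ (is_derive_div (N0 t) (df t) (dN t))).
    by rewrite /N line_f_alg // mul0r.
  have := @derive0_cst R _ -oo%E +oo%E (fun t _ _ => Z t) 0 s (lo _) (hi _) (lo _) (hi _).
  by rewrite /N /f /p !scale0r !add0r !mul0r addr0 expr1n expr0n mul0r addr0 divr1.
have Z t : is_derive t (1:R) (fun t => (p t + t * (p t ^+ 2 + f t ^+ 2)) / N t) 0.
  have h1 := is_deriveD (dp t) (is_derive_mulr (is_derive_id1 t) (is_deriveD (dX _ _ _ (dp t)) (dX _ _ _ (df t)))).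
  apply: (@is_derive_eq _ _ _ _ _ _ _ _ (is_derive_div (N0 t) h1 (dN t))).
  by rewrite /= mul1r /N line_p_alg // mul0r.
have := @derive0_cst R _ -oo%E +oo%E (fun t _ _ => Z t) 0 s (lo _) (hi _) (lo _) (hi _).
by rewrite /N /f /p !scale0r !add0r !mul0r !addr0 expr1n expr0n mul0r addr0 divr1.
Qed.

End LineFormula.

Section Incompleteness.
Context {R : realType} {n : nat}.
Notation V := 'rV[R]_n.
Variables (D : set V) (Dopen : open D) (F : V -> V -> R) (HF : finsler D F).
Hypotheses (B : burgers D F) (D0 : D 0) (n2 : (2 <= n)%N).

Lemma exists_geodesic : exists (e : R) (c : R -> V), 0 < e /\ geodesic D F (- e)%:E e%:E c.
Proof.
have y0 : delta_mx 0 (Ordinal n2) != 0 :> V.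
  by apply/eqP => /rowP/(_ (Ordinal n2)); rewrite !mxE !eqxx => /eqP; rewrite oner_eq0.
by have [e [c [e0 g _ _]]] := geodesic_ex Dopen HF D0 y0; exists e, c.
Qed.

Lemma not_forward_complete : ~ forward_complete (geodesic D F).
Proof.
have [e [c [e0 gc]]] := exists_geodesic.
have ee : ((- e)%:E < e%:E)%E by rewrite lte_fin gtrN.
move=> /(_ _ _ _ ee gc)[c' [[g [k k0 Fk]] _]].
(* The extension would last from 0 to [pi / k], which the strict bound excludes. *)
have h := geodesic_time_bound Dopen HF B k0 g Fk (s := 0) (t := pi / k).
have : k * (pi / k - 0) < pi.
  by apply: h; rewrite ?lte_fin ?oppr_lt0 ?ltry // divr_ge0 ?pi_ge0 // ltW.
by rewrite subr0 mulrC divfK ?gt_eqF // ltxx.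
Qed.

Lemma not_backward_complete : ~ backward_complete (geodesic D F).
Proof.
have [e [c [e0 gc]]] := exists_geodesic.
have ee : ((- e)%:E < e%:E)%E by rewrite lte_fin gtrN.
move=> /(_ _ _ _ ee gc)[c' [[g [k k0 Fk]] _]].
have h := geodesic_time_bound Dopen HF B k0 g Fk (s := - (pi / k)) (t := 0).
have : k * (0 - - (pi / k)) < pi.
  by apply: h; rewrite ?lte_fin ?ltNyr // oppr_le0 divr_ge0 ?pi_ge0 // ltW.
by rewrite sub0r opprK mulrC divfK ?gt_eqF // ltxx.
Qed.

End Incompleteness.

(** * Lengths and diameter *)

Section Integration.
Context {R : realType}.
Notation mu := (@lebesgue_measure R).

Lemma sub_cc (a b a' b' : R) : a <= a' -> b' <= b -> `[a', b'] `<=` `[a, b].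
Proof.
move=> h1 h2 t; rewrite /= !in_itv /= => /andP[h3 h4].
by rewrite (le_trans h1) // (le_trans h4).
Qed.

Lemma ftc_oo (f G : R -> R) (a b : R) : a < b ->
  (forall t, a <= t <= b -> {for t, continuous f}) ->
  (forall t, a <= t <= b -> is_derive t (1:R) G (f t)) ->
  (\int[mu]_(x in `[a, b]) (f x)%:E = (G b)%:E - (G a)%:E)%E.
Proof.
move=> ab fc dG; apply: continuous_FTC2 => //.
- by apply: continuous_in_subspaceT => x; rewrite inE /= in_itv /= => /fc.
- split.
  + by move=> x; rewrite in_itv /= => /andP[x1 x2]; have [] // := dG x _; rewrite !ltW.
  + have := is_derive_continuous (dG a _); rewrite lexx ltW // => /(_ isT) h.
    by apply: cvg_at_right_filter.
  + have := is_derive_continuous (dG b _); rewrite lexx ltW // => /(_ isT) h.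
    by apply: cvg_at_left_filter.
- move=> x; rewrite in_itv /= => /andP[x1 x2].
  by rewrite (derive1_val (dG x _)) // !ltW.
Qed.

(** The derivative of [m] is not assumed continuous, so instead of integrating it, the mean value
    theorem is applied to a primitive of [phi] minus [m], whose derivative is nonnegative. *)
Lemma continuous_integral_ge (phi m : R -> R) (a b : R) : a <= b ->
  (forall t, a <= t <= b -> {for t, continuous phi}) ->
  (forall t, a <= t <= b -> exists2 l, is_derive t (1:R) m l & l <= phi t) ->
  ((m b - m a)%:E <= \int[mu]_(x in `[a, b]) (phi x)%:E)%E.
Proof.
rewrite le_eqVlt => /predU1P[<-|ab] pc dm.
  by rewrite subrr set_itv1 integral_set1.
pose c := (a + b) / 2; pose d := (b - a) / 2.
(* [psi] extends [phi] by its end values, so that it has a primitive on both sides of each end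
   point. *)
pose psi t := phi (c + clamp d (t - c)).
have d0 : 0 <= d by rewrite divr_ge0 // subr_ge0 ltW.
have psic : continuous psi.
  move=> t; apply: (@continuous_comp _ _ _ (fun t => c + clamp d (t - c)) phi).
    apply: continuousD; first exact: cvg_cst.
    apply: (@continuous_comp _ _ _ (fun t => t - c) (clamp d)); last exact: clamp_continuous.
    by apply: continuousB; [exact: cvg_id | exact: cvg_cst].
  by apply: pc; have := clamp_itv (t - c) d0; rewrite /c /d => /andP[h1 h2]; apply/andP; split; lra.
have psiE t : a <= t <= b -> psi t = phi t.
  move=> /andP[h1 h2]; rewrite /psi clamp_id; first by congr phi; rewrite addrC subrK.
  by rewrite ler_norml /c /d; apply/andP; split; lra.
have [G [_ dG]] := primitive (a - 1) psic.
have dG' t : a <= t <= b -> is_derive t (1:R) G (psi t).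
  by move=> /andP[h1 h2]; apply: dG; lra.
have -> : (\int[mu]_(x in `[a, b]) (phi x)%:E = \int[mu]_(x in `[a, b]) (psi x)%:E)%E.
  by apply: eq_integral => x; rewrite inE /= in_itv /= => /psiE ->.
rewrite (ftc_oo ab (fun t _ => psic t) dG') -EFinB lee_fin.
have D t : a <= t <= b -> is_derive t (1:R) (fun t => G t - m t) (psi t - derive1 m t).
  by move=> h; have [l [dml _] _] := dm t h; apply: is_deriveB; [exact: dG' | exact: derive1_is_derive].
have HD t : t \in `]a, b[ -> is_derive t (1:R) (fun t => G t - m t) (psi t - derive1 m t).
  by rewrite in_itv /= => /andP[h1 h2]; apply: D; rewrite !ltW.
have [t tab E] := @MVT_segment R _ _ a b (ltW ab) HD (is_derive_within D).
have tab' : a <= t <= b by move: tab; rewrite in_itv.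
have [l dml lp] := dm t tab'.
have : 0 <= (G b - m b) - (G a - m a).
  rewrite E mulr_ge0 ?subr_ge0 ?(ltW ab) // (derive1_val dml) psiE //.
lra.
Qed.

Lemma piece_measurable (phi : R -> R) (a b : R) :
  (forall t, a < t < b -> {for t, continuous phi}) -> measurable_fun `[a, b] phi.
Proof.
move=> pc; apply: (@measurable_fun_itv_cc _ _ _ false true).
apply: open_continuous_measurable_fun => //.
by move=> t; rewrite inE /= in_itv /=; exact: pc.
Qed.

(** At the ends of a piece [phi] may be discontinuous and [m] not differentiable. The comparison is
    made on [[al, be]] strictly inside, where [m] has lost at most [e] of its increment;
    nonnegativity of [phi] takes care of the rest. *)
Lemma piece_integral_ge (phi m : R -> R) (a b a' b' : R) :
  a <= a' -> a' <= b' -> b' <= b ->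
  (forall t, a <= t <= b -> 0 <= phi t) ->
  (forall t, a < t < b -> {for t, continuous phi}) ->
  {within `[a', b'], continuous m} ->
  (forall t, a' < t < b' -> exists2 l, is_derive t (1:R) m l & l <= phi t) ->
  ((m b' - m a')%:E <= \int[mu]_(x in `[a, b]) (phi x)%:E)%E.
Proof.
move=> aa' + b'b p0 pc mc dm; have pm := piece_measurable pc.
have I0 : (0 <= \int[mu]_(x in `[a, b]) (phi x)%:E)%E.
  by apply: integral_ge0 => x; rewrite /= in_itv /= lee_fin => /p0.
rewrite le_eqVlt => /predU1P[<-|a'b']; first by rewrite subrr.
apply/lee_addgt0Pr => e e0.
have [_ ma mb] := (continuous_within_itvP m a'b').1 mc.
pose c := (a' + b') / 2.
have e2 : 0 < e / 2 by rewrite divr_gt0.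
have [al [al1 al2 al3]] : exists al, [/\ a' < al, al < c & `|m a' - m al| <= e / 2].
  have : \forall x \near a'^'+, [/\ a' < x, x < c & `|m a' - m x| <= e / 2].
    near=> x; split.
    - by near: x; exact: nbhs_right_gt.
    - by near: x; apply: nbhs_right_lt; rewrite /c; lra.
    - by near: x; have /cvgrPdist_le/(_ _ e2) := ma.
  by move=> /filter_ex.
have [be [be1 be2 be3]] : exists be, [/\ be < b', c < be & `|m b' - m be| <= e / 2].
  have : \forall x \near b'^'-, [/\ x < b', c < x & `|m b' - m x| <= e / 2].
    near=> x; split.
    - by near: x; exact: nbhs_left_lt.
    - by near: x; apply: nbhs_left_gt; rewrite /c; lra.
    - by near: x; have /cvgrPdist_le/(_ _ e2) := mb.
  by move=> /filter_ex.
have := @continuous_integral_ge phi m al be (ltW (lt_trans al2 be2)).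
move=> /(_ _ _)/le_trans H.
apply: (@le_trans _ _ ((m be - m al)%:E + e%:E)%E).
  rewrite -EFinD lee_fin.
  by move: al3 be3; rewrite !ler_norml => /andP[h1 h2] /andP[h3 h4]; lra.
apply: leeD => //; apply: H.
- by move=> t /andP[h1 h2]; apply: pc; apply/andP; split; lra.
- by move=> t /andP[h1 h2]; apply: dm; apply/andP; split; lra.
apply: ge0_subset_integral => //.
- exact/measurable_EFinP.
- by apply: sub_cc; lra.
Unshelve. all: by end_near. Qed.

(** Recursive form of a property of consecutive break points, suited to induction on the
    subdivision. *)
Fixpoint pieces (P : R -> R -> Prop) (a : R) (s : seq R) : Prop :=
  if s is x :: s' then P a x /\ pieces P x s' else True.

Lemma pieces_impl (P Q : R -> R -> Prop) a s :
  (forall a b, P a b -> Q a b) -> pieces P a s -> pieces Q a s.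
Proof. by move=> PQ; elim: s a => [//|x s IH] a /= [/PQ ? /IH]. Qed.

Lemma piecesP (P : R -> R -> Prop) a s :
  (forall i, (i < size s)%N -> P (nth a (a :: s) i) (nth a (a :: s) i.+1)) -> pieces P a s.
Proof.
elim: s a => [//|x s IH] a H; split; first exact: (H 0%N).
apply: IH => i si; have := H i.+1 si; rewrite /=.
rewrite (set_nth_default x) // 1?ltnW // => h; move: h.
by rewrite (@set_nth_default _ s x a i).
Qed.

Lemma path_last_le (a : R) s : path <%R a s -> a <= last a s.
Proof.
elim: s a => [|x s IH] a //= /andP[ax /IH]; exact: le_trans (ltW ax).
Qed.

Lemma pieces_measurable (phi : R -> R) a s : path <%R a s ->
  pieces (fun a b => forall t, a < t < b -> {for t, continuous phi}) a s ->
  measurable_fun `[a, last a s] phi.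
Proof.
elim: s a => [|x s IH] a /=; first by move=> _ _; rewrite set_itv1; exact: measurable_fun_set1.
move=> /andP[ax pth] [pc /(IH _ pth) m2].
have xl := path_last_le pth.
rewrite (@itv_bndbnd_setU _ _ (BLeft a) (BRight x) (BRight (last x s))) ?bnd_simp ?(ltW ax) //.
apply/measurable_funU => //; split; first exact: piece_measurable.
by apply: measurable_funS m2 => // t; rewrite /= !in_itv /= => /andP[/ltW -> ->].
Qed.

Lemma pieces_integral (phi : R -> R) a x s : a < x -> path <%R x s ->
  (forall t, a <= t <= last x s -> 0 <= phi t) ->
  pieces (fun a b => forall t, a < t < b -> {for t, continuous phi}) a (x :: s) ->
  (\int[mu]_(t in `[a, last x s]) (phi t)%:E =
   \int[mu]_(t in `[a, x]) (phi t)%:E + \int[mu]_(t in `[x, last x s]) (phi t)%:E)%E.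
Proof.
move=> ax pth p0 pc; have xl := path_last_le pth.
have m0 : measurable_fun `[a, last x s] phi.
  by apply: (@pieces_measurable _ a (x :: s)) => //=; rewrite ax.
have E : `[a, last x s]%classic = `[a, x[ `|` `[x, last x s].
  by apply: itv_bndbnd_setU; rewrite bnd_simp // ltW.
have m1 : measurable_fun (`[a, x[ `|` `[x, last x s]) (fun t => (phi t)%:E).
  by rewrite -E; apply/measurable_EFinP.
have p1 t : (`[a, x[ `|` `[x, last x s]) t -> (0 <= (phi t)%:E)%E.
  by rewrite -E /= in_itv /= => /p0; rewrite lee_fin.
have dj : [disjoint `[a, x[ & `[x, last x s]].
  by apply/disj_setPLR => t /=; rewrite !in_itv /= => /andP[_ tx]; rewrite leNgt tx.
rewrite E ge0_integral_setU //.
congr (_ + _)%E; rewrite integral_itv_bndo_bndc //.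
apply/measurable_EFinP; by apply: measurable_funS m0 => // t; rewrite /= !in_itv /= => /andP[-> h]; rewrite (le_trans (ltW h)).
Qed.

(** The window [[a', b']] may be smaller than the domain of the curve because a calibration may be
    available on part of it only. In the induction it lies in the first piece, in the later ones, or
    straddles the break point between them. *)
Lemma pieces_integral_ge (phi m : R -> R) a s a' b' : path <%R a s ->
  (forall t, a <= t <= last a s -> 0 <= phi t) ->
  pieces (fun a b => forall t, a < t < b -> {for t, continuous phi}) a s ->
  a <= a' -> a' <= b' -> b' <= last a s ->
  {within `[a', b'], continuous m} ->
  pieces (fun a b => forall t, a < t < b -> a' < t < b' ->
    exists2 l, is_derive t (1:R) m l & l <= phi t) a s ->
  ((m b' - m a')%:E <= \int[mu]_(x in `[a, last a s]) (phi x)%:E)%E.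
Proof.
elim: s a a' b' => [|x s IH] a a' b'.
  move=> _ _ _ h1 h2 h3 _ _; have -> : b' = a' by apply: le_anti; rewrite h2 (le_trans h3).
  by rewrite subrr set_itv1 integral_set1.
move=> pth p0 pc aa' a'b' b'l mc dm; rewrite [last a _]/= in p0 b'l *.
move: (pth) => /= /andP[ax pth']; have xl := path_last_le pth'.
have [pc1 pc2] := pc; have [dm1 dm2] := dm.
rewrite (pieces_integral ax pth' p0 pc).
have p1 t : a <= t <= x -> 0 <= phi t by move=> /andP[h1 h2]; apply: p0; rewrite h1 (le_trans h2).
have p2 t : x <= t <= last x s -> 0 <= phi t by move=> /andP[h1 h2]; apply: p0; rewrite h2 (le_trans (ltW ax)).
have I1 : (0 <= \int[mu]_(t in `[a, x]) (phi t)%:E)%E.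
  by apply: integral_ge0 => t; rewrite /= in_itv /= lee_fin => /p1.
have I2 : (0 <= \int[mu]_(t in `[x, last x s]) (phi t)%:E)%E.
  by apply: integral_ge0 => t; rewrite /= in_itv /= lee_fin => /p2.
have [b'x|xb'] := leP b' x.
  apply: (@le_trans _ _ (\int[mu]_(t in `[a, x]) (phi t)%:E)%E); last by rewrite leeDl.
  apply: piece_integral_ge => //.
  by move=> t /andP[h1 h2]; apply: dm1; apply/andP; split => //; [exact: le_lt_trans h1 | exact: lt_le_trans b'x].
have [xa'|a'x] := leP x a'.
  apply: (@le_trans _ _ (\int[mu]_(t in `[x, last x s]) (phi t)%:E)%E); last by rewrite leeDr.
  by apply: IH.
have -> : m b' - m a' = (m x - m a') + (m b' - m x) by lra.
rewrite EFinD; apply: leeD.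
  apply: piece_integral_ge => //; first exact: ltW.
    apply: continuous_subspaceW mc; apply: sub_cc => //; exact: ltW.
  move=> t /andP[h1 h2]; apply: dm1; apply/andP; split => //; [exact: le_lt_trans h1 | exact: lt_trans xb'].
apply: IH => //; first exact: ltW.
  apply: continuous_subspaceW mc; apply: sub_cc => //; exact: ltW.
apply: pieces_impl dm2 => u v h t uv /andP[h1 h2].
by apply: h => //; rewrite (lt_trans a'x).
Qed.

End Integration.

Section PiecewiseCurves.
Context {R : realType} {W : normedModType R}.
Implicit Types (c : R -> W) (F : W -> W -> R).

Lemma piecewise_C1 (a b : R) c : piecewise_smooth a b c -> exists s : seq R,
  [/\ path <%R a s, last a s = b &
   pieces (fun u v => forall t, u < t < v ->
     derivable c t 1 /\ {for t, continuous (derive1 c)}) a s].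
Proof.
move=> [s [pth l sm]]; exists s; split=> //; apply: piecesP => i si t /andP[t1 t2].
pose U := `]nth a (a :: s) i, nth a (a :: s) i.+1[%classic.
have Ut : U t by rewrite /U /= in_itv /= t1 t2.
have smU : smooth_on U c.
  move=> z Uz; have [|V0 [g [Vo Vz gC gc]]] := sm i si z.
    by move: Uz; rewrite /U /= !in_itv /= => /andP[/ltW -> /ltW ->].
  exists V0, g; split=> // y Uy Vy; apply: gc => //.
  by move: Uy; rewrite /U /= !in_itv /= => /andP[/ltW -> /ltW ->].
have Uo : open U by exact: interval_open.
have cC := smooth_on_open 1 Uo smU.
split; first exact: class_C_derivable cC Ut.
have cD := class_C_cont (class_CD (1 : R) cC) Ut.
apply: near_eq_cont cD; near=> s0; by rewrite derive1E.
Unshelve. all: by end_near. Qed.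

(** The calibration principle, with [m] the calibrating function along the curve. The hypotheses on
    [F] are stated along [c] only, so that it serves both in [R^n] and on the sphere. *)
Lemma curve_length_ge F c (a b a' b' : R) (m : R -> R) : piecewise_smooth a b c ->
  (forall t, a <= t <= b -> 0 <= F (c t) (derive1 c t)) ->
  (forall t, a < t < b -> derivable c t 1 -> {for t, continuous (derive1 c)} ->
     {for t, continuous (fun t => F (c t) (derive1 c t))}) ->
  a <= a' -> a' <= b' -> b' <= b ->
  {within `[a', b'], continuous m} ->
  (forall t, a' < t < b' -> derivable c t 1 ->
    exists2 l, is_derive t (1:R) m l & l <= F (c t) (derive1 c t)) ->
  ((m b' - m a')%:E <= curve_length F c a b)%E.
Proof.
move=> pw F0 Fc aa' a'b' b'b mc dm.
have [s [pth l pc]] := piecewise_C1 pw; rewrite /curve_length -l.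
have in_s : pieces (fun u v => a <= u /\ v <= b) a s.
  rewrite -l; elim: s {pc l F0 Fc b'b mc dm pw} (a) pth => [//|x s IH] a0 /= /andP[ax pth].
  split; first by split=> //; exact: path_last_le.
  by apply: pieces_impl (IH x pth) => u v [h1 h2]; split=> //; exact: le_trans (ltW ax) h1.
have piecesI (P Q : R -> R -> Prop) (a0 : R) (s0 : seq R) : pieces P a0 s0 -> pieces Q a0 s0 -> pieces (fun u v => P u v /\ Q u v) a0 s0.
  by elim: s0 a0 => [//|x s0 IH] a0 /= [h1 h2] [h3 h4]; split=> //; exact: IH.
have both := piecesI _ _ _ _ pc in_s.
apply: (@pieces_integral_ge R (fun t => F (c t) (derive1 c t)) m a s a' b') => //; rewrite ?l //.
  apply: pieces_impl both => u v [h [h1 h2]] t uv; have [d1 d2] := h t uv.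
  by apply: Fc => //; move: uv => /andP[h3 h4]; rewrite (le_lt_trans h1 h3) (lt_le_trans h4 h2).
apply: pieces_impl both => u v [h [h1 h2]] t uv t'; have [d1 d2] := h t uv.
by apply: dm.
Qed.

End PiecewiseCurves.

Section CalibContinuity.
Context {R : realType} {n : nat}.
Notation V := 'rV[R]_n.
Variables (D : set V) (Dopen : open D) (F : V -> V -> R) (HF : finsler D F).

Lemma calib_continuous (e x : V) b : D x -> e - b *: x != 0 -> {for x, continuous (calib F e b)}.
Proof.
move=> Dx y0; have xy : slit D (x, e - b *: x) by [].
have Fc := class_C_cont (finsler_smooth Dopen HF 0%N) xy.
have Pc := class_C_cont (pfac_smooth Dopen HF 0%N) xy.
have cc : {for x, continuous (fun z : V => (z, e - b *: z))}.
  have h1 : {for x, continuous (fun z : V => z)} by exact: cvg_id.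
  have h2 : {for x, continuous (fun z : V => e - b *: z)}.
    apply: differentiable_continuous; apply: differentiableB; first exact: differentiable_cst.
    by apply: differentiableZ; exact: ex_diff.
  exact: (cvg_pair h1 h2).
have F0 : F x (e - b *: x) != 0 by rewrite gt_eqF // (finsler_pos HF).
have c1 : {for x, continuous (fun z : V => F z (e - b *: z))}.
  exact: (@continuous_comp _ _ _ (fun z : V => (z, e - b *: z)) (fun p : V * V => F p.1 p.2) x cc Fc).
have c2 : {for x, continuous (fun z : V => pfac F z (e - b *: z))}.
  exact: (@continuous_comp _ _ _ (fun z : V => (z, e - b *: z)) (fun p : V * V => pfac F p.1 p.2) x cc Pc).
apply: (@continuous_comp _ _ _ (fun z : V => (pfac F z (e - b *: z) - b) / F z (e - b *: z)) (@atan R)).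
  apply: continuousM; last exact: continuousV.
  have cb : {for x, continuous (fun _ : V => b)} by exact: cst_continuous.
  have := continuousB c2 cb; exact.
exact: continuous_atan.
Qed.

Lemma calib_diff_lt_pi e b e' b' x x' : - calib F e b x - - calib F e' b' x' < pi.
Proof.
rewrite /calib.
have := atan_gtNpi2 ((pfac F x (e - b *: x) - b) / F x (e - b *: x)).
have := atan_ltpi2 ((pfac F x' (e' - b' *: x') - b') / F x' (e' - b' *: x')).
move: (atan _) (atan _) => A1 A2; lra.
Qed.

End CalibContinuity.

Section Diameter.
Context {R : realType} {n : nat}.
Notation V := 'rV[R]_n.
Implicit Types (x y u v w e : V).
Variables (D : set V) (Dopen : open D) (F : V -> V -> R) (HF : finsler D F).
Hypothesis B : burgers D F.

Lemma cst_curve_length x a b : D x -> curve_length F (fun=> x) a b = 0%E.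
Proof.
move=> Dx; rewrite /curve_length (eq_integral (fun=> 0%E)) ?integral0 // => t _.
by rewrite derive1_cst (finsler0 HF).
Qed.

Lemma segment_length x v : v != 0 -> (forall t : R, 0 <= t <= 1 -> D (t *: v + x)) ->
  (curve_length F (fun t => t *: v + x)%R 0%R 1%R < (pi : R)%:E)%E.
Proof.
move=> v0 h; have dc t : derive1 (fun t : R => t *: v + x) t = v.
  exact: derive1_val (is_derive_aff _ _ _).
have -> : curve_length F (fun t => t *: v + x) 0 1 =
    (\int[lebesgue_measure]_(t in `[0%R, 1%R]) (F (t *: v + x) v)%:E)%E.
  by rewrite /curve_length; apply: eq_integral => t _; rewrite dc.
have H1 (t : R) : 0 <= t <= 1 -> {for t, continuous (fun t : R => F (t *: v + x) v)}.
  move=> t01; apply: (finsler_continuous Dopen HF (c1 := fun t => t *: v + x) (c2 := fun=> v)); first exact: h.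
    exact: (is_derive_continuous (is_derive_aff _ _ _)).
  exact: cvg_cst.
have H2 (t : R) : 0 <= t <= 1 -> is_derive t (1:R) (fun s => - calib F v 0 (s *: v + x)) (F (t *: v + x) v).
  by move=> t01; apply: (line_geodesic_length Dopen HF B) => //; exact: h.
rewrite (ftc_oo ltr01 H1 H2) -EFinB lte_fin.
exact: calib_diff_lt_pi.
Qed.

Lemma line_piecewise_smooth x v : piecewise_smooth 0 1 (fun t : R => t *: v + x).
Proof.
exists [:: 1]; split=> //=; first by rewrite ltr01.
move=> i _ t _; exists setT, (fun t : R => t *: v + x); split=> //; first exact: openT.
move=> k; apply: (@class_C_aff _ _ _ _ _ _ (fun h : R => h *: v)).
  by move=> z; exact: (is_derive_continuous (is_derive_aff _ _ _)).
by move=> z w h; rewrite scalerDl -scalerA addrA.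
Qed.

Lemma diameter_le : (forall x y (t : R), D x -> D y -> 0 <= t <= 1 -> D (t *: (y - x) + x)) ->
  (diameter F D <= (pi : R)%:E)%E.
Proof.
move=> conv; apply: ge_ereal_sup => _ [x1 [x2 [D1 D2 ->]]].
pose v := x2 - x1; pose c := fun t : R => t *: v + x1.
apply: (@le_trans _ _ (curve_length F c 0 1)).
  apply: ereal_inf_lbound; exists 0, 1, c; split; first exact: ltr01.
  split; first exact: line_piecewise_smooth.
  split; first by move=> t t01; exact: conv.
  by rewrite /c scale0r add0r scale1r /v subrK.
have [v0|v0] := eqVneq v 0; last by apply/ltW/segment_length => // t t01; exact: conv.
rewrite /c v0 (_ : (fun t : R => t *: 0 + x1) = fun=> x1); last by apply/funext => t; rewrite scaler0 add0r.
by rewrite cst_curve_length // lee_fin pi_ge0.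
Qed.

End Diameter.

Lemma smooth_on_continuous {R : realType} {W : normedModType R} (u v : R) (c : R -> W) :
  smooth_on `[u, v] c -> {within `[u, v], continuous c}.
Proof.
move=> sm; apply/subspace_continuousP => t tuv.
have [U [g [Uo Ut gC gc]]] := sm t tuv.
have gt : {for t, continuous g} := class_C_cont (gC 0%N) Ut.
have H : g z @[z --> within `[u, v] (nbhs t)] --> c t.
  by rewrite -(gc t tuv Ut); exact: cvg_within_filter gt.
apply: cvg_trans H; apply: near_eq_cvg; near=> z; apply: gc.
  by near: z; exact: withinT.
by near: z; apply: cvg_within; exact: open_nbhs_nbhs.
Unshelve. all: by end_near. Qed.

Lemma piecewise_continuous {R : realType} {W : normedModType R} (a b : R) (c : R -> W) :
  piecewise_smooth a b c -> {within `[a, b], continuous c}.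
Proof.
move=> [s [pth l sm]].
have {sm} : pieces (fun u v => smooth_on `[u, v] c) a s by exact: piecesP.
rewrite -l; elim: s {l b} a pth => [|x s IH] a /=.
  by move=> _ _; rewrite set_itv1; exact: continuous_subspace1.
move=> /andP[ax pth] [sm1 /(IH _ pth) c2]; have xl := path_last_le pth.
have -> : `[a, last x s]%classic = `[a, x] `|` `[x, last x s].
  apply/seteqP; split => t /=; rewrite !in_itv /=.
    by move=> /andP[h1 h2]; case: (leP t x) => [h|/ltW h]; [left | right]; rewrite ?h1 ?h.
  case=> /andP[h1 h2]; first by rewrite h1 (le_trans h2).
  by rewrite h2 (le_trans (ltW ax)).
apply: withinU_continuous => //; first exact: interval_closed.
  exact: interval_closed.
exact: smooth_on_continuous.
Qed.

Lemma within_comp {R : realType} {W : normedModType R} (A : set R) (c : R -> W) (h : W -> R) :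
  {within A, continuous c} -> (forall t, A t -> {for c t, continuous h}) ->
  {within A, continuous (fun t => h (c t))}.
Proof.
move=> /subspace_continuousP cc hc; apply/subspace_continuousP => t At.
apply: (@cvg_comp _ _ _ c h _ (nbhs (c t))); first exact: cc.
exact: hc.
Qed.

Lemma slope_ratio_alg (R : fieldType) (a f N : R) : f != 0 -> N != 0 -> a / N / (f / N) = a / f.
Proof. by move=> f0 N0; field; rewrite N0 f0. Qed.

Section DiameterSpace.
Context {R : realType} {n : nat}.
Notation V := 'rV[R]_n.
Variables (F : V -> V -> R) (HF : finsler setT F) (B : burgers setT F).
Hypothesis n2 : (2 <= n)%N.

Let Topen : open [set: V] := openT.

(** For [b = 0] the vector [e - b x] is constant: the calibrated lines are the parallels to [v], and
    no point of the space is singular. *)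
Lemma calib_dist_le (v x1 x2 : V) : v != 0 ->
  ((calib F v 0 x1 - calib F v 0 x2)%:E <= finsler_dist F setT x1 x2)%E.
Proof.
move=> v0; apply: le_ereal_inf_tmp => _ [a [b [c [ab [pw [_ [ca [cb ->]]]]]]]].
have E x : v - 0 *: x = v by rewrite scale0r subr0.
have -> : calib F v 0 x1 - calib F v 0 x2 = - calib F v 0 (c b) - - calib F v 0 (c a).
  by rewrite ca cb opprK addrC.
have mc : {within `[a, b], continuous (fun t => - calib F v 0 (c t))}.
  apply: (@within_comp _ _ _ c (fun x => - calib F v 0 x)); first exact: piecewise_continuous.
  move=> t _; apply: continuousN; apply: (calib_continuous Topen HF) => //.
  by rewrite E.
apply: (@curve_length_ge _ _ F c a b a b (fun t => - calib F v 0 (c t))) => //.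
- by move=> t _; apply: (finsler_ge0 HF).
- move=> t _ d1 d2; apply: (finsler_continuous Topen HF (t := t) (c1 := c)) => //.
  exact: (is_derive_continuous (derive1_is_derive d1)).
- exact: ltW.
- move=> t _ dc; exists (dy F (derive1 c t) (c t) v).
    have y0 : v - 0 *: c t != 0 by rewrite E.
    have H := is_deriveN (is_derive_calib Topen HF B (e := v) (b := 0) (c := c) (t := t) I y0 (derive1_is_derive dc)).
    by rewrite opprK E in H.
  exact: (finsler_fundamental Topen HF).
Qed.

(** Along the line spanned by [v] the slope [P / F] is an affine nonconstant function of the
    parameter, so on the whole space the calibration comes arbitrarily close to both [pi / 2] and
    [- pi / 2]. *)
Lemma diameter_setT : diameter F setT = (pi : R)%:E.
Proof.
apply/eqP; rewrite eq_le (diameter_le Topen HF B) //=.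
apply/lee_addgt0Pr => e e0.
have y0 : delta_mx 0 (Ordinal n2) != 0 :> V.
  by apply/eqP => /rowP/(_ (Ordinal n2)); rewrite !mxE !eqxx => /eqP; rewrite oner_eq0.
set v := delta_mx 0 (Ordinal n2) : V in y0.
have E x : v - 0 *: x = v by rewrite scale0r subr0.
pose p := pfac F 0 v; pose f := F 0 v.
have f0 : 0 < f by exact: (finsler_pos HF).
have q0 : 0 < p ^+ 2 + f ^+ 2 by rewrite ltr_wpDl ?sqr_ge0 // exprn_gt0.
have cE t : calib F v 0 (t *: v) = atan ((p - t * (p ^+ 2 + f ^+ 2)) / f).
  rewrite /calib E subr0.
  have [h1 h2] := line_formula HF B (t *: v) (- t) y0.
  move: h1 h2; rewrite scaleNr addNr -/p -/f => -> ->; congr (atan _).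
  have d0 : 0 < (1 + - t * p) ^+ 2 + (- t) ^+ 2 * f ^+ 2 by exact: line_den_gt0.
  by rewrite mulNr; exact: slope_ratio_alg (lt0r_neq0 f0) (lt0r_neq0 d0).
have e2 : 0 < e / 2 by rewrite divr_gt0.
have /cvgrPdist_le/(_ _ e2)[M [_ HM]] := @cvgy_atan R.
pose A := `|M| + 1.
have MA : M < A by rewrite /A; apply: le_lt_trans (ler_norm _) _; rewrite ltrDl.
have hA := HM _ MA.
have aA : pi / 2 - e / 2 <= atan A by move: hA; rewrite /= ler_norml => /andP[]; move: (atan A) => ?; lra.
(* Parameters at which the slope takes the values [A] and [- A]. *)
pose t1 := (p - A * f) / (p ^+ 2 + f ^+ 2); pose t2 := (p + A * f) / (p ^+ 2 + f ^+ 2).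
have E1 : calib F v 0 (t1 *: v) = atan A.
  by rewrite cE /t1; congr (atan _); field; rewrite !gt_eqF.
have E2 : calib F v 0 (t2 *: v) = - atan A.
  by rewrite cE /t2 -atanN; congr (atan _); field; rewrite !gt_eqF.
apply: (@le_trans _ _ ((calib F v 0 (t1 *: v) - calib F v 0 (t2 *: v))%:E + e%:E)%E).
  by rewrite -EFinD lee_fin E1 E2; move: aA; move: (atan A) => ?; lra.
rewrite leeD2r //; apply: le_trans (calib_dist_le _ _ y0) _.
by apply: ereal_sup_ubound; exists (t1 *: v), (t2 *: v).
Qed.

End DiameterSpace.

(** * Gluing along a hyperplane *)

Section Gluing.
Context {R : realType} {W : normedModType R}.
Variables (l l' : W -> R).
Hypotheses (lc : continuous l) (laff : forall x v (h : R), l (h *: v + x) = h * l' v + l x).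
Implicit Types (U : set W) (g f : W -> R).

Definition half_glue (g1 g2 : W -> R) (x : W) : R := if 0 <= l x then g1 x else g2 x.

(** Mirrors the recursion of [class_C]: the iterated directional derivatives up to order [k] agree
    on the hyperplane, those in transverse directions included. *)
Fixpoint match_C k U (g1 g2 : W -> R) : Prop :=
  (forall x, U x -> l x = 0 -> g1 x = g2 x) /\
  (if k is k'.+1 then forall v, match_C k' U (fun x => 'D_v g1 x) (fun x => 'D_v g2 x) else True).

Lemma near_lpos x : 0 < l x -> \forall z \near x, 0 < l z.
Proof. by move=> h; exact: (cvgr_gt _ (lc (x:=x)) _ h). Qed.

Lemma near_lneg x : l x < 0 -> \forall z \near x, l z < 0.
Proof. by move=> h; exact: (cvgr_lt _ (lc (x:=x)) _ h). Qed.

Lemma glue_pos g1 g2 x : 0 < l x -> \forall z \near x, g1 z = half_glue g1 g2 z.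
Proof. by move/near_lpos; apply: filterS => z /ltW h; rewrite /half_glue h. Qed.

Lemma glue_neg g1 g2 x : l x < 0 -> \forall z \near x, g2 z = half_glue g1 g2 z.
Proof. by move/near_lneg; apply: filterS => z h; rewrite /half_glue leNgt h. Qed.

Lemma glue_cont U g1 g2 x : U x -> {for x, continuous g1} -> {for x, continuous g2} ->
  (l x = 0 -> g1 x = g2 x) -> {for x, continuous (half_glue g1 g2)}.
Proof.
move=> Ux c1 c2 m; case: (ltgtP (l x) 0) => h.
- exact: near_eq_cont (glue_neg g1 g2 h) c2.
- exact: near_eq_cont (glue_pos g1 g2 h) c1.
have e : half_glue g1 g2 x = g1 x by rewrite /half_glue h lexx.
apply/cvgrPdist_le => eps e0.
have /cvgrPdist_le/(_ _ e0) n1 := c1; have /cvgrPdist_le/(_ _ e0) n2 := c2.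
near=> z; rewrite e /half_glue; case: ifP => _; first by near: z.
by rewrite m //; near: z.
Unshelve. all: by end_near. Qed.

(** Both functions are defined on either side, so each difference quotient of the glued function is
    one of [g1] or of [g2]; on the hyperplane these have the same limit. *)
Lemma glue_derive g1 g2 x v : derivable g1 x v -> derivable g2 x v ->
  (l x = 0 -> g1 x = g2 x /\ 'D_v g1 x = 'D_v g2 x) ->
  is_derive x v (half_glue g1 g2) (half_glue (fun x => 'D_v g1 x) (fun x => 'D_v g2 x) x).
Proof.
move=> d1 d2 m; case: (ltgtP (l x) 0) => h.
- rewrite [half_glue (fun x => _) _ x]/half_glue leNgt h /=.
  by apply: near_eq_is_derive (glue_neg g1 g2 h) _; exact: derivableP.
- rewrite [half_glue (fun x => _) _ x]/half_glue (ltW h).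
  by apply: near_eq_is_derive (glue_pos g1 g2 h) _; exact: derivableP.
have [m1 m2] := m h.
have e : half_glue g1 g2 x = g1 x by rewrite /half_glue h lexx.
rewrite [half_glue (fun x => _) _ x]/half_glue h lexx.
have C : (fun t => t^-1 *: (half_glue g1 g2 (t *: v + x) - half_glue g1 g2 x)) @ 0^' --> 'D_v g1 x.
  apply/cvgrPdist_le => eps e0.
  have /cvgrPdist_le/(_ _ e0) n1 : (fun t : R => t^-1 *: (g1 (t *: v + x) - g1 x)) @ 0^' --> 'D_v g1 x by exact: d1.
  have /cvgrPdist_le/(_ _ e0) n2 : (fun t : R => t^-1 *: (g2 (t *: v + x) - g2 x)) @ 0^' --> 'D_v g2 x by exact: d2.
  near=> t; rewrite e {1}/half_glue; case: ifP => _; first by near: t.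
  by rewrite m1 m2; near: t.
apply: DeriveDef; first by apply/cvg_ex; exists ('D_v g1 x).
by apply: cvg_lim => //.
Unshelve. all: by end_near. Qed.

Lemma glue_class_C k U g1 g2 : open U -> class_C k U g1 -> class_C k U g2 ->
  match_C k U g1 g2 -> class_C k U (half_glue g1 g2).
Proof.
move=> Uo; elim: k g1 g2 => [|k IH] g1 g2 C1 C2 [m mD].
  split=> // x Ux; apply: (glue_cont Ux); [exact: class_C_cont C1 Ux|exact: class_C_cont C2 Ux|exact: m].
have D v x : U x -> is_derive x v (half_glue g1 g2) (half_glue (fun x => 'D_v g1 x) (fun x => 'D_v g2 x) x).
  move=> Ux; apply: glue_derive; [exact: class_C_derivable C1 Ux|exact: class_C_derivable C2 Ux|].
  move=> l0; split; first exact: m.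
  by case: k {IH C1 C2} mD => [|k] /(_ v)[+ _]; apply.
split.
  move=> x Ux; apply: (glue_cont Ux); [exact: class_C_cont C1 Ux|exact: class_C_cont C2 Ux|exact: m].
move=> v; split; first by move=> x Ux; have [] := D v x Ux.
apply: class_C_eq (IH _ _ (class_CD v C1) (class_CD v C2) (mD v)) => // x Ux.
by have [_ ->] := D v x Ux.
Qed.

Lemma adherent_zero f x : {for x, continuous f} ->
  (forall N, nbhs x N -> exists2 y, N y & f y = 0) -> f x = 0.
Proof.
move=> fc H; apply/eqP; rewrite -normr_le0; apply/ler_addgt0Pl => e e0; rewrite addr0.
have /cvgrPdist_le/(_ _ e0) := fc; move=> /H [y /= h f0].
by move: h; rewrite f0 subr0.
Qed.

(* At such a point the two one-sided functions are restrictions of the same smooth function,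
   so that all their derivatives agree there. *)
Definition transversal_at k U g1 g2 y := exists (N : set W) (H : W -> R),
  [/\ open N, N y, class_C k N H &
      forall z, N z -> U z -> (0 < l z -> g1 z = H z) /\ (l z < 0 -> g2 z = H z)].

Lemma linpartZ (c : R) v : l' (c *: v) = c * l' v.
Proof.
have := laff 0 (c *: v) 1; rewrite scale1r laff mul1r => h.
exact: (addIr _ (esym h)).
Qed.

(** The sign of [s] selects the side: the displacement [(s * l' v0) *: v0] increases [s * l], and
    the equality comes from that side by continuity. *)
Lemma one_sided_eq (v0 : W) (f H : W -> R) (s : R) y N : l' v0 != 0 -> s != 0 -> nbhs y N -> l y = 0 ->
  {for y, continuous f} -> {for y, continuous H} ->
  (forall z, N z -> 0 < s * l z -> f z = H z) -> f y = H y.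
Proof.
move=> lv0 s0 Ny ly cf cH fH; apply/eqP; rewrite -subr_eq0; apply/eqP.
apply: (@adherent_zero (fun z => f z - H z)); first exact: continuousB.
move=> N' Ny'; pose w := (s * l' v0) *: v0.
have cc : {for (0 : R), continuous (fun h : R => h *: w + y)} := is_derive_continuous (is_derive_aff w y 0).
have cl : (fun h : R => h *: w + y) h @[h --> 0^'+] --> y.
  by have := cvg_at_right_filter cc; rewrite scale0r add0r.
have NN : nbhs y (N `&` N') by exact: filterI.
have /filter_ex [h [h0 [Nh N'h]]] : \forall h \near 0^'+, 0 < h /\ (N `&` N') (h *: w + y).
  exact: (filterI (nbhs_right_gt (0 : R)) (cl _ NN)).
exists (h *: w + y) => //; rewrite fH ?subrr //.
rewrite laff ly addr0 linpartZ.
have -> : s * (h * (s * l' v0 * l' v0)) = h * (s * l' v0) ^+ 2 by ring.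
by rewrite mulr_gt0 // lt0r sqrf_eq0 mulf_neq0 //= sqr_ge0.
Qed.

Lemma match_val k U g1 g2 : (exists v, l' v != 0) -> open U ->
  class_C k U g1 -> class_C k U g2 ->
  (forall x N, U x -> l x = 0 -> nbhs x N ->
     exists y, [/\ N y, U y, l y = 0 & transversal_at k U g1 g2 y]) ->
  forall x, U x -> l x = 0 -> g1 x = g2 x.
Proof.
move=> [v0 lv0] Uo C1 C2 dens x Ux lx; apply/eqP; rewrite -subr_eq0; apply/eqP.
have c1 y : U y -> {for y, continuous g1} by move=> Uy; exact: class_C_cont C1 Uy.
have c2 y : U y -> {for y, continuous g2} by move=> Uy; exact: class_C_cont C2 Uy.
apply: (@adherent_zero (fun z => g1 z - g2 z)); first by apply: continuousB; [exact: c1|exact: c2].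
move=> N Nx; have [y [Ny Uy ly [N' [H [No N'y HC NH]]]]] := dens x N Ux lx Nx.
exists y => //; have cH := class_C_cont HC N'y.
have nb : nbhs y (N' `&` U) by apply: filterI; exact: open_nbhs_nbhs.
rewrite (@one_sided_eq v0 g1 H 1 y (N' `&` U)) //; last 2 first.
- exact: c1.
- by move=> z [Nz Uz]; rewrite mul1r; have [h _] := NH z Nz Uz.
rewrite (@one_sided_eq v0 g2 H (-1) y (N' `&` U)) ?subrr ?oppr_eq0 ?oner_eq0 //.
  exact: c2.
by move=> z [Nz Uz]; rewrite mulN1r oppr_gt0; have [_ h] := NH z Nz Uz.
Qed.

(** Near a transversal point the derivatives of [g1] and [g2], each on its own side, are those of
    [H]. So the density condition passes to derivatives at the same points, and each order reduces
    to the equality of values in [match_val]. *)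
Lemma match_C_transversal k U g1 g2 : (exists v, l' v != 0) -> open U ->
  class_C k U g1 -> class_C k U g2 ->
  (forall x N, U x -> l x = 0 -> nbhs x N ->
     exists y, [/\ N y, U y, l y = 0 & transversal_at k U g1 g2 y]) ->
  match_C k U g1 g2.
Proof.
move=> lv Uo; elim: k g1 g2 => [|k IH] g1 g2 C1 C2 dens.
  by split=> //; exact: match_val C1 C2 dens.
split; first exact: match_val C1 C2 dens.
move=> v; apply: IH; [exact: class_CD|exact: class_CD|].
move=> x N Ux lx Nx; have [y [Ny Uy ly [N' [H [No N'y HC NH]]]]] := dens x N Ux lx Nx.
exists y; split=> //; exists N', (fun x => 'D_v H x); split=> //; first exact: class_CD.
have near_eq z (P : W -> Prop) (g : W -> R) : N' z -> U z -> (\forall w \near z, P w) ->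
    (forall w, N' w -> U w -> P w -> g w = H w) -> 'D_v g z = 'D_v H z.
  move=> Nz Uz Pz gH; apply: near_eq_derive.
  have n1 : \forall w \near z, N' w by exact: open_nbhs_nbhs.
  have n2 : \forall w \near z, U w by exact: open_nbhs_nbhs.
  by near=> w; apply: gH; near: w.
move=> z Nz Uz; split=> lz.
  by apply: (near_eq z (fun w => 0 < l w)) => //; [exact: near_lpos|move=> w Nw Uw; have [h _] := NH w Nw Uw].
by apply: (near_eq z (fun w => l w < 0)) => //; [exact: near_lneg|move=> w Nw Uw; have [_ h] := NH w Nw Uw].
Unshelve. all: by end_near. Qed.

End Gluing.

Lemma is_derive_affr (R : realType) (u x t : R) : is_derive t (1:R) (fun s : R => s * u + x) u.
Proof. exact: (is_derive_aff (u : R^o) x t). Qed.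

(** * Fractional linear changes of coordinates *)

Section ProjectiveChange.
Context {R : realType} {n : nat}.
Notation V := 'rV[R]_n.
Implicit Types (x y u : V).
Variables (F : V -> V -> R) (HF : finsler setT F) (B : burgers setT F).
Variables (a a' : V -> V) (l l' : V -> R).
Hypotheses (aaff : forall x v (h : R), a (h *: v + x) = h *: a' v + a x)
  (a'lin : forall x v (h : R), a' (h *: v + x) = h *: a' v + a' x)
  (laff : forall x v (h : R), l (h *: v + x) = h * l' v + l x)
  (l'lin : forall x v (h : R), l' (h *: v + x) = h * l' v + l' x).

Let Topen : open [set: V] := openT.
Let FC := finsler_smooth Topen HF.
Let PC := pfac_smooth Topen HF.

Definition proj_map x : V := (l x)^-1 *: a x.
(** The differential of [proj_map] by the quotient rule, as an explicit formula linear in [y]. *)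
Definition proj_diff x y : V := (l x)^-2 *: (l x *: a' y - l' y *: a x).

Lemma proj_diffD x (h : R) u y : proj_diff x (h *: u + y) = h *: proj_diff x u + proj_diff x y.
Proof.
by rewrite /proj_diff a'lin l'lin; apply/rowP => i; rewrite !mxE; ring.
Qed.

Lemma is_derive_proj_map x u : l x != 0 -> is_derive (0:R) (1:R) (fun s : R => proj_map (s *: u + x)) (proj_diff x u).
Proof.
move=> lx; apply/is_derive_coordP => i.
have -> : (fun s : R => proj_map (s *: u + x) 0 i) = fun s => (s * a' u 0 i + a x 0 i) / (s * l' u + l x).
  by apply/funext => s; rewrite /proj_map laff aaff !mxE mulrC.
have d1 := is_derive_affr (a' u 0 i) (a x 0 i) 0; have d2 := is_derive_affr (l' u) (l x) 0.
have l0 : 0 * l' u + l x != 0 by rewrite mul0r add0r.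
apply: (@is_derive_eq _ _ _ _ _ _ _ _ (@is_derive_div _ _ _ (0:R) _ _ l0 d1 d2)).
by rewrite !mul0r !add0r !mxE; field.
Qed.

(** The second derivative in the directions [u] and [y] is a combination of the first derivatives in
    these directions: fractional linear maps send lines to lines. This is why a pulled back metric
    is straight again. *)
Lemma is_derive_proj_diff x u y : l x != 0 -> is_derive (0:R) (1:R) (fun s : R => proj_diff (s *: u + x) y)
  (- (l' u / l x) *: proj_diff x y + - (l' y / l x) *: proj_diff x u).
Proof.
move=> lx; apply/is_derive_coordP => i.
have -> : (fun s : R => proj_diff (s *: u + x) y 0 i) = fun s =>
    (a' y 0 i * (s * l' u + l x) - l' y * (s * a' u 0 i + a x 0 i)) / (s * l' u + l x) ^+ 2.
  by apply/funext => s; rewrite /proj_diff laff aaff !mxE mulrC /GRing.scale /=; congr (_ / _); ring.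
have d1 := is_derive_affr (a' u 0 i) (a x 0 i) 0; have d2 := is_derive_affr (l' u) (l x) 0.
have d3 := is_deriveB (is_derive_mulr (is_derive_cst (a' y 0 i) (0:R) (1:R)) d2)
   (is_derive_mulr (is_derive_cst (l' y) (0:R) (1:R)) d1).
have d4 := is_derive_mulr d2 d2.
have l0 : (0 * l' u + l x) * (0 * l' u + l x) != 0 by rewrite mul0r add0r mulf_neq0.
have d5 := @is_derive_div _ _ _ (0:R) _ _ l0 d3 d4.
have -> : (fun s : R => (a' y 0 i * (s * l' u + l x) - l' y * (s * a' u 0 i + a x 0 i)) / (s * l' u + l x) ^+ 2)
  = (fun s : R => (a' y 0 i * (s * l' u + l x) - l' y * (s * a' u 0 i + a x 0 i)) / ((s * l' u + l x) * (s * l' u + l x))).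
  by apply/funext => s; rewrite expr2.
apply: (@is_derive_eq _ _ _ _ _ _ _ _ d5).
by rewrite !fctE !mul0r !add0r !mxE; field.
Qed.

Section Pulled.
Variables (f : V -> V -> R) (fC : smoothF setT f) (fh : homog setT 1 f).

Lemma dx_proj u x y : l x != 0 -> proj_diff x y != 0 ->
  is_derive x u (fun z => f (proj_map z) (proj_diff z y))
   (dx f (proj_diff x u) (proj_map x) (proj_diff x y) - l' u / l x * f (proj_map x) (proj_diff x y)
    - l' y / l x * dy f (proj_diff x u) (proj_map x) (proj_diff x y)).
Proof.
move=> lx Y0; apply: is_derive_line0.
have d1 := is_derive_proj_map u lx; have d2 := is_derive_proj_diff u y lx.
have y0 : proj_diff (0 *: u + x) y != 0 by rewrite scale0r add0r.
have d3 := is_derive_chain Topen fC (c1 := fun s : R => proj_map (s *: u + x))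
  (c2 := fun s : R => proj_diff (s *: u + x) y) I y0 d1 d2.
apply: (@is_derive_eq _ _ _ _ _ _ _ _ d3); rewrite scale0r add0r.
rewrite -addrA; congr (_ + _).
have e1 : dy f (proj_diff x y) (proj_map x) (proj_diff x y) = f (proj_map x) (proj_diff x y).
  by rewrite (@euler _ _ setT Topen 1) ?mul1r.
have e2 := dyD Topen (- (l' u / l x)) (proj_diff x y) (- (l' y / l x) *: proj_diff x u) fC (I : setT (proj_map x)) Y0.
have e3 := dyZ Topen (- (l' y / l x)) (proj_diff x u) fC (I : setT (proj_map x)) Y0.
rewrite e3 e1 !mulNr in e2; rewrite -e2.
exact: erefl.
Qed.

Lemma dy_proj u x y : l x != 0 -> proj_diff x y != 0 ->
  is_derive y u (fun z => f (proj_map x) (proj_diff x z))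
   (dy f (proj_diff x u) (proj_map x) (proj_diff x y)).
Proof.
move=> lx Y0; apply: is_derive_line0.
have -> : (fun s : R => f (proj_map x) (proj_diff x (s *: u + y))) =
   (fun s : R => f (proj_map x) (s *: proj_diff x u + proj_diff x y)).
  by apply/funext => s; rewrite proj_diffD.
have := @is_derive_line _ _ _ (f (proj_map x)) (proj_diff x y) (proj_diff x u) 0.
rewrite scale0r add0r; apply.
by have [] := is_derive_dy Topen (proj_diff x u) fC (I : setT (proj_map x)) Y0.
Qed.

End Pulled.

Variables (D : set V) (Dopen : open D) (G : V -> V -> R) (HG : finsler D G).
Hypotheses (Dl : forall x, D x -> l x != 0)
  (GE : forall x y, D x -> y != 0 -> G x y = F (proj_map x) (proj_diff x y)).

Lemma proj_diff_neq0 x y : D x -> y != 0 -> proj_diff x y != 0.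
Proof.
move=> Dx y0; apply/eqP => e; have := finsler_pos HG Dx y0.
by rewrite GE // e (finsler0 HF) // ltxx.
Qed.

Let Ph : homog setT 1 (pfac F). Proof. exact: pfac_homog. Qed.
Let Fh : homog setT 1 F. Proof. exact: finsler_homog. Qed.

Lemma dy_pulled u x y : D x -> y != 0 ->
  dy G u x y = dy F (proj_diff x u) (proj_map x) (proj_diff x y).
Proof.
move=> Dx y0; rewrite (@dy_eq _ _ D _ (fun x y => F (proj_map x) (proj_diff x y))) //.
by have [_] := dy_proj FC u (Dl Dx) (proj_diff_neq0 Dx y0).
Qed.

Lemma dx_pulled u x y : D x -> y != 0 ->
  dx G u x y = dx F (proj_diff x u) (proj_map x) (proj_diff x y) - l' u / l x * F (proj_map x) (proj_diff x y)
    - l' y / l x * dy F (proj_diff x u) (proj_map x) (proj_diff x y).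
Proof.
move=> Dx y0; rewrite (@dx_eq _ _ D Dopen _ (fun x y => F (proj_map x) (proj_diff x y))) //.
by have [_] := dx_proj FC Fh u (Dl Dx) (proj_diff_neq0 Dx y0).
Qed.

(** In the direction [y] both corrections of [dx_pulled] equal [l' y / l x] times F, and P is half
    of [F_x y / F]. *)
Lemma pfac_pulled x y : D x -> y != 0 ->
  pfac G x y = pfac F (proj_map x) (proj_diff x y) - l' y / l x.
Proof.
move=> Dx y0; have Y0 := proj_diff_neq0 Dx y0.
have F0 := finsler_pos HF (I : setT (proj_map x)) Y0.
rewrite {1}/pfac dx_pulled // GE // (dxF_pfac HF) //.
rewrite (@euler _ _ setT Topen 1) //.
by move: (pfac F _ _) (F _ _) F0 (Dl Dx) => p f f0 lx; field; rewrite lx gt_eqF.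
Qed.

(** With [mu = - l' y / l x], the corrections in [dx_proj] are the cross terms of
    [(Psi + mu) (Psi + mu)_y], and [mu] itself satisfies [mu_x = mu mu_y]. *)
Lemma burgers_pulled : burgers D G.
Proof.
move=> u x y Dx y0; have Y0 := proj_diff_neq0 Dx y0; have lx := Dl Dx.
have [B1 B2] := B (proj_diff x u) (I : setT (proj_map x)) Y0.
have l'D : is_derive y u (fun z => l' z / l x) (l' u / l x).
  apply: is_derive_line0.
  have -> : (fun s : R => l' (s *: u + y) / l x) = (fun s : R => s * (l' u / l x) + l' y / l x).
    by apply/funext => s; rewrite l'lin mulrDl mulrA.
  exact: is_derive_affr.
have lD : is_derive x u (fun z => l' y / l z) (- (l' y * l' u) / l x ^+ 2).
  apply: is_derive_line0.
  have -> : (fun s : R => l' y / l (s *: u + x)) = (fun s : R => l' y / (s * l' u + l x)).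
    by apply/funext => s; rewrite laff.
  have d2 := is_derive_affr (l' u) (l x) 0.
  have l0 : 0 * l' u + l x != 0 by rewrite mul0r add0r.
  apply: (@is_derive_eq _ _ _ _ _ _ _ _ (@is_derive_div _ _ _ (0:R) _ _ l0 (is_derive_cst (l' y) (0:R) (1:R)) d2)).
  by rewrite !fctE !mul0r !add0r ?sub0r.
have dyP : dy (pfac G) u x y = dy (pfac F) (proj_diff x u) (proj_map x) (proj_diff x y) - l' u / l x.
  rewrite (@dy_eq _ _ D _ (fun x y => pfac F (proj_map x) (proj_diff x y) - l' y / l x)) //; last exact: pfac_pulled.
  by have [_] := is_deriveB (dy_proj PC u lx Y0) l'D.
have dxP : dx (pfac G) u x y = dx (pfac F) (proj_diff x u) (proj_map x) (proj_diff x y) - l' u / l x * pfac F (proj_map x) (proj_diff x y)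
    - l' y / l x * dy (pfac F) (proj_diff x u) (proj_map x) (proj_diff x y) - (- (l' y * l' u) / l x ^+ 2).
  rewrite (@dx_eq _ _ D Dopen _ (fun x y => pfac F (proj_map x) (proj_diff x y) - l' y / l x)) //; last exact: pfac_pulled.
  by have [_] := is_deriveB (dx_proj PC Ph u lx Y0) lD.
rewrite dyP dxP dx_pulled // dy_pulled // pfac_pulled // GE // B1 B2.
move: (pfac F _ _) (F _ _) (dy F _ _ _) (dy (pfac F) _ _ _) (l' u) (l' y) (l x) lx => p f fu pu lu ly l0 lx0.
by split; field.
Qed.

(* A formula for the metric at x that involves only its values at [s *: y + x], possibly on the
   other side of the hyperplane [l = 0]. *)
Lemma crossing x y (s : R) : D x -> D (s *: y + x) -> y != 0 ->
  let p := pfac G (s *: y + x) y in let f := G (s *: y + x) y in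
  G x y = f / ((1 + s * p) ^+ 2 + s ^+ 2 * f ^+ 2).
Proof.
move=> Dx D1 y0 /=; set x1 := s *: y + x.
have lx := Dl Dx; have lx1 := Dl D1.
have l1E : l x1 = s * l' y + l x by exact: laff.
have a1E : a x1 = s *: a' y + a x by exact: aaff.
have Y1 := proj_diff_neq0 D1 y0.
(* [k] is negative when the two points lie on opposite sides of the hyperplane, but vectors are
   rescaled by its square, so positive homogeneity suffices. *)
pose k := l x1 / l x.
have k0 : k != 0 by rewrite mulf_neq0 ?invr_neq0.
have k2 : 0 < k ^+ 2 by rewrite lt0r sqrf_eq0 k0 sqr_ge0.
have YE : proj_diff x y = k ^+ 2 *: proj_diff x1 y.
  apply/rowP => i; rewrite /proj_diff !mxE a1E !mxE /k; move: (lx1); rewrite -/x1 l1E => lx1'; field; by rewrite lx lx1'.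
have XE : (s * k) *: proj_diff x1 y + proj_map x = proj_map x1.
  apply/rowP => i; rewrite /proj_diff /proj_map !mxE a1E !mxE /k.
  move: (lx1); rewrite -/x1 l1E => lx1'; field; by rewrite lx lx1'.
rewrite GE // YE (finslerZ HF _ (I : setT _) k2).
have [-> _] := line_formula HF B (proj_map x) (s * k) Y1.
rewrite XE GE // pfac_pulled // -/x1.
have F0 := finsler_pos HF (I : setT (proj_map x1)) Y1.
have d1 := line_den_gt0 (pfac F (proj_map x1) (proj_diff x1 y)) (s * k) F0.
have d2 := line_den_gt0 (pfac F (proj_map x1) (proj_diff x1 y) - l' y / l x1) s F0.
(* This absorbs the shift of P: the denominators at [s * k] and at [s] then differ by the factor
   [k ^ 2]. *)
have kE : k * (1 - s * (l' y / l x1)) = 1.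
  by rewrite /k; move: (lx1); rewrite -/x1 l1E => lx1'; field; rewrite lx lx1'.
move: (pfac F _ _) (F _ _) (l' y / l x1) F0 d1 d2 kE => p f q f0 d1 d2 kE.
have E : (1 + s * k * p) ^+ 2 + (s * k) ^+ 2 * f ^+ 2 = k ^+ 2 * ((1 + s * (p - q)) ^+ 2 + s ^+ 2 * f ^+ 2).
  have -> : 1 + s * k * p = k * (1 + s * (p - q)) by rewrite -[X in X + _]kE; ring.
  by ring.
by rewrite E invfM mulrCA [k ^+ 2 * _]mulrA mulfV ?mul1r // lt0r_neq0.
Qed.

End ProjectiveChange.

(** * The doubled metric on the sphere *)

Section InnerProduct.
Context {R : realType}.

Section Dot.
Context {m : nat}.
Implicit Types u v w : 'rV[R]_m.

Lemma edotE u v : edot u v = (u *m v^T) 0 0.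
Proof. by rewrite /edot mxE; apply: eq_bigr => i _; rewrite mxE. Qed.

Lemma edotC u v : edot u v = edot v u.
Proof. by apply: eq_bigr => i _; rewrite mulrC. Qed.

Lemma edotDl u v w : edot (u + v) w = edot u w + edot v w.
Proof. by rewrite !edotE mulmxDl mxE. Qed.

Lemma edotZl (a : R) u w : edot (a *: u) w = a * edot u w.
Proof. by rewrite !edotE -scalemxAl mxE. Qed.

Lemma edotNl u w : edot (- u) w = - edot u w.
Proof. by rewrite -scaleN1r edotZl mulN1r. Qed.

Lemma edotBl u v w : edot (u - v) w = edot u w - edot v w.
Proof. by rewrite edotDl edotNl. Qed.

Lemma edotDr u v w : edot w (u + v) = edot w u + edot w v.
Proof. by rewrite ![edot w _]edotC edotDl. Qed.

Lemma edotZr (a : R) u w : edot w (a *: u) = a * edot w u.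
Proof. by rewrite ![edot w _]edotC edotZl. Qed.

Lemma edotNr u w : edot w (- u) = - edot w u.
Proof. by rewrite ![edot w _]edotC edotNl. Qed.

Lemma edotBr u v w : edot w (u - v) = edot w u - edot w v.
Proof. by rewrite edotDr edotNr. Qed.

Lemma edot0l w : edot 0 w = 0.
Proof. by rewrite edotE mul0mx mxE. Qed.

Lemma edot_ge0 u : 0 <= edot u u.
Proof. by apply: sumr_ge0 => i _; rewrite -expr2 sqr_ge0. Qed.

Lemma edot_gt0 u : (0 < edot u u) = (u != 0).
Proof.
apply/idP/idP => [|u0]; first by apply: contraTneq => ->; rewrite edot0l ltxx.
rewrite lt_def edot_ge0 andbT; apply: contra u0 => /eqP e; apply/eqP/rowP => i; rewrite mxE.
have h := @psumr_eq0P _ _ xpredT (fun j => u 0 j * u 0 j) (fun j _ => _) e.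
by apply/eqP; rewrite -sqrf_eq0 expr2; apply/eqP; apply: h => // j; rewrite -expr2 sqr_ge0.
Qed.

Lemma orthogonal_mxT (A : 'M[R]_m) : A *m A^T = 1%:M -> A^T *m A = 1%:M.
Proof. exact: mulmx1C. Qed.

Lemma edot_mulmx u v (A : 'M[R]_m) : A *m A^T = 1%:M -> edot (u *m A) (v *m A) = edot u v.
Proof. by move=> AA; rewrite !edotE trmx_mul mulmxA -[u *m A *m _]mulmxA AA mulmx1. Qed.

Definition normalize u := (Num.sqrt (edot u u))^-1 *: u.

Lemma normalize_sphere u : u != 0 -> edot (normalize u) (normalize u) = 1.
Proof.
rewrite -edot_gt0 => u0; rewrite /normalize edotZl edotZr mulrA -invfM -expr2 sqr_sqrtr ?ltW //.
by rewrite mulVf // gt_eqF.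
Qed.

Lemma normalize_gt0 u : u != 0 -> 0 < (Num.sqrt (edot u u))^-1.
Proof. by rewrite -edot_gt0 invr_gt0 sqrtr_gt0. Qed.

Lemma normalizeZ (a : R) u : 0 < a -> normalize (a *: u) = normalize u.
Proof.
move=> a0; rewrite /normalize edotZl edotZr mulrA -expr2 sqrtrM ?sqr_ge0 // sqrtr_sqr gtr0_norm //.
rewrite scalerA invfM; congr (_ *: _); rewrite mulrC mulrA mulfV ?mul1r //.
by rewrite gt_eqF.
Qed.

Lemma normalizeN u : normalize (- u) = - normalize u.
Proof. by rewrite /normalize edotNl edotNr opprK scalerN. Qed.

Lemma normalize_id u : edot u u = 1 -> normalize u = u.
Proof. by move=> e; rewrite /normalize e sqrtr1 invr1 scale1r. Qed.

Lemma normalize_inj u v : u != 0 -> v != 0 -> normalize u = normalize v -> exists2 a : R, 0 < a & v = a *: u.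
Proof.
move=> u0 v0 e; have pu := normalize_gt0 u0; have pv := normalize_gt0 v0.
exists ((Num.sqrt (edot v v))^-1^-1 * (Num.sqrt (edot u u))^-1).
  by rewrite mulr_gt0 // invr_gt0.
by rewrite -scalerA -/(normalize u) e /normalize scalerA mulVf ?scale1r // gt_eqF.
Qed.

End Dot.

Lemma affine_continuous (m : nat) (W : normedModType R) (f f' : 'rV[R]_m -> W) :
  (forall x v (h : R), f (h *: v + x) = h *: f' v + f x) -> continuous f.
Proof.
move=> fa.
have E (r : seq 'I_m) x : f (\sum_(i <- r) x 0 i *: delta_mx 0 i) = \sum_(i <- r) x 0 i *: f' (delta_mx 0 i) + f 0.
  elim: r => [|i r IH]; first by rewrite !big_nil add0r.
  by rewrite !big_cons fa IH addrA.
have -> : f = fun x => \sum_i x 0 i *: f' (delta_mx 0 i) + f 0.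
  by apply/funext => x; rewrite -E -row_sum_delta.
move=> x; apply: continuousD; last exact: cst_continuous.
elim: (index_enum _) => [|i r IH].
  have -> : (fun z : 'rV[R]_m => \sum_(i <- [::]) z 0 i *: f' (delta_mx 0 i)) = fun=> 0.
    by apply/funext => z; rewrite big_nil.
  exact: cst_continuous.
have -> : (fun z : 'rV[R]_m => \sum_(j <- i :: r) z 0 j *: f' (delta_mx 0 j)) =
    (fun z => z 0 i *: f' (delta_mx 0 i) + \sum_(j <- r) z 0 j *: f' (delta_mx 0 j)).
  by apply/funext => z; rewrite big_cons.
apply: continuousD IH; apply: continuousZl; exact: coord_continuous.
Qed.

Lemma is_derive_rowP (V : normedModType R) m (f : V -> 'rV[R]_m) x v (u : 'rV[R]_m) :
  is_derive x v f u <-> forall i, is_derive x v (fun z => f z 0 i) (u 0 i).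
Proof.
split=> [H i|H].
  apply: is_derive_line0; have := @is_derive_line _ _ _ f x v 0.
  rewrite scale0r add0r => /(_ _)/is_derive_coordP h.
  by have [d <-] := H; have /h/(_ i) := d.
apply: is_derive_line0; apply/is_derive_coordP => i.
have [d <-] := H i; have := @is_derive_line _ _ _ (fun z => f z 0 i) x v 0.
by rewrite scale0r add0r; apply.
Qed.

Lemma continuous_rowP (V : normedModType R) m (f : V -> 'rV[R]_m) x :
  (forall i, {for x, continuous (fun z => f z 0 i)}) -> {for x, continuous f}.
Proof.
move=> H; apply/cvgrPdist_le => e e0.
have : \forall z \near x, forall i : 'I_m, `|f x 0 i - f z 0 i| <= e.
  by apply: filter_forall => i; have /cvgrPdist_le/(_ _ e0) := H i.
apply: filterS => z h; apply: norm_le_coord; first exact: ltW.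
by move=> i j; rewrite (ord1 i) !mxE.
Qed.

Lemma class_C_row (V : normedModType R) m k (U : set V) (f : V -> 'rV[R]_m) : open U ->
  (forall i, class_C k U (fun z => f z 0 i)) -> class_C k U f.
Proof.
move=> Uo; elim: k f => [|k IH] f fC.
  by split=> // x Ux; apply: continuous_rowP => i; exact: class_C_cont (fC i) Ux.
have D x v : U x -> is_derive x v f (\row_i 'D_v (fun z => f z 0 i) x).
  move=> Ux; apply/is_derive_rowP => i; rewrite mxE.
  by apply: derivableP; exact: class_C_derivable (fC i) Ux.
split; first by move=> x Ux; apply: continuous_rowP => i; exact: class_C_cont (fC i) Ux.
move=> v; split; first by move=> x /(D x v)[].
apply: IH => i; apply: class_C_eq (class_CD v (fC i)) => // x Ux.
by have [_ ->] := D x v Ux; rewrite mxE.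
Qed.

Lemma smooth_on_class_C (V W : normedModType R) (U A : set V) (f : V -> W) : open U -> A `<=` U ->
  (forall k, class_C k U f) -> smooth_on A f.
Proof. by move=> Uo AU fC x Ax; exists U, f; split=> //; exact: AU. Qed.

Lemma class_C_normalize (V : normedModType R) m k (U : set V) (f : V -> 'rV[R]_m) : open U ->
  (forall x, U x -> f x != 0) -> (forall i, class_C k U (fun z => f z 0 i)) ->
  class_C k U (fun z => normalize (f z)).
Proof.
move=> Uo f0 fC; have pos x : U x -> 0 < edot (f x) (f x) by move=> /f0; rewrite edot_gt0.
apply: class_C_row => // i.
apply: (@class_C_eq _ _ _ _ _ (fun z => (Num.sqrt (edot (f z) (f z)))^-1 * f z 0 i)) => //.
  by move=> x _; rewrite mxE.
apply: class_C_mul => //; apply: class_C_inv => //.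
  by move=> x /pos p; rewrite gt_eqF // sqrtr_gt0.
apply: class_C_sqrt => //; apply: class_C_sum => // j.
exact: class_C_mul.
Qed.

Lemma is_derive_edot m (c d : R -> 'rV[R]_m) t u v :
  is_derive t (1:R) c u -> is_derive t (1:R) d v ->
  is_derive t (1:R) (fun s => edot (c s) (d s)) (edot u (d t) + edot (c t) v).
Proof.
move=> /is_derive_coordP dc /is_derive_coordP dd; rewrite /edot -big_split /=.
elim: (index_enum _) => [|i r IH].
  have -> : (fun s => \sum_(i <- [::]) c s 0 i * d s 0 i) = fun=> 0.
    by apply/funext => z; rewrite big_nil.
  by rewrite big_nil; exact: is_derive_cst.
have -> : (fun s => \sum_(j <- i :: r) c s 0 j * d s 0 j) =
    (fun s => c s 0 i * d s 0 i + \sum_(j <- r) c s 0 j * d s 0 j).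
  by apply/funext => z; rewrite big_cons.
by rewrite big_cons; apply: is_deriveD IH; exact: is_derive_mulr.
Qed.

(** Differential of [normalize] at [w]: the part of [u] orthogonal to [w], divided by the Euclidean
    length of [w]. *)
Definition dnormalize m (w u : 'rV[R]_m) : 'rV[R]_m :=
  (Num.sqrt (edot w w))^-1 *: u + (- edot w u / Num.sqrt (edot w w) ^+ 3) *: w.

Lemma is_derive_normalize m (c : R -> 'rV[R]_m) t u : c t != 0 -> is_derive t (1:R) c u ->
  is_derive t (1:R) (fun s => normalize (c s)) (dnormalize (c t) u).
Proof.
move=> c0 dc; have E : 0 < edot (c t) (c t) by rewrite edot_gt0.
have de := is_derive_edot dc dc.
have ds : is_derive (edot (c t) (c t)) (1:R) (@Num.sqrt R) (2 * Num.sqrt (edot (c t) (c t)))^-1.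
  exact: is_derive1_sqrt.
have d1 := @is_derive1_comp _ _ (fun s => edot (c s) (c s)) t _ _ ds de.
have s0 : Num.sqrt (edot (c t) (c t)) != 0 by rewrite gt_eqF // sqrtr_gt0.
have d2 : is_derive t (1:R) (fun s => (Num.sqrt (edot (c s) (c s)))^-1) (- edot (c t) u / Num.sqrt (edot (c t) (c t)) ^+ 3).
  have H := @is_derive_div _ (fun=> 1) (fun s => Num.sqrt (edot (c s) (c s))) t _ _ s0 (is_derive_cst (1 : R) t (1:R)) d1.
  have -> : (fun s => (Num.sqrt (edot (c s) (c s)))^-1) = (fun s => 1 / Num.sqrt (edot (c s) (c s))).
    by apply/funext => s; rewrite mul1r.
  apply: (@is_derive_eq _ _ _ _ _ _ _ _ H).
  rewrite [edot u _]edotC; move: (edot _ u) (Num.sqrt _) s0 => a b b0; field; exact: b0.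
apply/is_derive_coordP => i.
have dci := (is_derive_coordP _ _ _).1 dc i.
have -> : (fun s => normalize (c s) 0 i) = (fun s => (Num.sqrt (edot (c s) (c s)))^-1 * c s 0 i).
  by apply/funext => s; rewrite mxE.
apply: (@is_derive_eq _ _ _ _ _ _ _ _ (is_derive_mulr d2 dci)).
by rewrite !mxE addrC.
Qed.

End InnerProduct.

(** * Central charts of the sphere *)

Section Charts.
Context {R : realType} {n : nat}.
Notation V := 'rV[R]_n.
Notation E := 'rV[R]_(n + 1).
Implicit Types (A B : 'M[R]_(n + 1)) (x y : V) (w v : E).

(** For orthogonal [A] a chart is the radial projection of the hyperplane tangent to the sphere at
    [inc A 0]. Keeping this affine map apart from the normalization shows that changes of charts are
    fractional linear. *)
Definition inc A x : E := row_mx x 1%:M *m A.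
Definition dinc A y : E := row_mx y 0 *m A.

Lemma inc_aff A x y (h : R) : inc A (h *: y + x) = h *: dinc A y + inc A x.
Proof.
by rewrite /inc /dinc scalemxAl -mulmxDl scale_row_mx add_row_mx scaler0 add0r.
Qed.

Lemma dinc_lin A x y (h : R) : dinc A (h *: y + x) = h *: dinc A y + dinc A x.
Proof.
by rewrite /dinc scalemxAl -mulmxDl scale_row_mx add_row_mx scaler0 add0r.
Qed.

Lemma incN A x : inc (- A) x = - inc A x.
Proof. by rewrite /inc mulmxN. Qed.

Lemma dincN A x : dinc (- A) x = - dinc A x.
Proof. by rewrite /dinc mulmxN. Qed.

Lemma dinc0 A : dinc A 0 = 0.
Proof. by rewrite /dinc row_mx0 mul0mx. Qed.

Lemma orthogonal_mxN A : orthogonal_mx A -> orthogonal_mx (- A).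
Proof. by rewrite /orthogonal_mx => AA; rewrite linearN /= mulmxN mulNmx opprK. Qed.

Lemma orthogonal1 : orthogonal_mx (1%:M : 'M[R]_(n + 1)).
Proof. by rewrite /orthogonal_mx trmx1 mulmx1. Qed.

Lemma edot_row (x y : V) (a b : 'rV[R]_1) : edot (row_mx x a) (row_mx y b) = edot x y + a 0 0 * b 0 0.
Proof.
rewrite /edot big_split_ord big_ord1 /=; congr (_ + _).
  by apply: eq_bigr => i _; rewrite !row_mxEl.
by rewrite !row_mxEr.
Qed.

Lemma edot_inc A x : orthogonal_mx A -> edot (inc A x) (inc A x) = 1 + edot x x.
Proof. by move=> AA; rewrite edot_mulmx // edot_row mxE eqxx mulr1n mulr1 addrC. Qed.

Lemma inc_neq0 A x : orthogonal_mx A -> inc A x != 0.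
Proof. by move=> AA; rewrite -edot_gt0 edot_inc // ltr_pwDl // edot_ge0. Qed.

Lemma chart_paramE A x : orthogonal_mx A -> chart_param A x = normalize (inc A x).
Proof. by move=> AA; rewrite /normalize edot_inc // /chart_param /gnomonic -scalemxAl. Qed.

Lemma chart_paramN A x : chart_param (- A) x = - chart_param A x.
Proof. by rewrite /chart_param mulmxN. Qed.

Lemma chart_param_sphere A x : orthogonal_mx A -> sphere (chart_param A x).
Proof. by move=> AA; rewrite chart_paramE //; apply: normalize_sphere; exact: inc_neq0. Qed.

Lemma is_derive_inc A (c : R -> V) t u : is_derive t (1:R) c u ->
  is_derive t (1:R) (fun s => inc A (c s)) (dinc A u).
Proof.
move=> dc; pose L : V -> E := dinc A.
have Ll : linear L by move=> h x y; exact: dinc_lin.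
have -> : (fun s => inc A (c s)) = (fun s => dinc A (c s) + inc A 0).
  by apply/funext => s; rewrite -[X in inc A X]addr0 -[c s in LHS]scale1r inc_aff scale1r.
suff d : is_derive t (1:R) (fun s => dinc A (c s)) (dinc A u).
  by apply: (@is_derive_eq _ _ _ _ _ _ _ _ (is_deriveD d (is_derive_cst (inc A 0) t (1:R)))); rewrite addr0.
apply/is_derive_coordP => i.
have dci := (is_derive_coordP _ _ _).1 dc.
have H := is_derive_edot dc (is_derive_cst (\row_j A (lshift 1 j) i : V) t (1:R)).
have S z : dinc A z 0 i = edot z (\row_j A (lshift 1 j) i).
  rewrite /dinc !mxE big_split_ord /= big_ord1 row_mxEr mxE mul0r addr0.
  by apply: eq_bigr => j _; rewrite row_mxEl mxE.
have -> : (fun s => dinc A (c s) 0 i) = (fun s => edot (c s) (\row_j A (lshift 1 j) i)).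
  by apply/funext => s.
apply: (@is_derive_eq _ _ _ _ _ _ _ _ H).
by rewrite S edotC addrC edotC [X in X + _](_ : _ = 0) ?add0r // edot0l.
Qed.

Lemma is_derive_chart A (c : R -> V) t u : orthogonal_mx A -> is_derive t (1:R) c u ->
  is_derive t (1:R) (fun s => chart_param A (c s)) (dnormalize (inc A (c t)) (dinc A u)).
Proof.
move=> AA dc; have H := is_derive_normalize (inc_neq0 (c t) AA) (is_derive_inc A dc).
have -> : (fun s => chart_param A (c s)) = (fun s => normalize (inc A (c s))) => //.
by apply/funext => s; exact: chart_paramE.
Qed.

Lemma is_derive_chart_param A x y : orthogonal_mx A ->
  is_derive x y (chart_param A) (dnormalize (inc A x) (dinc A y)).
Proof.
move=> AA; have H := is_derive_chart AA (is_derive_aff y x 0).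
by apply: is_derive_line0; move: H; rewrite scale0r add0r.
Qed.

Lemma class_C_chart_param A k : orthogonal_mx A -> class_C k setT (chart_param A).
Proof.
move=> AA; apply: (@class_C_eq _ _ _ _ _ (fun x => normalize (inc A x))) => //; first exact: openT.
  by move=> x _; rewrite chart_paramE.
apply: class_C_normalize; [exact: openT|by move=> x _; exact: inc_neq0|move=> i].
have ff (x v : V) (h : R) : inc A (h *: v + x) 0 i = h *: dinc A v 0 i + inc A x 0 i.
  by rewrite inc_aff !mxE.
exact: class_C_aff (affine_continuous ff) ff.
Qed.

Lemma derive_chart_param A x y : orthogonal_mx A ->
  'D_y (chart_param A) x = dnormalize (inc A x) (dinc A y).
Proof. by move=> AA; have [_] := is_derive_chart_param x y AA. Qed.

Lemma edot_dnormalize m (w u : 'rV[R]_m) : w != 0 -> edot (normalize w) (dnormalize w u) = 0.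
Proof.
rewrite -edot_gt0 => w0; rewrite /normalize /dnormalize edotZl edotDr !edotZr.
have s0 : Num.sqrt (edot w w) != 0 by rewrite gt_eqF // sqrtr_gt0.
have h : Num.sqrt (edot w w) ^+ 2 = edot w w by rewrite sqr_sqrtr // ltW.
by move: (Num.sqrt (edot w w)) (edot w u) s0 h => a b a0 <-; field; exact: a0.
Qed.

Lemma dnormalizeN m (w u : 'rV[R]_m) : dnormalize (- w) (- u) = - dnormalize w u.
Proof. by rewrite /dnormalize !edotNl !edotNr !opprK !scalerN opprD. Qed.

Lemma dnormalize_eq0 m (w u : 'rV[R]_m) : w != 0 -> dnormalize w u = 0 -> exists a : R, u = a *: w.
Proof.
rewrite -edot_gt0 => w0 /eqP; rewrite addr_eq0 => /eqP e.
have s0 : Num.sqrt (edot w w) != 0 by rewrite gt_eqF // sqrtr_gt0.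
exists (Num.sqrt (edot w w) * (edot w u / Num.sqrt (edot w w) ^+ 3)).
by rewrite -scalerA -[_ / _]opprK -mulNr scaleNr -e scalerA mulfV // scale1r.
Qed.

(** Denominator, and with [acoord] numerator, of the change from the chart of [A] to the coordinates
    of the hemisphere on which F is given. The zero set of [lcoord A] is the equator seen in the
    chart. *)
Definition lcoord A x : R := last_coord (inc A x).
Definition lcoord' A y : R := last_coord (dinc A y).
Definition acoord A x : V := lsubmx (inc A x).
Definition acoord' A y : V := lsubmx (dinc A y).

Lemma last_coordD w v (h : R) : last_coord (h *: v + w) = h * last_coord v + last_coord w.
Proof. by rewrite /last_coord !mxE. Qed.

Lemma lcoord_aff A x y (h : R) : lcoord A (h *: y + x) = h * lcoord' A y + lcoord A x.
Proof. by rewrite /lcoord inc_aff last_coordD. Qed.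

Lemma lcoord'_lin A x y (h : R) : lcoord' A (h *: y + x) = h * lcoord' A y + lcoord' A x.
Proof. by rewrite /lcoord' dinc_lin last_coordD. Qed.

Lemma acoord_aff A x y (h : R) : acoord A (h *: y + x) = h *: acoord' A y + acoord A x.
Proof. by rewrite /acoord inc_aff linearD linearZ. Qed.

Lemma acoord'_lin A x y (h : R) : acoord' A (h *: y + x) = h *: acoord' A y + acoord' A x.
Proof. by rewrite /acoord' dinc_lin linearD linearZ. Qed.

Lemma lcoordN A x : lcoord (- A) x = - lcoord A x.
Proof. by rewrite /lcoord incN /last_coord mxE. Qed.

Lemma lcoord_continuous A : continuous (lcoord A).
Proof.
have ff (x v : V) (h : R) : lcoord A (h *: v + x) = h *: lcoord' A v + lcoord A x by exact: lcoord_aff.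
exact: (affine_continuous ff).
Qed.

Lemma row_split w : w = row_mx (lsubmx w) (last_coord w)%:M.
Proof.
rewrite -[LHS]hsubmxK; congr row_mx; apply/rowP => i; rewrite (ord1 i) !mxE eqxx mulr1n.
by congr (w _ _); apply: val_inj.
Qed.

Lemma row_inc A w (b : R) x : w = row_mx (lsubmx w) b%:M -> w *m A = b *: inc A x + dinc A (lsubmx w - b *: x).
Proof.
move=> {1}->; rewrite /inc /dinc scalemxAl -mulmxDl scale_row_mx add_row_mx.
by rewrite addrC subrK addr0 scale_scalar_mx mulr1.
Qed.

Lemma mulmx_inc A w x : w *m A = last_coord w *: inc A x + dinc A (lsubmx w - last_coord w *: x).
Proof. exact: row_inc (row_split w). Qed.

(** In the frame of the chart at [x] the pole is a multiple of [inc A x] plus some [dinc A v]. At an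
    equatorial [x] only the second part contributes to its last coordinate, which is 1. *)
Lemma lcoord_transverse A x : orthogonal_mx A -> lcoord A x = 0 -> exists v : V, lcoord' A v = 1.
Proof.
move=> AA l0; pose w : E := row_mx 0 1%:M *m A^T.
have wA : w *m A = row_mx 0 1%:M by rewrite -mulmxA orthogonal_mxT // mulmx1.
exists (lsubmx w - last_coord w *: x).
have : last_coord (w *m A) = 1 by rewrite wA /last_coord row_mxEr mxE eqxx.
by rewrite (mulmx_inc A w x) last_coordD -/(lcoord A x) l0 mulr0 add0r.
Qed.

Lemma inc_indep A x y (a : R) : orthogonal_mx A -> dinc A y = a *: inc A x -> y = 0.
Proof.
move=> AA e; have E1 : row_mx y 0 = a *: row_mx x 1%:M :> E.
  have := congr1 (fun z => z *m A^T) e; rewrite -scalemxAl /dinc /inc -!mulmxA AA !mulmx1.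
  by [].
move/(congr1 rsubmx): (E1); rewrite scale_row_mx !row_mxKr => /(congr1 (fun M : 'M[R]_(1, 1) => M 0 0)).
rewrite !mxE eqxx mulr1 => a0; move/(congr1 lsubmx): E1; rewrite scale_row_mx !row_mxKl -a0.
by rewrite scale0r.
Qed.

Lemma chart_immersion A x y : orthogonal_mx A -> 'D_y (chart_param A) x = 0 -> y = 0.
Proof.
move=> AA; rewrite derive_chart_param // => /(dnormalize_eq0 (inc_neq0 x AA))[a].
exact: inc_indep.
Qed.

Lemma inc_inj A x y (a : R) : orthogonal_mx A -> inc A y = a *: inc A x -> a = 1 /\ y = x.
Proof.
move=> AA e; have E1 : row_mx y 1%:M = a *: row_mx x 1%:M :> E.
  have := congr1 (fun z => z *m A^T) e; rewrite -scalemxAl /inc -!mulmxA AA !mulmx1.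
  by [].
move/(congr1 rsubmx): (E1); rewrite scale_row_mx !row_mxKr => /(congr1 (fun M : 'M[R]_(1, 1) => M 0 0)).
rewrite !mxE eqxx mulr1 => a1; move/(congr1 lsubmx): E1; rewrite scale_row_mx !row_mxKl -a1.
by rewrite scale1r.
Qed.

Lemma chart_inj A x y : orthogonal_mx A -> chart_param A x = chart_param A y -> x = y.
Proof.
move=> AA; rewrite !chart_paramE // => /(normalize_inj (inc_neq0 x AA) (inc_neq0 y AA))[a _ e].
by have [_ ->] := inc_inj AA e.
Qed.

Lemma last_coord_normalize w : w != 0 -> exists2 r : R, 0 < r & last_coord (normalize w) = r * last_coord w.
Proof.
move=> w0; exists (Num.sqrt (edot w w))^-1; first exact: normalize_gt0.
by rewrite /last_coord mxE.
Qed.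

Definition erow : E := row_mx 0 1%:M.

(** An equatorial point is approached by normalizing [s *: erow + w] with [s > 0]. *)
Lemma closure_hemisphere w : sphere w -> 0 <= last_coord w -> closure hemisphere w.
Proof.
move=> Sw; rewrite le_eqVlt => /orP[/eqP l0|lp]; last by apply: subset_closure.
move=> N Nw; pose c (s : R) : E := s *: erow + w.
have cn s : 0 < s -> c s != 0.
  move=> s0; apply/eqP => /(congr1 (@last_coord R n)).
  rewrite /c /last_coord !mxE (unsplitK (inr _)) /= mxE eqxx mulr1n mulr1.
  rewrite -/(last_coord w) -l0 addr0 => /eqP; by rewrite gt_eqF.
have w0 : w != 0 by rewrite -edot_gt0 Sw.
have dc := is_derive_aff erow w 0.
have c00 : 0 *: erow + w != 0 by rewrite scale0r add0r.
have cc := is_derive_continuous (is_derive_normalize (c := c) c00 dc).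
have Nc0 : nbhs (normalize (c 0)) N by rewrite /c scale0r add0r normalize_id.
have cl := cvg_at_right_filter cc.
have [s [s0 Ns]] := filter_ex (filterI (nbhs_right_gt (0 : R)) (cl _ Nc0)).
exists (normalize (c s)); split=> //; split; first exact: normalize_sphere (cn s s0).
have [r r0 ->] := last_coord_normalize (cn s s0).
rewrite mulr_gt0 // /c /last_coord !mxE (unsplitK (inr _)) /= mxE eqxx mulr1n mulr1.
by rewrite -/(last_coord w) -l0 addr0.
Qed.

End Charts.

Lemma finsler_sub {R : realType} {n : nat} (D D' : set 'rV[R]_n) f : D' `<=` D -> finsler D f -> finsler D' f.
Proof.
move=> DD [h1 h2]; split=> [x /DD|p [/DD Dp p0]]; first exact: h1.
have [U [g [Uo Up gC gf]]] := h2 p (conj Dp p0); exists U, g; split=> // z [/DD Dz z0].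
exact: gf.
Qed.

Section SphereMetric.
Context {R : realType} {n : nat}.
Notation V := 'rV[R]_n.
Notation E := 'rV[R]_(n + 1).
Variables (F : V -> V -> R) (HF : finsler setT F) (B : burgers setT F).
Variables (Fbar : E -> E -> R) (HFb : sphere_finsler (closure hemisphere) Fbar)
  (FbE : forall w v, hemisphere w -> tangent w v -> Fbar w v = pullback gnomonic_inv F w v).
Implicit Types (A C : 'M[R]_(n + 1)) (x y : V) (w v : E).

(* The values at non-tangent v are junk in the statement; projecting to the tangent space makes
   the metric nonnegative and continuous there too, so that the length integrand of a piecewise
   smooth curve is harmless at the break points. *)
Definition double_metric w v : R :=
  let v' := v - edot w v *: w in
  if 0 <= last_coord w then Fbar w v' else Fbar (- w) (- v').
Notation G := double_metric.

Definition chart_bar A := pullback (chart_param A) Fbar.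
Definition chart_metric A := pullback (chart_param A) G.
Notation Fb := chart_bar.
Notation GA := chart_metric.
Notation PM A := (proj_map (acoord A) (lcoord A)).
Notation PD A := (proj_diff (acoord A) (acoord' A) (lcoord A) (lcoord' A)).

Lemma derive_gnomonic_inv w v : last_coord w != 0 ->
  'D_v gnomonic_inv w = (last_coord w)^-2 *: (last_coord w *: lsubmx v - last_coord v *: lsubmx w).
Proof.
move=> lw; suff : is_derive w v gnomonic_inv ((last_coord w)^-2 *: (last_coord w *: lsubmx v - last_coord v *: lsubmx w)) by case.
apply: is_derive_line0; apply/is_derive_coordP => i.
have -> : (fun s : R => gnomonic_inv (s *: v + w) 0 i) =
    (fun s => (s * lsubmx v 0 i + lsubmx w 0 i) / (s * last_coord v + last_coord w)).
  by apply/funext => s; rewrite /gnomonic_inv last_coordD !mxE mulrC.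
have d1 := is_derive_affr (lsubmx v 0 i) (lsubmx w 0 i) 0; have d2 := is_derive_affr (last_coord v) (last_coord w) 0.
have l0 : 0 * last_coord v + last_coord w != 0 by rewrite mul0r add0r.
apply: (@is_derive_eq _ _ _ _ _ _ _ _ (@is_derive_div _ _ _ (0:R) _ _ l0 d1 d2)).
rewrite !mul0r !add0r !mxE.
by move: (last_coord v) (last_coord w) lw => c d d0; field.
Qed.

Lemma last_coord_chart A x : orthogonal_mx A -> exists2 r : R, 0 < r & last_coord (chart_param A x) = r * lcoord A x.
Proof.
move=> AA; rewrite chart_paramE //; exact: last_coord_normalize (inc_neq0 x AA).
Qed.

Lemma tangent_chart A x y : orthogonal_mx A -> edot (chart_param A x) ('D_y (chart_param A) x) = 0.
Proof. by move=> AA; rewrite derive_chart_param // chart_paramE // edot_dnormalize // inc_neq0. Qed.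

Lemma derive_chart_paramN A x y : orthogonal_mx A -> 'D_y (chart_param (- A)) x = - 'D_y (chart_param A) x.
Proof.
move=> AA; rewrite !derive_chart_param //; last exact: orthogonal_mxN.
by rewrite incN dincN dnormalizeN.
Qed.

(** The chart of [- A] is antipodal to that of [A], so the lower half of the doubled metric is the
    extended metric read in the chart of [- A]. *)
Lemma chart_metricE A x y : orthogonal_mx A ->
  GA A x y = if 0 <= lcoord A x then Fb A x y else Fb (- A) x y.
Proof.
move=> AA; rewrite /chart_metric /chart_bar /pullback /double_metric tangent_chart // scale0r subr0.
have [r r0 ->] := last_coord_chart x AA.
by rewrite pmulr_rge0 // derive_chart_paramN // chart_paramN.
Qed.

Lemma chart_metric_pos A x y : orthogonal_mx A -> 0 <= lcoord A x -> GA A x y = Fb A x y.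
Proof. by move=> AA h; rewrite chart_metricE // h. Qed.

Lemma chart_bar_proj A x y : orthogonal_mx A -> 0 < lcoord A x -> Fb A x y = F (PM A x) (PD A x y).
Proof.
move=> AA lx; have [r r0 lr] := last_coord_chart x AA.
have h : hemisphere (chart_param A x).
  by split; [exact: chart_param_sphere|rewrite lr mulr_gt0].
rewrite /chart_bar /pullback FbE //; last exact: tangent_chart.
have lp : last_coord (chart_param A x) != 0 by rewrite lr mulf_neq0 ?gt_eqF.
rewrite /pullback derive_gnomonic_inv // {lr r r0 h}; move: lp; rewrite derive_chart_param // chart_paramE //.
rewrite /gnomonic_inv /normalize /dnormalize.
set s := (Num.sqrt _)^-1; set r := (- _ / _).
have lz (a : R) w : last_coord (a *: w) = a * last_coord w by rewrite /last_coord mxE.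
have ld w v : last_coord (w + v) = last_coord w + last_coord v by rewrite /last_coord mxE.
have l0 : last_coord (inc A x) != 0 by rewrite gt_eqF.
rewrite !ld !lz mulf_eq0 negb_or => /andP[s0 _]; congr F.
  by rewrite /proj_map /acoord linearZ /= scalerA invfM mulrAC mulVf // mul1r.
rewrite /proj_diff /acoord /acoord' /lcoord /lcoord'; apply/rowP => i; rewrite !mxE.
by move: (last_coord _) (last_coord _) r s l0 s0 => c d r s c0 s0; field; rewrite c0 s0.
Qed.

Lemma proj_mapN A x : PM (- A) x = PM A x.
Proof. by rewrite /proj_map /acoord lcoordN incN invrN scaleNr linearN scalerN opprK. Qed.

Lemma proj_diffN A x y : PD (- A) x y = PD A x y.
Proof.
rewrite /proj_diff /acoord /acoord' /lcoord' lcoordN incN dincN !linearN /= sqrrN.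
have -> : last_coord (- dinc A y) = - last_coord (dinc A y) by rewrite /last_coord mxE.
by apply/rowP => i; rewrite !mxE; ring.
Qed.

(** The sign of [A] cancels in the quotients [proj_map] and [proj_diff], so one formula holds on
    both sides of the equator. This makes [crossing] applicable to pairs of points that the equator
    separates. *)
Lemma chart_metric_proj A x y : orthogonal_mx A -> lcoord A x != 0 ->
  GA A x y = F (PM A x) (PD A x y).
Proof.
move=> AA lx; rewrite chart_metricE //; case: leP => l0.
  by apply: chart_bar_proj => //; rewrite lt_def lx.
rewrite -proj_mapN -proj_diffN; apply: chart_bar_proj; first exact: orthogonal_mxN.
by rewrite lcoordN oppr_gt0.
Qed.

Lemma chart_metricN_neq0 A x y : orthogonal_mx A -> lcoord A x != 0 -> GA (- A) x y = GA A x y.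
Proof.
move=> AA lx; rewrite !chart_metric_proj ?proj_mapN ?proj_diffN //; first exact: orthogonal_mxN.
by rewrite lcoordN oppr_eq0.
Qed.

Lemma chart_bar_finsler A : orthogonal_mx A -> finsler [set x | 0 <= lcoord A x] (Fb A).
Proof.
move=> AA; apply: finsler_sub (HFb AA) => x lx; apply: closure_hemisphere.
  exact: chart_param_sphere.
by have [r r0 ->] := last_coord_chart x AA; rewrite pmulr_rge0.
Qed.

Lemma chart_metric_minkowski A x : orthogonal_mx A -> minkowski_norm (GA A x).
Proof.
move=> AA; case: (leP 0 (lcoord A x)) => lx.
  have -> : GA A x = Fb A x by apply/funext => y; rewrite chart_metric_pos.
  by have [h _] := chart_bar_finsler AA; exact: h.
have -> : GA A x = Fb (- A) x by apply/funext => y; rewrite chart_metricE // leNgt lx.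
have [h _] := chart_bar_finsler (orthogonal_mxN AA); apply: h.
by rewrite /= lcoordN oppr_ge0 ltW.
Qed.

Lemma lcoord_fst_continuous A : continuous (fun p : V * V => lcoord A p.1).
Proof.
move=> p; apply: (@continuous_comp _ _ _ (fst : V * V -> V) (lcoord A)); first exact: cvg_fst.
exact: lcoord_continuous.
Qed.

Lemma chart_metric_finsler_neq0 A : orthogonal_mx A -> finsler [set x | lcoord A x != 0] (GA A).
Proof.
move=> AA; split=> [x _|p [lp p0]]; first exact: chart_metric_minkowski.
have main C (D : set V) : orthogonal_mx C -> D `<=` [set x | 0 <= lcoord C x] -> open D -> D p.1 ->
    (forall x y, D x -> GA A x y = Fb C x y) ->
    exists (U : set (V * V)) (g : V * V -> R), [/\ open U, U p, (forall k, class_C k U g) &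
      forall z, [set q : V * V | [set x | lcoord A x != 0] q.1 /\ q.2 != 0] z -> U z -> g z = GA A z.1 z.2].
  move=> CC DC Do Dp DE; have [_ h2] := chart_bar_finsler CC.
  have [U [g [Uo Up gC gf]]] := h2 p (conj (DC _ Dp) p0).
  exists (U `&` [set z | D z.1]), g; split=> //.
  - by apply: openI => //; apply: open_comp Do => z _; exact: cvg_fst.
  - by move=> k; apply: class_C_sub (gC k) => z [].
  by move=> z [_ z0] [Uz Dz]; rewrite gf //; [rewrite DE|split => //; exact: DC].
have [lx|lx] := ltP 0 (lcoord A p.1).
  apply: (main A [set x | 0 < lcoord A x]) => //.
  - by move=> x; exact: ltW.
  - exact: (open_comp (fun x _ => @lcoord_continuous _ _ A x) (@open_gt _ 0)).
  - by move=> x y /ltW h; rewrite chart_metric_pos.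
have l0 : lcoord A p.1 < 0 by rewrite lt_def eq_sym lp.
apply: (main (- A) [set x | lcoord A x < 0]) => //.
- exact: orthogonal_mxN.
- by move=> x /ltW h; rewrite /= lcoordN oppr_ge0.
- exact: (open_comp (fun x _ => @lcoord_continuous _ _ A x) (@open_lt _ 0)).
by move=> x y h; rewrite chart_metricE // leNgt h.
Qed.

Let D0 A := [set x | lcoord A x != 0].

Lemma D0_open A : open (D0 A).
Proof. exact: (open_comp (fun x _ => @lcoord_continuous _ _ A x) (@open_neq _ 0)). Qed.

Lemma chart_metric_proj_D0 A : orthogonal_mx A ->
  forall x y, D0 A x -> y != 0 -> GA A x y = F (PM A x) (PD A x y).
Proof. by move=> AA x y Dx _; exact: chart_metric_proj. Qed.

Lemma chart_metric_burgers_neq0 A : orthogonal_mx A -> burgers (D0 A) (GA A).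
Proof.
move=> AA; exact: (burgers_pulled HF B (acoord_aff A) (acoord'_lin A) (lcoord_aff A) (lcoord'_lin A) (@D0_open A)
  (chart_metric_finsler_neq0 AA) (fun x h => h) (chart_metric_proj_D0 AA)).
Qed.

Lemma chart_metric_crossing A x y : orthogonal_mx A -> D0 A x -> D0 A (1 *: y + x) -> y != 0 ->
  let p := pfac (GA A) (1 *: y + x) y in let f := GA A (1 *: y + x) y in
  GA A x y = f / ((1 + 1 * p) ^+ 2 + 1 ^+ 2 * f ^+ 2).
Proof.
move=> AA; exact: (crossing HF B (acoord_aff A) (lcoord_aff A) (@D0_open A)
  (chart_metric_finsler_neq0 AA) (fun x h => h) (chart_metric_proj_D0 AA)).
Qed.

(* A vector transverse to the equator reaches the region where the metric is known to be
   smooth, hence [chart_metric_crossing] with [s = 1]. *)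
Lemma transversal_glue A k (U : set (V * V)) (g1 g2 : V * V -> R) x y : orthogonal_mx A ->
  (forall z, U z -> 0 < lcoord A z.1 -> g1 z = GA A z.1 z.2) ->
  (forall z, U z -> lcoord A z.1 < 0 -> g2 z = GA A z.1 z.2) ->
  lcoord A x = 0 -> lcoord' A y != 0 ->
  transversal_at (fun p : V * V => lcoord A p.1) k U g1 g2 (x, y).
Proof.
move=> AA e1 e2 lx ly.
pose sh (p : V * V) : V * V := (1 *: p.2 + p.1, p.2).
have shaff (p q : V * V) (h : R) : sh (h *: q + p) = h *: sh q + sh p.
  rewrite /sh /=; congr (_, _) => //=.
  by rewrite !scale1r scalerDr !addrA; congr (_ + _); rewrite -!addrA; congr (_ + _); rewrite addrC.
have shc : continuous sh.
  move=> p; apply: (@cvg_pair _ _ _ _ (nbhs (1 *: p.2 + p.1)) (nbhs p.2)); last exact: cvg_snd.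
  have -> : (fun q : V * V => 1 *: q.2 + q.1) = (fun q : V * V => q.2 + q.1).
    by apply/funext => q; rewrite scale1r.
  rewrite scale1r; apply: (@cvgD _ _ _ _ _ (@snd V V) (@fst V V)); [exact: cvg_snd|exact: cvg_fst].
pose HG := chart_metric_finsler_neq0 AA.
pose f p := GA A p.1 p.2 / ((1 + 1 * pfac (GA A) p.1 p.2) ^+ 2 + 1 ^+ 2 * GA A p.1 p.2 ^+ 2).
have fpos p : slit (D0 A) p -> 0 < (1 + 1 * pfac (GA A) p.1 p.2) ^+ 2 + 1 ^+ 2 * GA A p.1 p.2 ^+ 2.
  by move=> [Dp p0]; apply: line_den_gt0; exact: (finsler_pos HG).
have So := open_slit (@D0_open A).
have GC := finsler_smooth (@D0_open A) HG; have PC := pfac_smooth (@D0_open A) HG.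
have fC : class_C k (slit (D0 A)) f.
  apply: class_C_mul => //; apply: class_C_inv => //.
    by move=> p /fpos h; rewrite gt_eqF.
  have c1 : class_C k (slit (D0 A)) (fun p => 1 + 1 * pfac (GA A) p.1 p.2).
    by apply: class_CDd => //; [exact: class_C_cst|apply: class_C_mul => //; exact: class_C_cst].
  apply: (@class_C_eq _ _ _ _ _ (fun p => (1 + 1 * pfac (GA A) p.1 p.2) * (1 + 1 * pfac (GA A) p.1 p.2) + GA A p.1 p.2 * GA A p.1 p.2)) => //.
    by move=> p _; move: (pfac _ _ _) (GA A _ _) => a b; ring.
  by apply: class_CDd => //; apply: class_C_mul.
exists (sh @^-1` slit (D0 A)), (f \o sh); split.
- by apply: open_comp => // p _; exact: shc.
- split; rewrite /= /D0 /= ?lcoord_aff ?lx ?addr0 ?mul1r //.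
  by apply: contra ly => /eqP ->; rewrite /lcoord' dinc0 /last_coord mxE.
- exact: class_C_comp_aff shaff So fC.
move=> [a b] /= [D1 b0] Uz; split=> l0.
  by rewrite e1 // (chart_metric_crossing AA (x := a) (y := b)) // /D0 /= gt_eqF.
by rewrite e2 // (chart_metric_crossing AA (x := a) (y := b)) // /D0 /= lt_eqF.
Qed.

(** Off the equator the metric is that of one half. On it, smoothness up to the boundary provides
    extensions [g1] and [g2] of the halves across the equator, which are glued there. *)
Lemma chart_metric_finsler A : orthogonal_mx A -> finsler setT (GA A).
Proof.
move=> AA; split=> [x _|p [_ p0]]; first exact: chart_metric_minkowski.
have [lp|lp] := eqVneq (lcoord A p.1) 0; last first.
  have [_ h2] := chart_metric_finsler_neq0 AA.
  have [U [g [Uo Up gC gf]]] := h2 p (conj lp p0).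
  exists (U `&` slit (D0 A)), g; split=> //.
  - by apply: openI => //; exact: open_slit (@D0_open A).
  - by move=> k; apply: class_C_sub (gC k) => z [].
  by move=> z _ [Uz Dz]; rewrite gf.
have [_ h1] := chart_bar_finsler AA; have [_ h2] := chart_bar_finsler (orthogonal_mxN AA).
have [|U1 [g1 [U1o U1p g1C g1f]]] := h1 p; first by split=> //=; rewrite lp.
have [|U2 [g2 [U2o U2p g2C g2f]]] := h2 p; first by split=> //=; rewrite lcoordN lp oppr0.
pose U := U1 `&` U2 `&` [set z | z.2 != 0].
have Uo : open U.
  apply: openI; first exact: openI.
  have -> : [set z : V * V | z.2 != 0] = slit setT by apply/seteqP; split=> z //= [].
  exact: open_slit openT.
have e1 z : U z -> 0 <= lcoord A z.1 -> g1 z = GA A z.1 z.2.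
  by move=> [[Uz _] z0] lz; rewrite g1f // chart_metric_pos.
have e2 z : U z -> lcoord A z.1 < 0 -> g2 z = GA A z.1 z.2.
  move=> [[_ Uz] z0] lz; rewrite g2f //; first by rewrite chart_metricE // leNgt lz.
  by split=> //=; rewrite lcoordN oppr_ge0 ltW.
exists U, (half_glue (fun p : V * V => lcoord A p.1) g1 g2); split=> //; last first.
  by move=> z _ Uz; rewrite /half_glue; case: leP => lz; [exact: e1|exact: e2].
move=> k; have C1 : class_C k U g1 by apply: class_C_sub (g1C k) => z [[]].
have C2 : class_C k U g2 by apply: class_C_sub (g2C k) => z [[]].
have Laff (z v : V * V) (h : R) : lcoord A (h *: v + z).1 = h * lcoord' A v.1 + lcoord A z.1.
  by rewrite lcoord_aff.
have [v0 lv0] := lcoord_transverse AA lp.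
apply: (glue_class_C (lcoord_fst_continuous (A := A)) Uo C1 C2).
apply: (@match_C_transversal _ _ _ (fun p : V * V => lcoord' A p.1) (lcoord_fst_continuous (A := A)) Laff) => //.
  by exists (v0, 0); rewrite /= lv0 oner_eq0.
move=> [x y] N Ux lx Nx; rewrite /= in lx.
(* The base point stays on the equator and only the vector is tilted by [s *: v0], which makes it
   transverse for some small positive [s]. *)
pose c (s : R) : V * V := s *: (0, v0) + (x, y).
have cc := is_derive_continuous (is_derive_aff (0 : V, v0) (x, y) (0 : R)).
have Nc : nbhs (c 0) (N `&` U).
  by rewrite /c scale0r add0r; apply: filterI => //; exact: open_nbhs_nbhs.
have cl := cvg_at_right_filter cc.
have pos : \forall s \near (0:R)^'+, 0 < s by exact: nbhs_right_gt.
have nd : \forall s \near (0:R)^'+, lcoord' A (s *: v0 + y) != 0.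
  have [e|ne] := eqVneq (lcoord' A y) 0.
    by apply: filterS pos => s s0; rewrite lcoord'_lin lv0 e mulr1 addr0 gt_eqF.
  have lc : {for (0:R), continuous (fun s : R => lcoord' A (s *: v0 + y))}.
    have -> : (fun s : R => lcoord' A (s *: v0 + y)) = (fun s : R => s * 1 + lcoord' A y).
      by apply/funext => s; rewrite lcoord'_lin lv0.
    exact: (is_derive_continuous (is_derive_affr 1 (lcoord' A y) 0)).
  have := cvg_at_right_filter lc; rewrite scale0r add0r => /(_ [set r | r != 0]); apply.
  by apply: open_nbhs_nbhs; split => //; exact: open_neq.
have [s [ns [Ns Us]]] := filter_ex (filterI nd (cl _ Nc)).
have cE : c s = (x, s *: v0 + y) by rewrite /c; congr (_, _); rewrite /= scaler0 add0r.
exists (x, s *: v0 + y); rewrite -cE; split=> //; first by rewrite cE.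
rewrite cE; apply: transversal_glue => //.
- by move=> z Uz /ltW; exact: e1.
Qed.

Lemma lcoord_dense A x N : orthogonal_mx A -> nbhs x N -> exists2 z : V, N z & lcoord A z != 0.
Proof.
move=> AA Nx; have [lx|lx] := eqVneq (lcoord A x) 0; last by exists x => //; exact: nbhs_singleton.
have [v lv] := lcoord_transverse AA lx.
have cc := is_derive_continuous (is_derive_aff v x (0 : R)).
have Nc : nbhs (0 *: v + x) N by rewrite scale0r add0r.
have cl := cvg_at_right_filter cc.
have [s [s0 Ns]] := filter_ex (filterI (nbhs_right_gt (0 : R)) (cl _ Nc)).
by exists (s *: v + x) => //; rewrite lcoord_aff lv lx mulr1 addr0 gt_eqF.
Qed.

Lemma smoothF_cont (f : V -> V -> R) x y : smoothF setT f -> y != 0 -> {for x, continuous (fun z => f z y)}.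
Proof.
move=> fC y0; have c1 := class_C_cont (fC 0%N) (conj (I : setT (x, y).1) y0 : slit setT (x, y)).
have c2 : {for x, continuous (fun z : V => (z, y))}.
  have h1 : {for x, continuous (fun z : V => z)} by exact: cvg_id.
  have h2 : {for x, continuous (fun z : V => y)} by exact: cst_continuous.
  exact: (cvg_pair h1 h2).
exact: (@continuous_comp _ _ _ (fun z : V => (z, y)) (fun p : V * V => f p.1 p.2) x c2 c1).
Qed.

Lemma dense_zero A (f : V -> V -> R) x y : orthogonal_mx A -> smoothF setT f -> y != 0 ->
  (forall z, lcoord A z != 0 -> f z y = 0) -> f x y = 0.
Proof.
move=> AA fC y0 H; apply: (adherent_zero (f := fun z => f z y)); first exact: smoothF_cont.
by move=> N /(lcoord_dense AA)[z Nz /H]; exists z.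
Qed.

Let Topen : open [set: V] := openT.

(** On the equator itself the charts of [A] and [- A] read the extended metric at antipodal points,
    so the equality there is reached by density. *)
Lemma chart_metricN A x y : orthogonal_mx A -> GA (- A) x y = GA A x y.
Proof.
move=> AA; have HG := chart_metric_finsler AA; have HGN := chart_metric_finsler (orthogonal_mxN AA).
have [->|y0] := eqVneq y 0; first by rewrite (finsler0 HG) // (finsler0 HGN).
apply/eqP; rewrite -subr_eq0; apply/eqP.
apply: (@dense_zero A (fun x y => GA (- A) x y - GA A x y)) => //.
  by apply: smoothFB => //; exact: finsler_smooth.
by move=> z lz; rewrite chart_metricN_neq0 // subrr.
Qed.

Lemma chart_metric_burgers A : orthogonal_mx A -> burgers setT (GA A).
Proof.
move=> AA u x y _ y0; have HG := chart_metric_finsler AA.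
have GC := finsler_smooth Topen HG; have PC := pfac_smooth Topen HG.
have BG := chart_metric_burgers_neq0 AA.
have dxG := smoothF_dx Topen u GC; have dyG := smoothF_dy Topen u GC.
have dxP := smoothF_dx Topen u PC; have dyP := smoothF_dy Topen u PC.
split; apply/eqP; rewrite -subr_eq0; apply/eqP.
- apply: (@dense_zero A (fun x y => dx (GA A) u x y - (pfac (GA A) x y * dy (GA A) u x y + GA A x y * dy (pfac (GA A)) u x y))) => //.
    by apply: (smoothFB Topen) => //; apply: (smoothFD Topen); exact: (smoothFM Topen).
  by move=> z lz; have [e _] := BG u z y lz y0; rewrite e subrr.
- apply: (@dense_zero A (fun x y => dx (pfac (GA A)) u x y - (pfac (GA A) x y * dy (pfac (GA A)) u x y - GA A x y * dy (GA A) u x y))) => //.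
    by apply: (smoothFB Topen) => //; apply: (smoothFB Topen); exact: (smoothFM Topen).
  by move=> z lz; have [_ e] := BG u z y lz y0; rewrite e subrr.
Qed.

Lemma double_metric_finsler : sphere_finsler sphere G.
Proof. by move=> A AA; apply: finsler_sub (chart_metric_finsler AA) => x _. Qed.

Lemma double_metric_curvature : sphere_const_flag_curvature G 1.
Proof. by move=> A AA; exact: (burgers_curvature Topen (chart_metric_finsler AA) (chart_metric_burgers AA)). Qed.

Lemma double_metric_hemisphere w v : hemisphere w -> tangent w v -> G w v = pullback gnomonic_inv F w v.
Proof.
move=> h t; rewrite -FbE // /double_metric; case: (h) => _ /ltW ->.
by rewrite t scale0r subr0.
Qed.

End SphereMetric.

(** * Geodesics of the sphere *)

Section Circles.
Context {R : realType} {m : nat}.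
Implicit Types (f g u : 'rV[R]_m) (k t : R).

Definition circ f g k t : 'rV[R]_m := cos (k * t) *: f + sin (k * t) *: g.

Definition indep f g := forall a b : R, a *: f + b *: g = 0 -> a = 0 /\ b = 0.

Lemma circ_neq0 f g k t : indep f g -> circ f g k t != 0.
Proof.
move=> I; apply/eqP => /I[c0 s0]; have := cos2Dsin2 (k * t).
by rewrite c0 s0 expr0n addr0 => /esym/eqP; rewrite oner_eq0.
Qed.

Lemma is_derive_cosk k t : is_derive t (1:R) (fun s => cos (k * s)) (- k * sin (k * t)).
Proof.
have dk : is_derive t (1:R) (fun s : R => k * s) k.
  apply: (@is_derive_eq _ _ _ _ _ _ _ _ (is_derive_mulr (is_derive_cst k t (1:R)) (is_derive_id1 t))).
  by rewrite mulr1 mul0r add0r.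
apply: (@is_derive_eq _ _ _ _ _ _ _ _ (is_derive1_comp (is_derive_cos (k * t)) dk)).
by rewrite -[LHS]/(_ * _); ring.
Qed.

Lemma is_derive_sink k t : is_derive t (1:R) (fun s => sin (k * s)) (k * cos (k * t)).
Proof.
have dk : is_derive t (1:R) (fun s : R => k * s) k.
  apply: (@is_derive_eq _ _ _ _ _ _ _ _ (is_derive_mulr (is_derive_cst k t (1:R)) (is_derive_id1 t))).
  by rewrite mulr1 mul0r add0r.
apply: (@is_derive_eq _ _ _ _ _ _ _ _ (is_derive1_comp (is_derive_sin (k * t)) dk)).
by rewrite mulrC.
Qed.

Lemma is_derive_circ f g k t :
  is_derive t (1:R) (circ f g k) (circ (k *: g) (- k *: f) k t).
Proof.
apply/is_derive_coordP => i.
have -> : (fun s => circ f g k s 0 i) = (fun s => cos (k * s) * f 0 i + sin (k * s) * g 0 i).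
  by apply/funext => s; rewrite !mxE.
have d1 := is_derive_mulr (is_derive_cosk k t) (is_derive_cst (f 0 i) t (1:R)).
have d2 := is_derive_mulr (is_derive_sink k t) (is_derive_cst (g 0 i) t (1:R)).
apply: (@is_derive_eq _ _ _ _ _ _ _ _ (is_deriveD d1 d2)).
by rewrite !fctE !mxE; ring.
Qed.

Lemma circ_continuous f g k : continuous (circ f g k).
Proof. by move=> t; exact: is_derive_continuous (is_derive_circ f g k t). Qed.

Lemma class_C_circ f g k j : class_C j setT (circ f g k).
Proof.
elim: j f g => [|j IH] f g; first by split; [move=> x _; exact: circ_continuous|].
split; first by move=> x _; exact: circ_continuous.
have D (v t : R) : is_derive t v (circ f g k) (circ (v *: (k *: g)) (v *: (- k *: f)) k t).
  apply/is_derive_rowP => i; have H := (is_derive_coordP _ _ _).1 (is_derive_circ f g k t) i.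
  have [d1 d2] := H; have := is_derive_scale v d1; rewrite d2 -[v *: 1]/(v * 1) mulr1 => h.
  by apply: (@is_derive_eq _ _ _ _ _ _ _ _ h); rewrite !mxE; ring.
move=> v; split; first by move=> x _; have [] := D v x.
apply: class_C_eq (IH (v *: (k *: g)) (v *: (- k *: f))) => //; first exact: openT.
by move=> x _; have [_ ->] := D v x.
Qed.

End Circles.

Section ChartCoordinates.
Context {R : realType} {n : nat}.
Notation V := 'rV[R]_n.
Notation E := 'rV[R]_(n + 1).
Implicit Types (A C : 'M[R]_(n + 1)) (x y : V) (u w v : E).

Lemma erowE A : erow *m A = inc A 0. Proof. by []. Qed.

Lemma edot_erow : edot (erow : E) erow = 1.
Proof. by rewrite edot_row edot0l mxE eqxx mulr1 add0r. Qed.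

Lemma householder m (u : 'rV[R]_m) : u != 0 ->
  exists2 H : 'M[R]_m, H *m H^T = 1%:M & forall w : 'rV[R]_m, w *m H = w - (2 * edot w u / edot u u) *: u.
Proof.
rewrite -edot_gt0 => /lt0r_neq0 u0; pose c := (edot u u)^-1.
have dotM (w z : 'rV[R]_m) : w *m z^T = (edot w z)%:M.
  by apply/matrixP => i j; rewrite (ord1 i) (ord1 j) -edotE mxE eqxx.
exists (1%:M - (2 * c) *: (u^T *m u)); last first.
  move=> w; rewrite mulmxBr mulmx1 -scalemxAr mulmxA dotM mul_scalar_mx scalerA.
  by congr (_ - _ *: _); rewrite /c; move: (edot w u) (edot u u) u0 => a b b0; field.
have At : (1%:M - (2 * c) *: (u^T *m u))^T = 1%:M - (2 * c) *: (u^T *m u).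
  by rewrite linearB /= trmx1 linearZ /= trmx_mul trmxK.
rewrite At mulmxBl mul1mx mulmxBr mulmx1 -scalemxAl -scalemxAr.
have -> : u^T *m u *m (u^T *m u) = edot u u *: (u^T *m u).
  by rewrite mulmxA -[u^T *m u *m _]mulmxA dotM mul_mx_scalar -scalemxAl.
rewrite opprB -addrA [X in _ + X](_ : _ = 0) ?addr0 // !scalerA -scalerBl -scaleNr -scalerDl.
rewrite [X in X *: _](_ : _ = 0) ?scale0r //.
by rewrite /c; move: (edot u u) u0 => a a0; field.
Qed.

(** The reflection in the direction [erow - w] exchanges these two unit vectors; [w = erow] is a
    separate case because the direction vanishes. *)
Lemma chart_at w : sphere w -> exists2 A, orthogonal_mx A & inc A 0 = w.
Proof.
move=> Sw; have Sw' : edot w w = 1 := Sw.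
have [->|ne] := eqVneq w erow; first by exists 1%:M; [exact: orthogonal1|rewrite -erowE mulmx1].
have u0 : (erow : E) - w != 0 by rewrite subr_eq0 eq_sym.
have [H HH HE] := householder u0; exists H => //; rewrite -erowE HE.
have d0 : edot ((erow : E) - w) (erow - w) != 0 by rewrite gt_eqF // edot_gt0.
have -> : 2 * edot erow (erow - w) = edot ((erow : E) - w) (erow - w).
  by rewrite !edotBl !edotBr edot_erow Sw' [edot w _]edotC; ring.
by rewrite mulfV // scale1r opprB addrC subrK.
Qed.

(** [ba A u] and [bl A u] are homogeneous coordinates of [u] in the chart. Their quotient is
    [chart_coord], and they stay meaningful for points at infinity of the chart. *)
Definition bl A u : R := last_coord (u *m A^T).
Definition ba A u : V := lsubmx (u *m A^T).

Lemma chart_coordE A u : chart_coord A u = (bl A u)^-1 *: ba A u. Proof. by []. Qed.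

Lemma bl_lin A u v (h : R) : bl A (h *: v + u) = h * bl A v + bl A u.
Proof. by rewrite /bl mulmxDl -scalemxAl last_coordD. Qed.

Lemma ba_lin A u v (h : R) : ba A (h *: v + u) = h *: ba A v + ba A u.
Proof. by rewrite /ba mulmxDl -scalemxAl linearD linearZ. Qed.

Lemma blZ A u (h : R) : bl A (h *: u) = h * bl A u.
Proof. by rewrite /bl -scalemxAl /last_coord mxE. Qed.

Lemma baZ A u (h : R) : ba A (h *: u) = h *: ba A u.
Proof. by rewrite /ba -scalemxAl linearZ. Qed.

Lemma bl_inc A x : orthogonal_mx A -> bl A (inc A x) = 1.
Proof. by move=> AA; rewrite /bl /inc -mulmxA AA mulmx1 /last_coord row_mxEr mxE eqxx. Qed.

Lemma ba_inc A x : orthogonal_mx A -> ba A (inc A x) = x.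
Proof. by move=> AA; rewrite /ba /inc -mulmxA AA mulmx1 row_mxKl. Qed.

Lemma bl_dinc A x : orthogonal_mx A -> bl A (dinc A x) = 0.
Proof. by move=> AA; rewrite /bl /dinc -mulmxA AA mulmx1 /last_coord row_mxEr mxE. Qed.

Lemma ba_dinc A x : orthogonal_mx A -> ba A (dinc A x) = x.
Proof. by move=> AA; rewrite /ba /dinc -mulmxA AA mulmx1 row_mxKl. Qed.

Lemma chart_frame A u x : orthogonal_mx A -> u = bl A u *: inc A x + dinc A (ba A u - bl A u *: x).
Proof.
move=> AA; rewrite -[X in X = _]mulmx1 -(orthogonal_mxT AA) mulmxA.
exact: mulmx_inc.
Qed.

Lemma inc_coord A u : orthogonal_mx A -> bl A u != 0 -> inc A (chart_coord A u) = (bl A u)^-1 *: u.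
Proof.
move=> AA b0; have e : ba A u - bl A u *: chart_coord A u = 0.
  by rewrite chart_coordE scalerA mulfV // scale1r subrr.
have h := chart_frame u (chart_coord A u) AA; rewrite e dinc0 addr0 in h.
by apply: (scalerI b0); rewrite -h scalerA mulfV // scale1r.
Qed.

Lemma chart_coord_normalize A u : u != 0 -> chart_coord A (normalize u) = chart_coord A u.
Proof.
move=> u0; have s0 := normalize_gt0 u0; rewrite !chart_coordE /normalize blZ baZ scalerA invfM mulrAC.
by rewrite mulVf ?mul1r // gt_eqF.
Qed.

Lemma chart_domE A w : orthogonal_mx A -> chart_dom A w <-> sphere w /\ 0 < bl A w.
Proof.
move=> AA; rewrite /chart_dom /hemisphere /= /sphere /= edot_mulmx //.
by rewrite trmxK; exact: orthogonal_mxT.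
Qed.

Lemma chart_dom_normalize A u : orthogonal_mx A -> u != 0 -> chart_dom A (normalize u) <-> 0 < bl A u.
Proof.
move=> AA u0; split=> [/(chart_domE _ AA)[_]|b0]; last apply/(chart_domE _ AA); rewrite /normalize ?blZ.
  by rewrite pmulr_rgt0 // normalize_gt0.
by split; [exact: normalize_sphere|rewrite mulr_gt0 // normalize_gt0].
Qed.

Lemma chart_param_coord A u : orthogonal_mx A -> 0 < bl A u -> chart_param A (chart_coord A u) = normalize u.
Proof. by move=> AA b0; rewrite chart_paramE // inc_coord ?gt_eqF // normalizeZ // invr_gt0. Qed.

Lemma chart_param_coordK A w : orthogonal_mx A -> chart_dom A w -> chart_param A (chart_coord A w) = w.
Proof. by move=> AA /(chart_domE _ AA)[Sw b0]; rewrite chart_param_coord // normalize_id. Qed.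

Lemma chart_dom_param A x : orthogonal_mx A -> chart_dom A (chart_param A x).
Proof. by move=> AA; rewrite chart_paramE //; apply/(chart_dom_normalize AA (inc_neq0 x AA)); rewrite bl_inc. Qed.

Lemma bl_continuous A : continuous (bl A).
Proof.
have ff u v (h : R) : bl A (h *: v + u) = h *: bl A v + bl A u by exact: bl_lin.
exact: (affine_continuous ff).
Qed.

Lemma is_derive_bl A (c : R -> E) t v : is_derive t (1:R) c v -> is_derive t (1:R) (fun s => bl A (c s)) (bl A v).
Proof.
move=> dc; have S u : bl A u = edot u (\row_j A (rshift n ord0) j).
  by rewrite /bl /last_coord mxE; apply: eq_bigr => j _; rewrite !mxE.
have -> : (fun s => bl A (c s)) = (fun s => edot (c s) (\row_j A (rshift n ord0) j)).
  by apply/funext => s; exact: S.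
apply: (@is_derive_eq _ _ _ _ _ _ _ _ (is_derive_edot dc (is_derive_cst _ t (1:R)))).
by rewrite S [edot _ 0]edotC edot0l addr0.
Qed.

Lemma is_derive_ba A (c : R -> E) t v : is_derive t (1:R) c v -> is_derive t (1:R) (fun s => ba A (c s)) (ba A v).
Proof.
move=> dc; apply/is_derive_coordP => i; have S u : ba A u 0 i = edot u (\row_j A (lshift 1 i) j).
  by rewrite /ba !mxE; apply: eq_bigr => j _; rewrite !mxE.
have -> : (fun s => ba A (c s) 0 i) = (fun s => edot (c s) (\row_j A (lshift 1 i) j)).
  by apply/funext => s; exact: S.
apply: (@is_derive_eq _ _ _ _ _ _ _ _ (is_derive_edot dc (is_derive_cst _ t (1:R)))).
by rewrite S [edot _ 0]edotC edot0l addr0.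
Qed.

Definition coord_diff A u v : V := (bl A u)^-2 *: (bl A u *: ba A v - bl A v *: ba A u).

Lemma is_derive_chart_coord A (c : R -> E) t v : bl A (c t) != 0 -> is_derive t (1:R) c v ->
  is_derive t (1:R) (fun s => chart_coord A (c s)) (coord_diff A (c t) v).
Proof.
move=> b0 dc; apply/is_derive_coordP => i.
have db := is_derive_bl A dc; have da := (is_derive_coordP _ _ _).1 (is_derive_ba A dc) i.
have -> : (fun s => chart_coord A (c s) 0 i) = (fun s => ba A (c s) 0 i / bl A (c s)).
  by apply/funext => s; rewrite chart_coordE mxE mulrC.
apply: (@is_derive_eq _ _ _ _ _ _ _ _ (@is_derive_div _ _ (fun s => bl A (c s)) t _ _ b0 da db)).
rewrite /coord_diff; move: (bl A (c t)) (bl A v) b0 (ba A v) (ba A (c t)) => b b' b0 x y.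
by rewrite !mxE; field.
Qed.

End ChartCoordinates.

Lemma near_ereal_itv {R : realType} (lo hi : \bar R) (s : R) : (lo < s%:E)%E -> (s%:E < hi)%E ->
  \forall z \near s, (lo < z%:E)%E /\ (z%:E < hi)%E.
Proof.
move=> ls hs; apply: filterI; apply: open_nbhs_nbhs; split=> //.
  exact: open_ereal_gt.
exact: open_ereal_lt.
Qed.

Lemma affine_diff (R : realFieldType) (a b k s t : R) : a + (s * k + 0) = b + (t * k + 0) -> b - a = k * (s - t).
Proof. by move=> e; lra. Qed.

(** * Closed form of the geodesics in a chart *)

Section GeodesicForm.
Context {R : realType} {n : nat}.
Notation V := 'rV[R]_n.
Variables (D : set V) (Dopen : open D) (F : V -> V -> R) (HF : finsler D F) (B : burgers D F).

(** With [a0 - a] the angle elapsed since the initial time, the bracket equals [cos a / cos a0];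
    this keeps the denominator of [geodesic_form] positive. *)
Lemma slope_trig (k q0 q a a0 : R) : a0 = atan q0 -> a = atan q ->
  0 < cos (a0 - a) + q0 * sin (a0 - a) /\
  (q0 - q) / (1 + q0 ^+ 2) * (cos (a0 - a) + q0 * sin (a0 - a)) = sin (a0 - a).
Proof.
move=> h0 h; have c0 : 0 < cos a0 by rewrite h0 cos_gt0_pihalf // atan_gtNpi2 atan_ltpi2.
have c1 : 0 < cos a by rewrite h cos_gt0_pihalf // atan_gtNpi2 atan_ltpi2.
have q0E : q0 = sin a0 / cos a0 by rewrite h0 -[LHS]atanK.
have qE : q = sin a / cos a by rewrite h -[LHS]atanK.
rewrite sinB cosB q0E qE.
have := cos2Dsin2 a0; have := cos2Dsin2 a.
move: (cos a0) (sin a0) (cos a) (sin a) c0 c1 => x y z w x0 z0 e1 e2.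
have xn : x != 0 by rewrite gt_eqF. have zn : z != 0 by rewrite gt_eqF.
have mE : x * z + y * w + y / x * (y * z - x * w) = z / x.
  by apply: (mulIf xn); rewrite divfK // mulrDl mulrAC divfK // -[RHS]mulr1 -e2; ring.
split; first by rewrite mE divr_gt0.
rewrite mE; have -> : 1 + (y / x) ^+ 2 = x ^- 2.
  by rewrite -[RHS]mul1r -[X in _ = X * _]e2; field.
by field; rewrite zn xn.
Qed.

(** With [q = P / k], the equations [q' = - k (1 + q ^ 2)] and [c'' = - 2 P c'] make
    [c' / (1 + q ^ 2)] constant. Hence c is an affine function of [q], that is, of the tangent of an
    angle decreasing at the rate [k]. *)
Lemma geodesic_form lo hi c (k : R) t0 : 0 < k ->
  (forall t : R, (lo < t%:E)%E -> (t%:E < hi)%E -> D (c t) /\ geodesic_eq_at F c t) ->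
  (forall t : R, (lo < t%:E)%E -> (t%:E < hi)%E -> F (c t) (derive1 c t) = k) ->
  (lo < t0%:E)%E -> (t0%:E < hi)%E ->
  let p := pfac F (c t0) (derive1 c t0) in
  forall t : R, (lo < t%:E)%E -> (t%:E < hi)%E ->
    let m := cos (k * (t - t0)) + p / k * sin (k * (t - t0)) in
    0 < m /\ c t = (sin (k * (t - t0)) / k / m) *: derive1 c t0 + c t0.
Proof.
move=> k0 cg ck l0 h0 p t l h m.
have nz s : (lo < s%:E)%E -> (s%:E < hi)%E -> derive1 c s != 0.
  move=> ls hs; apply/eqP => e; have := ck s ls hs; rewrite e (finsler0 HF); last by have [] := cg s ls hs.
  by move=> e'; rewrite -e' ltxx in k0.
pose q s := pfac F (c s) (derive1 c s) / k.
have qd s : (lo < s%:E)%E -> (s%:E < hi)%E -> is_derive s (1:R) (fun s => atan (q s)) (- k).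
  move=> ls hs; have [Ds gs] := cg s ls hs.
  have := slope_geodesic Dopen HF B Ds (nz s ls hs) gs; rewrite ck //; apply: near_eq_is_derive.
  by apply: filterS (near_ereal_itv ls hs) => z [lz hz]; rewrite /q ck.
have th s : (lo < s%:E)%E -> (s%:E < hi)%E -> atan (q t0) - atan (q s) = k * (s - t0).
  move=> ls hs; have dk z : is_derive z (1:R) (fun z : R => z * k + 0) k by exact: is_derive_affr.
  have H z : (lo < z%:E)%E -> (z%:E < hi)%E -> is_derive z (1:R) (fun z => atan (q z) + (z * k + 0)) 0.
    move=> lz hz; apply: (@is_derive_eq _ _ _ _ _ _ _ _ (is_deriveD (qd z lz hz) (dk z))).
    by rewrite addNr.
  exact: affine_diff (derive0_cst H ls hs l0 h0).
have dq s : (lo < s%:E)%E -> (s%:E < hi)%E -> is_derive s (1:R) q (- k * (1 + q s ^+ 2)).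
  move=> ls hs; have [Ds gs] := cg s ls hs.
  have [_ dc2] := geodesic_eq_straight Dopen HF B Ds (nz s ls hs) gs.
  have [dc1 _] := geodesic_eq_straight Dopen HF B Ds (nz s ls hs) gs.
  have dp := is_derive_chain Dopen (pfac_smooth Dopen HF) Ds (nz s ls hs) dc1 dc2.
  rewrite (dyZ Dopen _ _ (pfac_smooth Dopen HF) Ds (nz s ls hs)) in dp.
  rewrite (burgers_dxP Dopen HF B Ds (nz s ls hs)) in dp.
  rewrite (@euler _ _ D Dopen 1 _ _ _ (pfac_homog Dopen HF) (pfac_smooth Dopen HF) Ds (nz s ls hs)) ck // in dp.
  apply: (@is_derive_eq _ _ _ _ _ _ _ _ (is_derive_mulr dp (is_derive_cst (k^-1) s (1:R)))).
  rewrite !fctE /q; move: (pfac F _ _) => P; have k1 : k != 0 by rewrite gt_eqF.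
  by field.
pose v s := (1 + q s ^+ 2)^-1 *: derive1 c s.
have q1 s : 1 + q s ^+ 2 != 0 by rewrite gt_eqF // ltr_pwDl // sqr_ge0.
have dv s : (lo < s%:E)%E -> (s%:E < hi)%E -> forall i, is_derive s (1:R) (fun s => v s 0 i) 0.
  move=> ls hs i; have [Ds gs] := cg s ls hs.
  have [_ /is_derive_coordP/(_ i) dc2] := geodesic_eq_straight Dopen HF B Ds (nz s ls hs) gs.
  have -> : (fun s => v s 0 i) = (fun s => derive1 c s 0 i / (1 + q s * q s)).
    by apply/funext => z; rewrite /v mxE mulrC expr2.
  have qq := is_deriveD (is_derive_cst (1:R) s (1:R)) (is_derive_mulr (dq s ls hs) (dq s ls hs)).
  have q1' : (cst 1 + (fun z => q z * q z)) s != 0 by rewrite !fctE -expr2.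
  apply: (@is_derive_eq _ _ _ _ _ _ _ _ (is_derive_div q1' dc2 qq)).
  have PE : pfac F (c s) (derive1 c s) = q s * k by rewrite /q divfK // gt_eqF.
  rewrite !fctE add0r mxE PE; move: (q s) (derive1 c s 0 i) (q1 s) => Q a; rewrite expr2 => k2.
  by field.
have vE s : (lo < s%:E)%E -> (s%:E < hi)%E -> v s = v t0.
  move=> ls hs; apply/rowP => i; apply: (@derive0_cst _ (fun s => v s 0 i) lo hi) => // z lz hz.
  exact: dv.
have dw s : (lo < s%:E)%E -> (s%:E < hi)%E -> forall i, is_derive s (1:R) (fun s => c s 0 i + q s * (v t0 0 i / k)) 0.
  move=> ls hs i; have [Ds gs] := cg s ls hs.
  have [/is_derive_coordP/(_ i) dc1 _] := geodesic_eq_straight Dopen HF B Ds (nz s ls hs) gs.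
  apply: (@is_derive_eq _ _ _ _ _ _ _ _ (is_deriveD dc1 (is_derive_mulr (dq s ls hs) (is_derive_cst (v t0 0 i / k) s (1:R))))).
  rewrite !fctE mulr0 addr0 -(vE s ls hs) /v mxE.
  have k1 : k != 0 by rewrite gt_eqF.
  by move: (derive1 c s 0 i) (1 + q s ^+ 2) (q1 s) => a b b0; field; rewrite k1 b0.
have tE : atan (q t0) - atan (q t) = k * (t - t0) by exact: th.
have [m0 sE] := @slope_trig k (q t0) (q t) (atan (q t)) (atan (q t0)) erefl erefl.
rewrite tE -[q t0]/(p / k) -/m in m0 sE; split=> //.
have -> : sin (k * (t - t0)) / k / m = (q t0 - q t) / (1 + q t0 ^+ 2) / k.
  rewrite -sE -[q t0]/(p / k); have k1 : k != 0 by rewrite gt_eqF. have m1 : m != 0 by rewrite gt_eqF.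
  by rewrite mulrAC mulfK.
apply/rowP => i; have := @derive0_cst _ _ lo hi (fun z lz hz => dw z lz hz i) t t0 l h l0 h0.
rewrite /v !mxE; move: (c t 0 i) (c t0 0 i) (derive1 c t0 0 i) (q t) (q t0) (q1 t0) => a b d x y y1 e.
have k1 : k != 0 by rewrite gt_eqF.
have -> : a = b + y * ((1 + y ^+ 2)^-1 * d / k) - x * ((1 + y ^+ 2)^-1 * d / k) by rewrite -e addrK.
by field; rewrite k1 y1.
Qed.

End GeodesicForm.

Section SphereGeodesics.
Context {R : realType} {n : nat}.
Notation V := 'rV[R]_n.
Notation E := 'rV[R]_(n + 1).
Variable G : E -> E -> R.
Notation GA A := (pullback (chart_param A) G).
Hypotheses (GF : forall A, orthogonal_mx A -> finsler setT (GA A))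
  (GB : forall A, orthogonal_mx A -> burgers setT (GA A))
  (GN : forall A x y, orthogonal_mx A -> GA (- A) x y = GA A x y).
Implicit Types (A C : 'M[R]_(n + 1)) (x y : V) (u w v : E).

Let Topen : open [set: V] := openT.

(** Chosen so that the combination of [inc A x] and [frame A x y] with coefficients cosine and sine
    is [inc] of the point given by [geodesic_form], multiplied by the denominator [m] found
    there. *)
Definition frame A x y : E :=
  (pfac (GA A) x y / GA A x y) *: inc A x + (GA A x y)^-1 *: dinc A y.

(* The great circle through chart_param A x with velocity 'D_y (chart_param A) x. *)
Definition great A x y (t : R) : E := normalize (circ (inc A x) (frame A x y) (GA A x y) t).

Lemma frame_indep A x y : orthogonal_mx A -> y != 0 -> indep (inc A x) (frame A x y).
Proof.
move=> AA y0 a b; rewrite /frame; have k0 : GA A x y != 0.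
  by rewrite gt_eqF // (finsler_pos (GF AA)).
rewrite scalerDr !scalerA addrA -scalerDl addrC => e.
have h1 := congr1 (bl A) e; have h2 := congr1 (ba A) e.
rewrite bl_lin blZ bl_dinc // bl_inc // mulr0 add0r mulr1 in h1.
have z1 : bl A 0 = 0 by rewrite -[0](scale0r (0 : E)) blZ mul0r.
have z2 : ba A 0 = 0 by rewrite -[0](scale0r (0 : E)) baZ scale0r.
rewrite z1 in h1; rewrite ba_lin baZ ba_dinc // ba_inc // h1 scale0r addr0 z2 in h2.
move/eqP: h2; rewrite scaler_eq0 (negbTE y0) orbF mulf_eq0 invr_eq0 (negbTE k0) orbF => /eqP b0.
by move: h1; rewrite b0 mul0r addr0.
Qed.

Lemma pullback_curve A (c : R -> E) (z : R -> V) t z' : orthogonal_mx A ->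
  is_derive t (1:R) z z' -> (\forall s \near t, chart_param A (z s) = c s) ->
  derivable c t 1 /\ G (c t) (derive1 c t) = GA A (z t) z'.
Proof.
move=> AA dz cz; have d := near_eq_is_derive cz (is_derive_chart AA dz).
split; first by case: d.
by rewrite (derive1_val d) -(nbhs_singleton cz) /pullback derive_chart_param.
Qed.

(** In the chart the curve has the form given by [geodesic_form]. Multiplying its image under [inc]
    by the positive denominator [m], which normalization ignores, turns it into the circle of
    [great]. *)
Lemma sphere_geodesic_chart lo hi c (k : R) t0 A : 0 < k ->
  (forall t : R, (lo < t%:E)%E -> (t%:E < hi)%E ->
     [/\ sphere (c t), derivable c t 1 &
         forall A, orthogonal_mx A -> chart_dom A (c t) ->
           geodesic_eq_at (GA A) (chart_coord A \o c) t]) ->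
  (forall t : R, (lo < t%:E)%E -> (t%:E < hi)%E -> G (c t) (derive1 c t) = k) ->
  (lo < t0%:E)%E -> (t0%:E < hi)%E -> orthogonal_mx A -> chart_dom A (c t0) ->
  let x := chart_coord A (c t0) in let y := derive1 (chart_coord A \o c) t0 in
  [/\ y != 0, GA A x y = k & \forall s \near t0, c s = great A x y (s - t0)].
Proof.
move=> k0 cg ck l0 h0 AA dom x y; pose z := chart_coord A \o c.
have [_ dc0 _] := cg t0 l0 h0; have cc := is_derive_continuous (derive1_is_derive dc0).
have cb : {for t0, continuous (fun s => bl A (c s))}.
  exact: (@continuous_comp _ _ _ c (bl A) t0 cc (@bl_continuous _ _ A (c t0))).
have [_ b0] := (chart_domE (c t0) AA).1 dom.
have nb : \forall s \near t0, 0 < bl A (c s) by exact: (cvgr_gt _ cb _ b0).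
have [e /= e0 He] := (nbhs_ballP _ _).1 (filterI (near_ereal_itv l0 h0) nb).
have bal s : ((t0 - e)%:E < s%:E)%E -> (s%:E < (t0 + e)%:E)%E -> ball t0 e s.
  rewrite !lte_fin => h1 h2; rewrite /ball /= /ball_ ltr_norml; apply/andP; split; lra.
have dm s : ((t0 - e)%:E < s%:E)%E -> (s%:E < (t0 + e)%:E)%E -> chart_dom A (c s).
  move=> h1 h2; have [[ls hs] bs] := He s (bal s h1 h2); have [Sc _ _] := cg s ls hs.
  exact/(chart_domE _ AA).
have ge s : ((t0 - e)%:E < s%:E)%E -> (s%:E < (t0 + e)%:E)%E -> geodesic_eq_at (GA A) z s.
  move=> h1 h2; have [[ls hs] bs] := He s (bal s h1 h2); have [_ _ H] := cg s ls hs.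
  by apply: H => //; exact: dm.
have sp s : ((t0 - e)%:E < s%:E)%E -> (s%:E < (t0 + e)%:E)%E -> GA A (z s) (derive1 z s) = k.
  move=> h1 h2; have [[ls hs] bs] := He s (bal s h1 h2); have [dz _ _] := ge s h1 h2.
  have cz : \forall s \near s, chart_param A (z s) = c s.
    by apply: filterS (near_ereal_itv h1 h2) => r [lr hr]; apply: chart_param_coordK => //; exact: dm.
  by have [_ <-] := pullback_curve AA (derive1_is_derive (nbhs_singleton dz)) cz; exact: ck.
have l0' : ((t0 - e)%:E < t0%:E)%E by rewrite lte_fin ltrBlDr ltrDl.
have h0' : (t0%:E < (t0 + e)%:E)%E by rewrite lte_fin ltrDl.
have kE : GA A x y = k by exact: sp.
have y0 : y != 0.
  by apply/eqP => e1; move: k0; rewrite -kE e1 (finsler0 (GF AA)) // ltxx.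
split=> //; apply: filterS (near_ereal_itv l0' h0') => s [ls hs].
have [m0 zE] := geodesic_form Topen (GF AA) (GB AA) k0 (fun t l h => conj I (ge t l h)) sp l0' h0' ls hs.
rewrite -[z t0]/x -[derive1 z t0]/y in m0 zE; set m := (X in 0 < X) in m0 zE.
rewrite -(chart_param_coordK AA (dm s ls hs)) chart_paramE // -[chart_coord A (c s)]/(z s) zE inc_aff.
rewrite /great /circ /frame kE -(normalizeZ _ m0); congr normalize.
have m1 : m != 0 by rewrite gt_eqF.
rewrite scalerDr scalerA mulrC divfK // addrC scalerDr !scalerA addrA -scalerDl.
by congr (_ *: _ + _); rewrite /m [X in _ + X]mulrC.
Qed.

Lemma great_mE A x y t (k := GA A x y) (p := pfac (GA A) x y) : orthogonal_mx A ->
  circ (inc A x) (frame A x y) k t =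
  (cos (k * t) + p / k * sin (k * t)) *: inc A x + (sin (k * t) / k) *: dinc A y.
Proof.
by move=> AA; rewrite /circ /frame scalerDr !scalerA addrA -scalerDl [p / k * _]mulrC.
Qed.

(** While [m] is not zero the curve is in the chart of [A] or, if [m] is negative, in that of [- A],
    where the metric reads the same by [GN]. The speed is then compared with that at [x] by
    [line_formula]. *)
Lemma great_speed_generic A x y t (k := GA A x y) (p := pfac (GA A) x y) : orthogonal_mx A -> y != 0 ->
  cos (k * t) + p / k * sin (k * t) != 0 ->
  G (great A x y t) (derive1 (great A x y) t) = k.
Proof.
move=> AA y0 m0; have k0 : 0 < k by exact: (finsler_pos (GF AA)).
pose m s := cos (k * s) + p / k * sin (k * s).
have dm : is_derive t (1:R) m (k * (p / k * cos (k * t) - sin (k * t))).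
  have H := is_deriveD (is_derive_cosk k t) (is_derive_mulr (is_derive_cst (p / k) t (1:R)) (is_derive_sink k t)).
  by apply: (@is_derive_eq _ _ _ _ _ _ _ _ H); rewrite !fctE; ring.
have mc : {for t, continuous m} := is_derive_continuous dm.
pose r s := sin (k * s) / k / m s.
have dr : is_derive t (1:R) r (m t ^- 2).
  have H := @is_derive_div _ _ m t _ _ m0 (is_derive_mulr (is_derive_sink k t) (is_derive_cst (k^-1) t (1:R))) dm.
  apply: (@is_derive_eq _ _ _ _ _ _ _ _ H); rewrite !fctE mulr0 addr0.
  move: m0; rewrite -/(m t) /m; have := cos2Dsin2 (k * t).
  move: (cos _) (sin _) => a b ab m0; have k1 : k != 0 by rewrite gt_eqF.
  have -> : k * a * k^-1 * (a + p / k * b) - b * k^-1 * (k * (p / k * a - b)) = a ^+ 2 + b ^+ 2 by field.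
  by rewrite ab mul1r.
pose z s := r s *: y + x.
have dz : is_derive t (1:R) z (m t ^- 2 *: y).
  apply/is_derive_coordP => i.
  have -> : (fun s => z s 0 i) = (fun s => r s * y 0 i + x 0 i) by apply/funext => s; rewrite !mxE.
  have H := is_deriveD (is_derive_mulr dr (is_derive_cst (y 0 i) t (1:R))) (is_derive_cst (x 0 i) t (1:R)).
  by apply: (@is_derive_eq _ _ _ _ _ _ _ _ H); rewrite !fctE mulr0 !addr0 mxE.
have uE s : m s != 0 -> circ (inc A x) (frame A x y) k s = m s *: inc A (z s).
  move=> ms; rewrite great_mE // inc_aff scalerDr scalerA -/(m s) addrC; congr (_ *: _ + _).
  by rewrite [RHS]mulrC /r divfK.
have val : GA A (z t) (m t ^- 2 *: y) = k.
  have m2 : 0 < m t ^- 2 by rewrite invr_gt0 lt0r sqrf_eq0 m0 sqr_ge0.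
  rewrite (finslerZ (GF AA)) //; have [-> _] := line_formula (GF AA) (GB AA) (z t) (- r t) y0.
  have -> : - r t *: y + z t = x by rewrite /z addrA -scalerDl addNr scale0r add0r.
  rewrite -/k -/p /r -/(m t); move: m0; rewrite -/(m t).
  have := cos2Dsin2 (k * t); have : m t - p / k * sin (k * t) = cos (k * t) by rewrite /m addrK.
  have k1 : k != 0 by rewrite gt_eqF.
  move: (m t) (cos (k * t)) (sin (k * t)) => c a b <- ab c0.
  have -> : (1 + - (b / k / c) * p) ^+ 2 + (- (b / k / c)) ^+ 2 * k ^+ 2 = ((c - p / k * b) ^+ 2 + b ^+ 2) / c ^+ 2.
    by field; rewrite c0 k1.
  by rewrite ab mul1r invrK mulrCA mulVf ?mulr1 // sqrf_eq0.
have [mp|mn] := ltP 0 (m t).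
  have cz : \forall s \near t, chart_param A (z s) = great A x y s.
    apply: filterS (cvgr_gt _ mc _ mp) => s ms.
    have -> : great A x y s = normalize (m s *: inc A (z s)) by rewrite -(uE s (lt0r_neq0 ms)).
    by rewrite (normalizeZ _ ms) (chart_paramE _ AA).
  have [_ e] := @pullback_curve A (great A x y) z t _ AA dz cz.
  rewrite e.
  exact: val.
have mn' : m t < 0 by rewrite lt_def eq_sym m0.
have NN := orthogonal_mxN AA.
have cz : \forall s \near t, chart_param (- A) (z s) = great A x y s.
  apply: filterS (cvgr_lt _ mc _ mn') => s ms.
  have -> : great A x y s = normalize (m s *: inc A (z s)) by rewrite -(uE s (ltr0_neq0 ms)).
  have ms' : 0 < - m s by rewrite oppr_gt0.
  rewrite (chart_paramE _ NN) incN -(normalizeZ (- inc A (z s)) ms').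
  by rewrite scalerN scaleNr opprK.
have [_ e] := @pullback_curve (- A) (great A x y) z t _ NN dz cz.
have e' := GN (z t) (m t ^- 2 *: y) AA.
rewrite e e'; exact: val.
Qed.

End SphereGeodesics.

Section StraightCurves.
Context {R : realType} {n : nat}.
Notation V := 'rV[R]_n.
Variables (F : V -> V -> R) (HF : finsler setT F) (B : burgers setT F).

Let Topen : open [set: V] := openT.

(** Differentiating the constant speed along the curve forces [l = - 2 P], which is the geodesic
    equation of a straight metric. *)
Lemma straight_geodesic_eq (c v : R -> V) (t k l : R) : v t != 0 ->
  (\forall s \near t, is_derive s (1:R) c (v s)) -> is_derive t (1:R) v (l *: v t) ->
  (\forall s \near t, F (c s) (v s) = k) -> geodesic_eq_at F c t.
Proof.
move=> v0 nc dv nk; have FC := finsler_smooth Topen HF.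
have dc : is_derive t (1:R) c (v t) := nbhs_singleton nc.
have cv : \forall s \near t, v s = derive1 c s by apply: filterS nc => s d; rewrite (derive1_val d).
have dF := is_derive_chain Topen FC (c1 := c) (c2 := v) I v0 dc dv.
have dF0 : is_derive t (1:R) (fun s => F (c s) (v s)) 0.
  apply: near_eq_is_derive (is_derive_cst k t (1:R)).
  by apply: filterS nk => s ->.
have e0 : dx F (v t) (c t) (v t) + dy F (l *: v t) (c t) (v t) = 0.
  by have [_ <-] := dF; have [_ ->] := dF0.
rewrite (dyZ Topen _ _ FC I v0) (@euler _ _ setT Topen 1 _ _ _ (finsler_homog HF) FC I v0) mul1r in e0.
rewrite (dxF_pfac HF I v0) in e0.
have F0 := finsler_pos HF (I : setT (c t)) v0.
have lE : l = - (2 * pfac F (c t) (v t)).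
  move: e0; rewrite -mulrDl => /eqP; rewrite mulf_eq0 (gt_eqF F0) orbF.
  by rewrite addrC addr_eq0 => /eqP.
have d1 : derive1 c t = v t by exact: derive1_val dc.
have d2 : is_derive t (1:R) (derive1 c) (l *: v t) by exact: near_eq_is_derive cv dv.
split.
- by apply: filterS nc => s [].
- by case: d2.
move=> i; rewrite (derive1_val d2) d1 lE.
have := burgers_straight Topen HF B (I : setT (c t)) v0 => /rowP/(_ i).
by rewrite !mxE => ->; ring.
Qed.

End StraightCurves.

(** The bracket is a Wronskian, free of [t] because [cos ^ 2 + sin ^ 2 = 1]: in any chart the
    velocity keeps a fixed direction, so the image is straight. *)
Lemma coord_diff_circ {R : realType} {n : nat} (C : 'M[R]_(n + 1)) (f g : 'rV[R]_(n + 1)) (k t : R) :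
  coord_diff C (circ f g k t) (circ (k *: g) (- k *: f) k t) =
  (bl C (circ f g k t))^-2 *: (k *: (bl C f *: ba C g - bl C g *: ba C f)).
Proof.
rewrite /coord_diff; congr (_ *: _); rewrite /circ.
have e (a b : R) u v : bl C (a *: u + b *: v) = a * bl C u + b * bl C v.
  by rewrite bl_lin blZ.
have e' (a b : R) u v : ba C (a *: u + b *: v) = a *: ba C u + b *: ba C v.
  by rewrite ba_lin baZ.
rewrite !e !e' !blZ !baZ; apply/rowP => i; have := cos2Dsin2 (k * t).
move: (cos _) (sin _) (bl C f) (bl C g) (ba C f) (ba C g) => a b x y z w ab.
rewrite !mxE -[RHS]mul1r -ab; ring.
Qed.

Section Shift.
Context {R : realType} {W : normedModType R}.

Lemma derive1_shift (c : R -> W) (t0 t : R) : derive1 (fun s => c (s - t0)) t = derive1 c (t - t0).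
Proof.
rewrite !derive1E /derive.
suff -> : (fun h : R => h^-1 *: (c (h *: (1 : R^o) + t - t0) - c (t - t0))) =
    (fun h => h^-1 *: (c (h *: (1 : R^o) + (t - t0)) - c (t - t0))) by [].
by apply/funext => h; rewrite addrA.
Qed.

Lemma derivable_shift (c : R -> W) (t0 t : R) : derivable c (t - t0) 1 -> derivable (fun s => c (s - t0)) t 1.
Proof.
rewrite /derivable.
suff -> : (fun h : R => h^-1 *: (c (h *: (1 : R^o) + t - t0) - c (t - t0))) =
    (fun h => h^-1 *: (c (h *: (1 : R^o) + (t - t0)) - c (t - t0))) by [].
by apply/funext => h; rewrite addrA.
Qed.

Lemma near_shift (P : R -> Prop) (t0 t : R) : (\forall s \near (t - t0), P s) -> \forall s \near t, P (s - t0).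
Proof.
move=> H; have c : {for t, continuous (fun s : R => s - t0)}.
  by apply: continuousB; [exact: cvg_id|exact: cst_continuous].
exact: (c _ H).
Qed.

End Shift.

Lemma ereal_itv_inhabited {R : realType} (lo hi : \bar R) : (lo < hi)%E ->
  exists t0 : R, (lo < t0%:E)%E /\ (t0%:E < hi)%E.
Proof.
case: lo hi => [l||] [h||] //.
- by rewrite lte_fin => lh; exists ((l + h) / 2); rewrite !lte_fin; split; lra.
- by move=> _; exists (l + 1); rewrite lte_fin ltry; split=> //; lra.
- by move=> _; exists (h - 1); rewrite lte_fin ltNyr; split=> //; lra.
- by move=> _; exists 0; rewrite ltNyr ltry.
Qed.

Section GreatCircles.
Context {R : realType} {n : nat}.
Notation V := 'rV[R]_n.
Notation E := 'rV[R]_(n + 1).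
Variable G : E -> E -> R.
Notation GA A := (pullback (chart_param A) G).
Hypotheses (GF : forall A, orthogonal_mx A -> finsler setT (GA A))
  (GB : forall A, orthogonal_mx A -> burgers setT (GA A))
  (GN : forall A x y, orthogonal_mx A -> GA (- A) x y = GA A x y).
Implicit Types (A C : 'M[R]_(n + 1)) (x y : V) (u w v : E).
Notation great := (great G).
Notation frame := (frame G).

Let Topen : open [set: V] := openT.

Section OneGreatCircle.
Variables (A : 'M[R]_(n + 1)) (x y : V) (AA : orthogonal_mx A) (y0 : y != 0).
Let k := GA A x y.
Let U := circ (inc A x) (frame A x y) k.
Let U' := circ (k *: frame A x y) (- k *: inc A x) k.
Let k0 : 0 < k. Proof. exact: (finsler_pos (GF AA)). Qed.
Let U0 t : U t != 0. Proof. apply: circ_neq0; exact: (frame_indep GF). Qed.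
Let dU t : is_derive t (1:R) U (U' t). Proof. exact: is_derive_circ. Qed.

Lemma great_sphere t : sphere (great A x y t).
Proof. exact: normalize_sphere (U0 t). Qed.

Lemma great_derivable t : derivable (great A x y) t 1.
Proof. by have [] := is_derive_normalize (U0 t) (dU t). Qed.

Let W C : V := k *: (bl C (inc A x) *: ba C (frame A x y) - bl C (frame A x y) *: ba C (inc A x)).
Let z C s : V := chart_coord C (U s).
Let Z C s : V := (bl C (U s))^-2 *: W C.

Let zE C : chart_coord C \o great A x y = z C.
Proof. by apply/funext => s /=; rewrite /great chart_coord_normalize. Qed.

Let dz C s : bl C (U s) != 0 -> is_derive s (1:R) (z C) (Z C s).
Proof. by move=> b0; rewrite /Z -coord_diff_circ; exact: is_derive_chart_coord. Qed.

Let dZ C s : bl C (U s) != 0 -> is_derive s (1:R) (Z C) ((- 2 * bl C (U' s) / bl C (U s)) *: Z C s).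
Proof.
move=> b0; apply/is_derive_coordP => i; have db := is_derive_bl C (dU s).
have -> : (fun s => Z C s 0 i) = (fun s => W C 0 i / (bl C (U s) * bl C (U s))).
  by apply/funext => r; rewrite /Z mxE expr2 mulrC.
have b1 : bl C (U s) * bl C (U s) != 0 by rewrite mulf_neq0.
have H := @is_derive_div _ _ (fun s => bl C (U s) * bl C (U s)) s _ _ b1 (is_derive_cst (W C 0 i) s (1:R)) (is_derive_mulr db db).
apply: (@is_derive_eq _ _ _ _ _ _ _ _ H); rewrite !fctE /Z !mxE mul0r sub0r.
by move: (W C 0 i) (bl C (U' s)) (bl C (U s)) b0 => a b c c0; field.
Qed.

Let near_bl C t : 0 < bl C (U t) -> \forall s \near t, 0 < bl C (U s).
Proof.
move=> b0; have cb : {for t, continuous (fun s => bl C (U s))}.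
  exact: is_derive_continuous (is_derive_bl C (dU t)).
exact: (cvgr_gt _ cb _ b0).
Qed.

Let speedE C t : orthogonal_mx C -> 0 < bl C (U t) ->
  G (great A x y t) (derive1 (great A x y) t) = GA C (z C t) (Z C t).
Proof.
move=> CC b0; have cz : \forall s \near t, chart_param C (z C s) = great A x y s.
  by apply: filterS (near_bl b0) => s b; rewrite chart_param_coord.
by have [_ e] := @pullback_curve _ _ G C (great A x y) (z C) t _ CC (dz (lt0r_neq0 b0)) cz.
Qed.

(** At a zero of [m] the point is outside the charts of [A] and [- A]. In a chart centred at the
    point the speed is continuous, and [m] does not vanish identically nearby, since
    [m ^ 2 + (m' / k) ^ 2 = 1 + q ^ 2] with [q = P / k] excludes a common zero of [m] and [m']. *)
Lemma great_speed t : G (great A x y t) (derive1 (great A x y) t) = k.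
Proof.
pose m s := cos (k * s) + pfac (GA A) x y / k * sin (k * s).
have [m0|m0] := eqVneq (m t) 0; last exact: (great_speed_generic GF GB GN).
have [C CC wC] := chart_at (great_sphere t).
have b0 : 0 < bl C (U t).
  apply/(chart_dom_normalize CC (U0 t)); rewrite -/(great A x y t) -wC.
  rewrite -(normalize_id (u := inc C 0)); last by rewrite wC; exact: great_sphere.
  by rewrite -(chart_paramE 0 CC); exact: chart_dom_param.
rewrite (speedE CC b0); apply/eqP; rewrite -subr_eq0; apply/eqP.
apply: (@adherent_zero _ R (fun s => GA C (z C s) (Z C s) - k)).
  apply: continuousB; last exact: cst_continuous.
  exact: (finsler_continuous Topen (GF CC) (I : setT (z C t)) (is_derive_continuous (dz (lt0r_neq0 b0)))
    (is_derive_continuous (dZ (lt0r_neq0 b0)))).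
move=> N Nt; apply: contrapT => H.
have nm : \forall s \near t, 0 = m s.
  apply: filterS (filterI Nt (near_bl b0)) => s [Ns bs]; apply/esym/eqP/negPn/negP => ms.
  by apply: H; exists s => //; rewrite -(speedE CC bs) (great_speed_generic GF GB GN) ?subrr.
have dm : is_derive t (1:R) m (k * (pfac (GA A) x y / k * cos (k * t) - sin (k * t))).
  have H1 := is_deriveD (is_derive_cosk k t) (is_derive_mulr (is_derive_cst (pfac (GA A) x y / k) t (1:R)) (is_derive_sink k t)).
  by apply: (@is_derive_eq _ _ _ _ _ _ _ _ H1); rewrite !fctE; ring.
have dm0 : is_derive t (1:R) m 0 by exact: near_eq_is_derive nm (is_derive_cst (0:R) t (1:R)).
have e : k * (pfac (GA A) x y / k * cos (k * t) - sin (k * t)) = 0.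
  by have [_ <-] := dm; have [_ ->] := dm0.
move: m0 e (cos2Dsin2 (k * t)); rewrite /m; have k1 := lt0r_neq0 k0.
move: (pfac (GA A) x y / k) (cos (k * t)) (sin (k * t)) => q a b e1 /eqP.
rewrite mulf_eq0 (negbTE k1) /= => /eqP e2 e3.
have : (1 + q ^+ 2) * (a ^+ 2 + b ^+ 2) = (a + q * b) ^+ 2 + (q * a - b) ^+ 2 by ring.
rewrite e1 e2 e3 mulr1 expr0n addr0 => /eqP; by rewrite gt_eqF // ltr_pwDl // sqr_ge0.
Qed.

Lemma great_sphere_geodesic : sphere_geodesic G -oo +oo (great A x y).
Proof.
split=> [t _ _|]; last by exists k; [exact: k0|move=> t _ _; exact: great_speed].
split; [exact: great_sphere|exact: great_derivable|move=> C CC dom].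
have b0 : 0 < bl C (U t) by exact/(chart_dom_normalize CC (U0 t)).
rewrite zE; apply: (straight_geodesic_eq (GF CC) (GB CC) (v := Z C) (k := k)) (dZ (lt0r_neq0 b0)) _.
- apply/eqP => e; have := speedE CC b0; rewrite e (finsler0 (GF CC)) // great_speed => e'.
  by move: k0; rewrite e' ltxx.
- by apply: filterS (near_bl b0) => s /lt0r_neq0; exact: dz.
by apply: filterS (near_bl b0) => s bs; rewrite -(speedE CC bs) great_speed.
Qed.

End OneGreatCircle.

Lemma sphere_geodesic_shift (c : R -> E) t0 : sphere_geodesic G -oo +oo c ->
  sphere_geodesic G -oo +oo (fun t => c (t - t0)).
Proof.
move=> [H [k k0 K]]; split; last by exists k => // t _ _; rewrite derive1_shift; exact: K (ltNyr _) (ltry _).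
move=> t _ _; have [h1 h2 h3] := H (t - t0) (ltNyr _) (ltry _).
split; [exact: h1|exact: derivable_shift h2|].
move=> A AA dom; have [g1 g2 g3] := h3 A AA dom; rewrite /comp.
have e : derive1 (fun s => chart_coord A (c (s - t0))) = fun s => derive1 (chart_coord A \o c) (s - t0).
  by apply/funext => s; exact: (derive1_shift (chart_coord A \o c)).
split.
- by have := near_shift g1; apply: filterS => s; exact: (derivable_shift (c := chart_coord A \o c)).
- by rewrite e; exact: derivable_shift.
by move=> i; rewrite e (derive1_shift (derive1 (chart_coord A \o c))); exact: g3.
Qed.

Lemma near_eq_derive1 (W : normedModType R) (c d : R -> W) t : derivable c t 1 ->
  (\forall s \near t, c s = d s) -> derive1 d t = derive1 c t.
Proof. by move=> dc cd; exact: derive1_val (near_eq_is_derive cd (derive1_is_derive dc)). Qed.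

Lemma near_neq (W : normedModType R) (z w : R -> W) t : {for t, continuous z} -> {for t, continuous w} ->
  z t != w t -> \forall s \near t, z s != w s.
Proof.
move=> zc wc ne; have c : {for t, continuous (fun s => z s - w s)} by exact: continuousB.
have n0 : z t - w t != 0 by rewrite subr_eq0.
have H : \forall s \near t, z s - w s != 0 by exact: (cvgr_neq0 _ c n0).
by apply: filterS H => s; rewrite subr_eq0.
Qed.

Lemma near_neq_derive (W : normedModType R) (z w : R -> W) t : derivable z t 1 -> derivable w t 1 ->
  z t = w t -> derive1 z t != derive1 w t -> \forall s \near t, s != t -> z s != w s.
Proof.
move=> dz dw zw ne.
have [d e] := is_deriveB (derive1_is_derive dz) (derive1_is_derive dw).
have n0 : 'D_1 (z - w) t != 0 by rewrite e subr_eq0.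
have H : \forall h \near (0:R)^', h^-1 *: ((z - w) (h *: (1 : R) + t) - (z - w) t) != 0.
  exact: (cvgr_neq0 _ d n0).
have : \forall h \near (t - t), h != 0 -> (z - w) (h + t) != 0.
  rewrite subrr; apply: filterS H => h H; apply/negP => /eqP e0; move/negP: H; apply; apply/eqP.
  have -> : (z - w) t = 0 by rewrite !fctE zw subrr.
  by rewrite -[h *: 1]/(h * 1) mulr1 e0 subr0 scaler0.
move=> H'; have H1 := near_shift H'; apply: filterS H1 => s H1 st.
have st' : s - t != 0 by rewrite subr_eq0.
by move: (H1 st'); rewrite subrK !fctE subr_eq0.
Qed.

(* The set of times at which the two geodesics agree nearby is open and closed, that is, its
   indicator function has derivative 0. *)
Lemma sphere_geodesic_unique lo hi (c d : R -> E) (t0 : R) :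
  sphere_geodesic G lo hi c -> sphere_geodesic G lo hi d ->
  (lo < t0%:E)%E -> (t0%:E < hi)%E -> (\forall s \near t0, c s = d s) ->
  forall t : R, (lo < t%:E)%E -> (t%:E < hi)%E -> c t = d t.
Proof.
move=> [cg [kc kc0 ck]] [dg [kd kd0 dk]] l0 h0 cd0.
have kcd : kd = kc.
  have [_ dc _] := cg t0 l0 h0.
  by rewrite -(ck t0 l0 h0) -(dk t0 l0 h0) (near_eq_derive1 dc cd0) (nbhs_singleton cd0).
rewrite {}kcd {kd kd0} in dk; pose S (t : R) := \forall s \near t, c s = d s.
pose chi (t : R) : R := if `[< S t >] then 1 else 0.
have dchi t : (lo < t%:E)%E -> (t%:E < hi)%E -> is_derive t (1:R) chi 0.
  move=> lt ht; apply: (near_eq_is_derive _ (is_derive_cst (chi t) t (1:R))); rewrite /chi.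
  case: asboolP => St.
    have : \forall s \near t, S s by exact: near_join.
    by apply: filterS => s Ss; case: asboolP.
  have [Sc dc gc] := cg t lt ht; have [Sd dd gd] := dg t lt ht.
  suff : \forall s \near t, ~ S s.
    by apply: filterS => s nS; case: asboolP.
  have cc := is_derive_continuous (derive1_is_derive dc).
  have cd := is_derive_continuous (derive1_is_derive dd).
  have [e|ne] := eqVneq (c t) (d t); last first.
    by apply: filterS (near_neq cc cd ne) => s /eqP ns /nbhs_singleton.
  have [C CC wC] := chart_at Sc.
  have dom : chart_dom C (c t).
    rewrite -wC -(normalize_id (u := inc C 0)); last by rewrite wC.
    by rewrite -(chart_paramE 0 CC); exact: chart_dom_param.
  have dom' : chart_dom C (d t) by rewrite -e.
  have [[dzc _ _] [dzd _ _]] := (gc C CC dom, gd C CC dom').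
  have [_ _ nc] := sphere_geodesic_chart GF GB kc0 cg ck lt ht CC dom.
  have [_ _ nd] := sphere_geodesic_chart GF GB kc0 dg dk lt ht CC dom'.
  (* Equal positions and velocities would put [t] in the set of agreement, by
     [sphere_geodesic_chart]. If only the positions agree, the curves separate on a punctured
     neighbourhood, so no nearby time belongs to the set. *)
  have [e1|ne1] := eqVneq (derive1 (chart_coord C \o c) t) (derive1 (chart_coord C \o d) t).
    case: St; rewrite /S; rewrite e e1 in nc.
    by apply: filterS (filterI nc nd) => s [-> ->].
  have := near_neq_derive (nbhs_singleton dzc) (nbhs_singleton dzd) _ ne1; rewrite /= e => /(_ erefl).
  apply: filterS => s H Ss; have [st|st] := eqVneq s t; first by apply: St; rewrite -st.
  by have := H st; rewrite /= (nbhs_singleton Ss) eqxx.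
move=> t lt ht; have := derive0_cst dchi lt ht l0 h0; rewrite /chi.
case: asboolP => [St _|_]; first exact: nbhs_singleton St.
by case: asboolP => // _ /eqP; rewrite eq_sym oner_eq0.
Qed.

(** Near [t0] this is [sphere_geodesic_chart], and uniqueness spreads the agreement over the whole
    interval. Completeness and the shape of closed geodesics follow. *)
Lemma sphere_geodesic_great lo hi (c : R -> E) (t0 : R) : sphere_geodesic G lo hi c ->
  (lo < t0%:E)%E -> (t0%:E < hi)%E -> exists A x y,
    [/\ orthogonal_mx A, y != 0, GA A x y = G (c t0) (derive1 c t0) &
     forall t : R, (lo < t%:E)%E -> (t%:E < hi)%E -> c t = great A x y (t - t0)].
Proof.
move=> sg l0 h0; have [cg [k k0 ck]] := sg; have [Sc _ _] := cg t0 l0 h0.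
have [C CC wC] := chart_at Sc.
have dom : chart_dom C (c t0).
  rewrite -wC -(normalize_id (u := inc C 0)); last by rewrite wC.
  by rewrite -(chart_paramE 0 CC); exact: chart_dom_param.
have [y0 kE nc] := sphere_geodesic_chart GF GB k0 cg ck l0 h0 CC dom.
exists C, (chart_coord C (c t0)), (derive1 (chart_coord C \o c) t0); split=> //.
  by rewrite kE ck.
have [dg [kd kd0 dk]] := sphere_geodesic_shift t0 (great_sphere_geodesic (chart_coord C (c t0)) CC y0).
apply: (sphere_geodesic_unique sg _ l0 h0 nc); split; last first.
  by exists kd => // t _ _; exact: dk (ltNyr _) (ltry _).
by move=> t _ _; exact: dg (ltNyr _) (ltry _).
Qed.

Lemma sphere_geodesic_extend lo hi (c : R -> E) : (lo < hi)%E -> sphere_geodesic G lo hi c ->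
  exists2 d, sphere_geodesic G -oo +oo d & forall t : R, (lo < t%:E)%E -> (t%:E < hi)%E -> d t = c t.
Proof.
move=> lohi sg; have [t0 [l0 h0]] := ereal_itv_inhabited lohi.
have [A [x [y [AA y0 _ e]]]] := sphere_geodesic_great sg l0 h0.
exists (fun t => great A x y (t - t0)); last by move=> t lt ht; rewrite e.
exact: sphere_geodesic_shift (great_sphere_geodesic x AA y0).
Qed.

Lemma sphere_geodesic_sub lo hi (c : R -> E) : sphere_geodesic G -oo +oo c -> sphere_geodesic G lo hi c.
Proof.
move=> [H [k k0 K]]; split; last by exists k => // t _ _; exact: K (ltNyr _) (ltry _).
by move=> t _ _; exact: H (ltNyr _) (ltry _).
Qed.

Lemma sphere_complete : forward_complete (sphere_geodesic G) /\ backward_complete (sphere_geodesic G).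
Proof.
by split=> lo hi c lohi sg; have [d dg e] := sphere_geodesic_extend lohi sg; exists d; split=> //;
  exact: sphere_geodesic_sub.
Qed.

End GreatCircles.

(** * Angles in the plane *)

Section Trigonometry.
Context {R : realType}.

Lemma cos_2pi : cos (2 * pi : R) = 1.
Proof. by rewrite mulr_natl cos2pi. Qed.

Lemma sin_2pi : sin (2 * pi : R) = 0.
Proof. by rewrite mulr_natl sin_mulr2n sinpi mulr0 mul0rn. Qed.

Lemma polar_angle (a b : R) : (a != 0) || (b != 0) ->
  exists r phi : R, [/\ 0 < r, 0 <= phi <= 2 * pi, a = r * cos phi & b = r * sin phi].
Proof.
move=> ab; have s0 : 0 < a ^+ 2 + b ^+ 2.
  by case/orP: ab => h; [apply: ltr_pwDl|apply: ltr_wpDl]; rewrite ?sqr_ge0 // lt0r sqrf_eq0 h sqr_ge0.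
pose r := Num.sqrt (a ^+ 2 + b ^+ 2); have r0 : 0 < r by rewrite sqrtr_gt0.
have r2 : r ^+ 2 = a ^+ 2 + b ^+ 2 by rewrite sqr_sqrtr // ltW.
have ar : -1 <= a / r <= 1.
  rewrite -ler_norml normrM normfV (gtr0_norm r0) ler_pdivrMr // mul1r.
  by rewrite -(gtr0_norm r0) -ler_sqr ?nnegrE // real_normK ?num_real // real_normK ?num_real // r2 lerDl sqr_ge0.
have [/andP[ph0 ph1] cE] := acos_def ar.
have sE : sin (acos (a / r)) = `|b| / r.
  rewrite sin_acos //; have -> : 1 - (a / r) ^+ 2 = (b / r) ^+ 2.
    have rn : r != 0 by rewrite gt_eqF.
    apply: (mulIf (expf_neq0 2 rn)); rewrite mulrBl mul1r -!exprMn !divfK // r2; ring.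
  by rewrite sqrtr_sqr normrM normfV (gtr0_norm r0).
have rn : r != 0 by rewrite gt_eqF.
have pi0 : 0 <= (pi : R) by exact: pi_ge0.
exists r; case: (leP 0 b) => b0; rewrite ?(ger0_norm b0) ?(ltr0_norm b0) in sE.
  exists (acos (a / r)); split=> //; rewrite ?cE ?sE.
  - by rewrite ph0 /=; apply: le_trans ph1 _; lra.
  - by rewrite mulrC divfK.
  - by rewrite mulrC divfK.
exists (2 * pi - acos (a / r)); split=> //.
- by apply/andP; split; lra.
- by rewrite cosB cos_2pi sin_2pi mul1r mul0r addr0 cE mulrC divfK.
- by rewrite sinB cos_2pi sin_2pi mul1r mul0r sub0r sE mulNr opprK mulrC divfK.
Qed.

(** By the half-angle formula, as [sin (d / 2)] is positive for [0 < d < 2 pi]. *)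
Lemma cos_eq1 (d : R) : 0 <= d < 2 * pi -> cos d = 1 -> d = 0.
Proof.
move=> /andP[d0 d1] c1; apply/eqP; rewrite eq_le d0 andbT leNgt; apply/negP => dp.
have s0 : 0 < sin (d / 2) by apply: sin_gt0_pi; apply/andP; split; lra.
have : cos (d / 2 + d / 2) = 1 - 2 * sin (d / 2) ^+ 2.
  rewrite cosD; have := cos2Dsin2 (d / 2); move: (cos _) (sin _) => a b e.
  by rewrite -[X in _ = X - _]e; ring.
rewrite -splitr c1 => /eqP; rewrite -subr_eq0 opprB addrC subrK mulf_eq0 pnatr_eq0 /=.
by rewrite sqrf_eq0 gt_eqF.
Qed.

(** Both points of the plane have norm 1, which forces [r = 1]; then the difference of the angles,
    less than a full turn, has cosine 1. *)
Lemma angle_inj (k s t r a b : R) : 0 < k -> a < b -> k * (b - a) = 2 * pi ->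
  a <= s < b -> a <= t < b -> 0 < r ->
  cos (k * t) = r * cos (k * s) -> sin (k * t) = r * sin (k * s) -> s = t.
Proof.
move=> k0 ab kab sab tab r0 ce se.
have r1 : r = 1.
  have := cos2Dsin2 (k * t); rewrite ce se !exprMn -mulrDr cos2Dsin2 mulr1 => /eqP.
  by rewrite sqrf_eq1 => /orP[/eqP //|/eqP e]; move: r0; rewrite e ltr0N1.
rewrite r1 !mul1r in ce se.
wlog st : s t sab tab ce se / s <= t.
  by move=> H; case/orP: (le_total s t) => h; [exact: H|apply/esym; exact: H].
have : k * t - k * s = 0.
  apply: cos_eq1; last by rewrite cosB ce se -!expr2 cos2Dsin2.
  case/andP: sab => s1 s2; case/andP: tab => t1 t2.
  rewrite -mulrBr; apply/andP; split; first by rewrite mulr_ge0 ?subr_ge0 // ltW.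
  by rewrite -kab ltr_pM2l //; lra.
move/eqP; rewrite subr_eq0 => /eqP /mulfI h; apply/esym/h; by rewrite gt_eqF.
Qed.

End Trigonometry.

Lemma scale_polar {R : realType} (W : lmodType R) (f g : W) (r a b : R) : r != 0 ->
  a *: f + b *: g = r^-1 *: ((r * a) *: f + (r * b) *: g).
Proof. by move=> r0; rewrite scalerDr !scalerA !mulrA mulVf // !mul1r. Qed.

Lemma indep_eq {R : realType} m (f g : 'rV[R]_m) (a b c d r : R) : indep f g ->
  a *: f + b *: g = r *: (c *: f + d *: g) -> a = r * c /\ b = r * d.
Proof.
move=> I; rewrite scalerDr !scalerA => /eqP; rewrite -subr_eq0 opprD addrACA -!scalerBl => /eqP /I.
by move=> [/eqP e1 /eqP e2]; move: e1 e2; rewrite !subr_eq0 => /eqP -> /eqP ->.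
Qed.

Lemma class_C_coord {R : realType} (V : normedModType R) m k (U : set V) (f : V -> 'rV[R]_m) i : open U ->
  class_C k U f -> class_C k U (fun z => f z 0 i).
Proof.
move=> Uo; elim: k f => [|k IH] f fC.
  split=> // x Ux; apply: (@continuous_comp _ _ _ f (fun w : 'rV[R]_m => w 0 i)); first exact: class_C_cont fC Ux.
  exact: coord_continuous.
have D x v : U x -> is_derive x v (fun z => f z 0 i) ('D_v f x 0 i).
  move=> Ux; have d : is_derive x v f ('D_v f x) by apply: derivableP; exact: class_C_derivable fC Ux.
  exact: (is_derive_rowP _ _ _ _).1 d i.
split.
  move=> x Ux; apply: (@continuous_comp _ _ _ f (fun w : 'rV[R]_m => w 0 i)); first exact: class_C_cont fC Ux.
  exact: coord_continuous.
move=> v; split; first by move=> x /(D x v)[].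
by apply: class_C_eq (IH _ (class_CD v fC)) => // x Ux; have [_ ->] := D x v Ux.
Qed.

Section SphereGeometry.
Context {R : realType} {n : nat}.
Notation V := 'rV[R]_n.
Notation E := 'rV[R]_(n + 1).
Variable G : E -> E -> R.
Notation GA A := (pullback (chart_param A) G).
Hypotheses (GF : forall A, orthogonal_mx A -> finsler setT (GA A))
  (GB : forall A, orthogonal_mx A -> burgers setT (GA A))
  (GN : forall A x y, orthogonal_mx A -> GA (- A) x y = GA A x y).
Implicit Types (A C : 'M[R]_(n + 1)) (x y : V) (u w v : E).
Notation great := (great G).
Notation frame := (frame G).
Notation mu := (@lebesgue_measure R).

Let Topen : open [set: V] := openT.

Lemma chart_projectively_flat A : orthogonal_mx A -> projectively_flat setT (GA A).
Proof.
move=> AA lo hi c lohi [cg [k k0 ck]].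
have [t0 [l0 h0]] : exists t0 : R, (lo < t0%:E)%E /\ (t0%:E < hi)%E by exact: ereal_itv_inhabited.
exists (c t0), (derive1 c t0); split.
  apply/eqP => e; have := ck t0 l0 h0; rewrite e (finsler0 (GF AA)) // => e'.
  by move: k0; rewrite -e' ltxx.
move=> t lt ht; have [_ ->] := geodesic_form Topen (GF AA) (GB AA) k0 cg ck l0 h0 lt ht.
by eexists; rewrite addrC.
Qed.

Lemma chart_local_coordinates A : orthogonal_mx A -> local_coordinates setT (chart_param A).
Proof.
move=> AA; split.
- exact: openT.
- by apply: (smooth_on_class_C openT) => // k; exact: class_C_chart_param.
- by move=> _ [x _ <-]; exact: chart_param_sphere.
- by move=> x y _ _; exact: chart_inj.
- by move=> x y _; exact: chart_immersion.
Qed.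

Lemma sphere_flat : sphere_locally_projectively_flat G.
Proof.
move=> w Sw; have [A AA wA] := chart_at Sw; exists setT, (chart_param A); split.
- exact: chart_local_coordinates.
- by exists 0 => //; rewrite chart_paramE // wA normalize_id.
- exact: chart_projectively_flat.
Qed.

Lemma constant_speed_length (c : R -> E) (k a b : R) : a < b ->
  (forall t, a <= t <= b -> G (c t) (derive1 c t) = k) ->
  curve_length G c a b = (k * (b - a))%:E.
Proof.
move=> ab ck; rewrite /curve_length.
have -> : (\int[mu]_(t in `[a, b]) (G (c t) (derive1 c t))%:E = \int[mu]_(t in `[a, b]) (cst k%:E t))%E.
  apply: eq_integral => t; rewrite inE /= in_itv /= => /ck ->.
  by [].
rewrite integral_cst /=; last exact: measurable_itv.
by rewrite lebesgue_measure_itv /= lte_fin ab -EFinB -EFinM.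
Qed.

Lemma great_circle_span f g : indep f g -> great_circle [set w : E | sphere w /\ exists a b : R, w = a *: f + b *: g].
Proof.
move=> I; pose P : 'M[R]_(2, n + 1) := col_mx f g; exists P.
have PE (D : 'rV[R]_2) : D *m P = D 0 0 *: f + D 0 1 *: g.
  have DE : D = (row_mx (D 0 0)%:M (D 0 1)%:M : 'M[R]_(1, 1 + 1)).
    have l1 : lsubmx (D : 'M[R]_(1, 1 + 1)) = (D 0 0)%:M.
      by rewrite [LHS]mx11_scalar mxE; congr (_%:M); congr (D _ _); apply: val_inj.
    have l2 : rsubmx (D : 'M[R]_(1, 1 + 1)) = (D 0 1)%:M.
      by rewrite [LHS]mx11_scalar mxE; congr (_%:M); congr (D _ _); apply: val_inj.
    by rewrite -l1 -l2 hsubmxK.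
  have h := mul_row_col (D 0 0)%:M (D 0 1)%:M f g; rewrite !mul_scalar_mx in h.
  by rewrite -h; exact: (congr1 (fun M : 'M[R]_(1, 2) => M *m P) DE).
split.
  rewrite -kermx_eq0; apply/rowV0P => D /sub_kermxP; rewrite PE => /I[a0 b0].
  by apply/rowP => i; rewrite mxE; case: i => [[|[|//]]] ?; [rewrite -[RHS]a0|rewrite -[RHS]b0]; congr (D _ _); apply: val_inj.
apply/seteqP; split=> w /= [Sw H]; split=> //.
  have [a [b ->]] := H; apply/submxP; exists (row_mx a%:M b%:M : 'M[R]_(1, 1 + 1)).
  by apply/esym; have h := mul_row_col a%:M b%:M f g; rewrite !mul_scalar_mx in h.
have /submxP[D ->] := H; by exists (D 0 0), (D 0 1); rewrite PE.
Qed.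

(** The speed [k] is constant, so length [2 pi] means [k (b - a) = 2 pi]: the curve is the radial
    projection of exactly one turn of [circ]. The projection identifies only points on a common ray,
    which gives injectivity; polar coordinates in the plane of the frame show that the whole great
    circle is covered. *)
Lemma great_closed lo hi (a b : R) (c : R -> E) :
  (lo < a%:E)%E -> a < b -> (b%:E < hi)%E -> sphere_geodesic G lo hi c ->
  curve_length G c a b = (2 * pi : R)%:E ->
  [/\ great_circle (c @` `[a, b]), c a = c b & {in `[a, b[ &, injective c}].
Proof.
move=> la ab bh sg; have ah : (a%:E < hi)%E by apply: lt_trans bh; rewrite lte_fin.
have itv t : a <= t <= b -> (lo < t%:E)%E /\ (t%:E < hi)%E.
  by move=> /andP[h1 h2]; split; [apply: lt_le_trans la _|apply: le_lt_trans _ bh]; rewrite lee_fin.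
have [A [x [y [AA y0 kE cE]]]] := sphere_geodesic_great GF GB GN sg la ah.
have [cg [k k0 ck]] := sg.
have L : curve_length G c a b = (k * (b - a))%:E.
  by apply: (constant_speed_length ab) => t /itv[lt ht]; exact: ck.
rewrite L.
move=> [kab]; rewrite ck // in kE.
have I : indep (inc A x) (frame A x y) by exact: (frame_indep GF).
have gE t : great A x y t = normalize (circ (inc A x) (frame A x y) k t) by rewrite /great kE.
have U0 t : circ (inc A x) (frame A x y) k t != 0 by exact: circ_neq0.
have aa : a <= a <= b by rewrite lexx ltW.
have bb : a <= b <= b by rewrite lexx ltW.
have k1 : k != 0 by rewrite gt_eqF.
split.
- have -> : c @` `[a, b] = [set w : E | sphere w /\ exists p q : R, w = p *: inc A x + q *: frame A x y].
    apply/seteqP; split=> [_ [t /= tab <-]|w /= [Sw [p [q wE]]]].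
      rewrite in_itv /= in tab; have [lt ht] := itv t tab; rewrite cE //; split.
        by rewrite gE; exact: normalize_sphere.
      by rewrite gE /normalize /circ scalerDr !scalerA; eexists; eexists.
    have pq : (p != 0) || (q != 0).
      rewrite -negb_and; apply/negP => /andP[/eqP p0 /eqP q0].
      move: Sw; rewrite /sphere /= wE p0 q0 !scale0r addr0 edot0l => /eqP.
      by rewrite eq_sym oner_eq0.
    have [r [phi [r0 /andP[ph0 ph1] pE qE]]] := polar_angle pq.
    have tab : a <= phi / k + a <= b.
      rewrite lerDr divr_ge0 //=; last exact: ltW.
      by rewrite -lerBrDr ler_pdivrMr // mulrC kab.
    exists (phi / k + a); first by rewrite /= in_itv.
    have eU : circ (inc A x) (frame A x y) k (phi / k) = r^-1 *: w.
      have rn : r != 0 by rewrite gt_eqF.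
      by rewrite /circ [k * (phi / k)]mulrC divfK // wE pE qE; exact: scale_polar.
    have [lt ht] := itv _ tab; rewrite cE // addrK gE eU normalizeZ ?invr_gt0 //.
    exact: normalize_id.
  exact: great_circle_span.
- have [lb _] := itv b bb; rewrite (cE a la ah) (cE b lb bh) subrr !gE /circ mulr0 kab.
  by rewrite cos0 sin0 cos_2pi sin_2pi.
move=> s t; rewrite !in_itv /= => sab tab.
have h1 : a <= s <= b by case/andP: sab => -> /ltW.
have h2 : a <= t <= b by case/andP: tab => -> /ltW.
have [ls hs] := itv s h1; have [lt ht] := itv t h2; rewrite !cE // !gE.
move=> /(normalize_inj (U0 _) (U0 _))[r r0].
move=> /(indep_eq I)[e1 e2].
have : s - a = t - a.
  apply: (@angle_inj R k (s - a) (t - a) r 0 (b - a)) => //; rewrite ?subr_gt0 ?subr0 ?subr_ge0 ?ltrD2r //.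
exact: addIr.
Qed.

Lemma great_piecewise_smooth A x y (a b : R) : orthogonal_mx A -> y != 0 -> a < b -> piecewise_smooth a b (great A x y).
Proof.
move=> AA y0 ab; exists [:: b]; split=> //=; first by rewrite ab.
case=> [|//] _; apply: (smooth_on_class_C openT) => // k.
apply: class_C_normalize; [exact: openT| |].
  by move=> t _; apply: circ_neq0; exact: (frame_indep GF).
by move=> i; apply: class_C_coord; [exact: openT|exact: class_C_circ].
Qed.

Lemma great_length A x y (b : R) : orthogonal_mx A -> y != 0 -> 0 < b ->
  curve_length G (great A x y) 0 b = (GA A x y * b)%:E.
Proof.
move=> AA y0 b0; rewrite -[b in RHS]subr0; apply: (constant_speed_length b0) => t _.
exact: (great_speed GF GB GN).
Qed.

Lemma finsler_dist_great A x y (b : R) : orthogonal_mx A -> y != 0 -> 0 < b -> GA A x y * b <= pi ->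
  (finsler_dist G sphere (great A x y 0) (great A x y b) <= (pi : R)%:E)%E.
Proof.
move=> AA y0 b0 kb; apply: (@le_trans _ _ (curve_length G (great A x y) 0 b)); last first.
  by rewrite great_length // lee_fin.
apply: ereal_inf_lbound; exists 0, b, (great A x y); split=> //; split; first exact: great_piecewise_smooth.
by split=> // t _; exact: (great_sphere GF).
Qed.

Lemma great0 A x y : orthogonal_mx A -> great A x y 0 = chart_param A x.
Proof. by move=> AA; rewrite chart_paramE // /great /circ mulr0 cos0 sin0 scale1r scale0r addr0. Qed.

Lemma metric_zero w : sphere w -> G w 0 = 0.
Proof.
move=> Sw; have [A AA wA] := chart_at Sw; have := finsler0 (GF AA) (I : setT (0 : V)).
rewrite /pullback derive_chart_param // dinc0 chart_paramE // wA normalize_id //.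
by rewrite /dnormalize scaler0 add0r edotC edot0l oppr0 mul0r scale0r.
Qed.

Lemma angle_of_slope (u : R) : exists phi, [/\ 0 < phi < pi, 0 < sin phi & cos phi = u * sin phi].
Proof.
exists (pi / 2 - atan u); have h1 := atan_gtNpi2 u; have h2 := atan_ltpi2 u.
have c0 : 0 < cos (atan u) by rewrite cos_gt0_pihalf // h1 h2.
have sE : sin (pi / 2 - atan u) = cos (atan u) by rewrite addrC sinDpihalf cosN.
have cE : cos (pi / 2 - atan u) = sin (atan u) by rewrite addrC cosDpihalf sinN opprK.
split; rewrite ?sE ?cE //; first by apply/andP; split; lra.
by rewrite -[u in u * _]atanK /tan divfK // gt_eqF.
Qed.

Hypothesis n2 : (2 <= n)%N.

Lemma unit_vector : exists y : V, y != 0.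
Proof.
exists (delta_mx 0 (Ordinal n2)); apply/eqP => /rowP/(_ (Ordinal n2)).
by rewrite !mxE !eqxx => /eqP; rewrite oner_eq0.
Qed.

(** Two points that are not proportional are joined by an arc of the great circle through them, run
    through an angle in []0, pi[]. Antipodal points are joined by a half turn in any direction, and
    equal points by the constant curve. *)
Lemma sphere_diameter_le : (diameter G sphere <= (pi : R)%:E)%E.
Proof.
apply: ge_ereal_sup => _ [w1 [w2 [S1 S2 ->]]]; have [A AA wA] := chart_at S1.
have w1E : chart_param A 0 = w1 by rewrite chart_paramE // wA normalize_id.
have w2E := chart_frame w2 0 AA; rewrite scaler0 subr0 wA in w2E.
have [y0|y0] := eqVneq (ba A w2) 0; last first.
  set y := ba A w2 in y0 w2E; pose k := GA A 0 y; pose p := pfac (GA A) 0 y.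
  have k0 : 0 < k by exact: (finsler_pos (GF AA)).
  have k1 : k != 0 by rewrite gt_eqF.
  (* The cotangent is found by comparing coefficients: at the angle [phi], [circ] must be a positive
     multiple of [w2], that is, its coefficients along [w1] and [dinc A y] must have the ratio
     [bl A w2]. *)
  have [phi [/andP[ph0 ph1] s0 cE]] := angle_of_slope ((bl A w2 - p) / k).
  have b0 : 0 < phi / k by rewrite divr_gt0.
  have w2G : great A 0 y (phi / k) = w2.
    rewrite -[RHS](normalize_id S2) -[RHS](normalizeZ w2 (divr_gt0 s0 k0)) /great great_mE // -/k -/p.
    congr normalize; rewrite [k * _]mulrC divfK // w2E wA cE scalerDr scalerA; congr (_ *: _ + _).
    by move: (sin phi) (bl A w2) => s b; field.
  rewrite -w1E -w2G -(great0 0 y AA); apply: finsler_dist_great => //.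
  by rewrite -/k mulrC divfK // ltW.
rewrite y0 dinc0 addr0 in w2E.
have : bl A w2 ^+ 2 = 1.
  have e1 : edot w1 w1 = 1 := S1; have e2 : edot w2 w2 = 1 := S2.
  move: w2E e2; move: (bl A w2) => b ->.
  by rewrite edotZl edotZr e1 mulr1 expr2.
move/eqP; rewrite sqrf_eq1 => /orP[/eqP b1|/eqP b1]; rewrite b1 ?scaleN1r ?scale1r in w2E.
  rewrite w2E; apply: (@le_trans _ _ (curve_length G (fun=> w1) 0 1)).
    apply: ereal_inf_lbound; exists 0, 1, (fun=> w1); split=> //; split=> //.
    by exists [:: 1]; split=> //=; [rewrite ltr01|case=> [|//] _; apply: (smooth_on_class_C openT) => // k; exact: class_C_cst].
  rewrite (@constant_speed_length _ 0) ?mul0r ?lee_fin ?pi_ge0 // => t _.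
  by rewrite (derive1_val (is_derive_cst w1 t (1:R))) metric_zero.
have [y yn] := unit_vector; have k0 : 0 < GA A 0 y by exact: (finsler_pos (GF AA)).
have w2G : great A 0 y (pi / GA A 0 y) = w2.
  rewrite w2E -[in RHS](normalize_id S1) -normalizeN /great /circ [_ * (pi / _)]mulrC divfK ?gt_eqF //.
  by rewrite cospi sinpi scale0r addr0 scaleN1r wA.
rewrite -w1E -w2G -(great0 0 y AA); apply: finsler_dist_great => //.
  by rewrite divr_gt0 // pi_gt0.
by rewrite mulrC divfK // gt_eqF.
Qed.

End SphereGeometry.

(** * Lower bound for the diameter of the sphere *)

Section SlopeBlowup.
Context {R : realType} {n : nat}.
Notation V := 'rV[R]_n.
Variables (F : V -> V -> R) (HF : finsler setT F).

Let Topen : open [set: V] := openT.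

(** Near 0 both F and P are bounded by multiples of the length of the vector, so the numerator tends
    to 1 and the denominator to 0. The vectors of interest are [x] and [- x]. *)
Lemma slope_blowup (K : R) : \forall x \near (0 : V), forall s : V, s != 0 -> `|s| <= `|x| ->
  K < (1 - `|pfac F x s|) / F x s.
Proof.
have [M M0 HM] := homog_bound Topen (pfac_smooth Topen HF) (pfac_homog Topen HF) (I : setT (0 : V)).
have [N N0 HN] := homog_bound Topen (finsler_smooth Topen HF) (finsler_homog HF) (I : setT (0 : V)).
have d0 : 0 < (M + N * (`|K| + 1))^-1 by rewrite invr_gt0 addr_gt0 // mulr_gt0 // ltr_wpDl.
have small : \forall x \near (0 : V), `|x| < (M + N * (`|K| + 1))^-1.
  exact: nbhs0_lt.
apply: filterS (filterI (filterI HM HN) small) => x [[h1 h2] h3] s s0 sx.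
have F0 := finsler_pos HF (I : setT x) s0.
rewrite ltr_pdivlMr //; have p1 := h1 s s0; have f1 := h2 s s0; rewrite (gtr0_norm F0) in f1.
have s3 : `|s| * (M + N * (`|K| + 1)) < 1.
  by rewrite -ltr_pdivlMr ?mul1r ?(le_lt_trans sx) // -invr_gt0.
have kn : 0 <= `|K| by exact: normr_ge0. have kk : K <= `|K| by exact: ler_norm.
move: (`|pfac F x s|) (F x s) F0 p1 f1 => p f f0 p1 f1.
have kf : K * f <= `|K| * f by rewrite ler_wpM2r // ltW.
have kf' : `|K| * f <= `|K| * (N * `|s|) by rewrite ler_wpM2l.
have ns : 0 <= N * `|s| by rewrite mulr_ge0 // ltW.
apply: (@le_lt_trans _ _ (`|K| * (N * `|s|))); first exact: le_trans kf kf'.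
rewrite ltrBrDl; apply: le_lt_trans s3.
rewrite mulrDr; apply: lerD; first by rewrite mulrC.
have -> : `|s| * (N * (`|K| + 1)) = `|K| * (N * `|s|) + N * `|s| by ring.
by rewrite lerDl.
Qed.

End SlopeBlowup.

Lemma atan_large {R : realType} (e : R) : 0 < e -> exists K : R, forall u, K < u -> pi / 2 - e < atan u.
Proof.
move=> e0; have /cvgrPdist_lt/(_ _ e0)[M [_ HM]] := @cvgy_atan R.
exists M => u /HM /=; rewrite ltr_norml => /andP[]; move: (atan u) => a; lra.
Qed.

(** Cutting off thirds leaves a gap in the middle, since neither [m1] nor [m2] exceeds [t2 - t1]. *)
Lemma interval_margin (R : realFieldType) (t1 t2 m1 m2 d1 d2 : R) : 0 < m1 -> 0 < m2 ->
  m1 <= d1 -> m2 <= d2 -> m1 <= t2 - t1 -> m2 <= t2 - t1 ->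
  [/\ t1 < t1 + m1 / 3, t1 + m1 / 3 < t2 - m2 / 3, t2 - m2 / 3 < t2,
      `|t1 - (t1 + m1 / 3)| < d1 & `|t2 - (t2 - m2 / 3)| < d2].
Proof.
move=> m10 m20 h1 h2 h3 h4.
have -> : t1 - (t1 + m1 / 3) = - (m1 / 3) by ring.
have -> : t2 - (t2 - m2 / 3) = m2 / 3 by ring.
by rewrite normrN !gtr0_norm ?divr_gt0 //; split; lra.
Qed.

Lemma calib_ratio (R : fieldType) (p f a b l : R) : f != 0 -> l != 0 ->
  (l^-1 * p - (- a * l + b) / l - a) / (l^-1 * f) = (p - b) / f.
Proof. by move=> f0 l0; field; rewrite f0 l0. Qed.

Section DiameterLower.
Context {R : realType} {n : nat}.
Notation V := 'rV[R]_n.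
Notation E := 'rV[R]_(n + 1).
Variable G : E -> E -> R.
Notation GA A := (pullback (chart_param A) G).
Hypotheses (GF : forall A, orthogonal_mx A -> finsler setT (GA A))
  (GB : forall A, orthogonal_mx A -> burgers setT (GA A))
  (Gproj : forall w v, sphere w -> G w v = G w (v - edot w v *: w)).
Implicit Types (A C : 'M[R]_(n + 1)) (x y : V) (u w v : E).
Variables (e : E) (Se : sphere e).

Let Topen : open [set: V] := openT.
Let e1 : edot e e = 1 := Se.

(** Away from the line through [e], so that in a chart around [w] the vector pointing along the line
    to [e] is not zero. *)
Definition transverse w := forall a : R, e <> a *: w.

(** The homogeneous coordinates of [e] in the chart enter as the parameters of [calib]; the
    calibrated lines are parallel in the chart when [bl C e] is 0. *)
Definition chart_calib C w : R := calib (GA C) (ba C e) (bl C e) (chart_coord C w).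
Notation hC := chart_calib.

Lemma transverseP C w : orthogonal_mx C -> bl C w != 0 ->
  transverse w <-> ba C e - bl C e *: chart_coord C w != 0.
Proof.
move=> CC b0; split=> [T|Y a ea].
  apply/eqP => /eqP; rewrite subr_eq0 => /eqP be; apply: (T (bl C e / bl C w)).
  rewrite [LHS](chart_frame e (chart_coord C w) CC) be subrr dinc0 addr0 inc_coord //.
  by rewrite scalerA.
by move: Y; rewrite ea blZ baZ chart_coordE scalerA mulfK // subrr eqxx.
Qed.

Lemma chart_coordZ C w (a : R) : a != 0 -> chart_coord C (a *: w) = chart_coord C w.
Proof. by move=> a0; rewrite !chart_coordE blZ baZ scalerA invfM mulrAC mulVf // mul1r. Qed.

Lemma inc_continuous A : continuous (inc A : V -> E).
Proof.
have ff (x v : V) (h : R) : inc A (h *: v + x) = h *: dinc A v + inc A x by exact: inc_aff.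
exact: (affine_continuous ff).
Qed.

(** Both sides are the speed of one curve on the sphere, read in two charts. *)
Lemma transition_metric A C x y : orthogonal_mx A -> orthogonal_mx C -> 0 < bl C (inc A x) ->
  GA A x y = GA C (chart_coord C (inc A x)) (coord_diff C (inc A x) (dinc A y)).
Proof.
move=> AA CC b0; have x0 : 0 *: y + x = x by rewrite scale0r add0r.
have du := is_derive_inc A (is_derive_aff y x 0).
have b0' : bl C (inc A (0 *: y + x)) != 0 by rewrite x0 gt_eqF.
have dz := is_derive_chart_coord b0' du.
have db : {for (0 : R), continuous (fun s : R => bl C (inc A (s *: y + x)))}.
  exact: is_derive_continuous (is_derive_bl C du).
have b00 : 0 < bl C (inc A (0 *: y + x)) by rewrite x0.
have cz : \forall s \near (0 : R), chart_param C (chart_coord C (inc A (s *: y + x))) = chart_param A (s *: y + x).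
  by apply: filterS (cvgr_gt _ db _ b00) => s bs; rewrite (chart_param_coord CC bs) (chart_paramE _ AA).
have cz' : \forall s \near (0 : R), chart_param A (s *: y + x) = chart_param A (s *: y + x).
  exact: filterE.
have [_ h1] := @pullback_curve _ _ G C (fun s : R => chart_param A (s *: y + x)) _ 0 _ CC dz cz.
have [_ h2] := @pullback_curve _ _ G A (fun s : R => chart_param A (s *: y + x)) _ 0 _ AA (is_derive_aff y x 0) cz'.
by rewrite /= x0 in h1 h2; rewrite -h2 h1.
Qed.

Lemma chart_calib_indep A C w : orthogonal_mx A -> orthogonal_mx C -> 0 < bl A w -> 0 < bl C w ->
  transverse w -> hC A w = hC C w.
Proof.
move=> AA CC ba0 bc0 T; have An : bl A w != 0 by rewrite gt_eqF. have Cn : bl C w != 0 by rewrite gt_eqF.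
have yA := (transverseP AA An).1 T; have yC := (transverseP CC Cn).1 T.
set x := chart_coord A w in yA *; set X := chart_coord C w in yC *.
pose D := [set x : V | 0 < bl C (inc A x)].
have Dopen : open D.
  have c : continuous (fun x : V => bl C (inc A x)).
    by move=> z; apply: (@continuous_comp _ _ _ (inc A) (bl C)); [exact: inc_continuous|exact: bl_continuous].
  exact: (open_comp (fun x _ => c x) (@open_gt _ 0)).
have HG : finsler D (GA A) by apply: finsler_sub (GF AA).
have aaff (z v : V) (h : R) : ba C (inc A (h *: v + z)) = h *: ba C (dinc A v) + ba C (inc A z).
  by rewrite inc_aff ba_lin.
have laff (z v : V) (h : R) : bl C (inc A (h *: v + z)) = h * bl C (dinc A v) + bl C (inc A z).
  by rewrite inc_aff bl_lin.
have Dx : D x.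
  by rewrite /D /= inc_coord // blZ mulr_gt0 // invr_gt0.
have GE z y : D z -> y != 0 -> GA A z y = GA C (proj_map (fun x => ba C (inc A x)) (fun x => bl C (inc A x)) z)
   (proj_diff (fun x => ba C (inc A x)) (fun y => ba C (dinc A y)) (fun x => bl C (inc A x)) (fun y => bl C (dinc A y)) z y).
  by move=> Dz _; exact: transition_metric.
have XE : proj_map (fun x => ba C (inc A x)) (fun x => bl C (inc A x)) x = X.
  by rewrite /proj_map -chart_coordE inc_coord // chart_coordZ // invr_neq0.
pose l := bl C (inc A x); have l0 : 0 < l := Dx; have ln : l != 0 by rewrite gt_eqF.
have dE : dinc A (ba A e - bl A e *: x) = - bl A e *: inc A x + e.
  by rewrite [X in _ = _ + X](chart_frame e x AA) addrA scaleNr addNr add0r.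
have lE : bl C (dinc A (ba A e - bl A e *: x)) = - bl A e * l + bl C e by rewrite dE bl_lin.
have aE : ba C (inc A x) = l *: X by rewrite -XE /proj_map scalerA mulfV // scale1r.
(* The vectors that define the calibrations in the two charts correspond up to the positive factor
   [l^-1]; the term subtracted in [pfac_pulled] is what turns [bl A e] into [bl C e]. *)
have YE : proj_diff (fun x => ba C (inc A x)) (fun y => ba C (dinc A y)) (fun x => bl C (inc A x)) (fun y => bl C (dinc A y)) x
   (ba A e - bl A e *: x) = l^-1 *: (ba C e - bl C e *: X).
  rewrite /proj_diff lE dE ba_lin aE -/l; apply/rowP => i; move: (X) => Z; rewrite !mxE.
  by move: (bl A e) (bl C e) (l) ln => p q m mn; field.
have gE := GE _ _ Dx yA; have pE := pfac_pulled (GF CC) aaff laff Dopen HG (fun z h => lt0r_neq0 h) GE Dx yA.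
have li : 0 < l^-1 by rewrite invr_gt0.
rewrite XE YE in gE pE; rewrite (finslerZ (GF CC) _ (I : setT X) li) in gE.
rewrite (pfac_homog Topen (GF CC) (I : setT X) yC li) expr1 lE in pE.
rewrite /hC /calib -/x -/X pE gE; congr atan.
have F0 := finsler_pos (GF CC) (I : setT X) yC.
exact: calib_ratio (lt0r_neq0 F0) ln.
Qed.

(* Under a change of chart P - b and F are multiplied by the same factor, so that the calibration
   of the lines through e does not depend on the chart; it goes from [pi / 2] at [- e] to
   [- pi / 2] at e. *)
Definition height w : R := xget 0 [set r | exists C, [/\ orthogonal_mx C, 0 < bl C w & r = hC C w]].

Lemma heightE C w : orthogonal_mx C -> 0 < bl C w -> transverse w -> height w = hC C w.
Proof.
move=> CC b0 T; apply: xget_unique; first by exists C.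
by move=> r [A [AA a0 ->]]; exact: chart_calib_indep.
Qed.

Lemma centered_chart w : w != 0 -> exists C, [/\ orthogonal_mx C, 0 < bl C w & inc C 0 = normalize w].
Proof.
move=> w0; have [C CC wC] := chart_at (normalize_sphere w0); exists C; split=> //.
by apply/(chart_dom_normalize CC w0)/(chart_domE _ CC); rewrite -wC bl_inc // wC; split; [exact: normalize_sphere|exact: ltr01].
Qed.

Lemma chart_coord_continuous C w : bl C w != 0 -> {for w, continuous (chart_coord C)}.
Proof.
move=> b0; apply: continuous_rowP => i.
have -> : (fun z => chart_coord C z 0 i) = (fun z => (bl C z)^-1 * ba C z 0 i).
  by apply/funext => z; rewrite chart_coordE mxE.
have bc : {for w, continuous (bl C)} by exact: bl_continuous.
have ff (u v : E) (h : R) : ba C (h *: v + u) 0 i = h *: ba C v 0 i + ba C u 0 i by rewrite ba_lin !mxE.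
have ac : {for w, continuous (fun z : E => ba C z 0 i)} by exact: (affine_continuous ff).
by apply: continuousM ac; apply: continuousV.
Qed.

Lemma height_near C w : orthogonal_mx C -> 0 < bl C w -> transverse w -> \forall z \near w, hC C z = height z.
Proof.
move=> CC b0 T; have bn : bl C w != 0 by rewrite gt_eqF.
have nb : \forall z \near w, 0 < bl C z by exact: (cvgr_gt _ (@bl_continuous _ _ C w) _ b0).
have cc : {for w, continuous (fun z => ba C e - bl C e *: chart_coord C z)}.
  apply: continuousB; first exact: cst_continuous.
  by apply: continuousZr; exact: chart_coord_continuous.
have y0 := (transverseP CC bn).1 T.
have ny : \forall z \near w, ba C e - bl C e *: chart_coord C z != 0 by exact: (cvgr_neq0 _ cc y0).
apply: filterS (filterI nb ny) => z [bz yz]; rewrite (heightE CC bz) //.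
by apply/(transverseP CC); rewrite ?gt_eqF.
Qed.

Lemma height_continuous w : w != 0 -> transverse w -> {for w, continuous height}.
Proof.
move=> w0 T; have [C [CC b0 _]] := centered_chart w0; have bn : bl C w != 0 by rewrite gt_eqF.
apply: near_eq_cont (height_near CC b0 T) _.
apply: (@continuous_comp _ _ _ (chart_coord C) (calib (GA C) (ba C e) (bl C e))); first exact: chart_coord_continuous.
by apply: (calib_continuous Topen (GF CC)) => //; apply/(transverseP CC).
Qed.

(** [v] need not be tangent. Normalizing the line [s *: v + w] projects its velocity to the tangent
    space, and by [Gproj] the metric sees only that projection. This covers whatever value the
    velocity takes at break points. *)
Lemma metric_coord C w v : orthogonal_mx C -> sphere w -> 0 < bl C w ->
  G w v = GA C (chart_coord C w) (coord_diff C w v).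
Proof.
move=> CC Sw b0; have w1 : edot w w = 1 := Sw; have w0 : 0 *: v + w = w by rewrite scale0r add0r.
have wn : w != 0 by rewrite -edot_gt0 w1.
have wn' : 0 *: v + w != 0 by rewrite w0.
have bn : bl C (0 *: v + w) != 0 by rewrite w0 gt_eqF.
have dz := is_derive_chart_coord bn (is_derive_aff v w 0).
have dn := is_derive_normalize wn' (is_derive_aff v w 0).
have cb : {for (0:R), continuous (fun s : R => bl C (s *: v + w))}.
  exact: is_derive_continuous (is_derive_bl C (is_derive_aff v w 0)).
have b00 : 0 < bl C (0 *: v + w) by rewrite w0.
have cz : \forall s \near (0 : R), chart_param C (chart_coord C (s *: v + w)) = normalize (s *: v + w).
  by apply: filterS (cvgr_gt _ cb _ b00) => s bs; exact: (chart_param_coord CC bs).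
have [_ h] := @pullback_curve _ _ G C (fun s : R => normalize (s *: v + w)) _ 0 _ CC dz cz.
rewrite (derive1_val dn) /= w0 (normalize_id w1) in h; rewrite -h.
rewrite [LHS]Gproj // /dnormalize w1 sqrtr1 invr1 scale1r expr1n divr1.
by rewrite scaleNr.
Qed.

Lemma metric_ge0 w v : sphere w -> 0 <= G w v.
Proof.
move=> Sw; have w1 : edot w w = 1 := Sw; have wn : w != 0 by rewrite -edot_gt0 w1.
have [C [CC b0 _]] := centered_chart wn; rewrite (metric_coord v CC Sw b0).
exact: (finsler_ge0 (GF CC)).
Qed.

Lemma metric_continuous (c d : R -> E) t : (\forall s \near t, sphere (c s)) ->
  {for t, continuous c} -> {for t, continuous d} -> {for t, continuous (fun s => G (c s) (d s))}.
Proof.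
move=> nS cc dc; have Sw : edot (c t) (c t) = 1 := nbhs_singleton nS.
have wn : c t != 0 by rewrite -edot_gt0 Sw.
have [C [CC b0 _]] := centered_chart wn; have bn : bl C (c t) != 0 by rewrite gt_eqF.
have cb : {for t, continuous (fun s => bl C (c s))}.
  exact: (@continuous_comp _ _ _ c (bl C) t cc (@bl_continuous _ _ C (c t))).
apply: (@near_eq_cont _ _ _ (fun s => GA C (chart_coord C (c s)) (coord_diff C (c s) (d s)))).
  by apply: filterS (filterI nS (cvgr_gt _ cb _ b0)) => s [Ss bs]; rewrite -metric_coord.
apply: (finsler_continuous Topen (GF CC) (I : setT (chart_coord C (c t)))).
  exact: (@continuous_comp _ _ _ c (chart_coord C) t cc (chart_coord_continuous bn)).
apply: continuous_rowP => i.
have bd : {for t, continuous (fun s => bl C (d s))}.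
  exact: (@continuous_comp _ _ _ d (bl C) t dc (@bl_continuous _ _ C (d t))).
have ff (u v : E) (h : R) : ba C (h *: v + u) 0 i = h *: ba C v 0 i + ba C u 0 i by rewrite ba_lin !mxE.
have fc : continuous (fun z : E => ba C z 0 i) by exact: (affine_continuous ff).
have ac : {for t, continuous (fun s => ba C (c s) 0 i)}.
  exact: (@continuous_comp _ _ _ c (fun z : E => ba C z 0 i) t cc (fc (c t))).
have ad : {for t, continuous (fun s => ba C (d s) 0 i)}.
  exact: (@continuous_comp _ _ _ d (fun z : E => ba C z 0 i) t dc (fc (d t))).
have -> : (fun s => coord_diff C (c s) (d s) 0 i) =
    (fun s => (bl C (c s) * bl C (c s))^-1 * (bl C (c s) * ba C (d s) 0 i - bl C (d s) * ba C (c s) 0 i)).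
  by apply/funext => s; rewrite /coord_diff !mxE expr2.
apply: continuousM; last by apply: continuousB; apply: continuousM.
apply: continuousV; first by rewrite mulf_neq0.
exact: continuousM.
Qed.

Lemma height_derive (c : R -> E) t : derivable c t 1 -> (\forall s \near t, sphere (c s)) -> transverse (c t) ->
  exists2 l, is_derive t (1:R) (fun s => - height (c s)) l & l <= G (c t) (derive1 c t).
Proof.
move=> dc nS T; have Sw : edot (c t) (c t) = 1 := nbhs_singleton nS.
have wn : c t != 0 by rewrite -edot_gt0 Sw.
have [C [CC b0 _]] := centered_chart wn; have bn : bl C (c t) != 0 by rewrite gt_eqF.
have y0 := (transverseP CC bn).1 T; have d1 := derive1_is_derive dc.
have dz := is_derive_chart_coord bn d1.
have dh := is_derive_calib Topen (GF CC) (GB CC) (c := fun s => chart_coord C (c s)) I y0 dz.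
exists (dy (GA C) (coord_diff C (c t) (derive1 c t)) (chart_coord C (c t)) (ba C e - bl C e *: chart_coord C (c t))).
  have H := is_deriveN dh; rewrite opprK in H; apply: near_eq_is_derive H.
  have cc := is_derive_continuous d1.
  have nh : \forall s \near t, hC C (c s) = height (c s) by exact: (cc _ (height_near CC b0 T)).
  by apply: filterS nh => s hs; rewrite !fctE -hs.
rewrite (metric_coord _ CC Sw b0); exact: (finsler_fundamental Topen (GF CC)).
Qed.

(** In the chart centred at [- e] the point [e] has homogeneous coordinates 0 and -1, so the vector
    of the calibration is the position [x] itself and the slope is [(P + 1) / F]. In [height_north]
    the vector is [- x] and the slope [(P - 1) / F]. *)
Lemma height_south eps : 0 < eps -> \forall w \near (- e), transverse w -> pi / 2 - eps < height w.
Proof.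
move=> eps0; have [K HK] := atan_large eps0.
have en : - e != 0 by rewrite oppr_eq0 -edot_gt0 e1.
have [C [CC b0 iC]] := centered_chart en; rewrite normalizeN (normalize_id e1) in iC.
have bn : bl C (- e) != 0 by rewrite gt_eqF.
have be : bl C e = -1 by rewrite -[e]opprK -iC -scaleN1r blZ bl_inc // mulr1.
have ae : ba C e = 0 by rewrite -[e]opprK -iC -scaleN1r baZ ba_inc // scaler0.
have c0 : chart_coord C (- e) = 0 by rewrite -iC chart_coordE ba_inc // scaler0.
have nb : \forall w \near (- e), 0 < bl C w by exact: (cvgr_gt _ (@bl_continuous _ _ C (- e)) _ b0).
have ccont : chart_coord C z @[z --> - e] --> (0 : V) by rewrite -c0; exact: chart_coord_continuous.
have ns := ccont _ (slope_blowup (GF CC) K).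
apply: filterS (filterI nb ns) => w [bw H] T; rewrite (heightE CC bw T) /hC /calib be ae.
have y0 := (transverseP CC (lt0r_neq0 bw)).1 T; rewrite be ae in y0.
rewrite scaleN1r sub0r opprK in y0 *; apply: HK; apply: lt_le_trans (H _ y0 (lexx _)) _.
have F0 := finsler_pos (GF CC) (I : setT (chart_coord C w)) y0.
rewrite ler_pM2r ?invr_gt0 // opprK addrC lerD2r.
by have := ler_norm (- pfac (GA C) (chart_coord C w) (chart_coord C w)); rewrite normrN; lra.
Qed.

Lemma height_north eps : 0 < eps -> \forall w \near e, transverse w -> height w < - (pi / 2 - eps).
Proof.
move=> eps0; have [K HK] := atan_large eps0.
have en : e != 0 by rewrite -edot_gt0 e1.
have [C [CC b0 iC]] := centered_chart en; rewrite (normalize_id e1) in iC.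
have bn : bl C e != 0 by rewrite gt_eqF.
have be : bl C e = 1 by rewrite -iC bl_inc.
have ae : ba C e = 0 by rewrite -iC ba_inc.
have c0 : chart_coord C e = 0 by rewrite chart_coordE ae scaler0.
have nb : \forall w \near e, 0 < bl C w by exact: (cvgr_gt _ (@bl_continuous _ _ C e) _ b0).
have ccont : chart_coord C z @[z --> e] --> (0 : V) by rewrite -c0; exact: chart_coord_continuous.
have ns := ccont _ (slope_blowup (GF CC) K).
apply: filterS (filterI nb ns) => w [bw H] T; rewrite (heightE CC bw T) /hC /calib be ae.
have y0 := (transverseP CC (lt0r_neq0 bw)).1 T; rewrite be ae in y0.
rewrite scale1r sub0r in y0 *.
have F0 := finsler_pos (GF CC) (I : setT (chart_coord C w)) y0.
have nx : `|- chart_coord C w| <= `|chart_coord C w| by rewrite normrN.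
have h1 := H _ y0 nx; rewrite ltrNr -atanN; apply: HK; apply: lt_le_trans h1 _.
rewrite -mulNr ler_pM2r ?invr_gt0 // opprB.
by have := ler_norm (pfac (GA C) (chart_coord C w) (- chart_coord C w)); lra.
Qed.

Lemma nbhs_neq u w : u != w -> nbhs u [set z | z != w].
Proof.
move=> uw; have c : {for u, continuous (fun z : E => z - w)}.
  by apply: continuousB; [exact: cvg_id|exact: cst_continuous].
have u0 : u - w != 0 by rewrite subr_eq0.
have H : \forall z \near u, z - w != 0 by exact: (cvgr_neq0 _ c u0).
by apply: filterS H => z; rewrite subr_eq0.
Qed.

Lemma within_nbhs (c : R -> E) (a b t : R) N : {within `[a, b], continuous c} -> a <= t <= b -> nbhs (c t) N ->
  exists2 d : R, 0 < d & forall s, a <= s <= b -> `|t - s| < d -> N (c s).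
Proof.
move=> cc tab Nt; have At : `[a, b]%classic t by rewrite /= in_itv.
have H0 : (@nbhs_subspace _ `[a, b]%classic t) (c @^-1` N) := cc t N Nt.
move: H0; rewrite -(nbhs_subspace_in At) => /nbhs_ballP[d /= d0 H].
by exists d => // s sab ts; apply: (H s) => //=; rewrite in_itv.
Qed.

Lemma sphere_parallel (a : R) w : edot w w = 1 -> e = a *: w -> w = e \/ w = - e.
Proof.
move=> w1 ea; have : a ^+ 2 = 1 by rewrite -e1 ea edotZl edotZr w1 mulr1 expr2.
move/eqP; rewrite sqrf_eq1 => /orP[/eqP a1|/eqP a1]; rewrite ea a1 ?scale1r ?scaleN1r ?opprK; by [left|right].
Qed.

(** Between the last passage through [- e] and the next one through [e] the curve is transverse, by
    [sphere_parallel], so [height] calibrates it there. At the two ends only the limits of [height]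
    are known, hence the shorter interval [[a', b']] and the loss [eps]. *)
Lemma path_length_ge (c : R -> E) (a b : R) : a < b -> piecewise_smooth a b c ->
  (forall t, a <= t <= b -> sphere (c t)) -> c a = - e -> c b = e ->
  ((pi : R)%:E <= curve_length G c a b)%E.
Proof.
move=> ab pw Sc ca cb; have wc := piecewise_continuous pw.
have ne : - e != e.
  apply/eqP => h; have /eqP : (2 : R) *: e = 0 by rewrite scaler_nat mulr2n -{1}h addNr.
  rewrite scaler_eq0 pnatr_eq0 /= => /eqP e0; move: e1; rewrite e0 edot0l => /eqP.
  by rewrite eq_sym oner_eq0.
pose A := [set t : R | a <= t <= b /\ c t = - e].
have Aa : A a by rewrite /A /= lexx (ltW ab).
have Aub : ubound A b by move=> t [/andP[]].
have hs : has_sup A by split; [exists a|exists b].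
pose t1 := sup A; have t1a : a <= t1 by apply: ub_le_sup => //; exists b.
have t1b : t1 <= b by apply: ge_sup => //; exists a.
have ct1 : c t1 = - e.
  apply: contrapT => /eqP h; have Nt : nbhs (c t1) [set w | w != - e].
    exact: nbhs_neq.
  have [|d d0 H] := within_nbhs wc _ Nt; first by rewrite t1a t1b.
  have [s [sab cs] ls] := sup_adherent d0 hs.
  have st : s <= t1 by apply: ub_le_sup => //; exists b.
  have ds : `|t1 - s| < d by rewrite ger0_norm ?subr_ge0 // ltrBlDl -ltrBlDr.
  by have := H s sab ds; rewrite /= cs eqxx.
pose A' := [set t : R | t1 <= t <= b /\ c t = e].
have Ab' : A' b by rewrite /A' /= lexx t1b.
have Alb : lbound A' t1 by move=> t [/andP[]].
have hi : has_inf A' by split; [exists b|exists t1].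
pose t2 := inf A'; have t12 : t1 <= t2 by apply: lb_le_inf => //; exists b.
have t2b : t2 <= b by apply: ge_inf => //; exists t1.
have ct2 : c t2 = e.
  apply: contrapT => /eqP h; have Nt : nbhs (c t2) [set w | w != e].
    exact: nbhs_neq.
  have [|d d0 H] := within_nbhs wc _ Nt; first by rewrite t2b (le_trans t1a t12).
  have [s [/andP[s1 s2] cs] ls] := inf_adherent d0 hi.
  have st : t2 <= s by apply: ge_inf; [exists t1|split=> //; apply/andP].
  have sab : a <= s <= b by rewrite s2 (le_trans t1a s1).
  have ds : `|t2 - s| < d by rewrite distrC ger0_norm ?subr_ge0 // ltrBlDl.
  by have := H s sab ds; rewrite /= cs eqxx.
have t12' : t1 < t2.
  by rewrite lt_neqAle t12 andbT; apply/eqP => h; move: ne; rewrite -ct1 h ct2 eqxx.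
have T t : t1 < t < t2 -> transverse (c t).
  move=> /andP[h1 h2] r er; have tab : a <= t <= b by rewrite (le_trans t1a (ltW h1)) (le_trans (ltW h2) t2b).
  have [h|h] := sphere_parallel (Sc t tab) er.
    have : t2 <= t by apply: ge_inf; [exists t1|split=> //; rewrite (ltW h1); case/andP: tab].
    by rewrite leNgt h2.
  have : t <= t1 by apply: ub_le_sup; [exists b|split].
  by rewrite leNgt h1.
apply/lee_addgt0Pr => eps eps0; have ep2 : 0 < eps / 2 by rewrite divr_gt0.
have N1 := height_south ep2; have N2 := height_north ep2; rewrite -ct1 in N1; rewrite -ct2 in N2.
have [|d1 d10 H1] := within_nbhs wc _ N1; first by rewrite t1a t1b.
have [|d2 d20 H2] := within_nbhs wc _ N2; first by rewrite t2b (le_trans t1a t12).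
pose m1 := Order.min d1 (t2 - t1); pose m2 := Order.min d2 (t2 - t1).
have m10 : 0 < m1 by rewrite lt_min d10 subr_gt0.
have m20 : 0 < m2 by rewrite lt_min d20 subr_gt0.
have m1d : m1 <= d1 /\ m1 <= t2 - t1 by apply/andP; rewrite -le_min.
have m2d : m2 <= d2 /\ m2 <= t2 - t1 by apply/andP; rewrite -le_min.
have [m1a m1b] := m1d; have [m2a m2b] := m2d.
pose a' := t1 + m1 / 3; pose b' := t2 - m2 / 3.
have aux : [/\ t1 < a', a' < b', b' < t2, `|t1 - a'| < d1 & `|t2 - b'| < d2].
  exact: interval_margin.
have [h1 h2 h3 h4 h5] := aux.
have Ta : transverse (c a') by apply: T; rewrite h1 (lt_trans h2 h3).
have Tb : transverse (c b') by apply: T; rewrite h3 (lt_trans h1 h2).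
have a'ab : a <= a' <= b by rewrite (le_trans t1a (ltW h1)) (le_trans (ltW (lt_trans h2 h3)) t2b).
have b'ab : a <= b' <= b by rewrite (le_trans t1a (ltW (lt_trans h1 h2))) (le_trans (ltW h3) t2b).
have g1 : pi / 2 - eps / 2 < height (c a') by exact: H1.
have g2 : height (c b') < - (pi / 2 - eps / 2) by exact: H2.
have itv t : a' <= t <= b' -> t1 < t < t2.
  by move=> /andP[l1 l2]; rewrite (lt_le_trans h1 l1) (le_lt_trans l2 h3).
have nSc t : a < t < b -> \forall s \near t, sphere (c s).
  move=> tab; have : \forall s \near t, s \in `]a, b[ by apply: near_in_itvoo; rewrite in_itv.
  by apply: filterS => s; rewrite in_itv /= => /andP[l1 l2]; apply: Sc; rewrite !ltW.
have inab t : t1 < t < t2 -> a < t < b.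
  by move=> /andP[l1 l2]; rewrite (le_lt_trans t1a l1) (lt_le_trans l2 t2b).
have cn w : sphere w -> w != 0 by move=> Sw; have w1 : edot w w = 1 := Sw; rewrite -edot_gt0 w1.
have L : ((- height (c b') - - height (c a'))%:E <= curve_length G c a b)%E.
  apply: (@curve_length_ge _ _ G c a b a' b' (fun t => - height (c t))) => //.
  - by move=> t /Sc; exact: metric_ge0.
  - move=> t tab dc d1c; apply: metric_continuous => //; first exact: nSc.
    exact: is_derive_continuous (derive1_is_derive dc).
  - by case/andP: a'ab.
  - exact: ltW.
  - by case/andP: b'ab.
  - apply: (@within_comp _ _ _ c (fun w => - height w)).
      apply: continuous_subspaceW wc => t /=; rewrite !in_itv /= => /andP[l1 l2].
      by case/andP: a'ab => l3 _; case/andP: b'ab => _ l4; rewrite (le_trans l3 l1) (le_trans l2 l4).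
    move=> t; rewrite /= in_itv /= => /itv tt; apply: continuousN; apply: height_continuous; last exact: T.
    by apply: cn; apply: Sc; case/andP: (inab t tt) => l1 l2; rewrite !ltW.
  - move=> t /andP[l1 l2] dc; have tt : t1 < t < t2 by apply: itv; rewrite !ltW.
    by apply: height_derive => //; [exact: nSc (inab t tt)|exact: T].
apply: le_trans (leeD2r _ L); rewrite -EFinD lee_fin; clear -g1 g2.
move: (height _) (height _) g1 g2 => x y; move: (pi : R) => p; lra.
Qed.

Lemma sphere_diameter_ge : ((pi : R)%:E <= diameter G sphere)%E.
Proof.
have Sn : sphere (- e) by rewrite /sphere /= edotNl edotNr opprK.
apply: (@le_trans _ _ (finsler_dist G sphere (- e) e)); last by apply: ereal_sup_ubound; exists (- e), e.
apply: le_ereal_inf_tmp => _ [a [b [c [ab [pw [Sc [ca [cb ->]]]]]]]].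
exact: path_length_ge.
Qed.

End DiameterLower.

(** Strict convexity speaks of inner points of segments with distinct ends; end points and
    degenerate segments are treated apart. *)
Lemma strictly_convex_segment {R : realType} {n : nat} (D : set 'rV[R]_n) x y (t : R) :
  strictly_convex D -> D x -> D y -> 0 <= t <= 1 -> D (t *: (y - x) + x).
Proof.
move=> H Dx Dy /andP[t0 t1]; have [->|xy] := eqVneq y x; first by rewrite subrr scaler0 add0r.
have [->|tn0] := eqVneq t 0; first by rewrite scale0r add0r.
have [->|tn1] := eqVneq t 1; first by rewrite scale1r subrK.
have -> : t *: (y - x) + x = t *: y + (1 - t) *: x.
  by rewrite scalerBr scalerBl scale1r -addrA [- _ + x]addrC.
apply: interior_subset; apply: H => //; try exact: subset_closure.
  by rewrite lt_neqAle eq_sym tn0.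
by rewrite lt_neqAle tn1.
Qed.

Lemma double_metric_proj {R : realType} {n : nat} (Fbar : 'rV[R]_(n + 1) -> 'rV[R]_(n + 1) -> R) w v :
  sphere w -> double_metric Fbar w v = double_metric Fbar w (v - edot w v *: w).
Proof.
move=> Sw; have w1 : edot w w = 1 := Sw.
by rewrite /double_metric edotBr edotZr w1 mulr1 subrr scale0r subr0.
Qed.

Theorem theorem1p5 (R : realType) (n : nat) (hn : (2 <= n)%N)
    (Omega : set 'rV[R]_n) (F : 'rV[R]_n -> 'rV[R]_n -> R)
    (Omega_open : open Omega) (Omega_connected : connected Omega)
    (Omega_convex : strictly_convex Omega) (Omega_0 : Omega 0)
    (F_finsler : finsler Omega F) (F_flat : projectively_flat Omega F)
    (F_curv : const_flag_curvature Omega F 1) :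
  (* (i) *)
  (~ forward_complete (geodesic Omega F) /\
   ~ backward_complete (geodesic Omega F)) /\
  (* (ii) *)
  ((diameter F Omega <= (pi : R)%:E)%E /\
   (Omega = setT -> diameter F Omega = (pi : R)%:E)) /\
  (* (iii) *)
  (Omega = setT ->
   (exists Fbar : 'rV[R]_(n + 1) -> 'rV[R]_(n + 1) -> R,
      sphere_finsler (closure hemisphere) Fbar /\
      forall w v, hemisphere w -> tangent w v ->
        Fbar w v = pullback gnomonic_inv F w v) ->
   exists G : 'rV[R]_(n + 1) -> 'rV[R]_(n + 1) -> R,
     [/\ sphere_finsler sphere G,
         forward_complete (sphere_geodesic G) /\
           backward_complete (sphere_geodesic G) &
         sphere_locally_projectively_flat G] /\
     [/\ sphere_const_flag_curvature G 1,
         diameter G sphere = (pi : R)%:E &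
         forall w v, hemisphere w -> tangent w v ->
           G w v = pullback gnomonic_inv F w v] /\
     forall (lo hi : \bar R) (a b : R) (c : R -> 'rV[R]_(n + 1)),
       (lo < a%:E)%E -> a < b -> (b%:E < hi)%E ->
       sphere_geodesic G lo hi c ->
       curve_length G c a b = (2 * pi : R)%:E ->
       [/\ great_circle (c @` `[a, b]), c a = c b &
           {in `[a, b[ &, injective c}]).
Proof.
have S := flat_straight Omega_open F_finsler F_flat.
have B := straight_burgers Omega_open F_finsler S hn F_curv.
split; first by split; [exact: (@not_forward_complete _ _ _ Omega_open _ F_finsler B Omega_0 hn)
  | exact: (@not_backward_complete _ _ _ Omega_open _ F_finsler B Omega_0 hn)].
split.
  split; last by move=> OT; rewrite OT in F_finsler B *; exact: diameter_setT F_finsler B hn.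
  apply: (diameter_le Omega_open F_finsler B) => x y t; exact: strictly_convex_segment.
move=> OT [Fbar [HFb FbE]]; rewrite {}OT in F_finsler B.
have GF := chart_metric_finsler F_finsler B HFb FbE.
have GB := chart_metric_burgers F_finsler B HFb FbE.
have GN := chart_metricN F_finsler B HFb FbE.
(* Any point of the sphere can play the part of [e] in the lower bound on the diameter; the pole is
   at hand. *)
have Se : sphere (erow : 'rV[R]_(n + 1)) by exact: edot_erow.
exists (double_metric Fbar); split; [split|split].
- exact: (double_metric_finsler F_finsler B HFb FbE).
- exact: (sphere_complete GF GB (fun A x y => @GN A x y)).
- exact: (sphere_flat GF GB).
- split.
  + exact: (double_metric_curvature F_finsler B HFb FbE).
  + apply/eqP; rewrite eq_le (sphere_diameter_le GF GB (fun A x y => @GN A x y) hn) /=.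
    exact: (sphere_diameter_ge GF GB (double_metric_proj Fbar) Se).
  + exact: double_metric_hemisphere FbE.
- by move=> lo hi a b c; exact: (great_closed GF GB (fun A x y => @GN A x y)).
Qed.
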